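(* Let $\Phi$ be a finite root system of Dynkin type, $c$ a Coxeter element, $D_\Phi$ a symmetrizer of the Cartan matrix $C_\Phi$, $K$ a field and $H=H(C_\Phi,D_\Phi,c)$ the GLS path algebra over $K$. The map $$\Psi_H\circ\tilde\phi_c^{-1}\circ\mathrm{cl}_c\colon\ \mathsf{Hasse}(\mathfrak{C}_c)\to\mathsf{Hasse}(\mathsf{tors}\,H)$$ is a quiver isomorphism. In particular, the $c$-Cambrian lattice $\mathfrak{C}_c$ is isomorphic to the torsion lattice $\mathsf{tors}\,H$.
   Context: $\Phi$ has rank $n$, simple roots $\alpha_1,\dots,\alpha_n$, positive roots $\Phi^+$, simple reflections $s_1,\dots,s_n$, Weyl group $W(\Phi)$, Cartan matrix $C_\Phi=(C_{ij})$, with $s_i(\alpha_j)=\alpha_j-C_{ij}\alpha_i$. A Coxeter element is a product $c=c_1\cdots c_n$ of all simple reflections, each once, in some order; $c=\cdots s_i\cdots s_j\cdots$ means $s_i$ occurs before $s_j$. GLS path algebra. $D_\Phi=\mathrm{diag}(d_1,\dots,d_n)$, $d_i$ positive integers, $D_\Phi C_\Phi$ symmetric. $Q^c$ has vertices $1,\dots,n$, arrows $\alpha_{ij}\colon i\to j$ whenever $c=\cdots s_i\cdots s_j\cdots$ and $s_is_j\neq s_js_i$, and loops $\varepsilon_i\colon i\to i$. $H=KQ^c/I$, $I$ generated by $\varepsilon_i^{d_i}$ and $\varepsilon_i^{|C_{ji}|}\alpha_{ij}-\alpha_{ij}\varepsilon_j^{|C_{ij}|}$ (paths composed left to right). $e_i$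 is the idempotent at $i$, $P_i=e_iH$, $H_i=e_iHe_i$; modules are finitely generated right modules. $M$ is locally free if each $Me_i$ is a free $H_i$-module; its rank vector is then $(r_i)$, $r_i=\mathrm{rank}_{H_i}Me_i$. All $\tau$-rigid $H$-modules are locally free. $\tau$-tilting pairs. $M$ is $\tau$-rigid if $\mathrm{Hom}_H(M,\tau M)=0$ ($\tau$ the Auslander-Reiten translation). A pair $(M,P)$, $P$ projective, is $\tau$-rigid if $M$ is $\tau$-rigid and $\mathrm{Hom}_H(P,M)=0$, and $\tau$-tilting if also $|M|+|P|=n$ ($|X|$ = number of non-isomorphic indecomposable summands). Pairs are basic and up to isomorphism. $\Psi_H(M,P)=\mathrm{Fac}\,M$, the class of quotients of finite direct sums of copies of $M$. $c$-clusters. $\Phi_{\ge-1}=\Phi^+\cup\{-\alpha_1,\dots,-\alpha_n\}$. $\sigma_i\colon\Phi_{\ge-1}\to\Phi_{\ge-1}$ fixes $-\alpha_j$ ($j\neq i$) and equals $s_i$ otherwise; $\tau_c=\sigma_{i_1}\circ\cdots\circ\sigma_{i_n}$ for $c=s_{i_1}\cdots s_{i_n}$. The $c$-compatibility degree is the unique function $(\cdot\parallel_c\cdot)\colon\Phi_{\ge-1}^2\to\mathbb{Z}_{\ge0}$ with $(-\alpha_i\parallel_c\sum_jb_j\alpha_j)=\max\{0,b_i\}$ and $(\tau_c\alpha\parallel_c\tau_c\beta)=(\alpha\parallel_c\beta)$. $\alpha,\beta$ are $c$-compatible if both degrees $(\alpha\parallel_c\beta),(\beta\parallel_c\alpha)$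 vanish; a $c$-cluster is a maximal set of pairwise $c$-compatible elements. $\phi_c$ sends an indecomposable $\tau$-rigid pair $(M,0)$ to $\sum r_i\alpha_i$ ($(r_i)$ the rank vector of $M$) and $(0,P_i)$ to $-\alpha_i$; it is a bijection onto $\Phi_{\ge-1}$. $\tilde\phi_c$ sends a $\tau$-tilting pair $\bigoplus(N_i,Q_i)$ (indecomposable summands) to the $c$-cluster $\{\phi_c(N_i,Q_i)\}$; it is a bijection from $\tau$-tilting pairs to $c$-clusters. Cambrian lattice. With $c^\infty=c_1\cdots c_nc_1\cdots c_n\cdots$, the $c$-sorting word of $w\in W(\Phi)$ is the reduced word of $w$ whose leftmost embedding as a subword of $c^\infty$ is lexicographically first; $w$ is $c$-sortable if the sequence of subsets of letters its $c$-sorting word uses in successive blocks $c_1\cdots c_n$ of $c^\infty$ is weakly decreasing under inclusion. $\mathrm{I}(w)=\{\alpha\in\Phi^+\mid w^{-1}(\alpha)\text{ is a negative root}\}$. $\mathfrak{C}_c$ is the set of $c$-sortable elements ordered by inclusion of inversion sets. The map $\mathrm{cl}_c$. For a $c$-sortable $w$ with $c$-sorting word $a=a_1\cdots a_k$: for each $s_i$ occurring in $a$, with rightmost occurrence $a_j=s_i$, take the positive root $a_1\cdots a_{j-1}(\alpha_i)$; for each $s_i$ not occurring in $a$, take $-\alpha_i$. $\mathrm{cl}_c(w)$ is the set of these $n$ roots; it is a $c$-cluster. $\mathsf{tors}\,H$ is the set of torsion classes of $\mathrm{mod}\,H$ ordered by inclusion. The Hasse quiver $\mathsf{Hasse}(L)$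 of a poset $L$ has an arrow $x\to y$ when $x$ covers $y$. *)

(* Defs.v *)
From HB Require Import structures.
From mathcomp Require Import all_boot all_order all_algebra.
From mathcomp Require Import generic_quotient ring_quotient.
From mathcomp Require Import all_classical.
From mathcomp Require Import reals.
Set Implicit Arguments.
Unset Strict Implicit.
Unset Printing Implicit Defensive.
Import GRing.Theory Num.Theory.
Local Open Scope classical_set_scope.
Local Open Scope ring_scope.

Record quiver := Quiver {
  vertex : finType;
  arrow : finType;
  source : arrow -> vertex;
  target : arrow -> vertex }.

Section PathAlgebra.
Variables (Q : quiver) (K : fieldType).

(* (v, p) stands for the path p starting at v; (v, [::]) is the trivial path e_v.
   An element of the path algebra is a finitely supported function on such pairs
   which vanishes on the pairs that are not paths. *)
Definition route := (vertex Q * seq (arrow Q))%type.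

Fixpoint composable (v : vertex Q) (p : seq (arrow Q)) : bool :=
  if p is a :: p' then (source a == v) && composable (target a) p' else true.

Definition path_end (v : vertex Q) (p : seq (arrow Q)) : vertex Q :=
  last v (map (@target Q) p).

Definition path_alg_pred (f : route -> K) : Prop :=
  finite_set [set x | f x != 0]
  /\ (forall v p, f (v, p) != 0 -> composable v p).

Record path_alg := PathAlg {
  pcoef :> route -> K;
  pcoefP : `[< path_alg_pred pcoef >] }.

HB.instance Definition _ := [isSub for pcoef].
HB.instance Definition _ := [Choice of path_alg by <:].

Implicit Types x y z : path_alg.

Lemma path_algP x : path_alg_pred x. Proof. exact/asboolP/pcoefP. Qed.

Lemma pcoef_inj x y : (forall v p, x (v, p) = y (v, p)) -> x = y.
Proof. by move=> xy; apply: val_inj; apply/funext => -[]. Qed.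

Lemma pzero_pred : path_alg_pred (fun=> 0).
Proof.
split=> [|v p]; last by rewrite eqxx.
by rewrite (_ : [set _ | _] = set0) // -subset0 => z /=; rewrite eqxx.
Qed.
Definition pzero := PathAlg (introT (asboolP _) pzero_pred).

Lemma padd_pred x y : path_alg_pred (fun r => x r + y r).
Proof.
have [xf xc] := path_algP x; have [yf yc] := path_algP y; split=> [|v p].
  apply: (@sub_finite_set _ _ ([set r | x r != 0] `|` [set r | y r != 0])).
    move=> r /=; have [->|x0 _] := eqVneq (x r) 0; last by left.
    by rewrite add0r; right.
  by rewrite finite_setU.
have [->|/xc//] := eqVneq (x (v, p)) 0; rewrite add0r; exact: yc.
Qed.
Definition padd x y := PathAlg (introT (asboolP _) (padd_pred x y)).

Lemma popp_pred x : path_alg_pred (fun r => - x r).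
Proof.
have [xf xc] := path_algP x; split=> [|v p]; last by rewrite oppr_eq0; exact: xc.
by rewrite (_ : [set _ | _] = [set r | x r != 0])//; apply/seteqP; split=> r /=;
  rewrite oppr_eq0.
Qed.
Definition popp x := PathAlg (introT (asboolP _) (popp_pred x)).

Fact paddA : associative padd.
Proof. by move=> x y z; apply: pcoef_inj => v p /=; rewrite addrA. Qed.
Fact paddC : commutative padd.
Proof. by move=> x y; apply: pcoef_inj => v p /=; rewrite addrC. Qed.
Fact padd0 : left_id pzero padd.
Proof. by move=> x; apply: pcoef_inj => v p /=; rewrite add0r. Qed.
Fact paddN : left_inverse pzero popp padd.
Proof. by move=> x; apply: pcoef_inj => v p /=; rewrite addNr. Qed.
HB.instance Definition _ :=
  GRing.isZmodule.Build path_alg paddA paddC padd0 paddN.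

Lemma pdelta_pred (v : vertex Q) (p : seq (arrow Q)) :
  path_alg_pred (fun r => ((r == (v, p)) && composable v p)%:R).
Proof.
split=> [|u q].
  apply: (sub_finite_set _ (finite_set1 (v, p))) => r /=.
  by case: (r =P (v, p)) => //= _; rewrite eqxx.
by case: ((u, q) =P (v, p)) => [[-> ->]|_] /=; [case: composable|]; rewrite ?eqxx.
Qed.
Definition path_elt v p := PathAlg (introT (asboolP _) (pdelta_pred v p)).

Lemma pone_pred : path_alg_pred (fun r => (r.2 == [::])%:R).
Proof.
split=> [|u q] /=; last by case: q => //= a q; rewrite ?mulr0n eqxx.
apply: (@sub_finite_set _ _ [set (v, [::]) | v in [set: vertex Q]]).
  by case=> v [|a p] /=; [exists v | rewrite ?mulr0n eqxx].
exact: finite_image.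
Qed.
Definition pone := PathAlg (introT (asboolP _) pone_pred).

(* Paths compose left to right: (f * g)(p) is the sum of f(p') g(p'') over the
   factorisations of p as p' followed by p''. *)
Definition pmul_fun (f g : route -> K) (r : route) : K :=
  \sum_(k < (size r.2).+1)
    f (r.1, take k r.2) * g (path_end r.1 (take k r.2), drop k r.2).

Lemma composable_cat v p q :
  composable v (p ++ q) = composable v p && composable (path_end v p) q.
Proof. by elim: p v => [|a p IH] v //=; rewrite IH andbA. Qed.

Lemma pmul_pred x y : path_alg_pred (pmul_fun x y).
Proof.
have [xf xc] := path_algP x; have [yf yc] := path_algP y.
have key v p : pmul_fun x y (v, p) != 0 -> exists k,
   x (v, take k p) != 0 /\ y (path_end v (take k p), drop k p) != 0.
  move=> /eqP nz; apply: contra_notP nz => /forallNP nz.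
  rewrite /pmul_fun big1 // => k _ /=.
  have /not_andP[/negP|/negP] := nz k; rewrite negbK => /eqP ->.
    by rewrite mul0r.
  by rewrite mulr0.
split=> [|v p /key[k [/xc xk /yc yk]]].
  apply: (@sub_finite_set _ _
    [set (r.1.1, r.1.2 ++ r.2.2) | r in [set r | x r != 0] `*` [set r | y r != 0]]).
    case=> v p /= /key[k [xk yk]].
    by exists ((v, take k p), (path_end v (take k p), drop k p)); rewrite //= cat_take_drop.
  by apply: finite_image; apply: finite_setX.
by rewrite -(cat_take_drop k p) composable_cat xk yk.
Qed.
Definition pmul x y := PathAlg (introT (asboolP _) (pmul_pred x y)).

Lemma pmul_nil f g v : pmul_fun f g (v, [::]) = f (v, [::]) * g (v, [::]).
Proof. by rewrite /pmul_fun /= big_ord1. Qed.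

Lemma pmul_cons f g v a p : pmul_fun f g (v, a :: p) =
  f (v, [::]) * g (v, a :: p)
  + pmul_fun (fun r => f (v, a :: r.2)) g (target a, p).
Proof. by rewrite /pmul_fun /= big_ord_recl /=. Qed.

Lemma pmul_funDl f1 f2 g r :
  pmul_fun (fun r => f1 r + f2 r) g r = pmul_fun f1 g r + pmul_fun f2 g r.
Proof. by rewrite -big_split; apply: eq_bigr => k _ /=; rewrite mulrDl. Qed.

Lemma pmul_funZl k f g r : pmul_fun (fun r => k * f r) g r = k * pmul_fun f g r.
Proof. by rewrite /pmul_fun mulr_sumr; apply: eq_bigr => i _; rewrite mulrA. Qed.

Lemma pmul_funA f g h v p :
  pmul_fun f (pmul_fun g h) (v, p) = pmul_fun (pmul_fun f g) h (v, p).
Proof.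
elim: p v f g => [|a p IH] v f g; first by rewrite !pmul_nil mulrA.
rewrite !pmul_cons pmul_nil mulrDr mulrA -addrA; congr (_ + _).
rewrite IH -pmul_funZl -pmul_funDl.
rewrite /pmul_fun; apply: eq_bigr => k _ /=; congr (_ * _).
by rewrite -/(pmul_fun f g (v, a :: take k p)) pmul_cons.
Qed.

Fact pmulA : associative pmul.
Proof. by move=> x y z; apply: pcoef_inj => v p; apply: pmul_funA. Qed.

Fact pmul1x : left_id pone pmul.
Proof.
move=> x; apply: pcoef_inj => v p /=; rewrite /pmul_fun big_ord_recl /=.
rewrite take0 drop0 eqxx mul1r big1 ?addr0 // => k _.
by case: p k => [[]//|a p k]; rewrite /= mul0r.
Qed.

Fact pmulx1 : right_id pone pmul.
Proof.
move=> x; apply: pcoef_inj => v p /=; rewrite /pmul_fun big_ord_recr /=.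
rewrite take_size drop_size eqxx mulr1 big1 ?add0r // => k _.
by rewrite -size_eq0 size_drop subn_eq0 leqNgt ltn_ord mulr0.
Qed.

Fact pmulDl : left_distributive pmul +%R.
Proof. by move=> x y z; apply: pcoef_inj => v p; apply: pmul_funDl. Qed.

Fact pmulDr : right_distributive pmul +%R.
Proof.
move=> x y z; apply: pcoef_inj => v p /=.
by rewrite -big_split; apply: eq_bigr => k _ /=; rewrite mulrDr.
Qed.

HB.instance Definition _ := GRing.Zmodule_isPzRing.Build path_alg
  pmulA pmul1x pmulx1 pmulDl pmulDr.

Lemma pconst_pred (k : K) :
  path_alg_pred (fun r => if r.2 is [::] then k else 0).
Proof.
split=> [|u q] /=; last by case: q => //= a q; rewrite ?mulr0n eqxx.
apply: (@sub_finite_set _ _ [set (v, [::]) | v in [set: vertex Q]]).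
  by case=> v [|a p] /=; [exists v | rewrite ?mulr0n eqxx].
exact: finite_image.
Qed.
Definition path_const k := PathAlg (introT (asboolP _) (pconst_pred k)).

Lemma path_constMl k x v p : (path_const k * x) (v, p) = k * x (v, p).
Proof.
rewrite /= /pmul_fun big_ord_recl /= take0 drop0 big1 ?addr0 // => i _.
by case: p i => [[]//|a p i]; rewrite /= mul0r.
Qed.

Lemma path_constC k x : path_const k * x = x * path_const k.
Proof.
apply: pcoef_inj => v p; rewrite path_constMl /= /pmul_fun big_ord_recr /=.
rewrite take_size drop_size mulrC big1 ?add0r // => i _.
case E: (drop i p) => [|a q]; last by rewrite mulr0.
by move/eqP: E; rewrite -size_eq0 size_drop subn_eq0 leqNgt ltn_ord.
Qed.

Fact path_const_zmod : zmod_morphism path_const.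
Proof.
by move=> k l; apply: pcoef_inj => v [|a p] //=; rewrite oppr0 addr0.
Qed.
Fact path_const_monoid : monoid_morphism path_const.
Proof.
split=> [|k l]; apply: pcoef_inj => v p; first by case: p.
by rewrite path_constMl; case: p => //= *; rewrite mulr0.
Qed.
HB.instance Definition _ :=
  GRing.isZmodMorphism.Build K path_alg path_const path_const_zmod.
HB.instance Definition _ :=
  GRing.isMonoidMorphism.Build K path_alg path_const path_const_monoid.

End PathAlgebra.

Section QuotientAlgebra.
Variable A : pzRingType.

Definition two_sided_ideal (I : set A) : Prop :=
  [/\ I 0, forall x y, I x -> I y -> I (x - y)
    & forall a b x, I x -> I (a * x * b)].

Variable S : set A.

Definition ideal_gen : {pred A} :=
  fun x => `[< forall I, two_sided_ideal I -> S `<=` I -> I x >].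

Lemma ideal_gen0 : zmod_closed ideal_gen.
Proof.
split=> [|x y /asboolP Ix /asboolP Iy]; apply/asboolP => I Iid SI.
  by case: Iid.
by case: (Iid) => _ IB _; apply: IB; [apply: Ix | apply: Iy].
Qed.
HB.instance Definition _ := GRing.isZmodClosed.Build A ideal_gen ideal_gen0.

Lemma ideal_genM a b x : x \in ideal_gen -> a * x * b \in ideal_gen.
Proof.
move=> /asboolP Ix; apply/asboolP => I Iid SI.
by case: (Iid) => _ _ IM; apply: IM; apply: Ix.
Qed.

Definition quot_alg : Type := Quotient.quot ideal_gen.
HB.instance Definition _ := GRing.Zmodule.on quot_alg.
HB.instance Definition _ := EqQuotient.on quot_alg.

Definition quot_proj (x : A) : quot_alg := \pi_(Quotient.quot ideal_gen)%qT x.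
Definition quot_repr (x : quot_alg) : A := repr (x : Quotient.quot ideal_gen).

Lemma quot_reprK x : quot_proj (quot_repr x) = x.
Proof. exact: reprK. Qed.

Lemma quot_projP x y : quot_proj x = quot_proj y <-> x - y \in ideal_gen.
Proof.
rewrite Quotient.idealrBE /quot_proj; split=> [->//|/eqP //].
Qed.

Lemma quot_projD x y : quot_proj (x + y) = quot_proj x + quot_proj y.
Proof. exact: Quotient.pi_add. Qed.

Definition qone : quot_alg := quot_proj 1.
Definition qmul (x y : quot_alg) := quot_proj (quot_repr x * quot_repr y).

Lemma quot_projM x y : quot_proj (x * y) = qmul (quot_proj x) (quot_proj y).
Proof.
apply/quot_projP; set x' := quot_repr _; set y' := quot_repr _.
have Ix : x - x' \in ideal_gen by apply/quot_projP; rewrite quot_reprK.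
have Iy : y - y' \in ideal_gen by apply/quot_projP; rewrite quot_reprK.
rewrite (_ : _ - _ = 1 * (x - x') * y + x' * (y - y') * 1).
  by rewrite rpredD ?ideal_genM.
by rewrite mul1r mulr1 mulrBl mulrBr addrA subrK.
Qed.

Fact qmulA : associative qmul.
Proof.
move=> x y z; rewrite -(quot_reprK x) -(quot_reprK y) -(quot_reprK z).
by rewrite -!quot_projM mulrA.
Qed.
Fact qmul1x : left_id qone qmul.
Proof. by move=> x; rewrite -(quot_reprK x) -quot_projM mul1r. Qed.
Fact qmulx1 : right_id qone qmul.
Proof. by move=> x; rewrite -(quot_reprK x) -quot_projM mulr1. Qed.
Fact qmulDl : left_distributive qmul +%R.
Proof.
move=> x y z; rewrite -(quot_reprK x) -(quot_reprK y) -(quot_reprK z).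
by rewrite -quot_projD -!quot_projM -quot_projD mulrDl.
Qed.
Fact qmulDr : right_distributive qmul +%R.
Proof.
move=> x y z; rewrite -(quot_reprK x) -(quot_reprK y) -(quot_reprK z).
by rewrite -quot_projD -!quot_projM -quot_projD mulrDr.
Qed.
HB.instance Definition _ := GRing.Zmodule_isPzRing.Build quot_alg
  qmulA qmul1x qmulx1 qmulDl qmulDr.

Fact quot_proj_zmod : zmod_morphism quot_proj.
Proof.
by move=> x y; apply/eqP; rewrite eq_sym subr_eq -quot_projD subrK.
Qed.
Fact quot_proj_monoid : monoid_morphism quot_proj.
Proof. by split=> // x y; exact: quot_projM. Qed.
HB.instance Definition _ :=
  GRing.isZmodMorphism.Build A quot_alg quot_proj quot_proj_zmod.
HB.instance Definition _ :=
  GRing.isMonoidMorphism.Build A quot_alg quot_proj quot_proj_monoid.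

End QuotientAlgebra.

(* Right modules over a ring A are the left modules over the converse ring:
   for a : A and m : M, the element m a is (a : A^c) *: m.  The structure of
   K-algebra on A is given by a ring morphism iota : K -> A, which is central
   in the intended use. *)
Section RightModules.
Variable A : pzRingType.
Implicit Types L M N P X Y : lmodType A^c.

Definition rmul M (m : M) (a : A) : M := (a : A^c) *: m.

Definition surj (T U : Type) (f : T -> U) : Prop := forall y, exists x, f x = y.

Definition zero_module M : Prop := forall m : M, m = 0.

Definition isom M N : Prop := exists f : {linear M -> N}, bijective f.

Definition fin_gen M : Prop :=
  exists (k : nat) (g : 'I_k -> M),
    forall m, exists a : 'I_k -> A, m = \sum_(i < k) rmul (g i) (a i).

Definition summand N M : Prop :=
  exists X, isom M ((N * X)%type : lmodType A^c).

Definition indecomposable M : Prop :=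
  ~ zero_module M /\
  forall X Y, isom M ((X * Y)%type : lmodType A^c) ->
    zero_module X \/ zero_module Y.

(* |M| = k *)
Definition num_indec_summands M (k : nat) : Prop :=
  exists N : 'I_k -> lmodType A^c,
    [/\ forall i, indecomposable (N i) /\ summand (N i) M,
        forall i j, isom (N i) (N j) -> i = j
      & forall X, indecomposable X -> summand X M -> exists i, isom X (N i)].

Definition basic M : Prop :=
  forall N, indecomposable N -> ~ summand ((N * N)%type : lmodType A^c) M.

Definition projective P : Prop :=
  forall M N (f : {linear M -> N}) (g : {linear P -> N}), surj f ->
    exists h : {linear P -> M}, forall x, f (h x) = g x.

(* P1 -p-> P0 -q-> M -> 0 is exact, q is a projective cover of M and p induces
   a projective cover of ker q. *)
Definition min_proj_presentation M P1 P0
    (p : {linear P1 -> P0}) (q : {linear P0 -> M}) : Prop :=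
  [/\ projective P0 /\ projective P1, surj q,
      forall X (g : {linear X -> P0}), surj (q \o g) -> surj g,
      forall y, q y = 0 <-> exists x, p x = y
    & forall X (g : {linear X -> P1}),
        (forall y, q y = 0 -> exists x, p (g x) = y) -> surj g].

(* The left module T is Tr M: it is the cokernel, through pr, of
   Hom_A(P0, A) -> Hom_A(P1, A), where a f is x |-> a (f x). *)
Definition is_transpose M (T : lmodType A) : Prop :=
  exists (P1 P0 : lmodType A^c) (p : {linear P1 -> P0}) (q : {linear P0 -> M}),
    min_proj_presentation p q /\
    exists pr : {linear P1 -> (A^c)^o} -> T,
      [/\ forall (a : A) (f g h : {linear P1 -> (A^c)^o}),
            (forall x, h x = a * (f x : A) + (g x : A) :> A) ->
            pr h = a *: pr f + pr g,
          surj pr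
        & forall f, pr f = 0 <->
            exists g : {linear P0 -> (A^c)^o}, forall x, f x = g (p x)].

Variables (K : fieldType) (iota : {rmorphism K -> A}).

Definition K_linear_form (T : lmodType A) (phi : T -> K) : Prop :=
  forall k x y, phi (iota k *: x + y) = k * phi x + phi y.

(* The right module N is D T = Hom_K(T, K), where phi a is l |-> phi (a l). *)
Definition is_dual (T : lmodType A) N : Prop :=
  exists theta : N -> T -> K,
    [/\ forall x, K_linear_form (theta x),
        forall (a : A) x y l,
          theta (rmul x a + y) l = theta x (a *: l) + theta y l
      & forall phi, K_linear_form phi ->
          exists! x, forall l, theta x l = phi l].

(* N is isomorphic to tau M = D Tr M *)
Definition is_AR_translate M N : Prop :=
  exists T : lmodType A, is_transpose M T /\ is_dual T N.

Definition tau_rigid M : Prop :=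
  fin_gen M /\
  exists2 N, is_AR_translate M N & forall (f : {linear M -> N}) x, f x = 0.

Definition tau_rigid_pair M P : Prop :=
  [/\ tau_rigid M, fin_gen P, projective P
    & forall (f : {linear P -> M}) x, f x = 0].

Definition tau_tilting_pair (n : nat) M P : Prop :=
  [/\ tau_rigid_pair M P, basic M, basic P
    & exists k l, [/\ num_indec_summands M k, num_indec_summands P l
                    & (k + l)%N = n]].

Definition Fac M N : Prop :=
  exists (k : nat) (f : {linear {ffun 'I_k -> M} -> N}), surj f.

Definition torsion_class (T : lmodType A^c -> Prop) : Prop :=
  [/\ forall M, T M -> fin_gen M,
      forall M, zero_module M -> T M,
      forall M N (f : {linear M -> N}), T M -> surj f -> T N
    & forall L M N (f : {linear L -> M}) (g : {linear M -> N}),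
        injective f -> (forall y, g y = 0 <-> exists x, f x = y) -> surj g ->
        T L -> T N -> T M].

Definition subclass (S T : lmodType A^c -> Prop) : Prop :=
  forall M, S M -> T M.

(* P is isomorphic to eA *)
Definition isom_right_ideal (e : A) P : Prop :=
  exists f : {linear P -> (A^c)^o}, injective f /\
    forall h : A, (exists x, f x = h) <-> (exists a, h = e * a).

(* Me is free of rank r over eAe *)
Definition corner_free (e : A) M (r : nat) : Prop :=
  exists b : 'I_r -> M, (forall j, rmul (b j) e = b j) /\
    forall m, rmul m e = m ->
      exists! h : {ffun 'I_r -> A},
        (forall j, exists a, h j = e * a * e)
        /\ m = \sum_(j < r) rmul (b j) (h j).

End RightModules.

(* inX and inY carve out the underlying sets of the two posets; f may take any
   value outside inX. *)
Section Hasse.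
Variables T U : Type.
Variables (inX : T -> Prop) (leX : T -> T -> Prop).
Variables (inY : U -> Prop) (leY : U -> U -> Prop).

Definition bij_on (f : T -> U) : Prop :=
  [/\ forall x, inX x -> inY (f x),
      forall x y, inX x -> inX y -> f x = f y -> x = y
    & forall y, inY y -> exists2 x, inX x & f x = y].

Definition order_iso (f : T -> U) : Prop :=
  bij_on f /\ forall x y, inX x -> inX y -> (leX x y <-> leY (f x) (f y)).
End Hasse.

Definition hasse_arrow (T : Type) (inX : T -> Prop) (leX : T -> T -> Prop)
    (x y : T) : Prop :=
  [/\ leX y x, x <> y
    & forall z, inX z -> leX y z -> leX z x -> z = x \/ z = y].

Definition hasse_iso (T U : Type)
    (inX : T -> Prop) (leX : T -> T -> Prop)
    (inY : U -> Prop) (leY : U -> U -> Prop) (f : T -> U) : Prop :=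
  bij_on inX inY f /\
  forall x y, inX x -> inX y ->
    (hasse_arrow inX leX x y <-> hasse_arrow inY leY (f x) (f y)).

Record root_system (R : realType) (V : vectType R) (n : nat) := RootSystem {
  rs_form : V -> V -> R;
  rs_formC : forall x y, rs_form x y = rs_form y x;
  rs_form_linear : forall a x y z,
    rs_form (a *: x + y) z = a * rs_form x z + rs_form y z;
  rs_form_gt0 : forall x, x != 0 -> 0 < rs_form x x;
  rs_root : seq V;
  rs_root0 : 0 \notin rs_root;
  rs_span : <<rs_root>>%VS = fullv;
  rs_reduced : forall (x : V) (a : R),
    x \in rs_root -> a *: x \in rs_root -> a = 1 \/ a = -1;
  rs_reflect : forall x y, x \in rs_root -> y \in rs_root ->
    y - (2 * rs_form x y / rs_form x x) *: x \in rs_root;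
  rs_integral : forall x y, x \in rs_root -> y \in rs_root ->
    2 * rs_form x y / rs_form x x \is a Num.int;
  rs_simple : n.-tuple V;
  rs_simple_root : {subset rs_simple <= rs_root};
  rs_simple_basis : basis_of fullv rs_simple;
  rs_simple_sign : forall x, x \in rs_root ->
    (forall i, coord rs_simple i x \is a Num.nat)
    \/ (forall i, coord rs_simple i (- x) \is a Num.nat) }.

Section RootSystem.
Variables (R : realType) (V : vectType R) (n : nat) (Phi : root_system V n).

Definition alpha (i : 'I_n) : V := tnth (rs_simple Phi) i.

Definition reflection (i : 'I_n) (x : V) : V :=
  x - (2 * rs_form Phi (alpha i) x / rs_form Phi (alpha i) (alpha i)) *: alpha i.

Fact reflection_is_linear i : linear (reflection i).
Proof.
move=> a x y; rewrite /reflection !(rs_formC Phi (alpha i)) rs_form_linear.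
rewrite mulrDr mulrDl (mulrCA 2) -(mulrA a) scalerDl opprD addrACA.
by rewrite scalerBr scalerA.
Qed.
HB.instance Definition _ i :=
  GRing.isLinear.Build R V V _ (reflection i) (reflection_is_linear i).

Definition simple_refl (i : 'I_n) : 'End(V) := linfun (reflection i).

Definition cartan : 'M[int]_n :=
  \matrix_(i, j) Num.floor (2 * rs_form Phi (alpha i) (alpha j)
                              / rs_form Phi (alpha i) (alpha i)).

Lemma simple_reflE i j :
  simple_refl i (alpha j) = alpha j - (cartan i j)%:~R *: alpha i.
Proof.
by rewrite lfunE /= mxE floorK // rs_integral ?rs_simple_root ?mem_tnth.
Qed.

Definition is_symmetrizer (d : 'I_n -> nat) : Prop :=
  (forall i, 0 < d i)%N /\
  (let DC := diag_mx (\row_i (d i)%:Z) *m cartan in DC^T = DC).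

Definition pos_root (x : V) : bool :=
  (x \in rs_root Phi) && [forall i, 0 <= coord (rs_simple Phi) i x].

Definition almost_pos_root (x : V) : bool :=
  pos_root x || [exists i, x == - alpha i].

(* s_{a_1} o ... o s_{a_k} for the word a = a_1 ... a_k *)
Definition wprod (a : seq 'I_n) : 'End(V) :=
  foldr (fun i f => (simple_refl i \o f)%VF) \1%VF a.

Definition weyl : set 'End(V) := range wprod.

Definition reduced_word (w : 'End(V)) (a : seq 'I_n) : Prop :=
  wprod a = w /\ forall b, wprod b = w -> (size a <= size b)%N.

Definition inversions (w : 'End(V)) : set V :=
  [set x | pos_root x /\ pos_root (- (w^-1)%VF x)].

(* A Coxeter element is given by a word c in which each letter occurs once. *)
Variable c : seq 'I_n.

Definition coxeter_word : Prop := perm_eq c (enum 'I_n).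

(* ts lists the positions, counted from 0, of an occurrence of a as a subword
   of the periodic word c c c ..., whose letter at position k n + index i c
   is i. *)
Definition embedding (a : seq 'I_n) (ts : seq nat) : Prop :=
  sorted ltn ts /\ [seq (t %% n)%N | t <- ts] = [seq index i c | i <- a].

Definition leftmost_embedding (a : seq 'I_n) (ts : seq nat) : Prop :=
  embedding a ts /\
  forall us, embedding a us -> ((ts : seqlexi nat) <= (us : seqlexi nat))%O.

Definition sorting_embedding (w : 'End(V)) (a : seq 'I_n) (ts : seq nat) :=
  [/\ reduced_word w a, leftmost_embedding a ts
    & forall b us, reduced_word w b -> leftmost_embedding b us ->
        ((ts : seqlexi nat) <= (us : seqlexi nat))%O].

Definition sorting_word (w : 'End(V)) (a : seq 'I_n) : Prop :=
  exists ts, sorting_embedding w a ts.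

(* The letters used in the block number k of the periodic word *)
Definition block (ts : seq nat) (k : nat) : {set 'I_n} :=
  [set i | (k * n + index i c)%N \in ts].

Definition sortable (w : 'End(V)) : Prop :=
  weyl w /\ exists a ts, sorting_embedding w a ts /\
    forall k, block ts k.+1 \subset block ts k.

Definition cambrian : set 'End(V) := [set w | sortable w].

Definition cambrian_le (v w : 'End(V)) : Prop :=
  inversions v `<=` inversions w.

(* In a = u ++ i :: v with i \notin v, the displayed i is the rightmost one. *)
Definition cl (w : 'End(V)) : set V :=
  [set x | exists a i, sorting_word w a /\
     ((exists u v, [/\ a = u ++ i :: v, i \notin v & x = wprod u (alpha i)])
      \/ (i \notin a /\ x = - alpha i))].

Definition sigma (i : 'I_n) (x : V) : V :=
  if [exists j, (j != i) && (x == - alpha j)] then x else simple_refl i x.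

Definition tau_c (x : V) : V := foldr sigma x c.

Definition is_compat_degree (f : V -> V -> nat) : Prop :=
  (forall i x, almost_pos_root x ->
     (f (- alpha i) x)%:R = Num.max 0 (coord (rs_simple Phi) i x)) /\
  (forall x y, almost_pos_root x -> almost_pos_root y ->
     f (tau_c x) (tau_c y) = f x y).

Definition c_compatible (x y : V) : Prop :=
  exists f, [/\ is_compat_degree f, f x y = 0%N & f y x = 0%N].

Definition pairwise_c_compatible (C : set V) : Prop :=
  (forall x, C x -> almost_pos_root x) /\
  forall x y, C x -> C y -> c_compatible x y.

Definition c_cluster (C : set V) : Prop :=
  pairwise_c_compatible C /\
  forall C', pairwise_c_compatible C' -> C `<=` C' -> C' = C.

Definition has_arrow (ij : 'I_n * 'I_n) : bool :=
  (index ij.1 c < index ij.2 c)%N &&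
  ((simple_refl ij.1 \o simple_refl ij.2)%VF
     != (simple_refl ij.2 \o simple_refl ij.1)%VF).

(* inl i is the loop at i; inr (i, j) is the arrow from i to j *)
Definition gls_quiver : quiver :=
  @Quiver 'I_n ('I_n + {ij | has_arrow ij})%type
    (fun a => match a with inl i => i | inr ij => (val ij).1 end)
    (fun a => match a with inl i => i | inr ij => (val ij).2 end).

Variables (d : 'I_n -> nat) (K : fieldType).

Definition loop (i : 'I_n) : path_alg gls_quiver K :=
  @path_elt gls_quiver K i [:: inl i].

Definition arr (ij : {ij | has_arrow ij}) : path_alg gls_quiver K :=
  @path_elt gls_quiver K (val ij).1 [:: inr ij].

Definition gls_relations : set (path_alg gls_quiver K) :=
  [set loop i ^+ d i | i in [set: 'I_n]] `|`
  [set (let: (i, j) := val ij in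
        loop i ^+ `|cartan j i|%N * arr ij - arr ij * loop j ^+ `|cartan i j|%N)
    | ij in [set: {ij | has_arrow ij}]].

Definition gls : Type := quot_alg gls_relations.
HB.instance Definition _ := GRing.PzRing.on gls.

Definition gls_proj (x : path_alg gls_quiver K) : gls := quot_proj gls_relations x.

Definition gls_scalar (k : K) : gls := quot_proj gls_relations (path_const _ k).
HB.instance Definition _ := GRing.RMorphism.copy gls_scalar
  (quot_proj gls_relations \o @path_const gls_quiver K).

Definition gls_idem (i : 'I_n) : gls := gls_proj (@path_elt gls_quiver K i [::]).

Notation gls_module := (lmodType gls^c).

Definition rank_vector (M : gls_module) (r : 'I_n -> nat) : Prop :=
  forall i, corner_free (gls_idem i) M (r i).

(* x = phi_c(N, Q) for an indecomposable pair (N, Q) *)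
Definition phi_c (N Q : gls_module) (x : V) : Prop :=
  (zero_module Q /\
     exists2 r, rank_vector N r & x = \sum_(i < n) alpha i *+ r i)
  \/ (zero_module N /\
     exists2 i, isom_right_ideal (gls_idem i) Q & x = - alpha i).

Definition indec_pair_summand (N Q M P : gls_module) : Prop :=
  [/\ indecomposable N, summand N M & zero_module Q]
  \/ [/\ zero_module N, indecomposable Q & summand Q P].

Definition tphi_c (M P : gls_module) : set V :=
  [set x | exists N Q, indec_pair_summand N Q M P /\ phi_c N Q x].

(* The graph of Psi_H o tphi_c^-1 o cl_c *)
Definition Psi_tphi_inv_cl (w : 'End(V)) (T : gls_module -> Prop) : Prop :=
  exists M P : gls_module,
    [/\ c_cluster (cl w), tau_tilting_pair gls_scalar n M P,
        tphi_c M P = cl w & T = Fac M].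

End RootSystem.

(* Main.v *)
(* The proof replaces H-modules by representations X of the quiver: vector spaces X_i with
   nilpotent loops and maps along the arrows.  At a source i, the reflection functor
   identifies the representations without quotient S_i, up to the orientation, with those
   without subobject S_i, so a torsion class T either misses S_i (and then T vanishes at i)
   or contains S_i and is the preimage of a torsion class for the rotated Coxeter word.  The
   same recursion defines c-sortable words, whence a bijection; the bricks of T
   have the inversions of the word as dimension vectors, up to scaling, and a torsion class
   is determined by its bricks, so inclusion becomes the weak order.  The indecomposable
   Ext-projectives of T are locally free and their rank vectors are the positive roots of
   cl_c(w), again by induction along reflections.  Finally M is tau-rigid iff it is
   Ext-projective in Fac M, so that the support tau-tilting module of T is the sum of its
   Ext-projectives; conversely a tau-tilting pair with cluster cl_c(w) generates a torsion
   class whose cluster contains cl_c(w), hence equals it by maximality. *)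

(* A representation is one vector space with the operators [Ge i], [Gl] and [Ga], so submodules,
   quotients and morphisms need no bookkeeping over vertices; the orientation enters only through
   [crep]. Reflection is a relation [refl M N], witnessed by a map P, not a functor: functoriality,
   faithfulness and exactness are statements about pairs of morphisms that agree along such maps.
   The obstacle is that torsion classes and bricks involve modules that are not locally free.
   Reflection is therefore set up for all modules, and bricks are tracked up to a positive scalar.
   Local freeness is what makes maps lift at a source, and it is carried along in the induction on
   Ext-projectives. Finite type gives that for adjacent i, j one of |C_ij|, |C_ji| is 1, so the
   reflected loop is nilpotent of the right order, and that there are finitely many roots, so the
   recursion ends. Skipped vertices are recorded in a set J instead of being deleted; n and the root
   system stay fixed. Compatibility is defined through an unspecified degree function, so a closed
   formula for the degree comes before any cluster can be recognised. *)
Require Import Defs.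
From HB Require Import structures.
From mathcomp Require Import all_boot all_order all_algebra.
From mathcomp Require Import all_classical.
From mathcomp Require Import reals zify ring lra.
Set Implicit Arguments.
Unset Strict Implicit.
Unset Printing Implicit Defensive.
Import Order.TTheory GRing.Theory Num.Theory.
Local Open Scope ring_scope.

(** * Linear algebra and representations *)

Section LinearAlgebra.
Variable K : fieldType.
Implicit Types U V W : vectType K.

Lemma lin_ex V W (h : V -> W) : linear h -> exists f : 'Hom(V, W), forall v, f v = h v.
Proof.
move=> lh; pose L := GRing.isLinear.Build K V W _ h lh.
pose h' : {linear V -> W} := HB.pack h L.
by exists (linfun h') => v; rewrite lfunE.
Qed.

Definition lin_pred V (P : V -> Prop) :=
  P 0 /\ forall k u v, P u -> P v -> P (k *: u + v).

(** A subspace of largest dimension inside P exhausts P, because a further vector of P would add a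
    line to it. Subspaces can thus be given by arbitrary propositions. *)
Lemma lin_pred_vspace V (P : V -> Prop) :
  lin_pred P -> exists U : {vspace V}, forall v, (v \in U) <-> P v.
Proof.
move=> [P0 Plin].
have PD u v : P u -> P v -> P (u + v).
  by move=> Pu Pv; rewrite -[u]scale1r; apply: Plin.
have PZ k u : P u -> P (k *: u) by move=> Pu; rewrite -[_ *: _]addr0; apply: Plin.
pose good k := `[< exists U : {vspace V}, \dim U = k /\ forall v, v \in U -> P v >].
have ex0 : exists k, good k.
  exists 0%N; apply/asboolP; exists 0%VS; rewrite dimv0; split=> // v.
  by rewrite memv0 => /eqP ->.
have bnd k : good k -> (k <= \dim {:V})%N.
  by move=> /asboolP[U [<- _]]; rewrite dimvS ?subvf.
case: (ex_maxnP ex0 bnd) => k /asboolP[U [dU UP]] kmax; exists U => v; split; first exact: UP.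
move=> Pv; apply: contrapT => /negP vU.
have : (\dim (U + <[v]>)%VS <= k)%N.
  apply/kmax/asboolP; exists (U + <[v]>)%VS; split=> // x /memv_addP[u uU [y /vlineP[t ->] ->]].
  by apply: PD; [apply: UP | apply: PZ].
rewrite dimv_disjoint_sum; last first.
  apply/eqP; rewrite -subv0; apply/subvP => x; rewrite memv_cap => /andP[xU /vlineP[t xt]].
  rewrite memv0 xt; apply: contraR vU; rewrite scaler_eq0 negb_or => /andP[t0 _].
  by rewrite -[v](scalerK t0) -xt memvZ.
rewrite dU dim_vline; case: eqP vU => [->|]; first by rewrite mem0v.
by rewrite addn1 ltnn.
Qed.

(** The form is a coordinate that does not vanish on the component of v complementary to P, composed
    with the projection along P. It produces quotients S_i of modules and, later, a map Y -> tau M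
    in the Auslander-Reiten formula. *)
Lemma separating_form V (P : V -> Prop) (v : V) : lin_pred P -> ~ P v ->
  exists phi : 'Hom(V, K^o), phi v = 1 /\ forall u, P u -> phi u = 0.
Proof.
move=> /lin_pred_vspace[U UP] /UP/negP vU.
pose w := v - projv U v.
have w0 : w != 0 by rewrite subr_eq0; apply: contraNneq vU => ->; rewrite memv_proj.
have [phi0 phi1] : exists phi : 'Hom(V, K^o), phi w = 1.
  have [i wi] : exists i, coord (vbasis {:V}) i w != 0.
    apply/existsP; rewrite -negb_forall; apply: contra w0 => /forallP ww.
    rewrite (coord_vbasis (memvf w)) big1 // => i _.
    by rewrite (eqP (ww i)) scale0r.
  have [|f fE] := @lin_ex V K^o (fun x => (coord (vbasis {:V}) i w)^-1 * coord (vbasis {:V}) i x).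
    have E (a b c k : K) : a * (k * b + c) = k * (a * b) + a * c by rewrite mulrDr mulrCA.
    by move=> k x y; rewrite linearP; apply: E.
  by exists f; rewrite fE mulVf.
have [|f fE] := @lin_ex V K^o (fun x => phi0 (x - projv U x)).
  move=> k x y; rewrite -linearP; congr (phi0 _).
  by rewrite linearP scalerBr opprD addrACA.
exists f; rewrite fE; split=> // u /UP uU.
by rewrite fE projv_id // subrr linear0.
Qed.

End LinearAlgebra.

Section Reps.
Variables (K : fieldType) (G : Type).

(** No relations are imposed here, so kernels, quotients and sums are formed for any set G of
    operators; with G = [void] these are plain vector spaces. The relations of the algebra are a
    separate predicate, inherited by quotients and submodules. *)
Record rep := Rep { sp :> vectType K; act : G -> 'End(sp) }.

Implicit Types L M N Q : rep.

Definition hom M N (f : 'Hom(M, N)) := forall g v, f (act M g v) = act N g (f v).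
Definition mono (V W : vectType K) (f : 'Hom(V, W)) := forall v, f v = 0 -> v = 0.
Definition epi (V W : vectType K) (f : 'Hom(V, W)) := forall w, exists v, f v = w.
Definition iso M N := exists f : 'Hom(M, N), [/\ hom f, mono f & epi f].
Definition ses L M N (i : 'Hom(L, M)) (q : 'Hom(M, N)) :=
  [/\ hom i, mono i, hom q, epi q & forall v, q v = 0 <-> exists w, v = i w].
Definition rep0 M := forall v : M, v = 0.
Definition stable M (P : M -> Prop) := forall g v, P v -> P (act M g v).

Lemma mono_inj (V W : vectType K) (f : 'Hom(V, W)) : mono f -> injective f.
Proof.
move=> fm u v fuv; apply/eqP; rewrite -subr_eq0; apply/eqP; apply: fm.
by rewrite linearB /= fuv subrr.
Qed.

Lemma hom1 M : hom (\1%VF : 'End(M)).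
Proof. by move=> g v; rewrite !id_lfunE. Qed.
Lemma hom0 M N : hom (0 : 'Hom(M, N)).
Proof. by move=> g v; rewrite !zero_lfunE linear0. Qed.
Lemma hom_comp L M N (f : 'Hom(M, N)) (h : 'Hom(L, M)) :
  hom f -> hom h -> hom (f \o h)%VF.
Proof. by move=> fh hh g v; rewrite !comp_lfunE hh fh. Qed.
Lemma homB M N (f h : 'Hom(M, N)) : hom f -> hom h -> hom (f - h).
Proof. by move=> fh hh g v; rewrite !(add_lfunE, opp_lfunE) fh hh linearB. Qed.
Lemma homD M N (f h : 'Hom(M, N)) : hom f -> hom h -> hom (f + h).
Proof. by move=> fh hh g v; rewrite !add_lfunE fh hh linearD. Qed.

Lemma hom_sum (I : Type) (r : seq I) M N (f : I -> 'Hom(M, N)) :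
  (forall t, hom (f t)) -> hom (\sum_(t <- r) f t).
Proof.
move=> fh; elim: r => [|t r IH]; first by rewrite big_nil; apply: hom0.
by rewrite big_cons; apply: homD.
Qed.

(** Most morphisms below are forced on generators rather than given by a formula; describing them by
    a graph reduces the construction to single-valuedness at 0. *)
Lemma graph_hom M N (R : M -> N -> Prop) :
  (forall k u v u' v', R u u' -> R v v' -> R (k *: u + v) (k *: u' + v')) ->
  (forall v, exists v', R v v') -> (forall v', R 0 v' -> v' = 0) ->
  (forall g v v', R v v' -> R (act M g v) (act N g v')) ->
  exists f : 'Hom(M, N), hom f /\ forall v, R v (f v).
Proof.
move=> Rlin /choice[h hR] R0 Ract.
have Runiq v v1 v2 : R v v1 -> R v v2 -> v1 = v2.
  move=> R1 R2; apply/eqP; rewrite -subr_eq0; apply/eqP/R0.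
  have -> : v1 - v2 = -1 *: v2 + v1 by rewrite scaleN1r addrC.
  by rewrite -(subrr v) addrC -[X in X + v]scaleN1r; apply: Rlin.
have [f fE] := @lin_ex K M N h (fun k u v => Runiq _ _ _ (hR _) (Rlin _ _ _ _ _ (hR u) (hR v))).
exists f; split=> [g v|v]; rewrite !fE //.
exact: Runiq (hR _) (Ract _ _ _ (hR v)).
Qed.

Lemma epi_factor M N Q (q : 'Hom(M, Q)) (f : 'Hom(M, N)) :
  hom q -> epi q -> hom f -> (forall v, q v = 0 -> f v = 0) ->
  exists h : 'Hom(Q, N), hom h /\ forall v, h (q v) = f v.
Proof.
move=> qh qe fh qf.
have key v v' : q v = q v' -> f v = f v'.
  move=> qv; apply/eqP; rewrite -subr_eq0 -linearB; apply/eqP/qf.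
  by rewrite linearB /= qv subrr.
have [||||h [hh hE]] := @graph_hom Q N (fun w w' => exists2 v, q v = w & f v = w').
- by move=> k u v u' v' [x <- <-] [y <- <-]; exists (k *: x + y); rewrite linearP.
- by move=> w; have [v <-] := qe w; exists (f v), v.
- by move=> w' [v /qf-> ->].
- by move=> g v v' [x <- <-]; exists (act M g x).
by exists h; split=> // v; have [x /key-> //] := hE (q v).
Qed.

Lemma mono_lift L M N (i : 'Hom(L, M)) (f : 'Hom(N, M)) :
  hom i -> mono i -> hom f -> (forall v, exists w, f v = i w) ->
  exists h : 'Hom(N, L), hom h /\ forall v, i (h v) = f v.
Proof.
move=> ih im fh fi.
have [||||h [hh hE]] := @graph_hom N L (fun v w => i w = f v).
- by move=> k u v u' v' E1 E2; rewrite !linearP /= E1 E2.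
- by move=> v; have [w] := fi v; exists w.
- by move=> w; rewrite linear0 => /im.
- by move=> g v v' E; rewrite ih fh E.
by exists h.
Qed.

Lemma hom_inv M N (f : 'Hom(M, N)) : hom f -> mono f -> epi f ->
  exists h : 'Hom(N, M), [/\ hom h, cancel f h & cancel h f].
Proof.
move=> fh fm fe.
have [h [hh hf]] := epi_factor fh fe (@hom1 M) (fun v e => etrans (id_lfunE v) (fm v e)).
have fK : cancel f h by move=> v; rewrite hf id_lfunE.
by exists h; split=> // w; have [v <-] := fe w; rewrite fK.
Qed.

Lemma iso_refl M : iso M M.
Proof.
by exists \1%VF; split=> [|v|w]; [apply: hom1 | rewrite id_lfunE | exists w; rewrite id_lfunE].
Qed.

Lemma iso_sym M N : iso M N -> iso N M.
Proof.
move=> [f [fh fm fe]]; have [h [hh fK hK]] := hom_inv fh fm fe.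
exists h; split=> // [w hw|v]; first by rewrite -(hK w) hw linear0.
by exists (f v).
Qed.

Lemma iso_trans L M N : iso L M -> iso M N -> iso L N.
Proof.
move=> [f [fh fm fe]] [h [hh hm he]]; exists (h \o f)%VF; split.
- exact: hom_comp.
- by move=> v; rewrite comp_lfunE => /hm/fm.
by move=> w; have [v <-] := he w; have [u <-] := fe v; exists u; rewrite comp_lfunE.
Qed.

Lemma subrep_ex M (P : M -> Prop) : lin_pred P -> stable P ->
  exists N (i : 'Hom(N, M)), [/\ hom i, mono i & forall v, P v <-> exists w, v = i w].
Proof.
move=> /lin_pred_vspace[U UP] st.
have st' g v : v \in U -> act M g v \in U by move=> /UP/st/UP.
pose N := @Rep (subvs_of U) (fun g => linfun (vsproj U \o (act M g \o vsval))).
exists N, (linfun vsval); split.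
- by move=> g v; rewrite !lfunE /= vsprojK ?st' ?subvsP.
- by move=> v; rewrite lfunE /= => v0; apply: val_inj; rewrite /= v0 ?linear0.
move=> v; rewrite -UP; split=> [vU|[w ->]]; last by rewrite lfunE /= subvsP.
by exists (vsproj U v); rewrite lfunE /= vsprojK.
Qed.

(** The quotient by U is realised as the image of v |-> v - [projv U v], that is, on a complement of
    U. *)
Lemma quotrep_ex M (P : M -> Prop) : lin_pred P -> stable P ->
  exists N (q : 'Hom(M, N)), [/\ hom q, epi q & forall v, q v = 0 <-> P v].
Proof.
move=> /lin_pred_vspace[U UP] st.
have st' g v : v \in U -> act M g v \in U by move=> /UP/st/UP.
have ql : linear (fun v : M => v - projv U v).
  by move=> k u v; rewrite linearP scalerBr opprD addrACA.
have [f fE] := lin_ex ql.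
pose W := limg f; pose q : 'Hom(M, subvs_of W) := linfun (vsproj W \o f).
have qE v : vsval (q v) = v - projv U v.
  by rewrite lfunE /= vsprojK ?memv_img ?memvf // fE.
pose N := @Rep (subvs_of W) (fun g => (q \o act M g \o linfun vsval)%VF).
have q0 v : q v = 0 <-> P v.
  rewrite -UP; split=> [qv|vU].
    have := qE v; rewrite qv linear0 => /esym/eqP; rewrite subr_eq0 => /eqP->.
    exact: memv_proj.
  by apply: val_inj; rewrite /= qE projv_id // subrr.
exists N, q; split=> //.
- move=> g v; rewrite !comp_lfunE [linfun vsval _]lfunE /= qE.
  rewrite [act M g (v - _)]linearB /= [q (_ - _)]linearB /=.
  rewrite [X in _ - X](_ : _ = 0) ?subr0 //.
  by apply/q0/UP; rewrite st' // memv_proj.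
move=> w; have /memv_imgP[v _ wv] := subvsP w.
by exists v; apply: val_inj; rewrite /= qE wv fE.
Qed.

Lemma lin_pred_ker (V W : vectType K) (f : 'Hom(V, W)) : lin_pred (fun v => f v = 0).
Proof. by split=> [|k u v fu fv]; rewrite ?linear0 // linearP /= fu fv scaler0 addr0. Qed.

Lemma lin_pred_img (V W : vectType K) (f : 'Hom(V, W)) :
  lin_pred (fun w => exists v, w = f v).
Proof.
split=> [|k _ _ [u ->] [v ->]]; first by exists 0; rewrite linear0.
by exists (k *: u + v); rewrite linearP.
Qed.

Lemma stable_ker M N (f : 'Hom(M, N)) : hom f -> stable (fun v => f v = 0).
Proof. by move=> fh g v fv; rewrite fh fv linear0. Qed.
Lemma stable_img M N (f : 'Hom(M, N)) : hom f -> stable (fun w => exists v, w = f v).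
Proof. by move=> fh g _ [v ->]; exists (act M g v); rewrite fh. Qed.

Lemma quot_ses M (P : M -> Prop) : lin_pred P -> stable P ->
  exists L N (i : 'Hom(L, M)) (q : 'Hom(M, N)), ses i q /\ forall v, q v = 0 <-> P v.
Proof.
move=> Pl Ps; have [L [i [ih im iP]]] := subrep_ex Pl Ps.
have [N [q [qh qe qP]]] := quotrep_ex Pl Ps.
by exists L, N, i, q; split=> //; split=> // v; rewrite qP iP.
Qed.

Lemma image_ex M N (f : 'Hom(M, N)) : hom f ->
  exists (I : rep) (q : 'Hom(M, I)) (i : 'Hom(I, N)),
    [/\ hom q, epi q, hom i, mono i & forall v, f v = i (q v)].
Proof.
move=> fh; have [I [i [ih im iP]]] := subrep_ex (lin_pred_img f) (stable_img fh).
have [|q [qh qE]] := @mono_lift I N M i f ih im fh.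
  by move=> v; apply/iP; exists v.
exists I, q, i; split=> // w.
have /iP[v iv] : exists w', i w = i w' by exists w.
by exists v; apply: (mono_inj im); rewrite qE.
Qed.

Definition rdim M := \dim {:M}.

Lemma mono_dim M N (f : 'Hom(M, N)) : mono f -> (rdim M <= rdim N)%N.
Proof.
move=> fm; have := limg_ker_dim f fullv.
have /eqP -> : lker f == 0%VS by apply/lker0P/mono_inj.
by rewrite capv0 dimv0 add0n /rdim => <-; rewrite dimvS ?subvf.
Qed.

Lemma epi_limg (V W : vectType K) (f : 'Hom(V, W)) : epi f -> limg f = fullv.
Proof.
move=> fe; apply/eqP; rewrite eqEsubv subvf; apply/subvP=> w _.
by have [v <-] := fe w; rewrite memv_img ?memvf.
Qed.

Lemma mono_epi M N (f : 'Hom(M, N)) : mono f -> (rdim N <= rdim M)%N -> epi f.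
Proof.
move=> fm NM w; have := limg_ker_dim f fullv.
have /eqP -> : lker f == 0%VS by apply/lker0P/mono_inj.
rewrite capv0 dimv0 add0n => dE.
have /eqP E : limg f == fullv by rewrite eqEdim subvf dE.
have : w \in limg f by rewrite E memvf.
by move=> /memv_imgP[v _ ->]; exists v.
Qed.

Lemma epi_mono M N (f : 'Hom(M, N)) : epi f -> (rdim M <= rdim N)%N -> mono f.
Proof.
move=> fe MN v fv; have := limg_ker_dim f fullv.
rewrite (epi_limg fe) -/(rdim M) -/(rdim N) => dE.
have : v \in (fullv :&: lker f)%VS by rewrite memv_cap memvf memv_ker fv /=.
have : \dim (fullv :&: lker f) = 0%N.
  by move: MN; rewrite -dE -{2}[rdim N]add0n leq_add2r leqn0 => /eqP.
by move/eqP; rewrite dimv_eq0 => /eqP ->; rewrite memv0 => /eqP.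
Qed.

Lemma rep0N M : ~ rep0 M -> exists v : M, v != 0.
Proof. by move=> nz; apply: contrapT => H; apply: nz => v; apply/eqP/negPn/negP => v0; apply: H; exists v. Qed.

End Reps.

(** * Torsion classes and bricks *)

Section Torsion.
Variables (K : fieldType) (G : Type).
Notation rep := (rep K G).
Implicit Types L M N Q X Y E S I : rep.
Implicit Types C T : rep -> Prop.

(** Stands for an abelian category of modules. The third clause, on a jointly injective pair of
    maps, covers submodules (p1 = p2) and direct sums at once. Extension closure in [tors] is
    relative: the middle term has to lie in C already. *)
Definition ambient C :=
  [/\ forall M, rep0 M -> C M,
      forall M N (f : 'Hom(M, N)), hom f -> epi f -> C M -> C N
    & forall M N Q (p1 : 'Hom(Q, M)) (p2 : 'Hom(Q, N)), hom p1 -> hom p2 ->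
        (forall v, p1 v = 0 -> p2 v = 0 -> v = 0) -> C M -> C N -> C Q].

Definition tors C T :=
  [/\ forall M, T M -> C M,
      forall M, rep0 M -> T M,
      forall M N (f : 'Hom(M, N)), hom f -> epi f -> T M -> T N
    & forall L M N (i : 'Hom(L, M)) (q : 'Hom(M, N)), ses i q -> C M -> T L -> T N -> T M].

Definition tfree T Y := forall M (f : 'Hom(M, Y)), T M -> hom f -> f = 0.

Definition brick M :=
  ~ rep0 M /\ forall f : 'End(M), hom f -> f = 0 \/ mono f.

Definition indec M :=
  ~ rep0 M /\ forall f : 'End(M), hom f -> (f \o f)%VF = f -> f = 0 \/ f = \1%VF.

Lemma hom_image0 M N (f : 'Hom(M, N)) : (forall v, f v = 0) -> f = 0.
Proof. by move=> f0; apply/lfunP => v; rewrite f0 zero_lfunE. Qed.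
Lemma tors_iso C T M N : tors C T -> iso M N -> T M -> T N.
Proof. by move=> [_ _ Tq _] [f [fh _ fe]]; apply: Tq fh fe. Qed.

Variable C : rep -> Prop.
Hypothesis Camb : ambient C.

Lemma ambient_sub M N (f : 'Hom(N, M)) : hom f -> mono f -> C M -> C N.
Proof. by move=> fh fm CM; case: Camb => _ _ Cj; exact: (Cj M M N f f fh fh (fun v e _ => fm v e) CM CM). Qed.

(** Among the submodules of M in T take one of largest dimension. If a map from T into the quotient
    were nonzero, the preimage of its image would be an extension of objects of T, hence a larger
    submodule in T. *)
Lemma tors_radical T M : tors C T -> C M ->
  exists L N (i : 'Hom(L, M)) (q : 'Hom(M, N)), [/\ ses i q, T L & tfree T N].
Proof.
move=> Tt CM; have [C0 Cq _] := Camb; have Cs := ambient_sub; have [TC T0 Tq Te] := Tt.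
pose good k := `[< exists L (i : 'Hom(L, M)), [/\ hom i, mono i, T L & rdim L = k] >].
have ex0 : exists k, good k.
  have [L [i [ih im iP]]] := @subrep_ex _ _ M (fun v => v = 0)
    (conj erefl (fun k u v (u0 : u = 0) (v0 : v = 0) => etrans (congr2 (fun a b => k *: a + b) u0 v0)
       (etrans (addr0 _) (scaler0 _ _)))) (fun g v v0 => etrans (congr1 (act M g) v0) (linear0 _)).
  exists (rdim L); apply/asboolP; exists L, i; split=> //; apply: T0 => v.
  by apply/im/iP; exists v.
have bnd k : good k -> (k <= rdim M)%N by move=> /asboolP[L [i [_ im _ <-]]]; apply: mono_dim im.
case: (ex_maxnP ex0 bnd) => k /asboolP[L [i [ih im TL dL]]] kmax.
have [N [q [qh qe qP]]] := quotrep_ex (lin_pred_img i) (stable_img ih).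
exists L, N, i, q; split=> // X f TX fh.
have [I [p [j [ph pe jh jm fE]]]] := image_ex fh.
have TI : T I by apply: Tq ph pe TX.
have sl : lin_pred (fun v : M => exists w, q v = j w).
  split; first by exists 0; rewrite !linear0.
  by move=> a u v [u' uE] [v' vE]; exists (a *: u' + v'); rewrite !linearP /= uE vE.
have ss : stable (fun v : M => exists w, q v = j w).
  by move=> g v [w vE]; exists (act I g w); rewrite qh jh vE.
have [E [e [eh em eP]]] := subrep_ex sl ss.
have [|i' [ih' iE]] := @mono_lift _ _ E M L e i eh em ih.
  move=> v; apply/eP; exists 0; rewrite linear0; apply/qP; by exists v.
have [||q' [qh' qE]] := @mono_lift _ _ I N E j (q \o e)%VF jh jm.
- exact: hom_comp.
- by move=> v; have /eP[w qw] : exists w, e v = e w; [exists v | exists w; rewrite comp_lfunE].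
have TE : T E.
  apply: (Te L E I i' q') => //; last by apply: Cs eh em CM.
  split=> //.
  - by move=> v iv; apply: im; rewrite -iE iv linear0.
  - move=> w; have [v qv] := qe (j w).
    have /eP[v' vE] : exists w, q v = j w by exists w.
    by exists v'; apply: (mono_inj jm); rewrite qE comp_lfunE -vE.
  move=> v; split=> [qv|[w ->]].
    have : q (e v) = 0 by rewrite -[q _]comp_lfunE -qE qv linear0.
    by move=> /qP[w vw]; exists w; apply: (mono_inj em); rewrite iE.
  apply: jm; rewrite qE comp_lfunE iE; apply/qP; by exists w.
have dE : (rdim E <= rdim L)%N by rewrite dL; apply/kmax/asboolP; exists E, e.
have im' : mono i' by move=> v iv; apply: im; rewrite -iE iv linear0.
have ie' := mono_epi im' dE.
apply: hom_image0 => x; have [v qv] := qe (f x).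
have /eP[w vw] : exists w, q v = j w by exists (p x); rewrite -fE.
have [u uw] := ie' w.
by rewrite -qv vw -uw iE; apply/qP; exists u.
Qed.

Lemma tors_of_tfree T M : tors C T -> C M ->
  (forall Y (f : 'Hom(M, Y)), C Y -> tfree T Y -> hom f -> epi f -> rep0 Y) -> T M.
Proof.
move=> Tt CM H; have [C0 Cq _] := Camb; have Cs := ambient_sub; have [TC T0 Tq Te] := Tt.
have [L [N [i [q [[ih im qh qe ex] TL Nf]]]]] := tors_radical Tt CM.
have N0 := H N q (Cq _ _ q qh qe CM) Nf qh qe.
apply: (Tq L M i) => // v; have /ex[w ->] : q v = 0 by apply: N0.
by exists w.
Qed.

(* A nonzero object of minimal dimension among those that are torsion for T and
   torsion-free for T' is a brick. *)
Lemma tors_brick_le T T' : tors C T -> tors C T' ->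
  (forall X, brick X -> T X -> T' X) -> forall M, T M -> T' M.
Proof.
move=> Tt Tt' TT' M TM; apply: contrapT => nT'M.
have [C0 Cq _] := Camb; have Cs := ambient_sub; have [TC T0 Tq Te] := Tt; have [TC' T0' Tq' Te'] := Tt'.
pose good k := `[< exists X, [/\ T X, tfree T' X, ~ rep0 X & rdim X = k] >].
have ex0 : exists k, good k.
  have [L [N [i [q [s TL Nf]]]]] := tors_radical Tt' (TC _ TM); have [ih im qh qe ex] := s.
  exists (rdim N); apply/asboolP; exists N; split=> //; first exact: Tq qh qe TM.
  move=> N0; apply: nT'M; apply: (Te' L M N i q) => //; [exact: TC | exact: T0'].
case: (ex_minnP ex0) => k /asboolP[X [TX Xf X0 dX]] kmin.
have bX : brick X.
  split=> // f fh; apply: contrapT => /not_orP[f0 fm].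
  have [I [p [j [ph pe jh jm fE]]]] := image_ex fh.
  have : (k <= rdim I)%N.
    apply/kmin/asboolP; exists I; split=> //; first exact: Tq ph pe TX.
      move=> Y h TY hh; apply: hom_image0 => v; apply: jm.
      have := Xf Y (j \o h)%VF TY (hom_comp jh hh).
      by move=> /lfunP/(_ v); rewrite comp_lfunE zero_lfunE.
    by move=> I0; apply: f0; apply: hom_image0 => v; rewrite fE (I0 (p v)) linear0.
  rewrite -dX => /(epi_mono pe) pm; apply: fm => v; rewrite fE => /jm; exact: pm.
apply: X0; have := Xf X \1%VF (TT' X bX TX) (@hom1 _ _ X).
by move=> /lfunP H v; have := H v; rewrite id_lfunE zero_lfunE.
Qed.

(** A torsion-free quotient of M receives only zero maps from the X t, whose images span it, so it
    vanishes. *)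
Lemma tors_span T M (I : finType) (X : I -> rep) (i : forall t, 'Hom(X t, M)) :
  tors C T -> C M -> (forall t, T (X t)) -> (forall t, hom (i t)) ->
  (forall v, exists x : forall t, X t, v = \sum_t i t (x t)) -> T M.
Proof.
move=> Tt CM TX ih sp; apply: tors_of_tfree => // Y f CY Yf fh fe y.
have [v <-] := fe y; have [x ->] := sp v; rewrite linear_sum big1 // => t _ /=.
have := Yf _ (f \o i t)%VF (TX t) (hom_comp fh (ih t)).
by move=> /lfunP/(_ (x t)); rewrite comp_lfunE zero_lfunE.
Qed.

(** Vanishing of Ext^1(X, L) for L in T, phrased as a lifting property; no Ext group has to be
    defined. *)
Definition extproj T X := T X /\
  forall L E Q (i : 'Hom(L, E)) (q : 'Hom(E, Q)) (f : 'Hom(X, Q)),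
    ses i q -> C E -> T L -> hom f -> exists h : 'Hom(X, E), hom h /\ forall v, q (h v) = f v.

Lemma dsum_ex M N : exists S (i1 : 'Hom(M, S)) (i2 : 'Hom(N, S)) (p1 : 'Hom(S, M)) (p2 : 'Hom(S, N)),
  [/\ hom i1 /\ hom i2, hom p1 /\ hom p2, forall v, p1 (i1 v) = v /\ p2 (i1 v) = 0,
      forall v, p1 (i2 v) = 0 /\ p2 (i2 v) = v & forall v, v = i1 (p1 v) + i2 (p2 v)].
Proof.
have /choice[A AE] : forall g, exists A : 'End((M * N)%type),
    forall v, A v = (act M g v.1, act N g v.2).
  by move=> g; apply: lin_ex => k [u1 u2] [v1 v2] /=; congr (_, _); rewrite linearP.
have [|i1 E1] := @lin_ex K M (M * N)%type (fun v => (v, 0)).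
  by move=> k u v; congr (_, _); rewrite /= scaler0 addr0.
have [|i2 E2] := @lin_ex K N (M * N)%type (fun v => (0, v)).
  by move=> k u v; congr (_, _); rewrite /= scaler0 addr0.
have [|p1 F1] := @lin_ex K (M * N)%type M (fun v => v.1) => //.
have [|p2 F2] := @lin_ex K (M * N)%type N (fun v => v.2) => //.
exists (@Rep K G (M * N)%type A), i1, i2, p1, p2; split.
- by split=> g v; rewrite /= AE ?E1 ?E2 /= linear0.
- by split=> g v; rewrite /= AE ?F1 ?F2.
- by move=> v; rewrite E1 F1 F2.
- by move=> v; rewrite E2 F1 F2.
by case=> u v; rewrite F1 F2 E1 E2; congr (_, _); rewrite /= ?addr0 ?add0r.
Qed.

Lemma pullback_ex E X Q (q : 'Hom(E, Q)) (f : 'Hom(X, Q)) : hom q -> hom f ->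
  exists (P : rep) (p1 : 'Hom(P, E)) (p2 : 'Hom(P, X)),
  [/\ hom p1 /\ hom p2, forall v, p1 v = 0 -> p2 v = 0 -> v = 0,
      forall v, q (p1 v) = f (p2 v)
    & forall e x, q e = f x -> exists v, p1 v = e /\ p2 v = x].
Proof.
move=> qh fh; have [S [i1 [i2 [p1 [p2 [[i1h i2h] [p1h p2h] E1 E2 ES]]]]]] := dsum_ex E X.
have [||P [j [jh jm jP]]] := @subrep_ex _ _ S (fun s => q (p1 s) = f (p2 s)).
- split; first by rewrite !linear0.
  by move=> k u v eu ev; rewrite !linearP /= eu ev.
- by move=> g v ev; rewrite p1h p2h qh fh ev.
exists P, (p1 \o j)%VF, (p2 \o j)%VF; split.
- by split; apply: hom_comp.
- move=> v; rewrite !comp_lfunE => e1 e2; apply: jm.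
  by rewrite [j v]ES e1 e2 !linear0 addr0.
- by move=> v; rewrite !comp_lfunE; apply/jP; exists v.
move=> e x ex.
have [e1 e2] := E1 e; have [x1 x2] := E2 x.
have /jP[v vE] : q (p1 (i1 e + i2 x)) = f (p2 (i1 e + i2 x)).
  by rewrite !linearD /= e1 x1 e2 x2 !linear0 addr0 add0r.
by exists v; rewrite !comp_lfunE -vE !linearD /= e1 x1 e2 x2 addr0 add0r.
Qed.

(** Pulling the sequence back along f leaves an extension of X itself, so it is enough to split
    those. *)
Lemma extproj_split T X : tors C T -> T X ->
  (forall L E (i : 'Hom(L, E)) (q : 'Hom(E, X)), ses i q -> C E -> T L ->
     exists h : 'Hom(X, E), hom h /\ forall v, q (h v) = v) -> extproj T X.
Proof.
move=> [TC T0 Tq Te] TX H; split=> // L E Q i q f [ih im qh qe ex] CE TL fh.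
have [P [p1 [p2 [[p1h p2h] pm pE pex]]]] := pullback_ex qh fh.
have CP : C P by case: Camb => _ _ Cj; apply: Cj p1h p2h pm CE (TC _ TX).
have il w : exists v, p1 v = i w /\ p2 v = 0.
  by apply: pex; rewrite linear0; apply/ex; exists w.
have [||||j [jh jE]] := @graph_hom _ _ L P (fun w v => p1 v = i w /\ p2 v = 0).
- by move=> k u v u' v' [a1 a2] [b1 b2]; rewrite !linearP /= a1 a2 b1 b2 scaler0 addr0.
- by move=> w; apply: il.
- by move=> v []; rewrite linear0 => ? ?; apply: pm.
- by move=> g w v [a1 a2]; rewrite p1h p2h a1 a2 ih linear0.
have [|h [hh hE]] := H L P j p2 _ CP TL.
  split=> //.
  - by move=> w jw; apply: im; have [<- _] := jE w; rewrite jw linear0.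
  - by move=> x; have [e ee] := qe (f x); have [v []] := pex e x ee; exists v.
  move=> v; split=> [p2v|[w ->]]; last by case: (jE w).
  have /ex[w pw] : q (p1 v) = 0 by rewrite pE p2v linear0.
  exists w; apply/eqP; rewrite -subr_eq0; apply/eqP/pm; rewrite linearB /=.
    by have [-> _] := jE w; rewrite pw subrr.
  by have [_ ->] := jE w; rewrite p2v subrr.
exists (p1 \o h)%VF; split; first exact: hom_comp.
by move=> v; rewrite comp_lfunE pE hE.
Qed.

Lemma extproj_iso T X Y : tors C T -> iso X Y -> extproj T X -> extproj T Y.
Proof.
move=> Tt XY [TX H]; split; first exact: tors_iso Tt XY TX.
have [f [fh fm fe]] := XY; have [u [uh fK uK]] := hom_inv fh fm fe.
move=> L E Q i q g s CE TL gh.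
have [h [hh hE]] := H L E Q i q (g \o f)%VF s CE TL (hom_comp gh fh).
exists (h \o u)%VF; split; first exact: hom_comp.
by move=> v; rewrite comp_lfunE hE comp_lfunE uK.
Qed.

End Torsion.

(* [Ge i] is the idempotent at the vertex i, [Gl] the sum of all loops and
   [Ga] the sum of all arrows. *)
Inductive gen n := Ge of 'I_n | Gl | Ga.
Arguments Gl {n}.
Arguments Ga {n}.

Local Notation lk k v := (iter k (fun u => act _ Gl u) v).

(* gp i j is |C_ij| for i <> j, and 0 for i = j; gd is the symmetrizer. *)
Record gdata n := GData {
  gp : 'I_n -> 'I_n -> nat;
  gd : 'I_n -> nat;
  gd_gt0 : forall i, (0 < gd i)%N;
  gpii : forall i, gp i i = 0%N;
  gp_d : forall i j, (0 < gp i j)%N ->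
    exists k, gd i = (k * gp j i)%N /\ gd j = (k * gp i j)%N }.

(** * Representations of the quiver with relations and reflections *)

Section QuiverReps.
Variables (K : fieldType) (n : nat) (D : gdata n).

Notation p := (gp D).
Notation d := (gd D).
Notation d_gt0 := (gd_gt0 D).
Notation pii := (gpii D).
Notation p_d := (@gp_d _ D).
Notation rep := (rep K (gen n)).
Implicit Types L M N Q X Y E S I : rep.
Implicit Types o : rel 'I_n.
Notation e i v := (act _ (Ge i) v).
Notation l v := (act _ Gl v).
Notation a v := (act _ Ga v).

(** Modules are right modules and paths act from left to right, so on the left of [crep_rel] the
    path eps_i^|C_ji| alpha_ij applies the loop before the arrow. [crep_o] confines the single
    operator [Ga] to the arrows of o. *)
Record crep o M : Prop := Crep {
  crep_ee : forall i j (v : M), e j (e i v) = if i == j then e i v else 0;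
  crep_1 : forall v : M, \sum_i e i v = v;
  crep_el : forall i (v : M), e i (l v) = l (e i v);
  crep_ld : forall i (v : M), lk (d i) (e i v) = 0;
  crep_o : forall i j (v : M), ~~ o i j -> e j (a (e i v)) = 0;
  crep_rel : forall i j (v : M),
    e j (a (lk (p j i) (e i v))) = lk (p i j) (e j (a (e i v))) }.

(** J bounds the support: modules over a quiver with vertices removed are kept as modules over the
    full quiver that vanish outside J. *)
Definition inC o (J : {set 'I_n}) M :=
  crep o M /\ forall j, j \notin J -> forall v : M, e j v = 0.

Lemma lkP M k c (u v : M) : lk k (c *: u + v) = c *: lk k u + lk k v.
Proof. by elim: k => //= k ->; rewrite linearP. Qed.
Lemma lk0 M k : lk k (0 : M) = 0.
Proof. by elim: k => //= k ->; rewrite linear0. Qed.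
Lemma lkD M k (u v : M) : lk k (u + v) = lk k u + lk k v.
Proof. by elim: k => //= k ->; rewrite linearD. Qed.
Lemma lkB M k (u v : M) : lk k (u - v) = lk k u - lk k v.
Proof. by elim: k => //= k ->; rewrite linearB. Qed.
Lemma lk_sum M k (I : Type) (r : seq I) (P : pred I) (F : I -> M) :
  lk k (\sum_(t <- r | P t) F t) = \sum_(t <- r | P t) lk k (F t).
Proof. by elim: k => //= k ->; rewrite linear_sum. Qed.
Lemma lk_add M j k (v : M) : lk j (lk k v) = lk (j + k) v.
Proof. by rewrite iterD. Qed.
Lemma hom_lk M N (f : 'Hom(M, N)) k v : hom f -> f (lk k v) = lk k (f v).
Proof. by move=> fh; elim: k => //= k <-. Qed.

Lemma crep_elk o M i k (v : M) : crep o M -> e i (lk k v) = lk k (e i v).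
Proof. by move=> cM; elim: k => //= k <-; rewrite (crep_el cM). Qed.
Lemma crep_eii o M i (v : M) : crep o M -> e i (e i v) = e i v.
Proof. by move=> cM; rewrite (crep_ee cM) eqxx. Qed.
Lemma crep_eij o M i j (v : M) : crep o M -> i != j -> e j (e i v) = 0.
Proof. by move=> cM ij; rewrite (crep_ee cM) (negbTE ij). Qed.

Lemma crep_amb o J : ambient (inC o J).
Proof.
split.
- move=> M M0; have A (x y : M) : x = y by rewrite (M0 x) (M0 y).
  by split; first split; move=> *; apply: A.
- move=> M N f fh fe [[H1 H2 H3 H4 H5 H6] H7]; split; last first.
    by move=> j jJ w; have [v <-] := fe w; rewrite -fh H7 ?linear0.
  split=> [i j w|w|i w|i w|i j w oij|i j w]; have [v <-] := fe w.
  + by rewrite -!fh H1; case: eqP; rewrite ?linear0.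
  + by rewrite -{2}(H2 v) linear_sum; apply: eq_bigr => i _ /=; rewrite fh.
  + by rewrite -!fh H3.
  + by rewrite -fh -hom_lk // H4 linear0.
  + by rewrite -!fh H5 ?linear0.
  by rewrite -!fh -hom_lk // -!fh H6 hom_lk.
move=> M N Q f g fh gh fg [[H1 H2 H3 H4 H5 H6] H7] [[G1 G2 G3 G4 G5 G6] G7].
have jt x y : f x = f y -> g x = g y -> x = y.
  by move=> fx gx; apply/eqP; rewrite -subr_eq0; apply/eqP/fg; rewrite linearB /= ?fx ?gx subrr.
split; last by move=> j jJ w; apply: jt; rewrite ?fh ?gh ?H7 ?G7 // linear0.
split=> [i j w|w|i w|i w|i j w oij|i j w]; apply: jt.
- by rewrite !fh H1; case: eqP; rewrite ?linear0 ?fh.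
- by rewrite !gh G1; case: eqP; rewrite ?linear0 ?gh.
- by rewrite -[RHS]H2 linear_sum; apply: eq_bigr => i _ /=; rewrite fh.
- by rewrite -[RHS]G2 linear_sum; apply: eq_bigr => i _ /=; rewrite gh.
- by rewrite !fh H3.
- by rewrite !gh G3.
- by rewrite (hom_lk _ _ fh) fh H4 linear0.
- by rewrite (hom_lk _ _ gh) gh G4 linear0.
- by rewrite !fh H5 ?linear0.
- by rewrite !gh G5 ?linear0.
- by rewrite !fh !(hom_lk _ _ fh) !fh H6.
by rewrite !gh !(hom_lk _ _ gh) !gh G6.
Qed.

Lemma p_sym i j : (0 < p i j)%N = (0 < p j i)%N.
Proof.
suff H k m : (0 < p k m)%N -> (0 < p m k)%N by apply/idP/idP; apply: H.
move=> /p_d[q [dk _]]; have := d_gt0 k; rewrite dk muln_gt0; by case/andP.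
Qed.

Lemma crep_quot o M N (f : 'Hom(M, N)) : hom f -> epi f -> crep o M -> crep o N.
Proof.
move=> fh fe cM; have [_ Cq _] := crep_amb o (finset xpredT).
by have [] // := Cq M N f fh fe; split=> // j; rewrite finset.in_set.
Qed.

Section Reflection.
Variables (i : 'I_n) (o o' : rel 'I_n).

(* i is a source for o, and o' is o with all arrows at i reversed *)
Record source_at : Prop := SourceAt {
  src_out : forall j, o i j = (0 < p i j)%N;
  src_in : forall j, o j i = false;
  snk_in : forall j, o' j i = (0 < p i j)%N;
  snk_out : forall j, o' i j = false;
  src_eq : forall j k, j != i -> k != i -> o j k = o' j k }.

Lemma src_ea M (v : M) : source_at -> crep o M -> e i (a v) = 0.
Proof.
move=> Hs cM; rewrite -(crep_1 cM v) !linear_sum big1 //= => j _.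
by rewrite (crep_o cM) // (src_in Hs).
Qed.

Lemma snk_ae N (w : N) : source_at -> crep o' N -> a (e i w) = 0.
Proof.
move=> Hs cN; rewrite -(crep_1 cN (a _)) big1 // => j _.
by rewrite (crep_o cN) // (snk_out Hs).
Qed.

(** The relation moves eps_i^p_ji across an arrow between i and j, so p_ji copies of M_j account for
    all paths. [outmap] is the map M_i -> (+)_j M_j^p_ji adjoint to the arrows leaving i. [inmap] is
    its counterpart for arrows entering i, with the complementary exponent p_ji - k - 1, so that one
    [shiftmap] describes the loop at i for both. *)
Definition outmap M (v : M) j k : M := e j (a (lk k (e i v))).
Definition inmap M N (P : 'Hom(M, N)) (x : 'I_n -> nat -> M) : N :=
  \sum_j \sum_(k < p j i) lk (p j i - k.+1) (e i (a (P (e j (x j k))))).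
(** Multiplication by eps_i on (+)_j M_j^p_ji: indices move by one, and at the last index eps_i^p_ji
    is replaced by eps_j^p_ij. [deltamap] puts v at the last index, which [inmap] sends through the
    bare arrow. *)
Definition shiftmap M (x : 'I_n -> nat -> M) j k : M :=
  if (k.+1 < p j i)%N then x j k.+1 else lk (p i j) (x j 0%N).
Definition deltamap M (v : M) j k : M := if k.+1 == p j i then v else 0.

(* The exact sequence 0 -> M_i -> \oplus_j M_j^{p j i} -> N_i -> 0, in which
   P : M -> N has kernel M_i and identifies M and N away from i. *)
Record reflD M N (P : 'Hom(M, N)) : Prop := ReflD {
  rf_s : source_at;
  rfM : crep o M;
  rfN : crep o' N;
  rf_ker : forall v, P v = 0 <-> v = e i v;
  rf_img : forall w, exists v, w = P v + e i w;
  rf_e : forall j v, j != i -> P (e j v) = e j (P v);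
  rf_ei : forall v, e i (P v) = 0;
  rf_l : forall v, P (l v) = l (P v);
  rf_a : forall v, P (a (v - e i v)) = a (P v) - e i (a (P v));
  rf_inj : forall v : M, (forall j k, (k < p j i)%N -> outmap v j k = 0) -> e i v = 0;
  rf_cx : forall v, inmap P (outmap v) = 0;
  rf_ex : forall x, inmap P x = 0 ->
    exists v, forall j k, (k < p j i)%N -> e j (x j k) = outmap v j k;
  rf_surj : forall w, exists x, e i w = inmap P x }.

Definition refl M N := exists P : 'Hom(M, N), reflD P.

Lemma vmapP M N (P : 'Hom(M, N)) c x y :
  inmap P (fun j k => c *: x j k + y j k) = c *: inmap P x + inmap P y.
Proof.
rewrite /inmap scaler_sumr -big_split; apply: eq_bigr => j _.
rewrite scaler_sumr -big_split; apply: eq_bigr => k _ /=.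
by rewrite !linearP /= lkP.
Qed.

Lemma vmap0 M N (P : 'Hom(M, N)) : inmap P (fun _ _ => 0) = 0.
Proof. by rewrite /inmap big1 // => j _; rewrite big1 // => k _; rewrite !linear0 lk0. Qed.

Lemma eq_vmap M N (P : 'Hom(M, N)) x y : crep o M ->
  (forall j k, (k < p j i)%N -> e j (x j k) = e j (y j k)) -> inmap P x = inmap P y.
Proof.
by move=> cM xy; apply: eq_bigr => j _; apply: eq_bigr => k _; rewrite xy.
Qed.

Lemma eq_vmap1 M N (P : 'Hom(M, N)) x y : (forall j k, x j k = y j k) -> inmap P x = inmap P y.
Proof. by move=> xy; apply: eq_bigr => j _; apply: eq_bigr => k _; rewrite xy. Qed.
Lemma umap_e M (v : M) j k : crep o M -> e j (outmap v j k) = outmap v j k.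
Proof. by move=> cM; rewrite /outmap (crep_eii _ _ cM). Qed.
Lemma umapP M c (u v : M) j k : outmap (c *: u + v) j k = c *: outmap u j k + outmap v j k.
Proof. by rewrite /outmap linearP lkP !linearP. Qed.
Lemma umapB M (u v : M) j k : outmap (u - v) j k = outmap u j k - outmap v j k.
Proof. by rewrite /outmap linearB lkB !linearB. Qed.
Lemma umapD M (u v : M) j k : outmap (u + v) j k = outmap u j k + outmap v j k.
Proof. by rewrite /outmap linearD lkD !linearD. Qed.
Lemma umap_ei M (v : M) j k : crep o M -> outmap (e i v) j k = outmap v j k.
Proof. by move=> cM; rewrite /outmap (crep_eii _ _ cM). Qed.
Lemma hom_umap M M' (f : 'Hom(M, M')) (v : M) j k : hom f -> f (outmap v j k) = outmap (f v) j k.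
Proof. by move=> fh; rewrite /outmap !fh hom_lk // fh. Qed.

Lemma umap_l M (v : M) j k : crep o M -> (k < p j i)%N ->
  outmap (l v) j k = e j (shiftmap (outmap v) j k).
Proof.
move=> cM kp; rewrite /shiftmap; case: ifP => kp'.
  by rewrite umap_e // /outmap (crep_el cM) -iterSr.
have pE : k.+1 = p j i by apply/eqP; rewrite eqn_leq kp leqNgt kp'.
rewrite (crep_elk _ _ _ cM) umap_e // /outmap /= (crep_el cM) -iterSr pE.
by rewrite (crep_rel cM).
Qed.

Lemma vmap_ei M N (P : 'Hom(M, N)) x : crep o' N -> e i (inmap P x) = inmap P x.
Proof.
move=> cN; rewrite linear_sum; apply: eq_bigr => j _; rewrite linear_sum; apply: eq_bigr => k _ /=.
by rewrite (crep_elk _ _ _ cN) (crep_eii _ _ cN).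
Qed.

Lemma vmap_ej M N (P : 'Hom(M, N)) j x : crep o' N -> j != i -> e j (inmap P x) = 0.
Proof. by move=> cN ji; rewrite -vmap_ei // (crep_eij _ cN) // eq_sym. Qed.

(** Stated without a reflection so that it also applies with P the identity of N, when M is still to
    be constructed. *)
Lemma vmap_shift_gen oM M N (P : 'Hom(M, N)) x : crep oM M -> crep o' N ->
  (forall j v, j != i -> P (e j v) = e j (P v)) -> (forall v, P (l v) = l (P v)) ->
  l (inmap P x) = inmap P (shiftmap x).
Proof.
move=> cM cN Pe Pl.
rewrite linear_sum; apply: eq_bigr => j _; rewrite linear_sum /=.
case E: (p j i) => [|m]; first by rewrite !big_ord0.
have ji : j != i by apply: contra_eqN E => /eqP->; rewrite pii.
rewrite big_ord_recl [RHS]big_ord_recr /= [LHS]addrC; congr (_ + _).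
  apply: eq_bigr => k _ /=; rewrite /shiftmap E ltnS ltn_ord /bump /= add1n subSS -iterS -subSn //.
rewrite subnn /= /shiftmap E ltnn (crep_elk _ _ _ cM).
have -> : P (lk (p i j) (e j (x j 0%N))) = lk (p i j) (e j (P (x j 0%N))).
  by rewrite -Pe //; elim: (p i j) => //= q <-; rewrite Pl.
by rewrite (crep_rel cN) E subn1 /= Pe.
Qed.

Lemma vmap_shift M N (P : 'Hom(M, N)) x : reflD P -> l (inmap P x) = inmap P (shiftmap x).
Proof. by move=> rP; apply: vmap_shift_gen (rfM rP) (rfN rP) (rf_e rP) (rf_l rP). Qed.

Lemma vmap_delta_gen oM M N (P : 'Hom(M, N)) v : crep oM M ->
  (forall j v, p j i = 0%N -> e i (a (P (e j v))) = 0) -> e i (a (P v)) = inmap P (deltamap v).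
Proof.
move=> cM P0; rewrite -{1}(crep_1 cM v) !linear_sum; apply: eq_bigr => j _ /=.
case E: (p j i) => [|m]; first by rewrite big_ord0 P0.
rewrite big_ord_recr /= big1 => [|k _]; last first.
  by rewrite /deltamap E eqSS (ltn_eqF (ltn_ord k)) !linear0 lk0.
by rewrite add0r /deltamap E eqxx subnn.
Qed.

Lemma vmap_delta M N (P : 'Hom(M, N)) v : reflD P -> e i (a (P v)) = inmap P (deltamap v).
Proof.
move=> rP; have cN := rfN rP; have cM := rfM rP.
apply: (vmap_delta_gen _ cM) => j u pj; have [->|ji] := eqVneq j i.
  have -> : P (e i u) = 0 by apply/(rf_ker rP); rewrite (crep_eii _ _ cM).
  by rewrite !linear0.
by rewrite (rf_e rP) // (crep_o cN) // (snk_in (rf_s rP)) p_sym pj.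
Qed.

(** N is handled through the normal form P m + inmap P x, whose ambiguity is settled by
    [refl_decomp0] and on which the operators act by [refl_act]. *)
Lemma refl_decomp M N (P : 'Hom(M, N)) w : reflD P ->
  exists m x, w = P m + inmap P x.
Proof.
by move=> rP; have [m {1}->] := rf_img rP w; have [x ->] := rf_surj rP w; exists m, x.
Qed.

Lemma refl_decomp0 M N (P : 'Hom(M, N)) m x : reflD P -> P m + inmap P x = 0 ->
  m = e i m /\ inmap P x = 0.
Proof.
move=> rP E; have V0 : inmap P x = 0.
  have := congr1 (fun u => e i u) E; rewrite linearD linear0 /= (rf_ei rP) add0r.
  by rewrite (vmap_ei _ _ (rfN rP)).
by split=> //; apply/(rf_ker rP); move: E; rewrite V0 addr0.
Qed.

Lemma rf_Pei M N (P : 'Hom(M, N)) v : reflD P -> P (e i v) = 0.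
Proof. by move=> rP; apply/(rf_ker rP); rewrite (crep_eii _ _ (rfM rP)). Qed.

Lemma refl_act M N (P : 'Hom(M, N)) g m x : reflD P ->
  act N g (P m + inmap P x) = match g with
  | Ge j => P (if j == i then 0 else e j m) + inmap P (if j == i then x else fun _ _ => 0)
  | Gl => P (l m) + inmap P (shiftmap x)
  | Ga => P (a (m - e i m)) + inmap P (deltamap m) end.
Proof.
move=> rP; have cN := rfN rP; rewrite linearD /=; case: g => [j||].
- case: (eqVneq j i) => [->|ji]; first by rewrite linear0 (rf_ei rP) vmap_ei.
  by rewrite vmap_ej // vmap0 (rf_e rP).
- by rewrite (rf_l rP) vmap_shift.
rewrite -(vmap_ei P x) // (snk_ae _ (rf_s rP)) // addr0 (rf_a rP) (vmap_delta _ rP) -(vmap_delta _ rP).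
by rewrite subrK.
Qed.

Definition agree M N M' N' (P : 'Hom(M, N)) (P' : 'Hom(M', N')) (f : 'Hom(M, M')) (g : 'Hom(N, N')) :=
  forall v, g (P v) = P' (f v).

Lemma agree_vmap M N M' N' (P : 'Hom(M, N)) (P' : 'Hom(M', N')) f g x :
  agree P P' f g -> hom f -> hom g -> g (inmap P x) = inmap P' (fun j k => f (x j k)).
Proof.
move=> fg fh gh; rewrite linear_sum; apply: eq_bigr => j _; rewrite linear_sum; apply: eq_bigr => k _ /=.
by rewrite hom_lk // !gh fg fh.
Qed.

Lemma refl_hom_wd M N M' N' (P : 'Hom(M, N)) (P' : 'Hom(M', N')) f m x :
  reflD P -> reflD P' -> hom f -> P m + inmap P x = 0 ->
  P' (f m) + inmap P' (fun j k => f (x j k)) = 0.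
Proof.
move=> rP rP' fh /(refl_decomp0 rP)[me V0].
rewrite me fh (rf_Pei _ rP').
have [v vE] := rf_ex rP V0; rewrite add0r -(rf_cx rP' (f v)).
by apply: eq_vmap (rfM rP') _ => j k kp; rewrite -fh vE // hom_umap // umap_e //; apply: rfM rP'.
Qed.

(** The map is forced on normal forms. Its graph is single-valued because a family x with inmap P x
    = 0 comes from [outmap] of some v, which f carries to [outmap] of f v. *)
Lemma refl_hom M N M' N' (P : 'Hom(M, N)) (P' : 'Hom(M', N')) f :
  reflD P -> reflD P' -> hom f -> exists g, hom g /\ agree P P' f g.
Proof.
move=> rP rP' fh.
pose R w w' := exists m x, w = P m + inmap P x /\ w' = P' (f m) + inmap P' (fun j k => f (x j k)).
have Rlin k u v u' v' : R u u' -> R v v' -> R (k *: u + v) (k *: u' + v').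
  move=> [m [x [-> ->]]] [m1 [x1 [-> ->]]].
  exists (k *: m + m1), (fun j t => k *: x j t + x1 j t).
  rewrite !linearP /= !vmapP !scalerDr; split; first by rewrite addrACA.
  rewrite addrACA -vmapP; congr (_ + _).
  by apply: eq_vmap1 => j t; rewrite linearP.
have R0 w' : R 0 w' -> w' = 0.
  by move=> [m [x [/esym E ->]]]; apply: refl_hom_wd E.
have [|||g [gh gE]] := @graph_hom _ _ N N' R Rlin.
- move=> w; have [m [x ->]] := refl_decomp w rP.
  by exists (P' (f m) + inmap P' (fun j k => f (x j k))), m, x.
- exact: R0.
- move=> g v v' [m [x [-> ->]]]; rewrite !refl_act //.
  case: g => [j||].
  + exists (if j == i then 0 else e j m), (if j == i then x else fun _ _ => 0); split=> //.
    by case: ifP => _; rewrite ?linear0 ?fh.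
  + exists (l m), (shiftmap x); split=> //; rewrite fh; congr (_ + _).
    by apply: eq_vmap1 => j k; rewrite /shiftmap; case: ifP => _ //; rewrite hom_lk.
  + exists (a (m - e i m)), (deltamap m); split=> //; rewrite fh [f (m - _)]linearB /= fh; congr (_ + _).
    by apply: eq_vmap1 => j k; rewrite /deltamap; case: ifP => _ //; rewrite linear0.
exists g; split=> // v.
have Rv : R (P v) (P' (f v)).
  exists v, (fun _ _ => 0); rewrite vmap0 addr0; split=> //.
  rewrite -[LHS]addr0; congr (_ + _); rewrite -(vmap0 P'); apply: eq_vmap1 => j k.
  by rewrite linear0.
apply/eqP; rewrite -subr_eq0; apply/eqP/R0.
rewrite -(subrr (P v)) ![_ - _]addrC -!scaleN1r; exact: Rlin.
Qed.

Lemma refl_faith M N M' N' (P : 'Hom(M, N)) (P' : 'Hom(M', N')) f f' g g' :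
  reflD P -> reflD P' -> hom f -> hom f' -> hom g -> hom g' ->
  agree P P' f g -> agree P P' f' g' -> f = f' <-> g = g'.
Proof.
move=> rP rP' fh f'h gh g'h fg f'g'; split=> E; apply/lfunP => v.
  have [m [x ->]] := refl_decomp v rP.
  by rewrite !linearD /= fg f'g' (agree_vmap _ fg) // (agree_vmap _ f'g') // E.
have e0 w : P' w = 0 -> e i w = 0 -> w = 0 by move=> /(rf_ker rP') wE we; rewrite wE we.
apply/eqP; rewrite -subr_eq0; apply/eqP/e0; first by rewrite linearB /= -fg -f'g' E subrr.
rewrite -[e i _](crep_eii _ _ (rfM rP')) (rf_inj rP') // => j k kp.
have cM' := rfM rP'.
rewrite umap_ei // umapB.
have ji : j != i by apply: contraTneq kp => ->; rewrite pii.
have key h (w : M') : h = outmap w j k -> P' h = 0 -> h = 0.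
  by move=> -> /(rf_ker rP') ->; rewrite /outmap (crep_eij _ cM').
rewrite -!hom_umap //; apply: (key _ (f v - f' v)).
  by rewrite !hom_umap // umapB.
by rewrite linearB /= -fg -f'g' E subrr.
Qed.

(** Away from i the map is forced by P, and at i by the components of [outmap]. A value at v exists
    because the family of the g (P ([outmap] v j k)) is killed by [inmap] for P', hence by exactness
    is the family of some element of M'. *)
Lemma refl_hom_back M N M' N' (P : 'Hom(M, N)) (P' : 'Hom(M', N')) g :
  reflD P -> reflD P' -> hom g -> exists f, hom f /\ agree P P' f g.
Proof.
move=> rP rP' gh; have cM := rfM rP; have cM' := rfM rP'; have cN' := rfN rP'.
have cN := rfN rP.
pose R v v' := g (P v) = P' v' /\
  forall j k, (k < p j i)%N -> g (P (outmap v j k)) = P' (outmap v' j k).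
have [||||f [fh fE]] := @graph_hom _ _ M M' R.
- move=> k u v u' v' [E1 E2] [E3 E4]; split; first by rewrite !linearP /= E1 E3.
  by move=> j t tp; rewrite !umapP !linearP /= E2 ?E4.
- move=> v.
  have [x xE] : exists x : 'I_n -> nat -> M', forall j k, P' (e j (x j k)) = g (P (outmap v j k)).
    suff /choice[x xE] : forall jk : 'I_n * nat, exists y : M', P' (e jk.1 y) = g (P (outmap v jk.1 jk.2)).
      by exists (fun j k => x (j, k)) => j k; apply: (xE (j, k)).
    move=> [j k] /=; have [y yE] := rf_img rP' (g (P (outmap v j k))).
    have [->|ji] := eqVneq j i.
      exists 0; rewrite !linear0 /outmap (src_ea _ (rf_s rP)) // !linear0 //.
    exists y; rewrite (rf_e rP') //; move: yE.
    rewrite -gh (rf_ei rP) linear0 addr0 => <-.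
    by rewrite -gh -(rf_e rP) // umap_e.
  have V0 : inmap P' x = 0.
    rewrite -(linear0 g) -(rf_cx rP v) linear_sum; apply: eq_bigr => j _.
    rewrite linear_sum; apply: eq_bigr => k _ /=; rewrite xE.
    by rewrite hom_lk // !gh umap_e.
  have [v1 v1E] := rf_ex rP' V0.
  have [v2 v2E] := rf_img rP' (g (P v)).
  rewrite -gh (rf_ei rP) linear0 addr0 in v2E.
  exists (v2 - e i v2 + e i v1); split.
    by rewrite linearD linearB /= -v2E !(rf_Pei _ rP') subr0 addr0.
  move=> j k kp; rewrite -xE v1E //; congr (P' _).
  by rewrite umapD umapB !umap_ei // subrr add0r.
- move=> w [E1 E2]; rewrite linear0 linear0 in E1.
  have : e i w = w by apply/esym/(rf_ker rP').
  move=> <-; rewrite (rf_inj rP') // => j k kp.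
  have ji : j != i by apply: contraTneq kp => ->; rewrite pii.
  have : P' (outmap w j k) = 0.
    by rewrite -E2 // /outmap linear0 lk0 !linear0.
  by move=> /(rf_ker rP') ->; rewrite /outmap (crep_eij _ cM').
move=> g0 v v' [E1 E2]; case: g0 => [j||].
- have [->|ji] := eqVneq j i; last first.
    split; first by rewrite !(rf_e rP, rf_e rP') // gh E1.
    by move=> j1 k kp; rewrite /outmap (crep_eij _ cM ji) (crep_eij _ cM' ji) !lk0 !linear0.
  split; last by move=> j1 k kp; rewrite !umap_ei // E2.
  by rewrite (rf_Pei _ rP) (rf_Pei _ rP') linear0.
- split; first by rewrite (rf_l rP) (rf_l rP') gh E1.
  move=> j k kp; rewrite !umap_l //.
  have ji : j != i by apply: contraTneq kp => ->; rewrite pii.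
  rewrite !(rf_e rP, rf_e rP') // gh; congr (act _ _ _).
  rewrite /shiftmap; case: ifP => k1; first exact: E2.
  have Plk X Y (PP : 'Hom(X, Y)) (y : X) m : reflD PP -> PP (lk m y) = lk m (PP y).
    by move=> r; elim: m => //= m <-; rewrite rf_l.
  by rewrite (Plk _ _ _ _ _ rP) (Plk _ _ _ _ _ rP') hom_lk // E2 //; case: (p j i) kp.
(* The arrows leaving i contribute the components of index 0 of [outmap]; the rest of the action of
   [Ga] is visible in the reflection. *)
have Pa X Y (PP : 'Hom(X, Y)) (y : X) : reflD PP ->
    PP (a y) = (a (PP y) - e i (a (PP y))) + \sum_j PP (outmap y j 0%N).
  move=> r; rewrite -(rf_a r) -linear_sum -linearD /=; congr (PP _).
  by rewrite /outmap /= (crep_1 (rfM r)) -linearD subrK.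
split; last by move=> j k kp; rewrite /outmap !(src_ea _ (rf_s rP)) // !lk0 !linear0.
rewrite (Pa _ _ _ _ rP) (Pa _ _ _ _ rP') linearD linearB /= !gh E1; congr (_ + _).
rewrite linear_sum; apply: eq_bigr => j _ /=.
case E: (p j i) => [|m]; last by apply: E2; rewrite E.
have oij : ~~ o i j by rewrite (src_out (rf_s rP)) p_sym E.
by rewrite /outmap /= !(crep_o _ _ oij) // !linear0.
exists f; split=> // v; by have [] := fE v.
Qed.

End Reflection.
End QuiverReps.

(** * Exactness of reflection *)

Section ReflExact.
Variables (K : fieldType) (n : nat) (D : gdata n) (i : 'I_n) (o o' : rel 'I_n).
Notation p := (gp D).
Notation rep := (rep K (gen n)).
Implicit Types L M N Q X Y E S I : rep.
Notation e i v := (act _ (Ge i) v).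
Notation reflD := (reflD D i o o').
Notation vmap := (inmap D i).
Notation umap := (outmap i).

Lemma epi_fam (V W : vectType K) (q : 'Hom(V, W)) (x : 'I_n -> nat -> W) : epi q ->
  exists y : 'I_n -> nat -> V, forall j k, q (y j k) = x j k.
Proof.
move=> qe; suff /choice[y yE] : forall jk : 'I_n * nat, exists y : V, q y = x jk.1 jk.2.
  by exists (fun j k => y (j, k)) => j k; apply: (yE (j, k)).
by move=> jk; apply: qe.
Qed.

Lemma vmapB M N (P : 'Hom(M, N)) x y :
  vmap P (fun j k => x j k - y j k) = vmap P x - vmap P y.
Proof.
rewrite addrC -scaleN1r -vmapP; apply: eq_vmap1 => j k.
by rewrite scaleN1r addrC.
Qed.

Lemma vmap_e M N (P : 'Hom(M, N)) x : crep D o M -> vmap P (fun j k => e j (x j k)) = vmap P x.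
Proof. by move=> cM; apply: (eq_vmap _ cM) => j k _; rewrite (crep_eii _ _ cM). Qed.

Lemma rf_P_inj M N (P : 'Hom(M, N)) (x y : M) : reflD P ->
  e i x = 0 -> e i y = 0 -> P x = P y -> x = y.
Proof.
move=> rP x0 y0 xy; apply/eqP; rewrite -subr_eq0; apply/eqP.
have /(rf_ker rP) -> : P (x - y) = 0 by rewrite linearB /= xy subrr.
by rewrite linearB /= x0 y0 subrr.
Qed.

Lemma rf_P_off M N M' N' (P : 'Hom(M, N)) (P' : 'Hom(M', N')) (f : 'Hom(M, M')) y m :
  reflD P -> reflD P' -> hom f -> e i y = 0 -> P' y = P' (f m) ->
  e i (m - e i m) = 0 /\ f (m - e i m) = y.
Proof.
move=> rP rP' fh y0 E.
have m0 : e i (m - e i m) = 0 by rewrite linearB /= (crep_eii _ _ (rfM rP)) subrr.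
split=> //; apply: (rf_P_inj rP') => //; first by rewrite -fh m0 linear0.
by rewrite linearB /= fh linearB /= (rf_Pei _ rP') subr0.
Qed.

Definition ragree M N M' N' (P : 'Hom(M, N)) (P' : 'Hom(M', N')) f g :=
  [/\ reflD P, reflD P', hom f, hom g & agree P P' f g].

Section Agree.
Variables (M N M' N' : rep) (P : 'Hom(M, N)) (P' : 'Hom(M', N')).
Variables (f : 'Hom(M, M')) (g : 'Hom(N, N')).

(** N_i is a quotient of (+)_j M_j^p_ji, so surjectivity passes to the reflections. *)
Lemma agree_epi : ragree P P' f g -> epi f -> epi g.
Proof.
move=> [rP rP' fh gh fg] fe w; have [m [x ->]] := refl_decomp w rP'.
have [m1 <-] := fe m; have [y yE] := epi_fam x fe.
exists (P m1 + vmap P y); rewrite linearD /= fg (agree_vmap _ _ _ fg) //.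
by congr (_ + _); apply: eq_vmap1.
Qed.

Lemma agree_epi_off y : ragree P P' f g -> epi g -> e i y = 0 -> exists m, e i m = 0 /\ f m = y.
Proof.
move=> [rP rP' fh gh fg] ge y0; have cM' := rfM rP'; have cM := rfM rP.
have [w wE] := ge (P' y); have [m mE] := rf_img rP w.
have PE : P' y = P' (f m).
  move: wE; rewrite mE linearD /= fg gh => H; have := congr1 (fun u => e i u) H.
  rewrite linearD /= !(rf_ei rP') (crep_eii _ _ (rfN rP')) add0r => e0.
  by rewrite -H e0 addr0.
by exists (m - e i m); apply: rf_P_off rP rP' fh y0 PE.
Qed.

Lemma agree_mono_off y : ragree P P' f g -> mono g -> e i y = 0 -> f y = 0 -> y = 0.
Proof.
move=> [rP rP' fh gh fg] gm y0 fy; have : P y = 0 by apply: gm; rewrite fg fy linear0.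
by move=> /(rf_ker rP); rewrite y0.
Qed.

Lemma umap_off j k (v : M) : source_at D i o o' -> crep D o M -> e i (umap v j k) = 0.
Proof.
move=> Hs cM; have [->|ji] := eqVneq j i; last by rewrite /outmap (crep_eij _ cM).
by rewrite /outmap !(src_ea _ Hs) // linear0.
Qed.

(** M_i embeds in (+)_j M_j^p_ji, so injectivity passes back from the reflections. *)
Lemma agree_mono : ragree P P' f g -> mono g -> mono f.
Proof.
move=> A; have [rP rP' fh gh fg] := A; move=> gm v fv; have cM := rfM rP.
have Pv : P v = 0 by apply: gm; rewrite fg fv linear0.
have /(rf_ker rP) -> := Pv; rewrite (rf_inj rP) // => j k kp.
apply: (agree_mono_off A gm); first exact: umap_off (rf_s rP) cM.
by rewrite hom_umap // fv /outmap linear0 lk0 !linear0.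
Qed.

End Agree.

Section Ses.
Variables (L M N L' M' N' : rep).
Variables (Pl : 'Hom(L, L')) (Pm : 'Hom(M, M')) (Pn : 'Hom(N, N')).
Variables (f : 'Hom(L, M)) (g : 'Hom(M, N)) (f' : 'Hom(L', M')) (g' : 'Hom(M', N')).
Hypotheses (rl : reflD Pl) (rm : reflD Pm) (rn : reflD Pn).
Hypotheses (f'h : hom f') (g'h : hom g') (fh : hom f) (gh : hom g).
Hypotheses (Af : agree Pl Pm f f') (Ag : agree Pm Pn g g').

Let Al : ragree Pl Pm f f'. Proof. by []. Qed.
Let Ar : ragree Pm Pn g g'. Proof. by []. Qed.

(** A snake lemma for the three sequences 0 -> M_i -> (+)_j M_j^p_ji -> N_i -> 0, which are exact at
    both ends because each of the three modules has a reflection. *)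
Lemma refl_ses : ses f g -> ses f' g'.
Proof.
move=> [_ fm _ ge ex]; have cM := rfM rm; have cL := rfM rl; have cN := rfM rn.
have ue := umap_e i.
have g'e := agree_epi Ar ge.
have gf v : g (f v) = 0 by apply/ex; exists v.
split=> //.
  move=> u; have [m [x ->]] := refl_decomp u rl.
  rewrite linearD /= Af (agree_vmap _ _ _ Af) // => /(refl_decomp0 rm)[fm0 V0].
  have -> : Pl m = 0.
    apply/(rf_ker rl); apply: (mono_inj fm); by rewrite fh.
  have [v vE] := rf_ex rm V0.
  have gv : e i (g v) = 0.
    apply: (rf_inj rn) => j k kp; rewrite -hom_umap // -vE // gh gf linear0 //.
  have /ex[z zE] : g (e i v) = 0 by rewrite gh.
  rewrite add0r -(rf_cx rl z); apply: eq_vmap cL _ => j k kp; apply: (mono_inj fm).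
  rewrite (ue _ _ _ _ _ _ _ (rfM rl)).
  by rewrite fh hom_umap // -zE (umap_ei _ _ _ _ cM) -vE.
move=> w; split=> [|[u ->]]; last first.
  have [m [x ->]] := refl_decomp u rl.
  rewrite linearD /= Af (agree_vmap _ _ _ Af) // linearD /= Ag (agree_vmap _ _ _ Ag) //.
  by rewrite gf linear0 add0r -(vmap0 D i Pn); apply: eq_vmap1.
have [m [x ->]] := refl_decomp w rm.
rewrite linearD /= Ag (agree_vmap _ _ _ Ag) // => /(refl_decomp0 rn)[gm V0].
have [v' vE] := rf_ex rn V0; have [v gv] := ge v'; rewrite -{}gv in vE.
have /ex[z0 z0E] : g (m - e i m) = 0 by rewrite linearB /= gh -gm subrr.
have [z zE] : exists z : 'I_n -> nat -> L, forall j k, (k < p j i)%N ->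
    f (z j k) = e j (x j k) - umap v j k.
  suff /choice[z zE] : forall jk : 'I_n * nat, exists z : L, (jk.2 < p jk.1 i)%N ->
      f z = e jk.1 (x jk.1 jk.2) - umap v jk.1 jk.2.
    by exists (fun j k => z (j, k)) => j k; apply: (zE (j, k)).
  move=> [j k] /=; case: (boolP (k < p j i)%N) => [kp|_]; last by exists 0.
  suff /ex[z ->] : g (e j (x j k) - umap v j k) = 0 by exists z.
  by rewrite linearB /= gh vE // hom_umap // subrr.
exists (Pl z0 + vmap Pl z); rewrite linearD /= Af (agree_vmap _ _ _ Af) // -z0E linearB /=.
rewrite (rf_Pei _ rm) subr0; congr (_ + _).
transitivity (vmap Pm (fun j k => e j (x j k) - umap v j k)).
  by rewrite vmapB (rf_cx rm) subr0 vmap_e.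
by apply: eq_vmap cM _ => j k kp; rewrite zE.
Qed.

Lemma refl_ses_back : ses f' g' -> ses f g.
Proof.
move=> [_ f'm _ g'e ex]; have cM := rfM rm; have cL := rfM rl; have cN := rfM rn.
have ue := umap_e i.
have fm := agree_mono Al f'm.
have gf' v : g' (f' v) = 0 by apply/ex; exists v.
have gf0 v : e i (g (f v)) = g (f v) /\ Pn (g (f v)) = 0.
  have H : Pn (g (f v)) = 0 by rewrite -Ag -Af gf'.
  by split=> //; have /(rf_ker rn) <- := H.
have gf v : g (f v) = 0.
  have [<- _] := gf0 v; apply: (rf_inj rn) => j k kp.
  rewrite -!hom_umap //; have [<- _] := gf0 (umap v j k).
  by rewrite hom_umap // hom_umap // (umap_off _ _ _ (rf_s rn) cN).
have exoff m : e i m = 0 -> g m = 0 -> exists v, m = f v.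
  move=> m0 gm; have /ex[u uE] : g' (Pm m) = 0 by rewrite Ag gm linear0.
  have [v vE] := rf_img rl u.
  have E : Pm m = Pm (f v).
    move: uE; rewrite vE linearD /= Af f'h => H; have := congr1 (fun u => e i u) H.
    rewrite linearD /= !(rf_ei rm) (crep_eii _ _ (rfN rm)) add0r => e0.
    by rewrite H -e0 addr0.
  by exists (v - e i v); have [_ ->] := rf_P_off rl rm fh m0 E.
split=> //.
- move=> y.
  have [m1 [_ m1E]] : exists m, e i m = 0 /\ g m = y - e i y.
    apply: (agree_epi_off Ar g'e); by rewrite linearB /= (crep_eii _ _ cN) subrr.
  have [x xE] : exists x : 'I_n -> nat -> M, forall j k, g (x j k) = umap y j k.
    suff /choice[x xE] : forall jk : 'I_n * nat, exists m : M, g m = umap y jk.1 jk.2.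
      by exists (fun j k => x (j, k)) => j k; apply: (xE (j, k)).
    move=> jk; have [m [_ mE]] := agree_epi_off Ar g'e (umap_off jk.1 jk.2 y (rf_s rn) cN).
    by exists m.
  have : g' (vmap Pm x) = 0.
    by rewrite (agree_vmap _ _ _ Ag) // -(rf_cx rn y); apply: eq_vmap1.
  move=> /ex[u uE].
  have [z zE] := rf_surj rl u.
  have V0 : vmap Pm (fun j k => x j k - f (z j k)) = 0.
    rewrite vmapB -(agree_vmap _ _ _ Af) // -zE f'h -uE (vmap_ei _ _ _ (rfN rm)) subrr //.
  have [m mE] := rf_ex rm V0.
  exists (m1 + e i m); rewrite linearD /= m1E gh -addrA [X in _ + X](_ : _ = 0) ?addr0 //.
  apply/eqP; rewrite addrC subr_eq0 eq_sym -subr_eq0 -linearB; apply/eqP.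
  by apply: (rf_inj rn) => j k kp; rewrite umapB -hom_umap // -mE // gh linearB /= gf subr0 xE (ue _ _ _ _ _ _ _ cN) subrr.
move=> m; split=> [gm|[v ->]]; last exact: gf.
have [v1 v1E] : exists v, m - e i m = f v.
  apply: exoff; first by rewrite linearB /= (crep_eii _ _ cM) subrr.
  by rewrite linearB /= gh gm linear0 subrr.
have [y yE] : exists y : 'I_n -> nat -> L, forall j k, umap m j k = f (y j k).
  suff /choice[y yE] : forall jk : 'I_n * nat, exists z : L, umap m jk.1 jk.2 = f z.
    by exists (fun j k => y (j, k)) => j k; apply: (yE (j, k)).
  move=> jk; apply: exoff; first exact: umap_off (rf_s rm) cM.
  by rewrite hom_umap // gm /outmap linear0 lk0 !linear0.
have V0 : vmap Pl y = 0.
  apply: f'm; rewrite (agree_vmap _ _ _ Af) // -(rf_cx rm m); by apply: eq_vmap1 => j k; rewrite yE.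
have [v vE] := rf_ex rl V0.
exists (v1 + e i v); rewrite linearD /= -v1E fh -[LHS](subrK (e i m)); congr (_ + _).
apply/eqP; rewrite -subr_eq0 -linearB; apply/eqP/(rf_inj rm) => j k kp.
by rewrite umapB -hom_umap // -vE // fh -yE (ue _ _ _ _ _ _ _ cM) subrr.
Qed.

End Ses.
End ReflExact.

(** * Existence of reflections *)

Section ReflExists.
Variables (K : fieldType) (n : nat) (D : gdata n) (i : 'I_n) (o o' : rel 'I_n).
Notation p := (gp D).
Notation rep := (rep K (gen n)).
Implicit Types L M N : rep.
Notation e i v := (act _ (Ge i) v).
Notation l v := (act _ Gl v).
Notation a v := (act _ Ga v).
Notation vmap := (inmap D i).
Notation umap := (outmap i).
Notation shift := (@shiftmap K n D i _).
Notation delta := (@deltamap K n D i _).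
Hypothesis Hs : source_at D i o o'.

Lemma umap_0 M j k : umap (0 : M) j k = 0.
Proof. by rewrite /outmap linear0 lk0 !linear0. Qed.

Lemma iter_shift M t (x : 'I_n -> nat -> M) j k : (k < p j i)%N ->
  ((k + t < p j i)%N -> iter t shift x j k = x j (k + t)%N) /\
  ((p j i <= k + t < p j i + p j i)%N -> iter t shift x j k = lk (p i j) (x j (k + t - p j i)%N)).
Proof.
elim: t k => [|t IH] k kp.
  split; first by rewrite addn0.
  by rewrite addn0 leqNgt kp.
split=> /= H; rewrite {1}/shiftmap.
  have k1 : (k.+1 < p j i)%N by apply: leq_ltn_trans H; rewrite addnS ltnS leq_addr.
  rewrite k1; have [E _] := IH k.+1 k1; rewrite E ?addSnnS //.
case: ifP => k1; first by have [_ E] := IH k.+1 k1; rewrite E ?addSnnS.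
have kE : k.+1 = p j i by apply/eqP; rewrite eqn_leq kp leqNgt k1.
have p0 : (0 < p j i)%N by rewrite -kE.
have [E _] := IH 0%N p0; rewrite E ?add0n; last by move: H; rewrite addnS -addSn kE ltn_add2l => /andP[].
by rewrite addnS -addSn kE addKn.
Qed.

Lemma iter_shift_p M (x : 'I_n -> nat -> M) j k : (k < p j i)%N ->
  iter (p j i) shift x j k = lk (p i j) (x j k).
Proof.
move=> kp; have [_ ->] := iter_shift (p j i) x kp; first by rewrite addnK.
by rewrite leq_addl ltn_add2r.
Qed.

(** With d_i = m p_ji and d_j = m p_ij this turns the d_i-th power of the reflected loop into the
    d_j-th power of the loop at j, which is zero. *)
Lemma iter_shift_pm M (x : 'I_n -> nat -> M) j k m : (k < p j i)%N ->
  iter (m * p j i)%N shift x j k = lk (m * p i j)%N (x j k).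
Proof.
move=> kp; elim: m => //= m IH; rewrite mulSn iterD iter_shift_p // IH.
by rewrite -iterD -mulSn.
Qed.

Lemma shift_ext M (x y : 'I_n -> nat -> M) j :
  (forall k, (k < p j i)%N -> x j k = y j k) ->
  forall k, (k < p j i)%N -> shift x j k = shift y j k.
Proof.
move=> xy k kp; rewrite /shiftmap; case: ifP => k1; first exact: xy.
by rewrite xy //; case: (p j i) kp.
Qed.

Lemma iter_shift_ext M t (x y : 'I_n -> nat -> M) j :
  (forall k, (k < p j i)%N -> x j k = y j k) ->
  forall k, (k < p j i)%N -> iter t shift x j k = iter t shift y j k.
Proof. by move=> xy; elim: t => //= t IH; apply: shift_ext. Qed.

Lemma shift_map M N (h : M -> N) x j k : h 0 = 0 -> (forall m v, h (lk m v) = lk m (h v)) ->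
  h (shift x j k) = shift (fun j k => h (x j k)) j k.
Proof. by move=> h0 hl; rewrite /shiftmap; case: ifP. Qed.

Lemma iter_shift_map M N (h : M -> N) t x j k : h 0 = 0 -> (forall m v, h (lk m v) = lk m (h v)) ->
  h (iter t shift x j k) = iter t shift (fun j k => h (x j k)) j k.
Proof.
move=> h0 hl; elim: t j k => //= t IH j k; rewrite shift_map //.
by congr (shiftmap _ _ _ _ _); apply/funext => j'; apply/funext => k'.
Qed.

Lemma shiftP M c (x y : 'I_n -> nat -> M) j k :
  shift (fun j k => c *: x j k + y j k) j k = c *: shift x j k + shift y j k.
Proof. by rewrite /shiftmap; case: ifP => // _; rewrite lkP. Qed.

(** Families x j k matter for k < p_ji only. The common bound Q stores them as finite functions,
    which form a [vectType]; the index type 'I_Q.+1 is inhabited, as [inord] requires. *)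
Definition Q := (\sum_j p j i)%N.
Lemma p_le_Q j : (p j i <= Q)%N.
Proof. by rewrite /Q (bigD1 j) //= leq_addr. Qed.

Definition at_ M (X : {ffun 'I_n * 'I_Q.+1 -> M}) j k : M := X (j, inord k).
Definition mk M (x : 'I_n -> nat -> M) : {ffun 'I_n * 'I_Q.+1 -> M} :=
  [ffun t : 'I_n * 'I_Q.+1 => x t.1 t.2].

Lemma atK M (x : 'I_n -> nat -> M) j k : (k <= Q)%N -> at_ (mk x) j k = x j k.
Proof. by move=> kp; rewrite /at_ ffunE /= inordK. Qed.
Lemma mkP M c (x y : 'I_n -> nat -> M) :
  mk (fun j k => c *: x j k + y j k) = c *: mk x + mk y.
Proof. by apply/ffunP => t; rewrite !ffunE. Qed.
Lemma atP M c (X Y : {ffun 'I_n * 'I_Q.+1 -> M}) j k :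
  at_ (c *: X + Y) j k = c *: at_ X j k + at_ Y j k.
Proof. by rewrite /at_ !ffunE. Qed.
Lemma at0 M j k : at_ (0 : {ffun 'I_n * 'I_Q.+1 -> M}) j k = 0.
Proof. by rewrite /at_ ffunE. Qed.
Lemma deltaP M c (u v : M) j k : delta (c *: u + v) j k = c *: delta u j k + delta v j k.
Proof. by rewrite /deltamap; case: ifP => // _; rewrite scaler0 addr0. Qed.
Lemma lt_leQ j k : (k < p j i)%N -> (k <= Q)%N.
Proof. by move=> kp; apply: ltnW; apply: leq_trans kp (p_le_Q j). Qed.

Lemma at_shift M (X : {ffun 'I_n * 'I_Q.+1 -> M}) t j k : (k < p j i)%N ->
  at_ (iter t (fun X => mk (shift (at_ X))) X) j k = iter t shift (at_ X) j k.
Proof.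
elim: t k => //= t IH k kp; rewrite atK ?(lt_leQ kp) //.
exact: shift_ext.
Qed.

Section Forward.
Variable M : rep.
Hypothesis cM : crep D o M.
Hypothesis injM : forall v : M, (forall j k, (k < p j i)%N -> umap v j k = 0) -> e i v = 0.

Let F := {ffun 'I_n * 'I_Q.+1 -> M}.
Let zact (g : gen n) (z : M * F) : M * F := match g with
  | Ge j => if j == i then (0, z.2) else (e j z.1, 0)
  | Gl => (l z.1, mk (shift (at_ z.2)))
  | Ga => (a (z.1 - e i z.1), mk (delta z.1)) end.

Let zact_lin g : linear (zact g).
Proof.
move=> c [u x] [v y]; case: g => [j||] /=.
- case: ifP => _; congr (_, _); rewrite /= ?scaler0 ?addr0 //; exact: linearP.
- congr (_, _); first exact: linearP.
  rewrite /= -mkP; congr mk; apply/funext => j; apply/funext => k; rewrite -shiftP.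
  by congr (shiftmap _ _ _ _ _); apply/funext => j'; apply/funext => k'; rewrite atP.
congr (_, _); rewrite /=; first by rewrite -linearP scalerBr addrACA -opprD -linearP.
by rewrite -mkP; congr mk; apply/funext => j; apply/funext => k; rewrite deltaP.
Qed.

(** M x F carries the families F at the vertex i, with [shift] as loop. N is its quotient by M_i and
    by the families that come from [outmap]; [injM] makes the resulting sequence exact on the
    left. *)
Lemma refl_ex : exists N, refl D i o o' M N.
Proof.
have /choice[A AE] : forall g, exists A : 'End((M * F)%type), forall z, A z = zact g z.
  by move=> g; apply: lin_ex; apply: zact_lin.
pose Z : rep := @Rep K (gen n) (M * F)%type A.
have ZE g (z : Z) : act Z g z = zact g z by apply: AE.
pose Ker (z : Z) := z.1 = e i z.1 /\ exists v, forall j k, (k < p j i)%N ->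
  e j (at_ z.2 j k) = umap v j k.
have Kl : lin_pred Ker.
  split; first split; rewrite /= ?linear0 //.
    by exists 0 => j k kp; rewrite at0 umap_0 ?linear0.
  move=> c [u x] [v y] [/= u1 [s sE]] [/= v1 [t tE]]; split => /=.
    by rewrite linearP /= -u1 -v1.
  by exists (c *: s + t) => j k kp; rewrite atP linearP /= sE // tE // umapP.
have Ks : stable Ker.
  move=> g [u x] [/= u1 [s sE]]; rewrite /Ker ZE; case: g => [j||] /=.
  - have [_|ji] := eqVneq j i => /=.
      by split; [rewrite linear0 | exists s].
    split; first by rewrite u1 (crep_eij _ cM) 1?eq_sym // linear0.
    by exists 0 => j' k kp; rewrite at0 umap_0 ?linear0.
  - split; first by rewrite (crep_el cM) -u1.
    exists (l s) => j k kp; rewrite atK ?(lt_leQ kp) // (umap_l _ cM kp).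
    rewrite (@shift_map M M (fun v => e j v)) ?linear0 //; last by move=> *; rewrite (crep_elk _ _ _ cM).
    rewrite [RHS](@shift_map M M (fun v => e j v)) ?linear0 //; last by move=> *; rewrite (crep_elk _ _ _ cM).
    by apply: shift_ext => // k' kp'; rewrite sE // (umap_e _ _ _ _ cM).
  have u0 : u - e i u = 0 by rewrite -u1 subrr.
  rewrite u0; split; first by rewrite !linear0.
  exists 0 => j k kp; rewrite atK ?(lt_leQ kp) // umap_0 ?linear0.
  rewrite /deltamap; case: ifP => _; last by rewrite linear0.
  by rewrite u1 (crep_eij _ cM) //; apply: contraTneq kp => <-; rewrite gpii.
have [N [q [qh qe qP]]] := quotrep_ex Kl Ks.
have q0 (z z' : Z) : Ker (z - z') -> q z = q z'.
  by move=> /qP/eqP; rewrite linearB subr_eq0 => /eqP.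
have qx0 (x y : F) u : (forall j k, (k < p j i)%N -> e j (at_ x j k) = e j (at_ y j k)) ->
    q (u, x) = q (u, y).
  move=> xy; apply: q0; split=> /=; first by rewrite subrr linear0.
  exists 0 => j k kp; rewrite umap_0 ?linear0.
  by rewrite -scaleN1r addrC atP linearP /= xy // scaleN1r addNr.
have lE t (z : Z) : lk t (q z) = q (lk t z).
  by rewrite hom_lk.
have ltE t (z : Z) : lk t z = (lk t z.1, iter t (fun X => mk (shift (at_ X))) z.2) :> Z.
  by case: z => u x; elim: t => //= t ->; rewrite ZE.
have elt t j (x : 'I_n -> nat -> M) k : (forall k, e j (x j k) = 0) -> e j (iter t shift x j k) = 0.
  move=> x0; rewrite (@iter_shift_map M M (fun v => e j v)) ?linear0 //; last by move=> *; rewrite (crep_elk _ _ _ cM).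
  elim: t k => [|t IH] k /=; first by rewrite x0.
  by rewrite /shiftmap; case: ifP => _; rewrite IH // lk0.
have cN : crep D o' N.
  have n0 : (0, 0) = 0 :> Z by [].
  split.
  - move=> j k w; have [[u x] <-] := qe w; rewrite -!qh !ZE /=.
    case: (boolP (j == i)) => [/eqP ->|ji]; case: (boolP (k == i)) => [/eqP ->|ki] /=.
    + by rewrite eqxx.
    + by rewrite eq_sym (negbTE ki) linear0 n0 linear0.
    + by rewrite (negbTE ji) n0 linear0.
    by rewrite (crep_ee cM); case: eqP => // _; rewrite n0 linear0.
  - move=> w; have [[u x] <-] := qe w.
    rewrite (eq_bigr (fun j => q (if j == i then (0, x) else (e j u, 0)))); last first.
      by move=> j _; rewrite -qh ZE.
    rewrite -linear_sum; apply: q0.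
    rewrite (bigD1 i) //= eqxx (eq_bigr (fun j => (e j u, 0) : Z)); last by move=> j /negbTE ->.
    have -> : \sum_(j < n | j != i) (e j u, 0) = (u - e i u, 0) :> Z.
      have -> : u - e i u = \sum_(j < n | j != i) e j u.
        by apply/eqP; rewrite subr_eq -{1}(crep_1 cM u) (bigD1 i) //= addrC.
      elim/big_rec2: _ => [//|j y1 y2 _ ->]; by congr (_, _); rewrite /= addr0.
    split=> /=; last first.
      by exists 0 => j k kp; rewrite addr0 subrr at0 umap_0 ?linear0.
    by rewrite add0r addrAC subrr add0r (linearN (act M (Ge i))) /= (crep_eii _ _ cM).
  - move=> j w; have [[u x] <-] := qe w; rewrite -!qh !ZE /=; case: ifP => _ /=.
      by rewrite linear0.
    rewrite (crep_el cM); congr (q (_, _)); apply/ffunP => t; rewrite !ffunE /shiftmap.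
    by case: ifP; rewrite at0 // lk0.
  - move=> j w; have [[u x] <-] := qe w; rewrite -!qh ZE lE ltE /=; case: ifP => [/eqP ->|_] /=; last first.
      rewrite (crep_ld cM) -(linear0 q); apply: qx0 => j' k kp.
      by rewrite at_shift // at0 elt ?linear0 // => k'; rewrite at0 linear0.
    rewrite lk0 -(linear0 q); apply: qx0 => j' k kp; rewrite at_shift // at0 linear0.
    have pij : (0 < p i j')%N by rewrite p_sym; case: (p j' i) kp.
    have [m [di dj]] := gp_d pij; rewrite di iter_shift_pm // -dj (crep_elk _ _ _ cM).
    by rewrite (crep_ld cM).
  - move=> j k w ojk; have [[u x] <-] := qe w; rewrite -!qh !ZE /=.
    case: (boolP (j == i)) => [ji|ji] /=.
      rewrite (linear0 (act M (Ge i))) subr0 (linear0 (act M Ga)) -(linear0 q).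
      case: ifP => _; last by rewrite (linear0 (act M (Ge k))).
      by congr (q (_, _)); apply/ffunP => t; rewrite !ffunE /deltamap; case: ifP.
    case: (boolP (k == i)) => [/eqP ki|ki] /=; last first.
      rewrite (crep_eij _ cM) // subr0 (crep_o cM) ?(src_eq Hs) //.
      exact: linear0.
    rewrite -(linear0 q); apply: qx0 => j' k' kp; rewrite atK ?(lt_leQ kp) // at0 linear0.
    rewrite /deltamap; case: ifP => _; last by rewrite linear0.
    have [jj|jj] := eqVneq j j'; last by rewrite (crep_eij _ cM).
    by move: ojk; rewrite ki (snk_in Hs) p_sym jj; case: (p j' i) kp.
  move=> j k w; have [[u x] <-] := qe w; rewrite -!qh !ZE /=.
  case: (boolP (j == i)) => [ji|ji] /=.
    have e0 j' : e j' (0 : M) = 0 by apply: linear0.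
    have a0 : a (0 : M) = 0 by apply: linear0.
    rewrite lE ltE -!qh !ZE /= lE ltE lk0 e0 subr0 a0.
    have -> : mk (delta (0 : M)) = 0.
      by apply/ffunP => t; rewrite !ffunE /deltamap; case: ifP.
    case: ifP => _; rewrite /= ?e0 lk0; apply: qx0 => j' k' kp;
      by rewrite at_shift // elt ?at0 ?linear0 // => k2; rewrite at0 linear0.
  rewrite !lE !ltE -!qh !ZE /=.
  have eju t : e i (lk t (e j u)) = 0 by rewrite (crep_elk _ _ _ cM) (crep_eij _ cM) // lk0.
  rewrite eju (crep_eij _ cM) // !subr0; case: (boolP (k == i)) => [/eqP ki|ki] /=; last first.
    rewrite (crep_rel cM); apply: qx0 => j' k' kp.
    by rewrite at_shift // elt ?at0 ?linear0 // => k2; rewrite at0 linear0.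
  rewrite lk0; apply: qx0 => j' k' kp; rewrite at_shift // atK ?(lt_leQ kp) //.
  have E : forall k2, (k2 < p j' i)%N -> at_ (mk (delta (e j u))) j' k2 = delta (e j u) j' k2.
    by move=> k2 kp2; rewrite atK ?(lt_leQ kp2).
  rewrite (iter_shift_ext _ E) //.
  have [jj|jj] := eqVneq j j'; last first.
    rewrite elt; last first.
      by move=> k2; rewrite /deltamap; case: ifP => _; rewrite ?linear0 // (crep_eij _ cM).
    by rewrite /deltamap; case: ifP => _; rewrite ?linear0 // (crep_elk _ _ _ cM) (crep_eij _ cM) // lk0.
  rewrite -jj in kp *; rewrite ki iter_shift_p // /deltamap; case: ifP => _ //.
  by rewrite lk0.
have [P PE] : exists P : 'Hom(M, N), forall v, P v = q (v, 0).
  by apply: lin_ex => c u v; rewrite -linearP; congr (q (_, _)); rewrite /= scaler0 addr0.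
(* A vector put at the last index by [delta] and shifted p_ji - k - 1 times sits at the index k, so
   the image of the family x under [inmap] is the class of x itself. *)
have VE x : vmap P x = q (0, mk x).
  rewrite /inmap.
  have E1 j (k : 'I_(p j i)) : lk (p j i - k.+1) (e i (a (P (e j (x j k))))) =
    q (0, iter (p j i - k.+1) (fun X => mk (shift (at_ X))) (mk (delta (e j (x j k))))).
    by rewrite PE -qh ZE /= -qh ZE /= eqxx lE ltE /= lk0.
  under eq_bigr => j _ do (under eq_bigr => k _ do rewrite E1; rewrite -linear_sum /=).
  rewrite -linear_sum /=.
  have sumZ (I : finType) (f : I -> F) : \sum_t (0, f t) = (0, \sum_t f t) :> Z.
    elim/big_rec2: _ => [//|t y1 y2 _ ->]; by congr (_, _); rewrite /= addr0.
  under eq_bigr => j _ do rewrite sumZ.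
  rewrite sumZ; apply: qx0 => j k kp; rewrite atK ?(lt_leQ kp) //.
  have atS (I : finType) (f : I -> F) : at_ (\sum_t f t) j k = \sum_t at_ (f t) j k.
    by rewrite /at_ sum_ffunE.
  rewrite atS linear_sum (bigD1 j) //= [X in _ + X]big1 ?addr0; last first.
    move=> j' j'j; rewrite atS linear_sum big1 //= => k' _.
    rewrite at_shift // elt // => k2; case: (leqP k2 Q) => k2Q.
      rewrite atK // /deltamap; case: ifP => _; rewrite ?linear0 //.
      by rewrite (crep_eij _ cM).
    rewrite /at_ ffunE /deltamap; case: ifP => _; rewrite ?linear0 //.
    by rewrite (crep_eij _ cM).
  rewrite atS linear_sum (bigD1 (Ordinal kp)) //= [X in _ + X]big1 ?addr0; last first.
    move=> k' k'k; rewrite at_shift //.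
    rewrite (iter_shift_ext _ (y := delta (e j (x j k')))) //; last first.
      by move=> k2 kp2; rewrite atK ?(lt_leQ kp2).
    have [E2 E3] := iter_shift (p j i - k'.+1) (delta (e j (x j k'))) kp.
    have kk : k <> k' by move=> kk; move/eqP: k'k; apply; apply: val_inj.
    have k'p := ltn_ord k'; move: E2 E3 kk k'p; move: (nat_of_ord k') => m E2 E3 kk mp.
    case: (ltnP (k + (p j i - m.+1)) (p j i)) => H.
      rewrite E2 // /deltamap; case: eqP => [H1|_]; last by rewrite linear0.
      by exfalso; lia.
    rewrite E3 /deltamap; last by lia.
    case: eqP => [H1|_]; last by rewrite lk0 linear0.
    by exfalso; lia.
  rewrite at_shift // (iter_shift_ext _ (y := delta (e j (x j k)))) //; last first.
    by move=> k2 kp2; rewrite atK ?(lt_leQ kp2).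
  have [E2 _] := iter_shift (p j i - k.+1) (delta (e j (x j k))) kp.
  have kE : (k + (p j i - k.+1)).+1 = p j i by rewrite -addSn subnKC.
  by rewrite E2 /deltamap kE ?eqxx ?leqnn // (crep_eii _ _ cM).
exists N, P; split=> //.
- move=> v; rewrite PE qP; split=> [[]//|vE]; split=> //=.
  by exists 0 => j k kp; rewrite at0 umap_0 ?linear0.
- move=> w; have [[u x] <-] := qe w; exists u; rewrite PE -qh ZE /= eqxx -linearD.
  by congr (q (_, _)); rewrite /= ?addr0 ?add0r.
- by move=> j v ji; rewrite !PE -qh ZE /= (negbTE ji).
- by move=> v; rewrite PE -qh ZE /= eqxx; exact: linear0.
- move=> v; rewrite !PE -qh ZE /=; congr (q (_, _)); apply/ffunP => t; rewrite !ffunE /shiftmap.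
  by case: ifP; rewrite at0 // lk0.
- move=> v; rewrite !PE -!qh !ZE /= eqxx -linearB; congr (q (_, _)); rewrite /= ?subr0 //.
  by rewrite subrr.
- move=> v; rewrite VE; apply/qP; split=> /=; first by rewrite linear0.
  by exists v => j k kp; rewrite atK ?(lt_leQ kp) // (umap_e _ _ _ _ cM).
- move=> x; rewrite VE => /qP[_ [v vE]]; exists v => j k kp.
  by rewrite -vE //= atK ?(lt_leQ kp).
move=> w; have [[u x] <-] := qe w; exists (at_ x); rewrite -qh ZE /= eqxx VE.
by congr (q (_, _)); apply/ffunP => -[j k]; rewrite ffunE /at_ /= inord_val.
Qed.

End Forward.

Section Backward.
Variable N : rep.
Hypothesis cN : crep D o' N.
Let W (x : 'I_n -> nat -> N) : N := vmap (\1%VF : 'End(N)) x.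
Hypothesis surjN : forall w : N, exists x, e i w = W x.

Let F := {ffun 'I_n * 'I_Q.+1 -> N}.
Let zact (g : gen n) (z : N * F) : N * F := match g with
  | Ge j => if j == i then (0, z.2) else (e j z.1, 0)
  | Gl => (l z.1, mk (fun j k => if (k < p j i)%N then shift (at_ z.2) j k else 0))
  | Ga => (a z.1 - e i (a z.1) + \sum_(j | (0 < p j i)%N) at_ z.2 j 0%N, 0) end.

Let zact_lin g : linear (zact g).
Proof.
move=> c [u x] [v y]; case: g => [j||] /=.
- case: ifP => _; congr (_, _); rewrite /= ?scaler0 ?addr0 //; exact: linearP.
- congr (_, _); first exact: linearP.
  rewrite /= -mkP; congr mk; apply/funext => j; apply/funext => k.
  case: ifP => _; last by rewrite scaler0 addr0.
  rewrite -shiftP.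
  by congr (shiftmap _ _ _ _ _); apply/funext => j'; apply/funext => k'; rewrite atP.
congr (_, _); rewrite /= ?scaler0 ?addr0 //.
rewrite scalerDr addrACA; congr (_ + _).
  by rewrite (linearP (act N Ga)) /= (linearP (act N (Ge i))) /= scalerBr opprD addrACA.
by rewrite scaler_sumr -big_split; apply: eq_bigr => j _; rewrite atP.
Qed.

(** Dually, M_i is the kernel of (+)_j N_j^p_ji -> N_i, cut out inside N x F; an arrow out of i
    reads the component of index 0. Normalised families, zero for k >= p_ji and with components in
    N_j, make elements unique. [surjN] gives exactness on the right. *)
Lemma refl_ex_back : exists M, refl D i o o' M N.
Proof.
have e0 j : e j (0 : N) = 0 by apply: linear0.
have a0 : a (0 : N) = 0 by apply: linear0.
have /choice[A AE] : forall g, exists A : 'End((N * F)%type), forall z, A z = zact g z.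
  by move=> g; apply: lin_ex; apply: zact_lin.
pose Z : rep := @Rep K (gen n) (N * F)%type A.
have ZE g (z : Z) : act Z g z = zact g z by apply: AE.
have W_ext x y : (forall j k, (k < p j i)%N -> x j k = y j k) -> W x = W y.
  by move=> xy; apply: (eq_vmap _ cN) => j k kp; rewrite xy.
pose U (z : Z) := [/\ e i z.1 = 0, forall j k, (k <= Q)%N ->
   at_ z.2 j k = if (k < p j i)%N then e j (at_ z.2 j k) else 0 & W (at_ z.2) = 0].
have W0 : W (fun _ _ => 0) = 0 by apply: vmap0.
have Ul : lin_pred U.
  split; first split; rewrite /= ?linear0 //.
  - by move=> j k kp; rewrite at0 linear0; case: ifP.
  - by rewrite -[RHS]W0; apply: W_ext => j k kp; rewrite at0.
  move=> c [u x] [v y] [/= u1 x1 wx] [/= v1 y1 wy]; split => /=.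
  - by rewrite linearP /= u1 v1 scaler0 addr0.
  - move=> j k kp; rewrite atP (x1 _ _ kp) (y1 _ _ kp); case: ifP => _; last by rewrite scaler0 addr0.
    by rewrite !linearP /= !(crep_eii _ _ cN).
  have -> : W (at_ (c *: x + y)) = c *: W (at_ x) + W (at_ y).
    by rewrite -vmapP; apply: W_ext => j k kp; rewrite atP.
  by rewrite wx wy scaler0 addr0.
have idE : forall v : N, \1%VF v = v by move=> v; rewrite id_lfunE.
have Us : stable U.
  move=> g [u x] [/= u1 x1 wx]; rewrite /U ZE; case: g => [j||] /=.
  - case: (boolP (j == i)) => [_|ji] /=; first by rewrite linear0.
    rewrite (crep_eij _ cN) //; split=> //.
      by move=> j' k kp; rewrite at0 linear0; case: ifP.
    by rewrite -[RHS]W0; apply: W_ext => j' k kp; rewrite at0.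
  - rewrite (crep_el cN) u1 linear0; split=> //.
      move=> j k kp; rewrite atK //; case: ifP => // kp'.
      rewrite (@shift_map N N (fun v => e j v)) ?linear0 //; last by move=> *; rewrite (crep_elk _ _ _ cN).
      apply: shift_ext => // k2 kp2; rewrite {1}x1 ?kp2 //; exact: lt_leQ kp2.
    have -> : W (at_ (mk (fun j k => if (k < p j i)%N then shift (at_ x) j k else 0))) = W (shift (at_ x)).
      by apply: W_ext => j k kp; rewrite atK ?(lt_leQ kp) // kp.
    rewrite /W -(vmap_shift_gen _ cN cN) => [|j v _|v]; rewrite ?idE //.
    by rewrite -/(W _) wx linear0.
  split=> //.
  + rewrite linearD linearB /= (crep_eii _ _ cN) subrr add0r linear_sum big1 //= => j pj.
    rewrite x1 // pj (crep_eij _ cN) //; by apply: contraTneq pj => ->; rewrite gpii.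
  + by move=> j' k kp; rewrite at0 linear0; case: ifP.
  by rewrite -[RHS]W0; apply: W_ext => j' k kp; rewrite at0.
have [M [q [qh qm qP]]] := subrep_ex Ul Us.
have q_inj := mono_inj qm.
have qU (v : M) : U (q v) by apply/qP; exists v.
have lE t (v : M) : q (lk t v) = lk t (q v) by rewrite hom_lk.
pose msh (x : F) : F := mk (fun j k => if (k < p j i)%N then shift (at_ x) j k else 0).
have ltE t (z : Z) : lk t z = (lk t z.1, iter t msh z.2) :> Z.
  by case: z => u x; elim: t => //= t ->; rewrite ZE.
have mshE t x j k : (k < p j i)%N -> at_ (iter t msh x) j k = iter t shift (at_ x) j k.
  elim: t k => //= t IH k kp; rewrite atK ?(lt_leQ kp) // kp; exact: shift_ext.
have U0 (x : F) : (forall j k, (k < p j i)%N -> at_ x j k = 0) -> U (0, x) -> x = 0.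
  move=> x0 [_ x1 _]; apply/ffunP => -[j k]; rewrite ffunE.
  have -> : x (j, k) = at_ x j k by rewrite /at_ inord_val.
  have kQ : (k <= Q)%N by rewrite -ltnS.
  by rewrite x1 //; case: ifP => // kp; rewrite x0 // linear0.
have ext (v v' : M) : (q v).1 = (q v').1 ->
    (forall j k, (k < p j i)%N -> at_ (q v).2 j k = at_ (q v').2 j k) -> v = v'.
  move=> E1 E2; apply: q_inj; apply/eqP; rewrite -subr_eq0; apply/eqP.
  have := qU (v - v'); rewrite linearB /=; case: (q v) (q v') E1 E2 => [u x] [u' x'] /= -> xx Uv.
  have E : (u', x) - (u', x') = (0, x - x') :> Z by congr (_, _); rewrite /= subrr.
  rewrite E in Uv *; rewrite (U0 _ _ Uv) // => j k kp.
  by rewrite -scaleN1r addrC atP xx // scaleN1r addNr.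
have q1 v : e i (q v).1 = 0 by have [] := qU v.
have q2 v j k : (k < p j i)%N -> e j (at_ (q v).2 j k) = at_ (q v).2 j k.
  by move=> kp; have [_ E _] := qU v; rewrite [RHS]E ?(lt_leQ kp) // kp.
have qe1 v j : (q (e j v)).1 = if j == i then 0 else e j (q v).1.
  by rewrite qh ZE /=; case: ifP.
have qe2 v j : (q (e j v)).2 = if j == i then (q v).2 else 0.
  by rewrite qh ZE /=; case: ifP.
have ql1 v t : (q (lk t v)).1 = lk t (q v).1 by rewrite lE ltE.
have ql2 v t j k : (k < p j i)%N -> at_ (q (lk t v)).2 j k = iter t shift (at_ (q v).2) j k.
  by move=> kp; rewrite lE ltE mshE.
have qa1 v : (q (a v)).1 = a (q v).1 - e i (a (q v).1) + \sum_(j | (0 < p j i)%N) at_ (q v).2 j 0%N.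
  by rewrite qh ZE.
have qa2 v : (q (a v)).2 = 0 by rewrite qh ZE.
have sh0 t j k : iter t shift (at_ (0 : F)) j k = 0.
  elim: t j k => [|t IH] j k /=; first by rewrite at0.
  by rewrite /shiftmap; case: ifP => _; rewrite ?IH ?lk0.
have qsum (J : finType) (f : J -> M) : (q (\sum_t f t)).1 = \sum_t (q (f t)).1.
  by rewrite linear_sum; elim/big_rec2: _ => [|t y1 y2 _ <-].
have qsum2 (J : finType) (f : J -> M) : (q (\sum_t f t)).2 = \sum_t (q (f t)).2.
  by rewrite linear_sum; elim/big_rec2: _ => [|t y1 y2 _ <-].
have sum_ei (v : M) j : j != i -> e j (\sum_(j | (0 < p j i)%N) at_ (q v).2 j 0%N) =
    if (0 < p j i)%N then at_ (q v).2 j 0%N else 0.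
  move=> ji; rewrite linear_sum /= big_mkcond (bigD1 j) //= big1 ?addr0 => [|j' j'j].
    by case: ifP => // pj; rewrite q2.
  by case: ifP => // pj; rewrite -q2 // (crep_eij _ cN).
have Q0 v j : (q (e j v)).1 = 0 -> j != i -> e j v = 0.
  by move=> E ji; apply: ext; rewrite ?E ?linear0 // => j' k kp; rewrite qe2 (negbTE ji).
have cM : crep D o M.
  split.
  - move=> j k v; apply: ext => [|j' k' kp]; rewrite ?qe1 ?qe2.
      case: (eqVneq j k) => [->|jk]; rewrite ?qe1 ?linear0.
        by case: (k == i); rewrite ?(crep_eii _ _ cN).
      case: ifP => // _; case: ifP => _; rewrite ?linear0 //.
      by rewrite (crep_eij _ cN).
    case: (eqVneq j k) => [->|jk]; rewrite ?qe2; first by case: (k == i).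
    rewrite linear0 /=; case: ifP => // /eqP ki; case: ifP => // /eqP ji.
    by case/eqP: jk; rewrite ji ki.
  - move=> v; apply: ext => [|j' k' kp]; rewrite ?qsum ?qsum2.
      rewrite (bigD1 i) //= qe1 eqxx add0r -[RHS](crep_1 cN) [RHS](bigD1 i) //= q1 add0r.
      by apply: eq_bigr => j /negbTE ji; rewrite qe1 ji.
    rewrite (bigD1 i) //= qe2 eqxx big1 ?addr0 // => j /negbTE ji; by rewrite qe2 ji.
  - move=> j v; apply: ext => [|j' k' kp]; rewrite ?qe1 ?qe2.
      rewrite !(ql1 _ 1%N) qe1 /=; case: ifP => _; rewrite ?linear0 //.
      by rewrite (crep_el cN).
    rewrite (ql2 _ 1%N) // qe2; case: ifP => _; first by rewrite (ql2 _ 1%N).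
    by rewrite (sh0 1%N) at0.
  - move=> j v; apply: ext => [|j' k' kp]; rewrite ?ql1 ?ql2 // ?qe1 ?qe2 linear0.
      case: ifP => _; rewrite ?lk0 // (crep_ld cN) //.
    case: ifP => [/eqP ->|_]; last by rewrite sh0 at0.
    have pij : (0 < p i j')%N by rewrite p_sym; case: (p j' i) kp.
    have [m [di dj]] := gp_d pij; rewrite di iter_shift_pm // -dj at0 -q2 // (crep_ld cN) //.
  - move=> j k v ojk.
    have [->|ki] := eqVneq k i.
      by apply: ext => [|j' k' kp]; rewrite ?qe1 ?qe2 eqxx ?qa2 linear0.
    apply: Q0 => //; rewrite qe1 (negbTE ki) qa1 qe1; have [ji|ji] := eqVneq j i.
      rewrite a0 e0 subr0 add0r.
      rewrite sum_ei // qe2 ji eqxx.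
      by rewrite ji (src_out Hs) p_sym in ojk; rewrite (negbTE ojk).
    rewrite linearD linearB /= [e k (e i _)](crep_eij _ cN) 1?eq_sym // subr0.
    rewrite (crep_o cN) -?(src_eq Hs) // add0r qe2 (negbTE ji).
    by rewrite linear_sum big1 //= => j' _; rewrite at0 linear0.
  move=> j k v.
  have [->|ki] := eqVneq k i.
    apply: ext => [|j' k' kp]; rewrite ?ql1 ?ql2 // ?qe1 ?qe2 eqxx ?lk0 // ?qa2.
    by rewrite at0 sh0.
  apply/eqP; rewrite -subr_eq0; apply/eqP.
  have -> : lk (p j k) (e k (a (e j v))) = e k (lk (p j k) (e k (a (e j v)))).
    apply: ext => [|j' k' kp]; rewrite ?qe1 ?qe2 ?(negbTE ki) ?ql1 ?ql2 // ?qe1 ?qe2 ?(negbTE ki).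
      by rewrite (crep_elk _ _ _ cN) (crep_eii _ _ cN).
    by rewrite sh0 at0.
  rewrite -linearB; apply: Q0 => //; rewrite linearB /= linearB /=.
  rewrite !qe1 (negbTE ki) qa1 !ql1 !qe1 (negbTE ki) qa1 qe1.
  have [ji|ji] := eqVneq j i.
    rewrite lk0 a0 e0 subr0 !add0r; set SS := (\sum_(_ | _) _).
    have -> : e k SS = if (0 < p k i)%N then lk (p i k) (at_ (q v).2 k 0%N) else 0.
      rewrite /SS ji sum_ei //; case: ifP => // pk; rewrite ql2 // iter_shift_p //.
      by rewrite qe2 eqxx.
    rewrite ji sum_ei // qe2 eqxx (crep_elk _ _ _ cN); case: ifP => pk; last by rewrite !e0 lk0 subr0.
    by rewrite q2 // subrr.
  have z0 t : \sum_(j0 < n | (0 < p j0 i)%N) at_ (q (lk t (e j v))).2 j0 0%N = 0.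
    by rewrite big1 // => j' pj; rewrite ql2 // qe2 (negbTE ji) sh0.
  rewrite z0 (z0 0%N) !addr0 !linearB /= (crep_eij _ cN) 1?eq_sym // !subr0 (crep_eij _ cN) 1?eq_sym // subr0.
  by rewrite (crep_rel cN) (crep_elk _ _ _ cN) (crep_eii _ _ cN) subrr.
have [P PE] : exists P : 'Hom(M, N), forall v, P v = (q v).1.
  by apply: lin_ex => c u v; rewrite linearP.
have umE v j k : (k < p j i)%N -> P (umap v j k) = at_ (q v).2 j k.
  move=> kp; have ji : j != i by apply: contraTneq kp => ->; rewrite gpii.
  have p0 : (0 < p j i)%N by case: (p j i) kp.
  rewrite PE /outmap qe1 (negbTE ji) qa1 ql1 qe1 eqxx lk0 a0 e0 subr0 add0r sum_ei // p0.
  by rewrite ql2 // qe2 eqxx; have [-> //] := iter_shift k (at_ (q v).2) p0.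
have vE x : vmap P x = W (fun j k => P (x j k)).
  rewrite /W /inmap; apply: eq_bigr => j _; apply: eq_bigr => k _; congr (iter _ _ _).
  rewrite idE !PE qe1; case: ifP => [/eqP ji|//].
  by exfalso; have := leq_ltn_trans (leq0n _) (ltn_ord k); rewrite ji gpii.
have Pinj j v : j != i -> P v = 0 -> e j v = 0.
  by move=> ji; rewrite PE => E; apply: Q0 => //; rewrite qe1 (negbTE ji) E linear0.
exists M, P; split=> //.
- move=> v; rewrite PE; split=> [E|->]; last by rewrite qe1 eqxx.
  by apply: ext => [|j k kp]; rewrite ?qe1 ?qe2 eqxx // E.
- move=> w; have /qP[v vE'] : U (w - e i w, 0).
    split=> /=; first by rewrite linearB /= (crep_eii _ _ cN) subrr.
      by move=> j k _; rewrite at0 linear0; case: ifP.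
    by rewrite -[RHS]W0; apply: W_ext => j' k kp; rewrite at0.
  by exists v; rewrite PE -vE' /= subrK.
- by move=> j v ji; rewrite !PE qe1 (negbTE ji).
- by move=> v; rewrite PE q1.
- by move=> v; rewrite !PE (ql1 _ 1%N).
- move=> v; rewrite !PE qa1; have z0 : forall j, at_ (q (v - e i v)).2 j 0%N = 0.
    by move=> j; rewrite linearB /= qh ZE /= eqxx /= subrr at0.
  rewrite big1 // addr0; have -> : (q (v - e i v)).1 = (q v).1.
    by rewrite linearB /= qh ZE /= eqxx /= subr0.
  by [].
- move=> v v0; apply: ext => [|j k kp]; rewrite ?qe1 ?qe2 eqxx linear0 //.
  by rewrite -umE // v0 // linear0 at0.
- move=> v; rewrite vE; have [_ _ <-] := qU v; apply: W_ext => j k kp; exact: umE.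
- move=> x; rewrite vE => Wx.
  pose X : F := mk (fun j k => if (k < p j i)%N then e j (P (x j k)) else 0).
  have /qP[v vE'] : U (0, X).
    split=> /=; first by rewrite linear0.
      move=> j k kp; rewrite atK //; case: ifP => // _; by rewrite (crep_eii _ _ cN).
    rewrite -Wx; apply: (eq_vmap _ cN) => j k kp; rewrite atK ?(lt_leQ kp) // kp (crep_eii _ _ cN) //.
  exists v => j k kp; have ji : j != i by apply: contraTneq kp => ->; rewrite gpii.
  apply/eqP; rewrite -subr_eq0; apply/eqP.
  have <- : e j (e j (x j k) - umap v j k) = e j (x j k) - umap v j k.
    by rewrite linearB /= (crep_eii _ _ cM) (umap_e _ _ _ _ cM).
  apply: Pinj => //; rewrite linearB /= umE // -vE' /= atK ?(lt_leQ kp) // kp !PE qe1 (negbTE ji).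
  by rewrite subrr.
move=> w; have [x xE] := surjN w.
have imP w' : exists v, P v = w' - e i w'.
  have /qP[v vE'] : U (w' - e i w', 0).
    split=> /=; first by rewrite linearB /= (crep_eii _ _ cN) subrr.
      by move=> j k _; rewrite at0 linear0; case: ifP.
    by rewrite -[RHS]W0; apply: W_ext => j' k kp; rewrite at0.
  by exists v; rewrite PE -vE'.
have /choice[y yE] : forall jk : 'I_n * nat, exists v, P v = x jk.1 jk.2 - e i (x jk.1 jk.2).
  by move=> jk; apply: imP.
exists (fun j k => y (j, k)); rewrite xE vE; apply: (eq_vmap _ cN) => j k kp; rewrite yE linearB /=.
have ji : j != i by apply: contraTneq kp => ->; rewrite gpii.
by rewrite (crep_eij _ cN) 1?eq_sym // subr0.
Qed.

End Backward.
End ReflExists.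

(** * Simple modules and torsion classes under reflection *)

Section Step.
Variables (K : fieldType) (n : nat) (D : gdata n).
Notation p := (gp D).
Notation d := (gd D).
Notation rep := (rep K (gen n)).
Implicit Types L M N X Y Z U : rep.
Notation e i v := (act _ (Ge i) v).
Notation l v := (act _ Gl v).
Notation a v := (act _ Ga v).

Definition srep (i : 'I_n) : rep := @Rep K (gen n) K^o
  (fun g => match g with Ge j => if j == i then \1%VF else 0 | _ => 0 end).

Lemma srep_in o (J : {set 'I_n}) i : i \in J -> inC D o J (srep i).
Proof.
move=> iJ.
have E j (v : srep i) : e j v = if j == i then v else 0.
  by rewrite /=; case: ifP => _; rewrite ?id_lfunE ?zero_lfunE.
have l0 (v : srep i) : l v = 0 by rewrite /= zero_lfunE.
have a0 (v : srep i) : a v = 0 by rewrite /= zero_lfunE.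
have lk1 k (v : srep i) : (0 < k)%N -> lk k v = 0 by case: k => //= k _; rewrite l0.
split; first split.
- move=> j k v; rewrite !E; case: (eqVneq j k) => [->|jk]; first by case: (k == i).
  by case: eqP => // ki; case: eqP => // ji; case/eqP: jk; rewrite ji ki.
- move=> v; rewrite (eq_bigr (fun j => if j == i then v else 0)); last by move=> j _; rewrite E.
  by rewrite (bigD1 i) //= eqxx big1 ?addr0 // => j /negbTE ->.
- by move=> j v; rewrite E !l0 if_same.
- by move=> j v; rewrite lk1 // gd_gt0.
- by move=> j k v _; rewrite a0 linear0.
- by move=> j k v; rewrite !a0 linear0 lk0.
by move=> j jJ v; rewrite E; case: eqP jJ => // ->; rewrite iJ.
Qed.

Lemma srep_neq0 i : ~ rep0 (srep i).
Proof. by move=> /(_ (1 : K^o)) /eqP; rewrite oner_eq0. Qed.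

Lemma srep_brick i : brick (srep i).
Proof.
split; first exact: srep_neq0.
move=> f _; have [f0|f0] := eqVneq (f (1 : K^o)) 0; [left|right].
  apply: hom_image0 => v; have -> : v = (v : K) *: (1 : K^o) by rewrite /GRing.scale /= mulr1.
  by rewrite linearZ /= f0 scaler0.
move=> v; have -> : v = (v : K) *: (1 : K^o) by rewrite /GRing.scale /= mulr1.
rewrite linearZ /= => /eqP; rewrite scaler_eq0 (negbTE f0) orbF => /eqP ->.
by rewrite scale0r.
Qed.

Lemma hom_srep i M (f : 'Hom(M, K^o)) : (forall j v, j != i -> f (e j v) = 0) ->
  (forall v, f (e i v) = f v) -> (forall v, f (l v) = 0) -> (forall v, f (a v) = 0) ->
  @hom K (gen n) M (srep i) f.
Proof.
move=> f1 f2 f3 f4 [j||] v /=; rewrite ?zero_lfunE //.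
case: (boolP (j == i)) => [/eqP ->|ji]; first by rewrite id_lfunE f2.
by rewrite zero_lfunE f1.
Qed.

Section Source.
Variables (i : 'I_n) (o o' : rel 'I_n).
Hypothesis Hs : source_at D i o o'.
Notation refl := (refl D i o o').
Notation umap := (outmap i).

Lemma epi_srep M (f : 'Hom(M, srep i)) v : f v != 0 -> epi f.
Proof.
move=> fv w; exists (((w : K) / (f v : K)) *: v); rewrite linearZ /= /GRing.scale /=.
by rewrite divfK.
Qed.

(** No arrow enters i, so M_i / l M_i is a quotient of M; it is nonzero because the loop is
    nilpotent. *)
Lemma src_top M v : crep D o M -> e i v != 0 :> M ->
  exists f : 'Hom(M, srep i), hom f /\ epi f.
Proof.
move=> cM v0.
pose W (v : M) := exists x y, v = l (e i x) + y /\ e i y = 0.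
have Wl : lin_pred W.
  split; first by exists 0, 0; rewrite !linear0 addr0.
  move=> c _ _ [x1 [y1 [-> y10]]] [x2 [y2 [-> y20]]]; exists (c *: x1 + x2), (c *: y1 + y2).
  by rewrite !linearP /= y10 y20 scaler0 addr0 scalerDr addrACA.
have [u uW] : exists u, ~ W u.
  apply: contrapT => H; case/eqP: v0.
  have allW (u : M) : exists x, e i u = l (e i x).
    have [x [y [-> y0]]] : W u by apply: contrapT => nW; apply: H; exists u.
    by exists x; rewrite linearD /= y0 addr0 (crep_el cM) (crep_eii _ _ cM).
  suff key k : exists x, e i v = lk k (e i x).
    by have [x ->] := key (d i); rewrite (crep_ld cM).
  elim: k => [|k [x ->]]; first by exists v.
  by have [y ->] := allW x; exists y; rewrite iterSr.
have [f [fu f0]] := separating_form Wl uW.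
have f00 y : e i y = 0 -> f y = 0 by move=> y0; apply: f0; exists 0, y; rewrite !linear0 add0r.
exists f; split.
  apply: hom_srep => [j w ji|w|w|w].
  - by rewrite f00 // (crep_eij _ cM).
  - apply/eqP; rewrite eq_sym -subr_eq0 -linearB; apply/eqP/f00.
    by rewrite linearB /= (crep_eii _ _ cM) subrr.
  - apply: f0; exists w, (l w - l (e i w)); split; first by rewrite addrC subrK.
    by rewrite linearB /= !(crep_el cM) (crep_eii _ _ cM) subrr.
  by rewrite f00 // (src_ea _ Hs).
by apply: (epi_srep (v := u)); rewrite fu oner_eq0.
Qed.

(** Powers of the loop beyond p_ji follow from the smaller ones, since the relation moves eps_i^p_ji
    across the arrow. *)
Lemma arrows_at M v : crep D o M -> (forall j k, (k < p j i)%N -> umap v j k = 0 :> M) ->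
  forall k, a (lk k (e i v)) = 0.
Proof.
move=> cM H k; rewrite -(crep_1 cM (a _)) big1 // => j _.
elim/ltn_ind: k => k IH; case: (ltnP k (p j i)) => kp; first exact: H.
case E: (p j i) => [|m].
  have oij : ~~ o i j by rewrite (src_out Hs) p_sym E.
  by rewrite -(crep_elk _ _ _ cM) (crep_o cM _ oij).
have E2 : lk (k - p j i) (e i v) = e i (lk (k - p j i) (e i v)).
  by rewrite (crep_elk _ _ _ cM) (crep_eii _ _ cM).
by rewrite -(subnKC kp) iterD E2 (crep_rel cM) -E2 IH ?lk0 //; lia.
Qed.

(** The last nonzero power of the loop on v is killed by all arrows and spans a copy of S_i. *)
Lemma src_soc M v : crep D o M -> (forall j k, (k < p j i)%N -> umap v j k = 0 :> M) ->
  e i v != 0 -> exists f : 'Hom(srep i, M), hom f /\ mono f.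
Proof.
move=> cM H v0; have aE := arrows_at cM H.
have ex0 : exists k, lk k (e i v) == 0 by exists (d i); rewrite (crep_ld cM).
case: (ex_minnP ex0) => -[|k] /eqP k0 kmin; first by case/eqP: v0.
set w := lk k (e i v).
have w0 : w != 0 by apply/negP => /kmin; rewrite ltnn.
have ew : e i w = w by rewrite /w (crep_elk _ _ _ cM) (crep_eii _ _ cM).
have [f fE] : exists f : 'Hom(K^o, M), forall c, f c = (c : K) *: w.
  by apply: lin_ex => c u1 u2; rewrite scalerDl scalerA.
exists f; split=> [[j||] c|c] /=; rewrite ?zero_lfunE ?fE ?scale0r.
- rewrite linearZ /=; case: (boolP (j == i)) => [/eqP ->|ji].
    by rewrite id_lfunE ew.
  by rewrite zero_lfunE scale0r -ew (crep_eij _ cM) ?scaler0 // eq_sym.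
- by rewrite linearZ /= -iterS k0 scaler0.
- by rewrite linearZ /= aE scaler0.
by move=> /eqP; rewrite scaler_eq0 (negbTE w0) orbF => /eqP.
Qed.

Lemma src_refl M : crep D o M -> (forall f : 'Hom(srep i, M), hom f -> f = 0) ->
  exists N, refl M N.
Proof.
move=> cM H; apply: refl_ex => // v v0; apply/eqP/negPn/negP => ev.
have [f [fh fm]] := src_soc cM v0 ev.
have := H f fh => f0; apply: (@srep_neq0 i) => w; apply: fm; by rewrite f0 zero_lfunE.
Qed.

(** If the image of W together with l N_i were not all of N_i, a separating form would give a map
    onto S_i. So N_i = im W + l N_i, and since the loop is nilpotent N_i = im W, as in Nakayama's
    lemma. *)
Lemma snk_refl N : crep D o' N -> (forall f : 'Hom(N, srep i), hom f -> f = 0) ->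
  exists M, refl M N.
Proof.
move=> cN H; pose W (x : 'I_n -> nat -> N) : N := inmap D i (\1%VF : 'End(N)) x.
apply: refl_ex_back => // w.
have eW x : e i (W x) = W x by apply: (vmap_ei _ _ _ cN).
pose Q (v : N) := exists x y z, v = W x + l (e i y) + z /\ e i z = 0.
have Ql : lin_pred Q.
  split; first by exists (fun _ _ => 0), 0, 0; rewrite /W vmap0 !linear0 !addr0.
  move=> c _ _ [x1 [y1 [z1 [-> z10]]]] [x2 [y2 [z2 [-> z20]]]].
  exists (fun j k => c *: x1 j k + x2 j k), (c *: y1 + y2), (c *: z1 + z2).
  rewrite /W vmapP !linearP /= z10 z20 scaler0 addr0 !scalerDr; split=> //.
  by rewrite addrACA; congr (_ + _); rewrite addrACA.
have allQ (u : N) : Q u.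
  apply: contrapT => uQ; have [f [fu f0]] := separating_form Ql uQ.
  have f00 y : e i y = 0 -> f y = 0.
    by move=> y0; apply: f0; exists (fun _ _ => 0), 0, y; rewrite /W vmap0 !linear0 !add0r.
  have fei y : f (e i y) = f y.
    apply/eqP; rewrite eq_sym -subr_eq0 -linearB; apply/eqP/f00.
    by rewrite linearB /= (crep_eii _ _ cN) subrr.
  have /H f_0 : @hom K (gen n) N (srep i) f.
    apply: hom_srep => [j y ji|y|y|y].
    - by rewrite f00 // (crep_eij _ cN).
    - exact: fei.
    - apply: f0; exists (fun _ _ => 0), y, (l y - l (e i y)); split.
        by rewrite /W vmap0 add0r addrC subrK.
      by rewrite linearB /= !(crep_el cN) (crep_eii _ _ cN) subrr.
    rewrite -fei; apply: f0.
    have -> : e i (a y) = W (deltamap D i y).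
      rewrite -[y in LHS](id_lfunE y) (vmap_delta_gen (D := D) (i := i) _ cN) // => j u' pj.
      rewrite id_lfunE; have [->|ji] := eqVneq j i; first by rewrite (snk_ae _ Hs) // linear0.
      by rewrite (crep_o cN) // (snk_in Hs) p_sym pj.
    by exists (deltamap D i y), 0, 0; rewrite !linear0 !addr0.
  by move: fu; rewrite f_0 zero_lfunE => /eqP; rewrite eq_sym oner_eq0.
have step (u : N) : exists x y, e i u = W x + l (e i y).
  have [x [y [z [-> z0]]]] := allQ u; exists x, y.
  by rewrite !linearD /= z0 addr0 eW (crep_el cN) (crep_eii _ _ cN).
suff key k : exists x y, e i w = W x + lk k (e i y).
  by have [x [y ->]] := key (d i); exists x; rewrite (crep_ld cN) addr0.
have lW x : exists x', l (W x) = W x'.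
  by exists (shiftmap D i x); apply: (vmap_shift_gen _ cN cN) => *; rewrite !id_lfunE.
have lkW m x : exists x', lk m (W x) = W x'.
  elim: m => [|m [x' E]] /=; first by exists x.
  by rewrite E; apply: lW.
elim: k => [|k [x [y ->]]]; first by exists (fun _ _ => 0), w; rewrite /W vmap0 add0r.
have [x1 [y1 ->]] := step y; have [x2 E] := lkW k x1.
exists (fun j t => 1 *: x j t + x2 j t), y1.
by rewrite /W vmapP scale1r lkD E -/(W _) addrA iterSr.
Qed.

Lemma refl_tfree M N : refl M N -> forall f : 'Hom(N, srep i), hom f -> f = 0.
Proof.
move=> [P rP] f fh; apply: hom_image0 => w.
have fe u : f (e i u) = f u by rewrite fh /= eqxx id_lfunE.
have fa u : f (a u) = 0 by rewrite fh /= zero_lfunE.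
have fl u : f (l u) = 0 by rewrite fh /= zero_lfunE.
rewrite -fe; have [x ->] := rf_surj rP w.
rewrite linear_sum big1 //= => j _; rewrite linear_sum big1 //= => k _.
by case: (_ - _)%N => [|m] /=; rewrite ?fl // fe fa.
Qed.

Lemma refl_cofree M N : refl M N -> forall f : 'Hom(srep i, M), hom f -> f = 0.
Proof.
move=> [P rP] f fh; apply: hom_image0 => w.
have -> : f w = e i (f w) by rewrite -fh /= eqxx id_lfunE.
apply: (rf_inj rP) => j k kp; rewrite -hom_umap // /outmap.
by rewrite [act (srep i) Ga _]zero_lfunE !linear0.
Qed.

Lemma refl_inC (J : {set 'I_n}) M N : i \in J -> refl M N -> inC D o J M <-> inC D o' J N.
Proof.
move=> iJ [P rP]; split=> -[_ H]; split; try exact: rfM rP; try exact: rfN rP; move=> j jJ v.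
  have ji : j != i by apply: contraNneq jJ => ->.
  have [m [x ->]] := refl_decomp v rP.
  by rewrite linearD /= (vmap_ej _ _ (rfN rP) ji) -(rf_e rP) // H // linear0 addr0.
have ji : j != i by apply: contraNneq jJ => ->.
have : P (e j v) = 0 by rewrite (rf_e rP) // H.
by move=> /(rf_ker rP) ->; rewrite (crep_eij _ (rfM rP)).
Qed.

(** Either no S_i embeds in X and X has a reflection, or X_i is nonzero and X also maps onto S_i;
    then the composite X -> S_i -> X is a nonzero endomorphism of a brick, hence injective. *)
Lemma src_brick X : crep D o X -> brick X -> iso X (srep i) \/ exists Y, refl X Y.
Proof.
move=> cX [X0 bX].
have [|/existsNP[f /not_implyP[fh f0]]] := pselect (forall f : 'Hom(srep i, X), hom f -> f = 0).
  by move=> H; right; apply: src_refl.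
left; have [v fv] : exists v, f v != 0.
  by apply: contrapT => H; apply: f0; apply: hom_image0 => v; apply/eqP/negPn/negP => fv; apply: H; exists v.
have [g [gh ge]] : exists g : 'Hom(X, srep i), hom g /\ epi g.
  apply: (@src_top _ (f v) cX); by rewrite -fh /= eqxx id_lfunE.
exists g; split=> //.
have [E|E] := bX (f \o g)%VF (hom_comp fh gh).
  have [u uv] := ge v; move/lfunP: E => /(_ u); rewrite comp_lfunE uv zero_lfunE => /eqP.
  by rewrite (negbTE fv).
by move=> u gu; apply: E; rewrite comp_lfunE gu linear0.
Qed.

Section Torsion.
Variable J : {set 'I_n}.
Hypothesis iJ : i \in J.
Notation C := (inC D o J).
Notation C' := (inC D o' J).
Implicit Types T : rep -> Prop.

(** Torsion classes are transported by way of torsion-free ones: as the left orthogonal of a family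
    of modules, [down] is a torsion class whatever T' is. It contains S_i, which has no nonzero map
    to a module with a reflection. [up] excludes in addition the modules that map onto S_i. *)
Definition down T' M := C M /\
  forall X Y (f : 'Hom(M, X)), refl X Y -> tfree T' Y -> hom f -> f = 0.
Definition up T N := [/\ C' N, forall f : 'Hom(N, srep i), hom f -> f = 0 &
  forall X Y (g : 'Hom(N, Y)), refl X Y -> tfree T X -> hom g -> g = 0].

Lemma hom0_quot M N X (q : 'Hom(M, N)) (f : 'Hom(N, X)) : epi q ->
  (f \o q)%VF = 0 -> f = 0.
Proof.
move=> qe E; apply: hom_image0 => w; have [v <-] := qe w.
by move/lfunP: E => /(_ v); rewrite comp_lfunE zero_lfunE.
Qed.

Lemma hom0_ext L M N X (u : 'Hom(L, M)) (q : 'Hom(M, N)) (f : 'Hom(M, X)) : ses u q -> hom f ->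
  (f \o u)%VF = 0 -> (forall g : 'Hom(N, X), hom g -> g = 0) -> f = 0.
Proof.
move=> [uh um qh qe ex] fh fu H.
have [|g [gh gE]] := epi_factor qh qe fh.
  by move=> v /ex[w ->]; move/lfunP: fu => /(_ w); rewrite comp_lfunE zero_lfunE.
by apply: hom_image0 => v; rewrite -gE (H g gh) zero_lfunE.
Qed.

Lemma rep0_hom M X (f : 'Hom(M, X)) : rep0 M -> f = 0.
Proof. by move=> M0; apply: hom_image0 => v; rewrite (M0 v) linear0. Qed.

Lemma down_tors T' : tors C (down T').
Proof.
have [C0 Cq _] := crep_amb K D o J.
split.
- by move=> M [].
- by move=> M M0; split; [apply: C0 | move=> X Y f _ _ _; apply: rep0_hom].
- move=> M N q qh qe [CM H]; split; first exact: Cq qh qe CM.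
  move=> X Y f rXY tY fh; apply: (hom0_quot qe); apply: H rXY tY _; exact: hom_comp.
move=> L M N u q s CM [_ HL] [_ HN]; split=> // X Y f rXY tY fh.
have [uh _ _ _ _] := s; apply: (hom0_ext s fh); last by move=> g; apply: HN rXY tY.
by apply: HL rXY tY _; apply: hom_comp.
Qed.

Lemma up_tors T : tors C' (up T).
Proof.
have [C0 Cq _] := crep_amb K D o' J.
split.
- by move=> M [].
- by move=> M M0; split; [apply: C0 | move=> f _; apply: rep0_hom | move=> X Y f _ _ _; apply: rep0_hom].
- move=> M N q qh qe [CM H1 H]; split; first exact: Cq qh qe CM.
    by move=> f fh; apply: (hom0_quot qe); apply: H1; apply: hom_comp.
  move=> X Y f rXY tY fh; apply: (hom0_quot qe); apply: H rXY tY _; exact: hom_comp.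
move=> L M N u q s CM [_ H1 HL] [_ H2 HN]; have [uh _ _ _ _] := s; split=> //.
  by move=> f fh; apply: (hom0_ext s fh) => //; apply: H1; apply: hom_comp.
move=> X Y f rXY tY fh.
apply: (hom0_ext s fh); last by move=> g; apply: HN rXY tY.
by apply: HL rXY tY _; apply: hom_comp.
Qed.

Lemma down_srep T' : down T' (srep i).
Proof. by split; [apply: srep_in | move=> X Y f r _; apply: refl_cofree r f]. Qed.

Lemma up_srep T : ~ up T (srep i).
Proof.
move=> [_ H _]; apply: (@srep_neq0 i) => v.
by have /lfunP/(_ v) := H \1%VF (@hom1 _ _ _); rewrite id_lfunE zero_lfunE.
Qed.

(** A torsion-free quotient of N has no quotient S_i, as N has none, so it is itself a reflection
    and serves as a test object on the side of M. *)
Lemma down_compat T' M N : tors C' T' -> refl M N -> down T' M <-> T' N.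
Proof.
move=> Tt rMN; have Camb := crep_amb K D o' J; have [P rP] := rMN; split; last first.
  move=> TN; split; first by apply/(refl_inC iJ rMN); case: Tt => H _ _ _; apply: H.
  move=> X Y f [PX rX] tY fh; have [g [gh fg]] := refl_hom rP rX fh.
  apply/(refl_faith rP rX fh (@hom0 _ _ _ _) gh (@hom0 _ _ _ _) fg).
    by move=> v; rewrite !zero_lfunE linear0.
  exact: tY TN gh.
move=> [CM H]; have CN : C' N by apply/(refl_inC iJ rMN).
apply: (tors_of_tfree Camb Tt CN) => Y q CY tY qh qe.
have [X rX] : exists X, refl X Y.
  apply: snk_refl; first by case: CY.
  move=> f fh; apply: (hom0_quot qe); apply: (refl_tfree rMN); exact: hom_comp.
have [PX rPX] := rX; have [f [fh fq]] := refl_hom_back rP rPX qh.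
have f0 := H X Y f rX tY fh.
have q0 : q = 0.
  apply/(refl_faith rP rPX fh (@hom0 _ _ _ _) qh (@hom0 _ _ _ _) fq) => //.
  by move=> v; rewrite !zero_lfunE linear0.
by move=> y; have [w <-] := qe y; rewrite q0 zero_lfunE.
Qed.

Lemma up_compat T M N : tors C T -> T (srep i) -> refl M N -> T M <-> up T N.
Proof.
move=> Tt Ts rMN; have Camb := crep_amb K D o J; have [P rP] := rMN; split.
  move=> TM; split; first by apply/(refl_inC iJ rMN); case: Tt => H _ _ _; apply: H.
    exact: refl_tfree rMN.
  move=> X Y g [PX rX] tX gh; have [f [fh fg]] := refl_hom_back rP rX gh.
  apply/(refl_faith rP rX fh (@hom0 _ _ _ _) gh (@hom0 _ _ _ _) fg).
    by move=> v; rewrite !zero_lfunE linear0.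
  exact: tX TM fh.
move=> [CN _ H]; have CM : C M by apply/(refl_inC iJ rMN).
apply: (tors_of_tfree Camb Tt CM) => X q CX tX qh qe.
have [Y rX] : exists Y, refl X Y.
  by apply: src_refl; [case: CX | move=> f fh; apply: tX Ts fh].
have [PX rPX] := rX; have [g [gh fq]] := refl_hom rP rPX qh.
have g0 := H X Y g rX tX gh.
have q0 : q = 0.
  apply/(refl_faith rP rPX qh (@hom0 _ _ _ _) gh (@hom0 _ _ _ _) fq) => //.
  by move=> v; rewrite !zero_lfunE linear0.
by move=> y; have [w <-] := qe y; rewrite q0 zero_lfunE.
Qed.

Definition at_vertex M := C M /\ forall v : M, v = e i v.

Lemma at_vertex_tors : tors C at_vertex.
Proof.
have [C0 Cq _] := crep_amb K D o J.
split.
- by move=> M [].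
- by move=> M M0; split; [apply: C0 | move=> v; rewrite (M0 v) linear0].
- move=> M N q qh qe [CM H]; split; first exact: Cq qh qe CM.
  by move=> w; have [v <-] := qe w; rewrite {1}[v]H qh.
move=> L M N u q [uh um qh qe ex] CM [_ HL] [_ HN]; split=> // v.
have cM : crep D o M by case: CM.
have /ex[w wE] : q (v - e i v) = 0 by rewrite linearB /= qh -HN subrr.
have : v - e i v = 0.
  by rewrite wE [w]HL uh -wE linearB /= (crep_eii _ _ cM) subrr.
by move/eqP; rewrite subr_eq0 => /eqP.
Qed.

(** S_i is the only brick supported at i, and bricks decide inclusion of torsion classes. *)
Lemma tors_at_vertex T M : tors C T -> T (srep i) -> at_vertex M -> T M.
Proof.
move=> Tt Ts; apply: (tors_brick_le (crep_amb K D o J) at_vertex_tors Tt) => X bX [CX Xe].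
have cX : crep D o X by case: CX.
have [/iso_sym XS|[Y [P rP]]] := src_brick cX bX; first exact: tors_iso Tt XS Ts.
case: bX => X0 _; case: X0 => v; rewrite [v]Xe; apply: (rf_inj rP) => j k kp.
rewrite [outmap _ _ _ _]Xe /outmap; have ji : j != i by apply: contraTneq kp => ->; rewrite gpii.
by rewrite (crep_eij _ cX).
Qed.

(** U is the torsion radical of M for the class of modules supported at i; the quotient contains no
    S_i and so has a reflection. *)
Lemma src_decomp M : C M -> exists U M1 (u : 'Hom(U, M)) (q : 'Hom(M, M1)),
  [/\ ses u q, at_vertex U, C M1 & exists N, refl M1 N].
Proof.
move=> CM; have Camb := crep_amb K D o J.
have [U [M1 [u [q [s AU tf]]]]] := tors_radical Camb at_vertex_tors CM.
have CM1 : C M1 by case: (s) => _ _ qh qe _; case: Camb => _ Cq _; apply: Cq qh qe CM.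
exists U, M1, u, q; split=> //; apply: src_refl; first by case: CM1.
move=> f fh; apply: tf fh; split; first exact: srep_in.
by move=> v; rewrite /= eqxx id_lfunE.
Qed.

(** Both classes contain S_i, hence all modules supported at i, and they agree on modules with a
    reflection; [src_decomp] builds every module from these two kinds. *)
Lemma down_up T M : tors C T -> T (srep i) -> T M <-> down (up T) M.
Proof.
move=> Tt Ts; have Dt := down_tors (up T); have Ut := up_tors T.
suff key T1 T2 : tors C T1 -> tors C T2 -> T1 (srep i) -> T2 (srep i) ->
    (forall X Y, refl X Y -> T1 X -> T2 X) -> T1 M -> T2 M.
  split; apply: key => //; try exact: down_srep.
    by move=> X Y r TX; apply/(down_compat Ut r)/(up_compat Tt Ts r).
  by move=> X Y r /(down_compat Ut r)/(up_compat Tt Ts r).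
move=> t1 t2 s1 s2 H T1M; have CM : C M by case: t1 => h _ _ _; apply: h.
have [U [M1 [u [q [s AU CM1 [N r]]]]]] := src_decomp CM.
have [_ _ qq ext] := t2; apply: (ext U M M1 u q) => //; first exact: tors_at_vertex.
by apply: (H _ _ r); case: (s) t1 => _ _ qh qe _ [_ _ h _]; apply: h qh qe T1M.
Qed.

End Torsion.
End Source.
End Step.

(** * Locally free modules and lifting at a source *)

Section Free.
Variables (K : fieldType) (n : nat) (D : gdata n).
Notation p := (gp D).
Notation d := (gd D).
Notation rep := (rep K (gen n)).
Implicit Types L M N X Y Z U E Q B C : rep.
Notation e i v := (act _ (Ge i) v).
Notation l v := (act _ Gl v).
Notation a v := (act _ Ga v).

Lemma lin_factor (U V W : vectType K) (q : 'Hom(U, V)) (f : 'Hom(U, W)) : epi q ->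
  (forall v, q v = 0 -> f v = 0) -> exists h : 'Hom(V, W), forall v, h (q v) = f v.
Proof.
move=> qe qf; exists (f \o q^-1)%VF => v; rewrite comp_lfunE.
apply/eqP; rewrite -subr_eq0 -linearB; apply/eqP/qf; rewrite linearB /=.
by rewrite limg_lfunVK ?subrr // memv_img ?memvf.
Qed.

Lemma lin_section (U V : vectType K) (q : 'Hom(U, V)) : epi q ->
  exists s : 'Hom(V, U), forall v, q (s v) = v.
Proof.
move=> qe; exists (q^-1)%VF => v; have [u <-] := qe v.
by rewrite limg_lfunVK // memv_img ?memvf.
Qed.

(* Higman's criterion: M_j is a free module over K[x]/x^{d_j} iff its identity is
   the relative trace of a linear map. *)
Definition trace j M N (th : 'Hom(M, N)) v : N :=
  \sum_(k < d j) lk k (th (lk (d j - k.+1) v)).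

Definition free_at j M := exists th : 'End(M),
  (forall v, th v = e j (th v)) /\ forall v, e j v = v -> v = trace j th v.

Definition locfree M := forall j, free_at j M.

(** The difference of the two sides telescopes, and both end terms contain the d_j-th power of the
    loop. *)
Lemma trace_l o o' j M N (th : 'Hom(M, N)) v : crep D o M -> crep D o' N ->
  (forall v, th v = e j (th v)) -> e j v = v -> trace j th (l v) = l (trace j th v).
Proof.
move=> cM cN the ev; rewrite /trace linear_sum /=.
pose T k := lk k (th (lk (d j - k) v)).
have -> : \sum_(k < d j) lk k (th (lk (d j - k.+1) (l v))) = \sum_(k < d j) T k.
  by apply: eq_bigr => k _; rewrite -iterSr /T -subSn.
have -> : \sum_(k < d j) l (lk k (th (lk (d j - k.+1) v))) = \sum_(k < d j) T k.+1 by [].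
apply/eqP; rewrite -subr_eq0 -opprB oppr_eq0 -sumrB.
rewrite -(big_mkord xpredT (fun k => T k.+1 - T k)) telescope_sumr //.
rewrite /T subnn /= subn0 -ev (crep_ld cM) linear0 subr0 the.
by rewrite (crep_ld cN).
Qed.

Lemma hom_trace j M N N' (f : 'Hom(N, N')) (th : 'Hom(M, N)) v : hom f ->
  f (trace j th v) = trace j ((f \o th)%VF : 'Hom(_, _)) v.
Proof.
by move=> fh; rewrite linear_sum; apply: eq_bigr => k _; rewrite /= hom_lk // comp_lfunE.
Qed.

Lemma eq_trace j M N (th th' : 'Hom(M, N)) v : (forall v, th v = th' v) ->
  trace j th v = trace j th' v.
Proof. by move=> E; apply: eq_bigr => k _; rewrite E. Qed.

Lemma trace_e o j M N (th : 'Hom(M, N)) v : crep D o N ->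
  (forall v, th v = e j (th v)) -> e j (trace j th v) = trace j th v.
Proof.
move=> cN the; rewrite linear_sum; apply: eq_bigr => k _ /=.
by rewrite (crep_elk _ _ _ cN) -the.
Qed.

Lemma trace_linear j M N (th : 'Hom(M, N)) : linear (trace j th).
Proof.
move=> c u v; rewrite /trace scaler_sumr -big_split; apply: eq_bigr => k _ /=.
by rewrite lkP linearP /= lkP.
Qed.

Lemma trace_lfun j M N (th : 'Hom(M, N)) : exists T : 'Hom(M, N), forall v, T v = trace j th v.
Proof. exact/lin_ex/trace_linear. Qed.

Section Source.
Variables (i : 'I_n) (o o' : rel 'I_n).
Hypothesis Hs : source_at D i o o'.
Notation refl := (refl D i o o').
Notation umap := (outmap i).

(* The obstruction to lifting lies at the source i only, where X is projective. *)
Lemma free_lift X E Q (q : 'Hom(E, Q)) (f : 'Hom(X, Q)) :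
  crep D o X -> crep D o E -> crep D o Q -> hom q -> epi q ->
  (forall v, q v = 0 -> v = e i v) -> free_at i X -> hom f ->
  exists h : 'Hom(X, E), hom h /\ forall v, q (h v) = f v.
Proof.
move=> cX cE cQ qh qe qk [th [the thE]] fh; have [s sE] := lin_section qe.
pose S : 'Hom(X, E) := (act E (Ge i) \o s \o f \o th)%VF.
have SE v : S v = e i (s (f (th v))) by rewrite /S !comp_lfunE.
have SS v : S v = e i (S v) by rewrite SE (crep_eii _ _ cE).
have [T TE] := trace_lfun i S.
(* Away from i, q is injective and the linear lift is already compatible with the operators; at i
   the linear lift S is made to commute with the loop by taking its trace. *)
pose h : 'Hom(X, E) := ((s \o f) - (act E (Ge i) \o (s \o f)) + (T \o act X (Ge i)))%VF.
have hE v : h v = s (f v) - e i (s (f v)) + trace i S (e i v).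
  by rewrite /h add_lfunE add_lfunE opp_lfunE !comp_lfunE TE.
have eh v : e i (h v) = trace i S (e i v).
  by rewrite hE linearD linearB /= (crep_eii _ _ cE) subrr add0r (trace_e _ cE SS).
have qhE v : q (h v) = f v.
  rewrite hE linearD linearB /= qh !sE hom_trace //.
  rewrite (@eq_trace i _ _ _ (f \o th)%VF); last first.
    by move=> w; rewrite comp_lfunE SE qh sE comp_lfunE -fh -the.
  rewrite -hom_trace // -thE ?(crep_eii _ _ cX) // fh subrK //.
exists h; split=> // g v.
apply/eqP; rewrite -subr_eq0; apply/eqP.
have : q (h (act X g v) - act E g (h v)) = 0 by rewrite linearB /= qh !qhE fh subrr.
move=> /qk ->; rewrite linearB /= eh.
have tr0 : trace i S 0 = 0.
  by rewrite /trace big1 // => k _; rewrite lk0 linear0 lk0.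
case: g => [j||].
- have [->|ji] := eqVneq j i.
    by rewrite (crep_eii _ _ cX) (crep_eii _ _ cE) eh subrr.
  by rewrite (crep_eij _ cX) // (crep_eij _ cE) // tr0 subrr.
- by rewrite (crep_el cX) (crep_el cE) eh (trace_l cX cE SS) ?(crep_eii _ _ cX) // subrr.
by rewrite !(src_ea _ Hs) // tr0 subrr.
Qed.

(** Freeness of C_i splits q at i compatibly with the loop, by h. The resulting retraction r onto X
    conjugates the trace witness of Z into one for X. *)
Lemma free_kernel X Z C (u : 'Hom(X, Z)) (q : 'Hom(Z, C)) oX oZ oC :
  crep D oX X -> crep D oZ Z -> crep D oC C -> hom u -> mono u -> hom q ->
  (forall v, q (u v) = 0) ->
  (forall z, e i z = z -> q z = 0 -> exists x, z = u x) ->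
  (forall w, e i w = w -> exists z, q z = w) ->
  free_at i Z -> free_at i C -> free_at i X.
Proof.
move=> cX cZ cC uh um qh qu qk qe [tz [tze tzE]] [tc [tce tcE]].
have [s sE] : exists s : 'Hom(C, Z), forall w, e i w = w -> q (s w) = w.
  pose W := limg q; exists (q^-1)%VF => w /qe[z <-].
  by rewrite limg_lfunVK // memv_img ?memvf.
pose S : 'Hom(C, Z) := (act Z (Ge i) \o s \o tc)%VF.
have SE v : S v = e i (s (tc v)) by rewrite /S !comp_lfunE.
have SS v : S v = e i (S v) by rewrite SE (crep_eii _ _ cZ).
have tce' v : e i (tc v) = tc v by rewrite -tce.
have qS v : q (S v) = tc v by rewrite SE qh sE tce'.
pose h w := trace i S w.
have hq w : e i w = w -> q (h w) = w.
  move=> ew; rewrite /h hom_trace // {2}[w]tcE //.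
  by apply: eq_trace => v; rewrite comp_lfunE qS.
have hl w k : e i w = w -> h (lk k w) = lk k (h w).
  move=> ew; elim: k => //= k <-; rewrite /h (trace_l cC cZ SS) //.
  by rewrite (crep_elk _ _ _ cC) ew.
have [r0 r0E] : exists r : Z -> X, forall z, u (r z) = e i z - h (q (e i z)).
  suff /choice[r rE] : forall z, exists x, u x = e i z - h (q (e i z)) by exists r.
  move=> z; have [||x ->] := qk (e i z - h (q (e i z))); last by exists x.
    by rewrite linearB /= (crep_eii _ _ cZ) (trace_e _ cZ SS).
  by rewrite linearB /= hq ?subrr // -qh (crep_eii _ _ cZ).
have [T TE] := trace_lfun i S.
pose F : 'Hom(Z, Z) := (act Z (Ge i) - (T \o (q \o act Z (Ge i))))%VF.
have FE z : u (r0 z) = F z by rewrite r0E /F add_lfunE opp_lfunE !comp_lfunE TE.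
have [r rE] : exists r : 'Hom(Z, X), forall z, r z = r0 z.
  by apply: lin_ex => c z1 z2; apply: (mono_inj um); rewrite linearP /= !FE linearP.
have ur z : u (r z) = e i z - h (q (e i z)) by rewrite rE r0E.
exists (r \o (tz \o u))%VF; split.
  move=> v; rewrite !comp_lfunE; apply: (mono_inj um); rewrite uh ur -tze.
  by rewrite linearB /= -tze (trace_e _ cZ SS).
move=> v ev; apply: (mono_inj um); rewrite hom_trace //.
have euv : e i (u v) = u v by rewrite -uh ev.
have E1 w : (u \o (r \o (tz \o u)))%VF w = tz (u w) - h (q (tz (u w))).
  by rewrite !comp_lfunE ur -tze.
transitivity (trace i tz (u v) - h (q (trace i tz (u v)))).
  by rewrite -tzE // qu /h /trace [X in _ - X]big1 ?subr0 // => k _; rewrite lk0 linear0 lk0.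
have [H HE] := trace_lfun i S.
rewrite /h -HE {1 2}/trace (linear_sum q) (linear_sum H) -sumrB; apply: eq_bigr => k _ /=.
rewrite HE (hom_lk _ _ qh) -/(h _) hl; last by rewrite -qh -tze.
by rewrite E1 lkB (hom_lk _ _ uh).
Qed.

Lemma free_at_bij X Y j (f : 'Hom(X, Y)) oX oY : crep D oX X -> crep D oY Y ->
  (forall v, f (e j v) = e j (f v)) -> (forall v, f (l v) = l (f v)) ->
  (forall x, e j x = x -> f x = 0 -> x = 0) -> (forall y, e j y = y -> exists x, f x = y) ->
  free_at j X <-> free_at j Y.
Proof.
move=> cX cY fe fl fm fs.
have [s [sE es]] : exists s : 'Hom(Y, X), (forall w, e j w = w -> f (s w) = w) /\
    forall w, e j (s w) = s w.
  exists (act X (Ge j) \o f^-1)%VF; split=> w; last by rewrite comp_lfunE (crep_eii _ _ cX).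
  move=> ew; rewrite comp_lfunE fe; have [v vE] := fs w ew.
  by rewrite limg_lfunVK ?ew // -vE memv_img ?memvf.
have flk k v : f (lk k v) = lk k (f v) by elim: k => //= k <-; rewrite fl.
have f_inj x y : e j x = x -> e j y = y -> f x = f y -> x = y.
  move=> ex ey xy; apply/eqP; rewrite -subr_eq0; apply/eqP/fm; rewrite linearB /= ?ex ?ey //.
  by rewrite xy subrr.
split=> -[th [the thE]].
  exists (f \o (th \o s))%VF; split=> [v|w ew]; first by rewrite !comp_lfunE {1}the fe.
  rewrite -{1}[w]sE // [s w]thE // linear_sum /=; apply: eq_bigr => k _ /=.
  rewrite flk !comp_lfunE; congr (iter _ _ (f (th _))).
  apply: f_inj; rewrite ?(crep_elk _ _ _ cX) ?es //.
  by rewrite flk !sE // (crep_elk _ _ _ cY) ew.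
exists (s \o (th \o f))%VF; split=> [v|w ew]; first by rewrite comp_lfunE es.
have Pw : e j (f w) = f w by rewrite -fe ew.
apply: f_inj => //.
  by apply: (trace_e _ cX) => v; rewrite comp_lfunE es.
rewrite {1}[f w]thE // [RHS]linear_sum; apply: eq_bigr => k _ /=.
by rewrite flk !comp_lfunE sE ?flk // -the.
Qed.

Lemma refl_free_off M N j : refl M N -> j != i -> free_at j M <-> free_at j N.
Proof.
move=> [P rP] ji; have cM := rfM rP; have cN := rfN rP.
apply: (free_at_bij (f := P) cM cN); [by move=> v; rewrite (rf_e rP) | exact: rf_l rP | |].
  move=> x ex Px; have e0 : e i x = 0 by rewrite -ex (crep_eij _ cM).
  by apply: (rf_P_inj rP); rewrite ?linear0.
move=> y ey; have [v vE] := rf_img rP y; exists v.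
by rewrite [RHS]vE -[in e i y]ey (crep_eij _ cN) // addr0.
Qed.

(* The cokernel of M -> Z is N_i, viewed as a module at the vertex i. *)
Lemma refl_hull M N : refl M N -> exists Z C (u : 'Hom(M, Z)) (q : 'Hom(Z, C)) (k : 'Hom(C, N)) N0,
  [/\ ses u q, refl Z N0 /\ (forall v : N0, e i v = 0),
      crep D o C /\ (forall v : C, v = e i v),
      hom k /\ mono k & forall w : N, e i w = w -> exists v, w = k v].
Proof.
move=> [P rP]; have cM := rfM rP; have cN := rfN rP; have Hs' := rf_s rP.
pose W (w : N) := w = e i w.
have Wl : lin_pred W.
  by split=> [|c u v eu ev]; rewrite /W ?linear0 // linearP /= -eu -ev.
have Ws : stable W.
  move=> g v ev; rewrite /W; case: g => [j||].
  - rewrite ev; have [->|ji] := eqVneq j i; first by rewrite !(crep_eii _ _ cN).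
    by rewrite (crep_eij _ cN) 1?eq_sym // linear0.
  - by rewrite (crep_el cN) -ev.
  by rewrite ev (snk_ae _ Hs') // linear0.
have [C [N0 [k [q0 [[kh km q0h q0e kex] q0W]]]]] := quot_ses Wl Ws.
have cN0 : crep D o' N0 by apply: crep_quot q0h q0e cN.
have N0i (v : N0) : e i v = 0.
  have [w <-] := q0e v; rewrite -q0h; apply/q0W; by rewrite /W (crep_eii _ _ cN).
have [Z [PZ rZ]] : exists Z, refl Z N0.
  apply: (snk_refl Hs' cN0) => f fh; apply: hom_image0 => v.
  have : f (e i v) = f v by rewrite fh /= eqxx id_lfunE.
  by rewrite N0i linear0.
have cZ := rfM rZ.
have [u [uh Au]] := refl_hom_back rP rZ q0h.
have ei (v : C) : v = e i v.
  apply: (mono_inj km); rewrite kh; apply/q0W; apply/kex; by exists v.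
have cC : crep D o C.
  have kk (v : C) : e i v = v by rewrite -ei.
  have kj j (v : C) : j != i -> e j v = 0.
    by move=> ji; apply: km; rewrite [v]ei !kh (crep_eij _ cN) // eq_sym.
  have ka (v : C) : a v = 0 by apply: km; rewrite [v]ei !kh (snk_ae _ Hs').
  split.
  - by move=> j j' v; apply: (mono_inj km); rewrite !kh (crep_ee cN); case: ifP; rewrite ?linear0 // kh.
  - by move=> v; apply: (mono_inj km); rewrite linear_sum -[RHS](crep_1 cN); apply: eq_bigr => j _ /=; rewrite kh.
  - by move=> j v; apply: (mono_inj km); rewrite !kh (crep_el cN).
  - by move=> j v; apply: (mono_inj km); rewrite hom_lk // kh (crep_ld cN) linear0.
  - by move=> j j' v _; rewrite ka linear0.
  by move=> j j' v; rewrite !ka !linear0 lk0.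
have A : ragree D i o o' P PZ u q0 by [].
have uj j y : j != i -> e j y = y -> exists x : M, e j x = x /\ u x = y.
  move=> ji ey; have [|x [x0 xE]] := agree_epi_off A q0e (y := y).
    by rewrite -ey (crep_eij _ cZ).
  by exists (e j x); rewrite (crep_eii _ _ cM) uh xE ey.
have u0 x : e i x = 0 -> u x = 0 -> x = 0.
  move=> ex ux; apply: (rf_P_inj rP) => //; first exact: linear0.
  have /q0W : q0 (P x) = 0 by rewrite Au ux linear0.
  by rewrite /W (rf_ei rP) linear0.
have vZ x : inmap D i PZ x = 0 by rewrite -(vmap_ei _ _ _ (rfN rZ)) N0i.
(* z in Z_i is sent to the image in N_i of its family of components *)
pose R (z : Z) (w : C) := exists y : 'I_n -> nat -> M,
  (forall j t, (t < p j i)%N -> umap z j t = u (e j (y j t))) /\ k w = inmap D i P y.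
have um0 (z : Z) j t : umap z j t = e j (umap z j t) by rewrite (umap_e _ _ _ _ cZ).
have pji j t : (t < p j i)%N -> j != i by move=> tp; apply: contraTneq tp => ->; rewrite gpii.
have [||||q [qh qR]] := @graph_hom _ _ Z C R.
- move=> c z1 z2 w1 w2 [y1 [E1 F1]] [y2 [E2 F2]]; exists (fun j t => c *: y1 j t + y2 j t).
  by split; [move=> j t tp; rewrite umapP !linearP /= E1 // E2 | rewrite linearP /= F1 F2 vmapP].
- move=> z.
  have /choice[y yE] : forall jt : 'I_n * nat, exists x : M, (jt.2 < p jt.1 i)%N ->
      e jt.1 x = x /\ u x = umap z jt.1 jt.2.
    move=> [j t] /=; case: (boolP (t < p j i)%N) => [tp|_]; last by exists 0.
    by have [x [xE ux]] := uj j _ (pji _ _ tp) (esym (um0 z j t)); exists x.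
  have /kex[w wE] : q0 (inmap D i P (fun j t => y (j, t))) = 0.
    by apply/q0W; rewrite /W (vmap_ei _ _ _ cN).
  exists w, (fun j t => y (j, t)); split=> // j t tp.
  by have [/= -> ->] := yE (j, t) tp.
- move=> w [y [E F]]; apply: km; rewrite F -(vmap0 D i P); apply: (eq_vmap _ cM) => j t tp.
  have ji := pji _ _ tp; rewrite linear0; apply: u0; first by rewrite (crep_eij _ cM).
  by rewrite -E // /outmap linear0 lk0 !linear0.
- move=> g z w [y [E F]]; case: g => [j||].
  + have [->|ji] := eqVneq j i.
      by rewrite -ei; exists y; split=> // j' t tp; rewrite (umap_ei _ _ _ _ cZ) E.
    exists (fun _ _ => 0); rewrite vmap0 [w]ei (crep_eij _ cC) 1?eq_sym // linear0; split=> // j' t tp.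
    by rewrite /outmap (crep_eij _ cZ ji) lk0 !linear0.
  + exists (shiftmap D i y); rewrite kh F (vmap_shift _ rP); split=> // j t tp.
    rewrite (umap_l _ cZ tp) uh /shiftmap; case: ifP => t1.
      by rewrite E // uh (crep_eii _ _ cZ).
    have p0 : (0 < p j i)%N by case: (p j i) tp.
    rewrite E // (hom_lk _ _ uh).
    by rewrite !uh !(crep_elk _ _ _ cZ) (crep_eii _ _ cZ).
  exists (fun _ _ => 0); rewrite vmap0; split=> [j t _|].
    by rewrite !linear0 /outmap (src_ea _ Hs cZ) ?lk0 !linear0.
  by rewrite kh [w]ei kh (snk_ae _ Hs') ?linear0.
have uu0 (x y : 'I_n -> nat -> M) j t : (t < p j i)%N -> u (e j (x j t)) = u (e j (y j t)) ->
    e j (x j t) = e j (y j t).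
  move=> tp xy; apply/eqP; rewrite -subr_eq0; apply/eqP/u0.
    by rewrite linearB /= !(crep_eij _ cM (pji _ _ tp)) subrr.
  by rewrite linearB /= xy subrr.
have um : mono u.
  move=> m um1; have E : P m = 0.
    have /q0W : q0 (P m) = 0 by rewrite Au um1 linear0.
    by rewrite /W (rf_ei rP).
  have /(rf_ker rP) -> := E; apply: (rf_inj rP) => j t tp; apply: u0.
    by rewrite (umap_off _ _ _ Hs').
  by rewrite hom_umap // um1 /outmap linear0 lk0 !linear0.
exists Z, C, u, q, k, N0; split=> //; last 2 first.
- split=> //; by exists PZ.
- by move=> w ew; apply/kex/q0W.
split=> //.
  move=> w; have [x xE] := rf_surj rP (k w).
  have [z zE] := rf_ex rZ (vZ (fun j t => u (e j (x j t)))).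
  exists z; have [y [E F]] := qR z; apply: (mono_inj km); rewrite F [w]ei kh xE.
  apply: (eq_vmap _ cM) => j t tp; apply: uu0 => //.
  by rewrite -E // -zE // -uh (crep_eii _ _ cM).
move=> z; have [y [E F]] := qR z; split=> [qz|[m zm]]; last first.
  apply: km; rewrite F -(rf_cx rP m); apply: (eq_vmap _ cM) => j t tp.
  by apply: uu0 => //; rewrite -E // zm -hom_umap // (umap_e _ _ _ _ cM).
have [|v vE] := rf_ex rP (x := y); first by rewrite -F qz linear0.
have [|x [x0 xE]] := agree_epi_off A q0e (y := z - e i z).
  by rewrite linearB /= (crep_eii _ _ cZ) subrr.
exists (x + e i v); rewrite linearD /= xE uh -[LHS](subrK (e i z)); congr (_ + _).
apply/eqP; rewrite -subr_eq0 -linearB; apply/eqP/(rf_inj rZ) => j t tp.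
by rewrite umapB E // vE // hom_umap // subrr.
Qed.

Lemma sum_mul_ord (V : zmodType) m q (F : nat -> V) :
  \sum_(t < m * q) F t = \sum_(c < m) \sum_(r < q) F (c * q + r)%N.
Proof.
elim: m => [|m IH]; first by rewrite !big_ord0.
rewrite big_ord_recr /= -IH mulSn addnC -(big_mkord xpredT F).
rewrite (@big_cat_nat _ _ _ (m * q)) ?leq_addr //= big_mkord; congr (_ + _).
rewrite -{1}(add0n (m * q)%N) big_addn addKn big_mkord.
by apply: eq_bigr => r _; rewrite addnC.
Qed.

Lemma iter_shift_gen M t (x : 'I_n -> nat -> M) j k : (k < p j i)%N ->
  iter t (@shiftmap K n D i M) x j k = lk (p i j * ((k + t) %/ p j i))%N (x j ((k + t) %% p j i)%N).
Proof.
move=> kp; have p0 : (0 < p j i)%N by case: (p j i) kp.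
elim: t k kp => [|t IH] k kp; first by rewrite addn0 divn_small // modn_small // muln0.
rewrite /= {1}/shiftmap; case: ifP => k1; first by rewrite IH // addSnnS.
have kE : k.+1 = p j i by apply/eqP; rewrite eqn_leq kp leqNgt k1.
by rewrite IH // add0n -iterD -addSnnS kE divnDl ?dvdnn // divnn p0 mulnDr muln1 modnDl.
Qed.

(** As N0 vanishes at i, Z_i is all of (+)_j Z_j^p_ji. With d_i = m p_ji and d_j = m p_ij, the d_j
    terms of a trace at j fall into m blocks of p_ij terms. One block is [ty]; placed at the last
    index it gives the witness at i. *)
Lemma coinduced_free Z N0 : refl Z N0 -> (forall v : N0, e i v = 0) ->
  (forall j, j != i -> free_at j Z) -> free_at i Z.
Proof.
move=> [P rP] N0i Zj; have cZ := rfM rP.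
have /choice[th thP] : forall j, exists th : 'End(Z), j != i ->
    (forall v, th v = e j (th v)) /\ forall v, e j v = v -> v = trace j th v.
  by move=> j; have [->|ji] := eqVneq j i; [exists 0 | have [th H] := Zj j ji; exists th].
have pji j t : (t < p j i)%N -> j != i by move=> tp; apply: contraTneq tp => ->; rewrite gpii.
have vZ x : inmap D i P x = 0 by rewrite -(vmap_ei _ _ _ (rfN rP)) N0i.
pose ty j (v : Z) := \sum_(m < p i j) lk m (th j (lk (p i j - m.+1) v)).
have tyP j c u v : ty j (c *: u + v) = c *: ty j u + ty j v.
  rewrite /ty scaler_sumr -big_split; apply: eq_bigr => m _ /=.
  by rewrite lkP linearP /= lkP.
have ty0 j : ty j 0 = 0.
  by rewrite /ty big1 // => m _; rewrite lk0 linear0 lk0.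
have tye j v : j != i -> e j (ty j v) = ty j v.
  move=> ji; rewrite linear_sum; apply: eq_bigr => m _ /=.
  by rewrite (crep_elk _ _ _ cZ); have [<-] := thP j ji.
pose fam z j t := if t.+1 == p j i then ty j (umap z j 0%N) else 0.
have /choice[T TP] : forall z, exists z', e i z' = z' /\ forall j t, (t < p j i)%N -> umap z' j t = fam z j t.
  move=> z; have [v vE] := rf_ex rP (vZ (fam z)).
  exists (e i v); rewrite (crep_eii _ _ cZ); split=> // j t tp.
  rewrite (umap_ei _ _ _ _ cZ) -vE // /fam; case: ifP; rewrite ?linear0 // tye //; exact: pji tp.
have uniq (z z' : Z) : e i z = z -> e i z' = z' ->
    (forall j t, (t < p j i)%N -> umap z j t = umap z' j t) -> z = z'.
  move=> ez ez' E; apply/eqP; rewrite -subr_eq0 -ez -ez' -linearB; apply/eqP/(rf_inj rP) => j t tp.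
  by rewrite umapB E // subrr.
have [TT TE] : exists TT : 'End(Z), forall z, TT z = T z.
  apply: lin_ex => c u v; have [e1 f1] := TP (c *: u + v); have [e2 f2] := TP u; have [e3 f3] := TP v.
  apply: uniq => //; first by rewrite linearP /= e2 e3.
  move=> j t tp; rewrite umapP f1 // f2 // f3 // /fam; case: ifP => _; last by rewrite scaler0 addr0.
  by rewrite umapP tyP.
have umlk (v : Z) t j k : (k < p j i)%N ->
    umap (lk t v) j k = lk (p i j * ((k + t) %/ p j i))%N (umap v j ((k + t) %% p j i)%N).
  move=> kp; rewrite -iter_shift_gen //.
  elim: t k kp => //= t IH k kp; rewrite (umap_l _ cZ kp) /shiftmap.
  have p0 : (0 < p j i)%N by case: (p j i) kp.
  case: ifP => k1; first by rewrite (umap_e _ _ _ _ cZ) IH.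
  by rewrite (crep_elk _ _ _ cZ) (umap_e _ _ _ _ cZ) IH.
exists TT; split=> [v|v ev]; first by rewrite TE; have [-> _] := TP v.
have eTT w : e i (TT w) = TT w by rewrite TE; have [-> _] := TP w.
apply: uniq => //; first by rewrite (trace_e _ cZ).
move=> j k kp; have ji := pji _ _ kp; have p0 : (0 < p j i)%N by case: (p j i) kp.
have [m0 [dj di]] := gp_d p0.
have lks (I : finType) (F : I -> Z) m : lk m (\sum_t F t) = \sum_t lk m (F t).
  by elim: m => //= m ->; rewrite linear_sum.
have umS (I : finType) (F : I -> Z) : umap (\sum_t F t) j k = \sum_t umap (F t) j k.
  elim/big_rec2: _ => [|t y1 y2 _ <-]; first exact: umap_0.
  by rewrite umapD.
rewrite /trace umS.
have [_ thE] := thP j ji.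
rewrite {1}[umap v j k]thE ?(umap_e _ _ _ _ cZ) // /trace dj.
rewrite (sum_mul_ord m0 (p i j) (fun s => lk s (th j (lk (m0 * p i j - s.+1) (umap v j k))))).
rewrite di (sum_mul_ord m0 (p j i) (fun t => umap (lk t (TT (lk (m0 * p j i - t.+1) v))) j k)).
apply: eq_bigr => c _; have cm := ltn_ord c.
have kr : (p j i - k.+1 < p j i)%N by lia.
(* Within a block only r = p_ji - k - 1 moves the index k to the last index, where [fam] is
   supported. *)
rewrite [RHS](bigD1 (Ordinal kr)) //= [X in _ + X]big1 ?addr0 => [|r rk].
  rewrite umlk //.
  have E1 : (k + (c * p j i + (p j i - k.+1)) = c * p j i + (p j i).-1)%N by lia.
  have p1 : ((p j i).-1 < p j i)%N by lia.
  rewrite E1 divnMDl // modnMDl divn_small // modn_small // addn0.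
  rewrite TE; have [_ ->] := TP (lk (m0 * p j i - (c * p j i + (p j i - k.+1)).+1) v); last by lia.
  have E2 : (m0 * p j i - (c * p j i + (p j i - k.+1)).+1 = 0 + (k + (m0 - c.+1) * p j i))%N.
    have := mulnBl m0 c.+1 (p j i); have : (c.+1 * p j i <= m0 * p j i)%N by rewrite leq_mul2r cm orbT.
    rewrite mulSn; lia.
  rewrite /fam prednK // eqxx E2 add0n addnC umlk // add0n divnMDl // modnMDl.
  rewrite divn_small // modn_small // addn0 /ty lks.
  apply: eq_bigr => r _; have rq := ltn_ord r; rewrite !lk_add; congr (lk _ (th j (lk _ _))).
    by rewrite mulnC.
  have := mulnBl m0 c.+1 (p i j); have : (c.+1 * p i j <= m0 * p i j)%N by rewrite leq_mul2r cm orbT.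
  rewrite (mulnC (p i j)) mulSn; lia.
rewrite umlk // TE.
have [_ ->] := TP (lk (m0 * p j i - (c * p j i + r).+1) v); last by rewrite ltn_mod.
rewrite /fam; case: ifP => [/eqP E|_]; last by rewrite lk0.
case/eqP: rk; apply: val_inj => /=; have rp := ltn_ord r.
move: E; rewrite addnCA modnMDl => E.
have [le|gt] := ltnP (k + r) (p j i); first by rewrite modn_small // in E; lia.
rewrite -(subnK gt) modnDr modn_small in E; lia.
Qed.

End Source.
End Free.

(** * Free modules at one vertex *)

Section Vertex.
Variables (K : fieldType) (n : nat) (D : gdata n).
Notation d := (gd D).
Notation rep := (rep K (gen n)).
Implicit Types L M N X Y Z U E Q B C : rep.
Notation e i v := (act _ (Ge i) v).
Notation l v := (act _ Gl v).
Notation a v := (act _ Ga v).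

Section FreeRep.
Variables (i : 'I_n) (V : vectType K).

(* B is the free K[x]/x^{d_i}-module V[x]/x^{d_i} placed at the vertex i; x u k is the
   coefficient of x^k in u. *)
Record free_rep (B : rep) (x : B -> nat -> V) : Prop := FreeRep {
  fr_lin : forall c u v k, x (c *: u + v) k = c *: x u k + x v k;
  fr_out : forall u k, (d i <= k)%N -> x u k = 0;
  fr_ex : forall y : nat -> V, exists u, forall k, (k < d i)%N -> x u k = y k;
  fr_inj : forall u, (forall k, x u k = 0) -> u = 0;
  fr_e : forall j u k, x (e j u) k = if j == i then x u k else 0;
  fr_l : forall u k, (k < d i)%N -> x (l u) k = if k is k'.+1 then x u k' else 0;
  fr_a : forall u : B, a u = 0 }.

Lemma free_rep_ex : exists B x, @free_rep B x.
Proof.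
pose F : vectType K := {ffun 'I_(d i) -> V}.
pose x (f : F) (k : nat) : V := if insub k is Some k' then f k' else 0.
have xE (f : F) (k : 'I_(d i)) : x f k = f k by rewrite /x valK.
have xP c (f g : F) k : x (c *: f + g) k = c *: x f k + x g k.
  by rewrite /x; case: insub => [k'|]; rewrite ?scaler0 ?addr0 // !ffunE.
pose sh (f : F) : F := finfun (fun k : 'I_(d i) =>
  match nat_of_ord k return V with k'.+1 => x f k' | 0%N => 0 end).
have [S SE] : exists S : 'End(F), forall f, S f = sh f.
  apply: lin_ex => c f g; apply/ffunP => k; rewrite !ffunE.
  by case: (k : nat) => [|k']; rewrite ?scaler0 ?addr0 // xP.
exists (@Rep K (gen n) F (fun g => match g with
  | Ge j => if j == i then \1%VF else 0 | Gl => S | Ga => 0 end)), x; split=> //=.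
- by move=> u k k_ge; rewrite /x insubF // ltnNge k_ge.
- move=> y; exists (finfun (fun k : 'I_(d i) => y k)) => k kd.
  by rewrite /x insubT /= ffunE.
- by move=> u u0; apply/ffunP => k; rewrite -xE u0 ffunE.
- move=> j u k; case: ifP => _; first by rewrite id_lfunE.
  by rewrite zero_lfunE /x; case: insub => [k'|] //; rewrite ffunE.
- by move=> u k kd; rewrite SE -[k]/(nat_of_ord (Ordinal kd)) xE ffunE.
by move=> u; rewrite zero_lfunE.
Qed.

Section Coordinates.
Variables (B : rep) (x : B -> nat -> V).
Hypothesis Bx : free_rep x.

Lemma fr0 k : x 0 k = 0.
Proof. by have := fr_lin Bx (-1) 0 0 k; rewrite scaler0 addr0 => ->; rewrite scaleN1r addNr. Qed.
Lemma frZ c u k : x (c *: u) k = c *: x u k.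
Proof. by rewrite -[c *: u]addr0 (fr_lin Bx) fr0 addr0. Qed.

Lemma fr_sum (I : finType) (P : pred I) (F : I -> B) k :
  x (\sum_(t | P t) F t) k = \sum_(t | P t) x (F t) k.
Proof.
apply: (big_morph (fun u => x u k)) => [u v|]; last exact: fr0.
by rewrite -[u]scale1r (fr_lin Bx) !scale1r.
Qed.

Lemma frB u v k : x (u - v) k = x u k - x v k.
Proof. by rewrite addrC -scaleN1r (fr_lin Bx) scaleN1r addrC. Qed.

Lemma fr_ext u v : (forall k, (k < d i)%N -> x u k = x v k) -> u = v.
Proof.
move=> xy; apply/eqP; rewrite -subr_eq0; apply/eqP/(fr_inj Bx) => k; rewrite frB.
by have [/xy->|dk] := ltnP k (d i); rewrite ?subrr // !(fr_out Bx) // subrr.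
Qed.

Lemma fr_lk t u k : (k < d i)%N -> x (lk t u) k = if (t <= k)%N then x u (k - t)%N else 0.
Proof.
elim: t k => [|t IH] k kd; first by rewrite subn0.
by rewrite /= (fr_l Bx) //; case: k kd => // k kd; rewrite IH ?subSS // ltnW.
Qed.

Lemma fr_vertex (u : B) : u = e i u.
Proof. by apply: fr_ext => k kd; rewrite (fr_e Bx) eqxx. Qed.

Lemma fr_crep o : crep D o B.
Proof.
split.
- move=> j j' v; apply: fr_ext => k kd; rewrite !(fr_e Bx).
  case: (boolP (j == j')) => [/eqP <-|jj]; first by rewrite (fr_e Bx); case: (j == i).
  by rewrite fr0; case: eqP => // E; case: eqP => // E'; rewrite E E' eqxx in jj.
- move=> v; rewrite (bigD1 i) //= -fr_vertex big1 ?addr0 // => j ji.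
  by apply: fr_ext => k kd; rewrite (fr_e Bx) (negbTE ji) fr0.
- move=> j v; apply: fr_ext => k kd; rewrite (fr_e Bx) !(fr_l Bx) //.
  by case: k kd => [|k] kd; case: ifP; rewrite // (fr_e Bx) => ->.
- move=> j v; apply: fr_ext => k kd; rewrite fr_lk // fr0.
  have [->|ji] := eqVneq j i; first by rewrite leqNgt kd.
  by rewrite (fr_e Bx) (negbTE ji) if_same.
- by move=> j j' v _; rewrite (fr_a Bx) linear0.
by move=> j j' v; rewrite !(fr_a Bx) !linear0 lk0.
Qed.

Lemma fr_in o (J : {set 'I_n}) : i \in J -> inC D o J B.
Proof.
move=> iJ; split; first exact: fr_crep.
move=> j jJ v; apply: fr_ext => k kd; rewrite (fr_e Bx) fr0; case: eqP => // ji.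
by rewrite ji iJ in jJ.
Qed.

Lemma fr_hom M (psi : 'Hom(V, M)) o : crep D o M -> (forall v, e i (psi v) = psi v) ->
  (forall k v, (k < d i)%N -> a (lk k (psi v)) = 0) ->
  exists G : 'Hom(B, M), hom G /\ forall u, G u = \sum_(k < d i) lk k (psi (x u k)).
Proof.
move=> cM eP aP.
have [G GE] : exists G : 'Hom(B, M), forall u, G u = \sum_(k < d i) lk k (psi (x u k)).
  apply: lin_ex => c u v; rewrite scaler_sumr -big_split; apply: eq_bigr => k _ /=.
  by rewrite (fr_lin Bx) linearP lkP.
exists G; split=> // g u; case: g => [j||]; rewrite !GE.
- have [->|ji] := eqVneq j i.
    rewrite linear_sum; apply: eq_bigr => k _ /=.
    by rewrite (fr_e Bx) eqxx (crep_elk _ _ _ cM) eP.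
  rewrite linear_sum; apply: eq_bigr => k _ /=.
  rewrite (fr_e Bx) (negbTE ji) linear0 lk0 (crep_elk _ _ _ cM) -eP.
  by rewrite (crep_eij _ cM) 1?eq_sym // lk0.
- rewrite linear_sum; case E : (d i) => [|m]; first by rewrite !big_ord0.
  rewrite big_ord_recl [RHS]big_ord_recr /=.
  have -> : l (lk m (psi (x u m))) = 0.
    by rewrite -iterS -E -eP (crep_ld cM).
  rewrite (fr_l Bx) ?E // linear0 add0r addr0; apply: eq_bigr => k _ /=.
  by rewrite /bump /= (fr_l Bx) // E ltnS ltn_ord.
rewrite (fr_a Bx) linear_sum !big1 // => k _ /=; last by rewrite fr0 linear0 lk0.
by rewrite aP.
Qed.

Section AtSource.
Variables (o o' : rel 'I_n) (Hs : source_at D i o o').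

(** K[x]/x^d is a Frobenius algebra: a linear map into V extends to a morphism into the free module,
    whose coefficient of x^k applies phi after d - k - 1 loops. At a source the arrows impose no
    condition. *)
Lemma fr_cohom M (phi : 'Hom(M, V)) : crep D o M ->
  exists H : 'Hom(M, B), hom H /\
    forall v k, (k < d i)%N -> x (H v) k = phi (lk (d i - k.+1) (e i v)).
Proof.
move=> cM; have /choice[H0 H0E] : forall v, exists u : B, forall k, (k < d i)%N ->
    x u k = phi (lk (d i - k.+1) (e i v)).
  by move=> v; apply: (fr_ex Bx (fun k => phi (lk (d i - k.+1) (e i v)))).
have [H HE] : exists H : 'Hom(M, B), forall v, H v = H0 v.
  apply: lin_ex => c u v; apply: fr_ext => k kd.
  by rewrite (fr_lin Bx) !H0E // linearP lkP linearP.
exists H; split=> [g v|v k kd]; last by rewrite HE H0E.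
apply: fr_ext => k kd; rewrite HE H0E //; case: g => [j||].
- rewrite (fr_e Bx) HE H0E //; have [->|ji] := eqVneq j i.
    by rewrite (crep_eii _ _ cM).
  by rewrite (crep_eij _ cM) // lk0 linear0.
- rewrite (fr_l Bx) // (crep_el cM) -iterSr; case: k kd => [|k] kd.
    by rewrite subn1 prednK ?gd_gt0 // (crep_ld cM) linear0.
  by rewrite HE H0E ?(ltnW kd) // -subSn.
by rewrite (src_ea _ Hs cM) lk0 linear0 (fr_a Bx) fr0.
Qed.

End AtSource.
End Coordinates.
End FreeRep.
End Vertex.

(** * Ext-projectives under reflection *)

Section ExtProj.
Variables (K : fieldType) (n : nat) (D : gdata n).
Notation p := (gp D).
Notation d := (gd D).
Notation rep := (rep K (gen n)).
Implicit Types L M N X Y Z U E Q B C : rep.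
Notation e i v := (act _ (Ge i) v).
Notation l v := (act _ Gl v).
Notation a v := (act _ Ga v).
Variables (i : 'I_n) (o o' : rel 'I_n).
Hypothesis Hs : source_at D i o o'.
Notation refl := (refl D i o o').
Notation umap := (outmap i).
Notation srep := (srep K).

(** At i, [refl_hull] presents M as the kernel of Z -> C, where Z_i is coinduced, hence free, and
    C_i = N_i is free. *)
Lemma refl_free M N : refl M N -> locfree D N -> locfree D M.
Proof.
move=> rMN fN; have [P rP] := rMN; have cM := rfM rP; have cN := rfN rP.
have off j : j != i -> free_at D j M by move=> ji; apply/(refl_free_off rMN ji)/fN.
have [Z [C [u [q [k [N0 [[uh um qh qe ex] [rZ N0i] [cC Ce] [kh km] kN]]]]]]] := refl_hull Hs rMN.
have cZ : crep D o Z by have [PZ rZ'] := rZ; exact: rfM rZ'.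
have Zj j : j != i -> free_at D j Z.
  move=> ji; apply/(free_at_bij (f := u) cM cZ _ _ _ _); last exact: off.
  - by move=> v; rewrite uh.
  - by move=> v; rewrite uh.
  - by move=> x _ /um.
  move=> y ey; have /ex[x ->] : q y = 0 by rewrite [q y]Ce -qh -ey (crep_eij _ cZ) ?linear0.
  by exists x.
have Zi := coinduced_free rZ N0i Zj.
have Ci : free_at D i C.
  apply/(free_at_bij (f := k) cC cN _ _ _ _); last exact: fN.
  - by move=> v; rewrite kh.
  - by move=> v; rewrite kh.
  - by move=> x _ /km.
  by move=> y /kN[v ->]; exists v.
move=> j; have [->|ji] := eqVneq j i; last exact: off.
apply: (free_kernel cM cZ cC uh um qh _ _ _ Zi Ci).
- by move=> v; apply/ex; exists v.
- by move=> z _ /ex[x ->]; exists x.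
by move=> w _; have [z <-] := qe w; exists z.
Qed.

Lemma vertex_hom0 U M (f : 'Hom(U, M)) : crep D o U -> (forall v : U, v = e i v) ->
  (forall f : 'Hom(srep i, M), hom f -> f = 0) -> crep D o M -> hom f -> f = 0.
Proof.
move=> cU Ue M0 cM fh; apply: hom_image0 => v; apply: contrapT => /eqP fv0.
have aU (u : U) : a u = 0 by rewrite [a u]Ue (src_ea _ Hs cU).
have [|| g [gh gm]] := @src_soc K n D i o o' Hs M (f v) cM.
- by move=> j k _; rewrite -hom_umap // /outmap aU !linear0.
- by rewrite -fh -Ue.
have g0 := M0 g gh; have /eqP := oner_neq0 K; apply.
by apply: (gm (1 : K^o)); rewrite g0 zero_lfunE.
Qed.

Section Matched.
Variable J : {set 'I_n}.
Hypothesis iJ : i \in J.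
Notation C := (inC D o J).
Notation C' := (inC D o' J).
Variables T T' : rep -> Prop.
Hypothesis Tt : tors C T.
Hypothesis Tt' : tors C' T'.
Hypothesis Ti : T (srep i).
Hypothesis T'i : ~ T' (srep i).
Hypothesis TT' : forall M N, refl M N -> T M <-> T' N.
Notation CA := (@crep_amb K n D).

Lemma tors_srep_free N : T' N -> forall f : 'Hom(N, srep i), hom f -> f = 0.
Proof.
move=> TN f fh; apply: contrapT => f0; apply: T'i.
have [_ _ T'q _] := Tt'; apply: (T'q _ _ f fh _ TN).
have [v fv] : exists v, f v != 0.
  by apply: contrapT => H; apply: f0; apply: hom_image0 => v; apply/eqP/negPn/negP => H'; apply: H; exists v.
exact: epi_srep fv.
Qed.

Lemma tors_refl_back N : T' N -> exists M, refl M N /\ T M.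
Proof.
move=> TN; have [T'C _ _ _] := Tt'.
have [M rM] := snk_refl Hs (T'C _ TN).1 (tors_srep_free TN).
by exists M; split=> //; apply/(TT' rM).
Qed.

(** Given an extension of N, reflect it back to one of X1 and lift X -> X1 to its middle term. The
    lift kills U, which has no nonzero map to a module with a reflection, so it descends to a
    splitting. *)
Lemma extproj_down X U X1 N (u : 'Hom(U, X)) (q : 'Hom(X, X1)) : extproj C T X -> ses u q ->
  (forall v : U, v = e i v) -> refl X1 N -> extproj C' T' N.
Proof.
move=> [TX Xl] [uh um qh qe uex] Ue rN; have [TC T0 Tq Te] := Tt; have [T'C T'0 T'q T'e] := Tt'.
have CX := TC _ TX; have cU : crep D o U := (ambient_sub (CA o J) uh um CX).1.
have TN : T' N by apply/(TT' rN); apply: Tq qh qe TX.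
apply: (extproj_split (CA o' J) Tt') => // L E f g fg CE TL.
have TE : T' E by apply: T'e fg CE TL TN.
have [ME [rE TME]] := tors_refl_back TE; have [ML [rL TML]] := tors_refl_back TL.
have [fh fm gh ge fex] := fg.
have [PE rPE] := rE; have [PL rPL] := rL; have [PN rPN] := rN.
have [f1 [f1h fA]] := refl_hom_back rPL rPE fh.
have [g1 [g1h gA]] := refl_hom_back rPE rPN gh.
have s1 : ses f1 g1 by apply: (refl_ses_back rPL rPE rPN fh gh f1h g1h fA gA).
have [h [hh hE]] := Xl _ _ _ _ _ q s1 (TC _ TME) TML qh.
have hu0 : (h \o u)%VF = 0.
  apply: vertex_hom0 => //; last exact: hom_comp.
    exact: refl_cofree rE.
  exact: rfM rPE.
have [k [kh kE]] : exists k : 'Hom(X1, ME), hom k /\ forall v, k (q v) = h v.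
  apply: epi_factor => // v /uex[w ->].
  by have := congr1 (fun f : 'Hom(_, _) => f w) hu0; rewrite comp_lfunE zero_lfunE.
have [k' [k'h k'A]] := refl_hom rPN rPE kh.
exists k'; split=> // v.
have gk : (g1 \o k)%VF = \1%VF.
  by apply/lfunP => w; have [x <-] := qe w; rewrite comp_lfunE kE hE id_lfunE.
have A : agree PN PN (g1 \o k)%VF (g \o k')%VF.
  by move=> w; rewrite !comp_lfunE k'A gA.
have A1 : agree PN PN (\1%VF : 'End(X1)) (\1%VF : 'End(N)) by move=> w; rewrite !id_lfunE.
have [/(_ gk) gk' _] := refl_faith rPN rPN (hom_comp g1h kh) (@hom1 _ _ X1) (hom_comp gh k'h) (@hom1 _ _ N) A A1.
by rewrite -[LHS]comp_lfunE gk' id_lfunE.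
Qed.

(* Lifting the projection of X onto X_i along the free cover of X_i. *)
Lemma extproj_free_at X : extproj C T X -> free_at D i X.
Proof.
move=> [TX Xl]; have [TC T0 Tq Te] := Tt; have CX := TC _ TX; have cX := CX.1.
pose P (v : X) := e i v = 0.
have [||Y [q [qh qe qP]]] := @quotrep_ex _ _ X P.
- by split=> [|c u v]; rewrite /P ?linear0 // linearP /= => -> ->; rewrite scaler0 addr0.
- move=> g v; rewrite /P => ev; case: g => [j||].
  + have [->|ji] := eqVneq j i; first by rewrite ev linear0.
    by rewrite (crep_eij _ cX).
  + by rewrite (crep_el cX) ev linear0.
  by rewrite (src_ea _ Hs cX).
have cY := crep_quot qh qe cX.
have Ye (v : Y) : e i v = v.
  have [w <-] := qe v; rewrite -qh; apply/eqP; rewrite -subr_eq0 -linearB; apply/eqP/qP.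
  by rewrite /P linearB /= (crep_eii _ _ cX) subrr.
have [B [x Bx]] := free_rep_ex D i Y.
have [|| G [Gh GE]] := fr_hom Bx (psi := \1%VF) cY.
- by move=> v; rewrite id_lfunE.
- by move=> k v _; rewrite id_lfunE -[a _]Ye (src_ea _ Hs cY).
have CB := fr_in Bx o iJ.
have d0 : (0 < d i)%N := gd_gt0 D i.
have G_epi : epi G.
  move=> y; have [u uE] := fr_ex Bx (fun k => if k == 0%N then y else 0).
  exists u; rewrite GE (bigD1 (Ordinal d0)) //= uE //= id_lfunE big1 ?addr0 // => k k0.
  by rewrite uE // ifN // linear0 lk0.
have [L [N0 [f [q0 [s sP]]]]] := quot_ses (lin_pred_ker G) (stable_ker Gh).
have [fh fm _ _ _] := s.
have TL : T L.
  apply: (tors_at_vertex Hs Tt Ti); split; first exact: (ambient_sub (CA o J) fh fm CB).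
  by move=> v; apply: (mono_inj fm); rewrite fh -(fr_vertex Bx).
have s' : ses f G.
  have [_ _ _ _ fex] := s; split=> // v; split=> [/sP/fex//|/fex/sP//].
have [h [hh hE]] := Xl _ _ _ _ _ q s' CB TL qh.
have [sg sgE] : exists sg : 'Hom(Y, X), forall v, sg (q v) = e i v.
  have [|sg sgE] := lin_factor (f := act X (Ge i)) qe; first by move=> v /qP.
  by exists sg.
have [th0 th0E] : exists th0 : 'Hom(X, Y), forall v, th0 v = x (h v) (d i).-1.
  by apply: lin_ex => c u v; rewrite linearP (fr_lin Bx).
have sgl k v : sg (lk k v) = lk k (sg v).
  have [w <-] := qe v; rewrite -hom_lk // !sgE.
  by rewrite (crep_elk _ _ _ cX).
exists (sg \o th0)%VF; split=> [v|v ev].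
  by rewrite comp_lfunE; have [w <-] := qe (th0 v); rewrite sgE (crep_eii _ _ cX).
rewrite -{1}ev -sgE -hE GE linear_sum; apply: eq_bigr => k _ /=.
rewrite sgl id_lfunE comp_lfunE th0E hom_lk // (fr_lk Bx) ?prednK //.
have kd := ltn_ord k; rewrite ifT; last by lia.
by congr (lk _ (sg (x _ _))); lia.
Qed.

Lemma extproj_locfree X U X1 N (u : 'Hom(U, X)) (q : 'Hom(X, X1)) : extproj C T X -> ses u q ->
  (forall v : U, v = e i v) -> refl X1 N -> locfree D N -> locfree D X.
Proof.
move=> eX [uh um qh qe uex] Ue rN fN j; have [->|ji] := eqVneq j i; first exact: extproj_free_at.
have [TC _ _ _] := Tt; have cX := (TC _ eX.1).1.
apply/(free_at_bij (f := q) cX (crep_quot qh qe cX) _ _ _ _); last exact: refl_free rN fN j.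
- by move=> v; rewrite qh.
- by move=> v; rewrite qh.
- move=> x ex /uex[w xw]; have xi : x = e i x by rewrite {1}xw [w]Ue uh -xw.
  by rewrite -ex xi (crep_eij _ cX) // eq_sym.
move=> y ey; have [x xE] := qe y; exists x; rewrite xE //.
Qed.

(** The free module of rank one at i, with rank vector alpha_i. It contains S_i, so at a source it
    is the one indecomposable candidate for an Ext-projective that reflection does not reach. *)
Definition erep : rep := sval (cid (free_rep_ex D i (K^o : vectType K))).

Lemma erepP : exists x : erep -> nat -> K^o, free_rep D i x.
Proof. exact: svalP (cid (free_rep_ex D i (K^o : vectType K))). Qed.

(** For w killed by the loop the trace formula gives w = l^(d_i - 1) u with u = th w. Sending the
    generator to u maps [erep] to X, and a form with value 1 on w gives a map back. The composite
    does not kill the lowest nonzero coefficient, so it is injective and [erep] is a direct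
    summand. *)
Lemma erep_of_vertex X : crep D o X -> indec X -> (forall v : X, v = e i v) ->
  free_at D i X -> iso erep X.
Proof.
move=> cX [X0 Xi] Xe [th [the thE]]; have [x Bx] := erepP.
have d0 : (0 < d i)%N := gd_gt0 D i.
have aX (v : X) : a v = 0 by rewrite [a v]Xe (src_ea _ Hs cX).
have [v v0] := rep0N X0.
have [w [w0 lw]] : exists w : X, w != 0 /\ l w = 0.
  have ex : exists k, lk k v == 0 by exists (d i); rewrite [v]Xe (crep_ld cX).
  case: (ex_minnP ex) => [[|k]] /=; first by rewrite (negbTE v0).
  move=> /eqP lk0 km; exists (lk k v); split=> //; apply/negP => /km; by rewrite ltnn.
pose u := th w.
have uE : lk (d i).-1 u = w.
  rewrite [RHS]thE -?Xe // /trace -[in RHS](prednK d0) big_ord_recr /= subnn /= big1 ?add0r // => k _.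
  have : ((d i).-1.+1 - k.+1 = ((d i).-1 - k.+1).+1)%N.
    by rewrite subnSK // subSS.
  by move=> ->; rewrite iterSr lw lk0 linear0 lk0.
have [ps psE] : exists ps : 'Hom(K^o, X), forall c, ps c = c *: u.
  by apply: lin_ex => c c1 c2; rewrite scalerDl scalerA.
have [||G [Gh GE]] := fr_hom Bx (psi := ps) cX.
- by move=> c; rewrite -Xe.
- by move=> k c _; rewrite aX.
have [phi [phi1 _]] := @separating_form _ X (fun v => v = 0) w
   (conj erefl (fun k u v (u0 : u = 0) (v0 : v = 0) => etrans (congr2 (fun a b => k *: a + b) u0 v0)
       (etrans (addr0 _) (scaler0 _ _)))) (elimN eqP w0).
have [H [Hh HE]] := fr_cohom Bx Hs phi cX.
have HGm : mono (H \o G)%VF.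
  move=> b; rewrite comp_lfunE => HG0; apply: contrapT => b0.
  have ex : exists k, x b k != 0.
    by apply: contrapT => nex; apply: b0; apply: (fr_inj Bx) => k; apply/eqP/negPn/negP => xk; apply: nex; exists k.
  case: (ex_minnP ex) => k xk kmin.
  have kd : (k < d i)%N by rewrite ltnNge; apply: contra xk => /(fr_out Bx) ->.
  have : x (H (G b)) k = 0 by rewrite HG0 (fr0 Bx).
  rewrite HE // -Xe GE.
  have -> : lk (d i - k.+1) (\sum_(t < d i) lk t (ps (x b t))) = x b k *: w.
    rewrite lk_sum (bigD1 (Ordinal kd)) //= big1 ?addr0 => [|t tk].
      rewrite lk_add; have -> : (d i - k.+1 + k = (d i).-1)%N by lia.
      by rewrite psE -[_ *: u]addr0 lkP lk0 addr0 uE.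
    have [tlt|kt] := ltnP t k.
      have -> : x b t = 0 by apply/eqP/negPn/negP => /kmin; rewrite leqNgt tlt.
      by rewrite linear0 !lk0.
    rewrite lk_add psE [_ *: u]Xe; have : (d i <= d i - k.+1 + t)%N.
      have : t != k :> nat by apply: contra tk => /eqP E; apply/eqP/val_inj.
      by lia.
    by move=> /subnK <-; rewrite -lk_add (crep_ld cX) lk0.
  by rewrite linearZ /= phi1 => /eqP; rewrite mulf_eq0 oner_eq0 orbF (negbTE xk).
have HGe : epi (H \o G)%VF := mono_epi HGm (leqnn _).
have [r [rh rK Kr]] := hom_inv (hom_comp Hh Gh) HGm HGe.
have Gm : mono G by move=> b Gb; apply: HGm; rewrite comp_lfunE Gb linear0.
have pp : ((G \o r \o H) \o (G \o r \o H))%VF = (G \o r \o H)%VF.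
  by apply/lfunP => y; rewrite !comp_lfunE -[H (G _)]comp_lfunE Kr.
have [E|E] := Xi _ (hom_comp (hom_comp Gh rh) Hh) pp.
  have := congr1 (fun f : 'Hom(_, _) => f (G (r (H u)))) E.
  rewrite !comp_lfunE zero_lfunE -[H (G _)]comp_lfunE Kr => /Gm/(congr1 (H \o G)%VF).
  rewrite Kr linear0 => Hu; case/eqP: (oner_neq0 K).
  have := HE u 0%N d0; rewrite Hu (fr0 Bx) -Xe subn1 uE phi1 //.
exists G; split=> // y; exists (r (H y)).
by have := congr1 (fun f : 'Hom(_, _) => f y) E; rewrite !comp_lfunE id_lfunE.
Qed.

(* An extprojective erep i forces the torsion class after reflection to vanish at i: the
   embedding of erep i in the socle quotient Z / M of refl_hull does not lift to Z. *)
Lemma extproj_erep N : extproj C T erep -> T' N -> forall w : N, e i w = 0.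
Proof.
move=> [_ El] TN w0; have [TC _ _ _] := Tt.
have [M [rMN TM]] := tors_refl_back TN.
have [Z [Q [u [q [k [N0 [uq [rZ N0i] [cQ Qe] [kh km] kN]]]]]]] := refl_hull Hs rMN.
have [uh um qh qe ex] := uq; have [PZ rPZ] := rZ; have cZ := rfM rPZ.
have [P rP] := rMN; have cN := rfN rP; have cM := rfM rP.
have CZ : C Z.
  split=> // j jJ z; have ji : j != i by apply: contraNneq jJ => ->.
  have /ex[m mE] : q (e j z) = 0 by rewrite [q _]Qe -qh (crep_eij _ cZ) ?linear0.
  rewrite -(crep_eii _ _ cZ) mE -uh; have [_ ->] := TC _ TM => //; exact: linear0.
have [w wE] := kN _ (crep_eii i w0 cN); rewrite wE.
suff -> : w = 0 by rewrite linear0.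
have [x Bx] := erepP.
have [ps psE] : exists ps : 'Hom(K^o, Q), forall c, ps c = c *: w.
  by apply: lin_ex => c c1 c2; rewrite scalerDl scalerA.
have aQ (v : Q) : a v = 0 by rewrite [a v]Qe (src_ea _ Hs cQ).
have [||f [fh fE]] := fr_hom Bx (psi := ps) cQ.
- by move=> c; rewrite -Qe.
- by move=> t c _; rewrite aQ.
have [h [hh hE]] := El _ _ _ _ _ f uq CZ TM fh.
have [b bE] := fr_ex Bx (fun t => if t == 0%N then 1 else 0).
have d0 : (0 < d i)%N := gd_gt0 D i.
have fb : f b = w.
  rewrite fE (bigD1 (Ordinal d0)) //= bE // psE scale1r big1 ?addr0 // => t t0.
  by rewrite bE // ifN // linear0 lk0.
have hb : h b = 0.
  rewrite [b](fr_vertex Bx) hh; apply: (rf_inj rPZ) => j t _.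
  by rewrite -hom_umap // /outmap (fr_a Bx) !linear0.
by rewrite -fb -hE hb linear0.
Qed.

(** X1 is locally free because its reflection is Ext-projective, so 0 -> U -> X -> X1 -> 0 splits.
    As X is indecomposable, either X = U lives at i or X = X1 has a reflection. *)
Lemma extproj_indec X : extproj C T X -> indec X ->
  (forall N, extproj C' T' N -> locfree D N) ->
  locfree D X /\
  ((exists N, refl X N /\ extproj C' T' N) \/
   (iso erep X /\ forall N, T' N -> forall w : N, e i w = 0)).
Proof.
move=> eX iX lf; have [TC T0 Tq Te] := Tt; have CX := TC _ eX.1; have cX := CX.1.
have [U [X1 [u [q [uq [CU Ue] CX1 [N rN]]]]]] := src_decomp Hs iJ CX.
have eN := extproj_down eX uq Ue rN; have fN := lf _ eN.
have fX := extproj_locfree eX uq Ue rN fN; split=> //.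
have [uh um qh qe ex] := uq; have fX1 := refl_free rN fN.
have [|h [hh hE]] := free_lift Hs CX1.1 cX CX1.1 qh qe _ (fX1 i) (@hom1 _ _ X1).
  by move=> v /ex[w ->]; rewrite -uh -Ue.
have [X0 Xi] := iX.
have [||E|E] := Xi (h \o q)%VF.
- exact: hom_comp.
- by apply/lfunP => v; rewrite !comp_lfunE hE id_lfunE.
- right; have Xe (v : X) : v = e i v.
    have /ex[w ->] : q v = 0.
      by have := congr1 (fun f : 'Hom(_, _) => q (f v)) E; rewrite comp_lfunE zero_lfunE linear0 hE id_lfunE.
    by rewrite -uh -Ue.
  have iE := erep_of_vertex cX iX Xe (fX i); split=> //.
  move=> N1; apply: extproj_erep; exact: (extproj_iso Tt (iso_sym iE) eX).
left; have qm : mono q.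
  move=> v qv; have := congr1 (fun f : 'Hom(_, _) => f v) E.
  by rewrite comp_lfunE qv linear0 id_lfunE.
have [M rM] : exists M, refl X M.
  apply: (src_refl Hs cX) => f fh; apply: hom_image0 => v; apply: qm.
  by have := congr1 (fun f : 'Hom(_, _) => f v) (refl_cofree rN (hom_comp qh fh)); rewrite comp_lfunE zero_lfunE.
exists M; split=> //.
(* The zero submodule plays the part of U in [extproj_down]. *)
have [U0 [u0 [u0h u0m u0P]]] := subrep_ex (lin_pred_ker (\1%VF : 'End(X))) (stable_ker (@hom1 _ _ X)).
have s0 : ses u0 (\1%VF : 'End(X)).
  by split=> //; [exact: hom1 | move=> w; exists w; rewrite id_lfunE].
apply: (extproj_down eX s0 _ rM) => v; apply: (mono_inj u0m).
have z0 (w : U0) : u0 w = 0 by rewrite -[LHS]id_lfunE; apply/u0P; exists w.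
by rewrite !z0.
Qed.

(** The middle term E of an extension of M may have no reflection, but its quotient E1 does. The
    extension of M with middle term E1 has a quotient of L as kernel and splits on the reflected
    side; freeness of M at i then lifts the splitting from E1 to E. *)
Lemma extproj_up M N : extproj C' T' N -> locfree D N -> refl M N -> extproj C T M.
Proof.
move=> [TN Nl] fN rMN; have [TC T0 Tq Te] := Tt; have [T'C T'0 T'q T'e] := Tt'.
have TM : T M by apply/(TT' rMN).
have fM := refl_free rMN fN; have [P rP] := rMN; have cM := rfM rP.
apply: (extproj_split (CA o J) Tt) => // L E f g fg CE TL.
have [fh fm gh ge fex] := fg.
have TE : T E by apply: Te fg CE TL TM.
have [U [E1 [u [q [uq [CU Ue] CE1 [NE rE]]]]]] := src_decomp Hs iJ CE.
have [uh um qh qe ex] := uq; have [PE rPE] := rE.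
have gu0 : (g \o u)%VF = 0.
  by apply: (vertex_hom0 CU.1 Ue (refl_cofree rMN) cM); apply: hom_comp.
have [g1 [g1h g1E]] : exists g1 : 'Hom(E1, M), hom g1 /\ forall v, g1 (q v) = g v.
  apply: epi_factor => // v /ex[w ->].
  by have := congr1 (fun f : 'Hom(_, _) => f w) gu0; rewrite comp_lfunE zero_lfunE.
have [L1 [f1 [f1h f1m f1P]]] := subrep_ex (lin_pred_ker g1) (stable_ker g1h).
have fg1 : ses f1 g1.
  by split=> // w; have [v <-] := ge w; exists (q v).
have TL1 : T L1.
  have [k [kh kE]] : exists k : 'Hom(L, L1), hom k /\ forall v, f1 (k v) = (q \o f)%VF v.
    apply: mono_lift => //; first exact: hom_comp.
    by move=> v; apply/f1P; rewrite comp_lfunE g1E; apply/fex; exists v.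
  apply: (Tq _ _ k kh _ TL) => w.
  have [v vE] := qe (f1 w); have /fex[y yE] : g v = 0 by rewrite -g1E vE; apply/f1P; exists w.
  by exists y; apply: (mono_inj f1m); rewrite kE comp_lfunE -yE vE.
have CL1 : C L1 := ambient_sub (CA o J) f1h f1m CE1.
have [NL rL] : exists NL, refl L1 NL.
  apply: (src_refl Hs CL1.1) => h hh; apply: hom_image0 => v; apply: f1m.
  by have := congr1 (fun f : 'Hom(_, _) => f v) (refl_cofree rE (hom_comp f1h hh)); rewrite comp_lfunE zero_lfunE.
have [PL rPL] := rL.
have [f2 [f2h fA]] := refl_hom rPL rPE f1h.
have [g2 [g2h gA]] := refl_hom rPE rP g1h.
have s2 : ses f2 g2 := refl_ses rPL rPE rP f2h g2h f1h g1h fA gA fg1.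
have TNL : T' NL by apply/(TT' rL).
have CNE : C' NE by apply/(refl_inC iJ rE).
have [k [kh kE]] := Nl _ _ _ _ _ _ s2 CNE TNL (@hom1 _ _ N).
have [k1 [k1h k1A]] := refl_hom_back rP rPE kh.
have A : agree P P (g1 \o k1)%VF (g2 \o k)%VF by move=> w; rewrite !comp_lfunE k1A gA.
have A1 : agree P P (\1%VF : 'End(M)) (\1%VF : 'End(N)) by move=> w; rewrite !id_lfunE.
have gk : (g2 \o k)%VF = \1%VF by apply/lfunP => w; rewrite comp_lfunE kE.
have [_ /(_ gk) gk1] := refl_faith rP rP (hom_comp g1h k1h) (@hom1 _ _ M) (hom_comp g2h kh) (@hom1 _ _ N) A A1.
have [|h [hh hE]] := free_lift Hs cM CE.1 CE1.1 qh qe _ (fM i) k1h.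
  by move=> v /ex[w ->]; rewrite -uh -Ue.
exists h; split=> // v; rewrite -g1E hE.
by have := congr1 (fun f : 'Hom(_, _) => f v) gk1; rewrite comp_lfunE id_lfunE.
Qed.

(** A lift z0 of the generator must be corrected by an element of L so that all arrows kill it.
    Since T' vanishes at i, exactness shows that every family in L1 comes from [outmap], which
    supplies the correction. *)
Lemma erep_up : (forall N, T' N -> forall w : N, e i w = 0) -> extproj C T erep.
Proof.
move=> T'0; have [TC T0 Tq Te] := Tt; have [x Bx] := erepP.
have TE : T erep.
  by apply: (tors_at_vertex Hs Tt Ti); split; [exact: (fr_in Bx) | exact: (fr_vertex Bx)].
apply: (extproj_split (CA o J) Tt) => // L E f g fg CE TL.
have [fh fm gh ge fex] := fg; have cE := CE.1; have CL := TC _ TL.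
have [U [L1 [u [q [uq [CU Ue] CL1 [NL rL]]]]]] := src_decomp Hs iJ CL.
have [uh um qh qe ex] := uq; have [PL rPL] := rL.
have TNL : T' NL by apply/(TT' rL); apply: Tq qh qe TL.
have d0 : (0 < d i)%N := gd_gt0 D i.
have [b bE] := fr_ex Bx (fun t => if t == 0%N then 1 else 0).
have [z0 z0E] := ge b.
have /choice[y yE] : forall jt : 'I_n * nat, exists y : L, f y = umap z0 jt.1 jt.2.
  move=> [j t] /=; have /fex[w ->] : g (umap z0 j t) = 0.
    by rewrite hom_umap // /outmap (fr_a Bx) linear0.
  by exists w.
have [m0 m0E] : exists m : L1, forall j t, (t < p j i)%N -> e j (q (y (j, t))) = umap m j t.
  apply: (rf_ex rPL (x := fun j t => q (y (j, t)))).
  by rewrite -(vmap_ei _ _ _ (rfN rPL)) T'0.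
have [m mE] := qe m0.
pose z := z0 - f m.
have uz j t : (t < p j i)%N -> umap z j t = 0.
  move=> tp; rewrite umapB -hom_umap // -[X in X - _](umap_e _ _ _ _ cE) -(yE (j, t)) -fh.
  rewrite -linearB /=; suff -> : e j (y (j, t)) - umap m j t = 0 by rewrite linear0.
  have ji : j != i by apply: contraTneq tp => ->; rewrite gpii.
  have /ex[w wE] : q (e j (y (j, t)) - umap m j t) = 0.
    by rewrite linearB /= qh m0E // hom_umap // mE subrr.
  have ee : e j (e j (y (j, t)) - umap m j t) = e j (y (j, t)) - umap m j t.
    by rewrite linearB /= (crep_eii _ _ CL.1) (umap_e _ _ _ _ CL.1).
  by rewrite -ee wE [w]Ue uh (crep_eij _ CL.1) // eq_sym.
have az k : a (lk k (e i z)) = 0 by apply: (arrows_at Hs cE uz).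
have [ps psE] : exists ps : 'Hom(K^o, E), forall c, ps c = c *: e i z.
  by apply: lin_ex => c c1 c2; rewrite scalerDl scalerA.
have [||h [hh hE]] := fr_hom Bx (psi := ps) cE.
- by move=> c; rewrite psE linearZ /= (crep_eii _ _ cE).
- by move=> k c _; rewrite psE -[c *: _]addr0 lkP lk0 addr0 linearZ /= az scaler0.
exists h; split=> // v; apply: (fr_ext Bx) => k kd.
have gz : g (e i z) = b.
  rewrite gh /z linearB /= z0E; have -> : g (f m) = 0 by apply/fex; exists m.
  by rewrite subr0 -(fr_vertex Bx).
rewrite hE linear_sum /= (fr_sum Bx) (bigD1 (Ordinal kd)) //= big1 ?addr0 => [|t tk].
  by rewrite psE hom_lk // linearZ /= gz (fr_lk Bx) // leqnn subnn (frZ Bx) bE //= [_ *: _]mulr1.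
rewrite psE hom_lk // linearZ /= gz (fr_lk Bx) //; case: ifP => // tk'.
rewrite (frZ Bx) bE; last by lia.
by case: eqP => [kt|_]; [case/eqP: tk; apply: val_inj => /=; lia | rewrite scaler0].
Qed.

End Matched.

Lemma erep_in (J : {set 'I_n}) : i \in J -> inC D o J erep.
Proof. by move=> iJ; have [x Bx] := erepP; exact: (fr_in Bx). Qed.
Lemma erep_vertex (v : erep) : v = e i v.
Proof. by have [x Bx] := erepP; exact: (fr_vertex Bx). Qed.

Lemma erep_dim : rdim erep = d i.
Proof.
have [x Bx] := erepP.
pose F : vectType K := {ffun 'I_(d i) -> K^o}.
have [f fE] : exists f : 'Hom(erep, F), forall u k, f u k = x u k.
  have [|f fE] := @lin_ex K erep F (fun u => [ffun k : 'I_(d i) => x u k]).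
    by move=> c u v; apply/ffunP => k; rewrite !ffunE (fr_lin Bx).
  by exists f => u k; rewrite fE ffunE.
have fi : lker f == 0%VS.
  apply/lker0P => u v uv; apply: (fr_ext Bx) => k kd.
  by rewrite -[k]/(nat_of_ord (Ordinal kd)) -!fE uv.
have fe : limg f = fullv.
  apply: epi_limg => w; have [u uE] := fr_ex Bx (fun k => if insub k is Some k' then w k' else 0).
  by exists u; apply/ffunP => k; rewrite fE uE // valK.
rewrite /rdim -(limg_ker_dim f fullv) fe (eqP fi) capv0 dimv0 add0n dimvf /=.
by rewrite /dim /= card_ord muln1.
Qed.

(** For an idempotent f the constant term of f b is an idempotent scalar, so 0 or 1. If it is 0, f
    raises the lowest exponent and hence vanishes; if it is 1, the same applies to 1 - f. *)
Lemma erep_indec : indec erep.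
Proof.
have [x Bx] := erepP; have d0 : (0 < d i)%N := gd_gt0 D i.
have [b bE] := fr_ex Bx (fun t => if t == 0%N then 1 else 0).
have b1 : x b 0%N = 1 by rewrite bE.
have gen (v : erep) : v = \sum_(k < d i) x v k *: lk k b.
  apply: (fr_ext Bx) => k kd.
  rewrite (fr_sum Bx) (bigD1 (Ordinal kd)) //= big1 ?addr0 => [|t tk].
    by rewrite (frZ Bx) (fr_lk Bx) // leqnn subnn b1 [_ *: _]mulr1.
  rewrite (frZ Bx) (fr_lk Bx) //; case: ifP => tk'; last by rewrite scaler0.
  rewrite bE; last by lia.
  by case: eqP => [kt|_]; [case/eqP: tk; apply: val_inj => /=; lia | rewrite scaler0].
have key (f : 'End(erep)) : hom f -> (f \o f)%VF = f -> x (f b) 0%N = 0 -> f = 0.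
  move=> fh ff f0; suff fb : f b = 0.
    apply: hom_image0 => v; rewrite [v]gen linear_sum big1 // => k _ /=.
    by rewrite linearZ /= hom_lk // fb lk0 scaler0.
  apply: contrapT => fb.
  have ex : exists k, x (f b) k != 0.
    by apply: contrapT => nex; apply: fb; apply: (fr_inj Bx) => k; apply/eqP/negPn/negP => xk; apply: nex; exists k.
  case: (ex_minnP ex) => k xk kmin; case/negP: (xk).
  have kd : (k < d i)%N by rewrite ltnNge; apply: contra xk => /(fr_out Bx) ->.
  rewrite -ff comp_lfunE [X in f X]gen linear_sum /= (fr_sum Bx) big1 // => t _.
  rewrite linearZ /= hom_lk // (frZ Bx) (fr_lk Bx) //; case: ifP => tk; last by rewrite scaler0.
  have [t0|t0] := posnP t; first by rewrite t0 f0 scale0r.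
  suff -> : x (f b) (k - t)%N = 0 by rewrite scaler0.
  by apply/eqP/negPn/negP => /kmin; rewrite leqNgt; lia.
split=> [E0|f fh ff].
  by have := oner_neq0 K; rewrite -b1 (E0 b) (fr0 Bx) eqxx.
have bsum : x (f (f b)) 0%N = x (f b) 0%N * x (f b) 0%N.
  rewrite [X in f X]gen linear_sum /= (fr_sum Bx) (bigD1 (Ordinal d0)) //= big1 ?addr0 => [|t t0].
    by rewrite linearZ /= (frZ Bx).
  rewrite linearZ /= hom_lk // (frZ Bx) (fr_lk Bx) // ifN ?scaler0 //.
  by rewrite leqn0; apply: contra t0 => /eqP E; apply/eqP/val_inj.
have [c0|c0] := eqVneq (x (f b) 0%N) 0; first by left; apply: key.
right; have c1 : x (f b) 0%N = 1.
  by apply: (mulfI c0); rewrite mulr1 -bsum -[f (f b)]comp_lfunE ff.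
apply/esym/eqP; rewrite -subr_eq0; apply/eqP/key.
- exact: homB (@hom1 _ _ erep) fh.
- apply/lfunP => v; rewrite !(comp_lfunE, add_lfunE, opp_lfunE, id_lfunE) linearB /=.
  by rewrite -[f (f v)]comp_lfunE ff subrr subr0.
by rewrite add_lfunE opp_lfunE id_lfunE (frB Bx) b1 c1 subrr.
Qed.

Section Transfer.
Variables (M N M' N' : rep).
Hypotheses (rM : refl M N) (rM' : refl M' N').

Lemma refl_iso : iso M M' <-> iso N N'.
Proof.
have [P rP] := rM; have [P' rP'] := rM'.
have A1 (X Y : rep) (Q : 'Hom(X, Y)) : agree Q Q (\1%VF : 'End(X)) (\1%VF : 'End(Y)).
  by move=> w; rewrite !id_lfunE.
have to_iso (X Y : rep) (f : 'Hom(X, Y)) (g : 'Hom(Y, X)) : hom f ->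
    (g \o f)%VF = \1%VF -> (f \o g)%VF = \1%VF -> iso X Y.
  move=> fh gf fg; exists f; split=> // [v fv|w].
    by have := congr1 (fun f : 'Hom(_, _) => f v) gf; rewrite comp_lfunE fv linear0 id_lfunE.
  by exists (g w); have := congr1 (fun f : 'Hom(_, _) => f w) fg; rewrite comp_lfunE id_lfunE.
have Ac (X Y X1 Y1 : rep) (Q : 'Hom(X, Y)) (Q1 : 'Hom(X1, Y1)) f g f1 g1 :
    agree Q Q1 f g -> agree Q1 Q f1 g1 -> agree Q Q (f1 \o f)%VF (g1 \o g)%VF.
  by move=> H H1 w; rewrite !comp_lfunE H H1.
split=> -[f [fh fm fe]]; have [g [gh fK gK]] := hom_inv fh fm fe.
  have [f1 [f1h Af]] := refl_hom rP rP' fh; have [g1 [g1h Ag]] := refl_hom rP' rP gh.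
  apply: (to_iso _ _ f1 g1 f1h).
    apply/(refl_faith rP rP (hom_comp gh fh) (@hom1 _ _ M) (hom_comp g1h f1h) (@hom1 _ _ N) (Ac _ _ _ _ _ _ _ _ _ _ Af Ag) (A1 _ _ _)).
    by apply/lfunP => v; rewrite comp_lfunE fK id_lfunE.
  apply/(refl_faith rP' rP' (hom_comp fh gh) (@hom1 _ _ M') (hom_comp f1h g1h) (@hom1 _ _ N') (Ac _ _ _ _ _ _ _ _ _ _ Ag Af) (A1 _ _ _)).
  by apply/lfunP => v; rewrite comp_lfunE gK id_lfunE.
have [f1 [f1h Af]] := refl_hom_back rP rP' fh; have [g1 [g1h Ag]] := refl_hom_back rP' rP gh.
apply: (to_iso _ _ f1 g1 f1h).
  apply/(refl_faith rP rP (hom_comp g1h f1h) (@hom1 _ _ M) (hom_comp gh fh) (@hom1 _ _ N) (Ac _ _ _ _ _ _ _ _ _ _ Af Ag) (A1 _ _ _)).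
  by apply/lfunP => v; rewrite comp_lfunE fK id_lfunE.
apply/(refl_faith rP' rP' (hom_comp f1h g1h) (@hom1 _ _ M') (hom_comp fh gh) (@hom1 _ _ N') (Ac _ _ _ _ _ _ _ _ _ _ Ag Af) (A1 _ _ _)).
by apply/lfunP => v; rewrite comp_lfunE gK id_lfunE.
Qed.

Lemma refl_rep0 : rep0 M <-> rep0 N.
Proof.
have [P rP] := rM.
have A0 : agree P P (0 : 'End(M)) (0 : 'End(N)) by move=> w; rewrite !zero_lfunE linear0.
have A1 : agree P P (\1%VF : 'End(M)) (\1%VF : 'End(N)) by move=> w; rewrite !id_lfunE.
have E0 (X : rep) : rep0 X <-> (\1%VF : 'End(X)) = 0.
  split=> [X0|E v]; first by apply: hom_image0.
  by have := congr1 (fun f : 'Hom(_, _) => f v) E; rewrite id_lfunE zero_lfunE.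
rewrite !E0.
exact: (refl_faith rP rP (@hom1 _ _ M) (@hom0 _ _ M M) (@hom1 _ _ N) (@hom0 _ _ N N) A1 A0).
Qed.

Lemma refl_indec : indec M <-> indec N.
Proof.
have [P rP] := rM.
have A0 : agree P P (0 : 'End(M)) (0 : 'End(N)) by move=> w; rewrite !zero_lfunE linear0.
have A1 : agree P P (\1%VF : 'End(M)) (\1%VF : 'End(N)) by move=> w; rewrite !id_lfunE.
have F0 f g : hom f -> hom g -> agree P P f g -> f = 0 <-> g = 0.
  by move=> fh gh A; exact: (refl_faith rP rP fh (@hom0 _ _ M M) gh (@hom0 _ _ N N) A A0).
have F1 f g : hom f -> hom g -> agree P P f g -> f = \1%VF <-> g = \1%VF.
  by move=> fh gh A; exact: (refl_faith rP rP fh (@hom1 _ _ M) gh (@hom1 _ _ N) A A1).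
have FF f g : hom f -> hom g -> agree P P f g -> (f \o f)%VF = f <-> (g \o g)%VF = g.
  move=> fh gh A; apply: (refl_faith rP rP (hom_comp fh fh) fh (hom_comp gh gh) gh _ A).
  by move=> w; rewrite !comp_lfunE !A.
split=> -[X0 Xi]; split.
- by rewrite -refl_rep0.
- move=> g gh gg; have [f [fh A]] := refl_hom_back rP rP gh.
  have [|/(F0 _ _ fh gh A)|/(F1 _ _ fh gh A)] := Xi f fh; first exact/(FF _ _ fh gh A).
    by left.
  by right.
- by rewrite refl_rep0.
move=> f fh ff; have [g [gh A]] := refl_hom rP rP fh.
have [|/(F0 _ _ fh gh A)|/(F1 _ _ fh gh A)] := Xi g gh; first exact/(FF _ _ fh gh A).
  by left.
by right.
Qed.

Lemma refl_brick : brick M <-> brick N.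
Proof.
have [P rP] := rM.
have A0 : agree P P (0 : 'End(M)) (0 : 'End(N)) by move=> w; rewrite !zero_lfunE linear0.
have F0 f g : hom f -> hom g -> agree P P f g -> f = 0 <-> g = 0.
  by move=> fh gh A; exact: (refl_faith rP rP fh (@hom0 _ _ M M) gh (@hom0 _ _ N N) A A0).
split=> -[X0 Xi]; split.
- by rewrite -refl_rep0.
- move=> g gh; have [f [fh A]] := refl_hom_back rP rP gh.
  have [/(F0 _ _ fh gh A)|fm] := Xi f fh; [by left | right].
  have fe : epi f := mono_epi fm (leqnn _).
  have ge : epi g by apply: (agree_epi (And5 rP rP fh gh A) fe).
  exact: epi_mono ge (leqnn _).
- by rewrite refl_rep0.
move=> f fh; have [g [gh A]] := refl_hom rP rP fh.
have [/(F0 _ _ fh gh A)|gm] := Xi g gh; [by left | right].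
by apply: (agree_mono (And5 rP rP fh gh A) gm).
Qed.

End Transfer.
End ExtProj.

(** * Dimension vectors under reflection *)

Section Dim.
Variables (K : fieldType) (n : nat) (D : gdata n).
Notation p := (gp D).
Notation d := (gd D).
Notation rep := (rep K (gen n)).
Implicit Types L M N X Y Z U E Q B C : rep.
Notation e i v := (act _ (Ge i) v).

Definition vdim j M := \dim (limg (act M (Ge j))).

Lemma mem_vdim o j M (v : M) : crep D o M -> (v \in limg (act M (Ge j))) <-> e j v = v.
Proof.
move=> cM; split=> [/memv_imgP[w _ ->]|<-]; first exact: (crep_eii _ _ cM).
by rewrite memv_img ?memvf.
Qed.

Lemma dim_bij (V W : vectType K) (f : 'Hom(V, W)) (A : {vspace V}) (B : {vspace W}) :
  (forall v, v \in A -> f v \in B) -> (forall v, v \in A -> f v = 0 -> v = 0) ->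
  (forall w, w \in B -> exists2 v, v \in A & f v = w) -> \dim A = \dim B.
Proof.
move=> fAB fi fs; rewrite -(limg_dim_eq (f := f) (U := A)).
  congr (\dim _); apply/vspaceP => w; apply/memv_imgP/idP => [[v vA ->]|/fs[v vA <-]].
    exact: fAB.
  by exists v.
apply/eqP; rewrite -subv0; apply/subvP => v; rewrite memv_cap memv_ker memv0 => /andP[vA /eqP fv].
by rewrite (fi v).
Qed.

Lemma vdim_iso o j M N : crep D o M -> crep D o N -> iso M N -> vdim j M = vdim j N.
Proof.
move=> cM cN [f [fh fm fe]]; apply: (dim_bij (f := f)).
- by move=> v /(mem_vdim _ _ cM) ev; apply/(mem_vdim _ _ cN); rewrite -fh ev.
- by move=> v _ /fm.
move=> w /(mem_vdim _ _ cN) ew; have [v vE] := fe w; exists (e j v); last by rewrite fh vE.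
by apply/(mem_vdim _ _ cM); rewrite (crep_eii _ _ cM).
Qed.

Lemma vdim_eq0 o j M : crep D o M -> vdim j M = 0%N -> forall v : M, e j v = 0.
Proof.
move=> cM /eqP; rewrite dimv_eq0 => /eqP E v; apply/eqP; rewrite -memv0 -E.
by rewrite memv_img ?memvf.
Qed.

Lemma vdim0 j M : (forall v : M, e j v = 0) -> vdim j M = 0%N.
Proof.
move=> E; apply/eqP; rewrite dimv_eq0 -subv0; apply/subvP => _ /memv_imgP[v _ ->].
by rewrite E mem0v.
Qed.

Lemma vdim_srep i j : vdim j (srep K i) = (j == i).
Proof.
case: (boolP (j == i)) => [/eqP ->|ji]; last first.
  by apply: vdim0 => v; rewrite /= (negbTE ji) zero_lfunE.
have -> : vdim i (srep K i) = \dim {: K^o}.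
  rewrite /vdim /= eqxx; congr (\dim _); apply/vspaceP => v; rewrite memvf.
  by apply/memv_imgP; exists v; rewrite ?memvf // id_lfunE.
by rewrite dimvf.
Qed.

Lemma vdim_erep i j : vdim j (erep K D i) = ((j == i) * d i)%N.
Proof.
case: (boolP (j == i)) => [/eqP ->|ji]; last first.
  apply: vdim0 => v; have [x Bx] := erepP K D i.
  by apply: (fr_ext Bx) => k _; rewrite (fr_e Bx) (negbTE ji) (fr0 Bx).
rewrite mul1n -(erep_dim K D i) /vdim /rdim; congr (\dim _); apply/vspaceP => v; rewrite memvf.
by apply/memv_imgP; exists v; rewrite ?memvf // -erep_vertex.
Qed.

Section Refl.
Variables (i : 'I_n) (o o' : rel 'I_n).
Hypothesis Hs : source_at D i o o'.
Notation refl := (refl D i o o').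
Notation umap := (outmap i).

Lemma refl_vdim_off M N j : refl M N -> j != i -> vdim j N = vdim j M.
Proof.
move=> [P rP] ji; have cM := rfM rP; have cN := rfN rP; symmetry; apply: (dim_bij (f := P)).
- by move=> v /(mem_vdim _ _ cM) ev; apply/(mem_vdim _ _ cN); rewrite -(rf_e rP) // ev.
- move=> v /(mem_vdim _ _ cM) ev; move/(rf_ker rP) => vE.
  by rewrite -ev vE (crep_eij _ cM) // eq_sym.
move=> w /(mem_vdim _ _ cN) ew; have [v vE] := rf_img rP w; exists (e j v).
  by apply/(mem_vdim _ _ cM); rewrite (crep_eii _ _ cM).
by rewrite (rf_e rP) // -[P v](addrK (e i w)) -vE linearB /= ew (crep_eij _ cN) ?subr0 // eq_sym.
Qed.

(** Rank-nullity for [inmap] on the space A of families with x j k in M_j for k < p_ji and zero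
    otherwise: its kernel is M_i and its image N_i. *)
Lemma refl_vdim M N : refl M N ->
  (vdim i M + vdim i N = \sum_j p j i * vdim j M)%N.
Proof.
move=> [P rP]; have cM := rfM rP; have cN := rfN rP.
pose Qn := (\sum_j p j i)%N.
have pQ j : (p j i <= Qn)%N by rewrite /Qn (bigD1 j) //= leq_addr.
pose I := ('I_n * 'I_Qn)%type.
pose F : vectType K := {ffun I -> M}.
pose ok (t : I) := (t.2 < p t.1 i)%N.
have [pr prE] : exists pr : 'End(F), forall x t, pr x t = if ok t then e t.1 (x t) else 0.
  have [|pr prE] := @lin_ex K F F (fun x => [ffun t => if ok t then e t.1 (x t) else 0]).
    move=> c x y; apply/ffunP => t; rewrite !ffunE; case: ifP => _; last by rewrite scaler0 addr0.
    by rewrite linearP.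
  by exists pr => x t; rewrite prE ffunE.
pose at_ (x : F) j k : M := if insub k is Some k' then x (j, k') else 0.
have atP c x y j k : at_ (c *: x + y) j k = c *: at_ x j k + at_ y j k.
  by rewrite /at_; case: insub => [k'|]; rewrite ?scaler0 ?addr0 // !ffunE.
have atE x j (k : 'I_Qn) : at_ x j k = x (j, k) by rewrite /at_ valK.
have [vm vmE] : exists vm : 'Hom(F, N), forall x, vm x = inmap D i P (at_ x).
  apply: lin_ex => c x y; rewrite -vmapP; apply: eq_vmap1 => j k; exact: atP.
have [um umE] : exists um : 'Hom(M, F), forall v t, um v t = if ok t then umap v t.1 t.2 else 0.
  have [|um umE] := @lin_ex K M F (fun v => [ffun t : I => if ok t then umap v t.1 t.2 else 0]).
    move=> c x y; apply/ffunP => t; rewrite !ffunE; case: ifP => _; last by rewrite scaler0 addr0.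
    by rewrite umapP.
  by exists um => v t; rewrite umE ffunE.
pose A := limg pr.
have prA x : x \in A <-> pr x = x.
  split=> [/memv_imgP[y _ ->]|<-]; last by rewrite memv_img ?memvf.
  by apply/ffunP => t; rewrite !prE; case: (ok t); rewrite ?(crep_eii _ _ cM).
have E1 : (\dim (A :&: lker vm) = vdim i M)%N.
  symmetry; apply: (dim_bij (f := um)).
  - move=> v _; rewrite memv_cap memv_ker; apply/andP; split.
      by apply/prA/ffunP => t; rewrite prE !umE; case: (ok t); rewrite ?(umap_e _ _ _ _ cM).
    apply/eqP; rewrite vmE -(rf_cx rP v); apply: (eq_vmap _ cM) => j k kp.
    by rewrite -[k]/(nat_of_ord (Ordinal (leq_trans kp (pQ j)))) atE umE ifT.
  - move=> v /(mem_vdim _ _ cM) ev um0; rewrite -ev; apply: (rf_inj rP) => j k kp.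
    by have := umE v (j, Ordinal (leq_trans kp (pQ j))); rewrite um0 ffunE ifT.
  move=> x; rewrite memv_cap memv_ker => /andP[/prA px /eqP]; rewrite vmE => /(rf_ex rP)[v vE].
  exists (e i v); first by apply/(mem_vdim _ _ cM); rewrite (crep_eii _ _ cM).
  apply/ffunP => -[j k]; rewrite umE -[RHS](congr1 (fun f : F => f (j, k)) px) prE; case: ifP => // kp.
  by rewrite (umap_ei _ _ _ _ cM) -vE // atE.
have E2 : (\dim (vm @: A) = vdim i N)%N.
  congr (\dim _); apply/vspaceP => w; apply/memv_imgP/idP => [[x _ ->]|/(mem_vdim _ _ cN) ew].
    by apply/(mem_vdim _ _ cN); rewrite vmE (vmap_ei _ _ _ cN).
  have [x xE] := rf_surj rP w.
  pose y : F := [ffun t : I => x t.1 t.2]; exists (pr y); first by rewrite memv_img ?memvf.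
  rewrite -ew xE vmE; apply: (eq_vmap _ cM) => j k kp.
  rewrite -[k]/(nat_of_ord (Ordinal (leq_trans kp (pQ j)))) atE prE ifT // ffunE.
  by rewrite (crep_eii _ _ cM).
rewrite -E1 -E2 limg_ker_dim.
pose dl (t : I) (v : M) : F := [ffun s => if s == t then v else 0].
have [inj injE] : exists inj : I -> 'Hom(M, F), forall t v, inj t v = dl t v.
  have /choice[f fE] : forall t, exists f : 'Hom(M, F), forall v, f v = dl t v.
    move=> t; apply: lin_ex => c u v; apply/ffunP => s; rewrite !ffunE; case: ifP => // _.
    by rewrite scaler0 addr0.
  by exists f.
pose At t : {vspace F} := (inj t @: limg (act M (Ge t.1)))%VS.
have AE : A = (\sum_(t | ok t) At t)%VS.
  apply/vspaceP => x; apply/idP/memv_sumP => [/prA px|[y yA ->]].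
    exists (fun t => inj t (x t)).
      move=> t kt; rewrite memv_img // -px prE kt memv_img ?memvf //.
    apply/ffunP => t; rewrite sum_ffunE.
    case: (boolP (ok t)) => kt; last first.
      have -> : x t = 0 by rewrite -px prE (negbTE kt).
      rewrite big1 // => s ks; rewrite injE ffunE ifN //.
      by apply: contraNneq kt => ->.
    rewrite (bigD1 t) //= injE ffunE eqxx big1 ?addr0 // => s /andP[_ st].
    by rewrite injE ffunE eq_sym (negbTE st).
  apply: memv_suml => t kt; apply/prA; have /memv_imgP[v /memv_imgP[w _ ->] ->] := yA t kt.
  apply/ffunP => s; rewrite prE injE !ffunE; case: (eqVneq s t) => [->|_].
    by rewrite kt (crep_eii _ _ cM).
  by rewrite linear0 if_same.
have Adir : directv (\sum_(t | ok t) At t)%VS.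
  apply/directv_sum_independent => y yA y0 t kt.
  have := congr1 (fun f : F => f t) y0; rewrite sum_ffunE (bigD1 t) //= big1 ?addr0 => [yt|s /andP[ks st]].
    have /memv_imgP[v _ E] := yA t kt; move: yt; rewrite E injE !ffunE eqxx => ->.
    by apply/ffunP => s; rewrite !ffunE if_same.
  by have /memv_imgP[v _ ->] := yA s ks; rewrite injE ffunE eq_sym (negbTE st).
have Adim t : \dim (At t) = vdim t.1 M.
  symmetry; apply: (dim_bij (f := inj t)).
  - by move=> v vA; rewrite memv_img.
  - move=> v _ E; have := congr1 (fun f : F => f t) E; by rewrite injE !ffunE eqxx.
  by move=> w /memv_imgP[v vA ->]; exists v.
rewrite AE (directvP Adir) /= (eq_bigr (fun t => vdim t.1 M)); last by move=> t _; exact: Adim.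
rewrite -(pair_big_dep xpredT (fun j (k : 'I_Qn) => (k < p j i)%N) (fun j _ => vdim j M)) /=.
apply: eq_bigr => j _.
by rewrite -(big_ord_widen Qn (fun _ => vdim j M) (pQ j)) sum_nat_const card_ord.
Qed.
End Refl.
End Dim.

(** * Root system *)

Section Roots.
Variables (R : realType) (V : vectType R) (n : nat) (Phi : root_system V n).
Notation alpha := (alpha Phi).
Notation s i := (simple_refl Phi i).
Notation co j x := (coord (rs_simple Phi) j x).
Notation root x := (x \in rs_root Phi).
Notation pos := (pos_root Phi).
Notation B := (rs_form Phi).
Implicit Types (x y z : V) (i j k : 'I_n) (a b : seq 'I_n).

Lemma formD x y z : B (x + y) z = B x z + B y z.
Proof. by have := rs_form_linear Phi 1 x y z; rewrite scale1r mul1r. Qed.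
Lemma form0 z : B 0 z = 0.
Proof. by have := rs_form_linear Phi 0 0 0 z; rewrite scale0r addr0 mul0r add0r => E; apply: (addIr (B 0 z)); rewrite add0r -formD addr0. Qed.
Lemma formZ c x z : B (c *: x) z = c * B x z.
Proof. by have := rs_form_linear Phi c x 0 z; rewrite addr0 form0 addr0. Qed.
Lemma formN x z : B (- x) z = - B x z.
Proof. by rewrite -scaleN1r formZ mulN1r. Qed.
Lemma formBl x y z : B (x - y) z = B x z - B y z.
Proof. by rewrite formD formN. Qed.

Lemma formZr c x z : B z (c *: x) = c * B z x.
Proof. by rewrite !(rs_formC _ z) formZ. Qed.
Lemma formBr x y z : B z (x - y) = B z x - B z y.
Proof. by rewrite !(rs_formC _ z) formBl. Qed.

Lemma basisS : basis_of fullv (rs_simple Phi). Proof. exact: rs_simple_basis. Qed.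
Lemma freeS : free (rs_simple Phi). Proof. exact: basis_free basisS. Qed.
Lemma co_alpha j i : co j (alpha i) = (i == j)%:R.
Proof. by rewrite /Defs.alpha (tnth_nth 0) coord_free ?freeS // eq_sym. Qed.

Lemma co_sum x : x = \sum_i co i x *: alpha i.
Proof.
have xS : x \in <<rs_simple Phi>>%VS by rewrite (span_basis basisS) memvf.
by rewrite {1}(coord_span xS); apply: eq_bigr => i _; rewrite /Defs.alpha (tnth_nth 0).
Qed.

Lemma co_ext x y : (forall i, co i x = co i y) -> x = y.
Proof. by move=> xy; rewrite (co_sum x) (co_sum y); apply: eq_bigr => i _; rewrite xy. Qed.
Lemma root_neq0 x : root x -> x != 0.
Proof. by apply: contraTneq => ->; exact: rs_root0. Qed.
Lemma alpha_root i : root (alpha i).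
Proof. by apply: rs_simple_root; apply: mem_tnth. Qed.
Lemma alpha_neq0 i : alpha i != 0. Proof. exact/root_neq0/alpha_root. Qed.
Lemma alpha_gt0 i : 0 < B (alpha i) (alpha i). Proof. exact/rs_form_gt0/alpha_neq0. Qed.
Lemma pos_alpha i : pos (alpha i).
Proof. by rewrite /pos_root alpha_root; apply/forallP => j; rewrite co_alpha ler0n. Qed.

Lemma alpha_inj : injective alpha.
Proof.
move=> i j E; have := co_alpha j i; rewrite E co_alpha eqxx.
by case: eqP => // _ /eqP; rewrite oner_eq0.
Qed.

Lemma simpleE i x : s i x = x - (2 * B (alpha i) x / B (alpha i) (alpha i)) *: alpha i.
Proof. by rewrite lfunE. Qed.
Lemma simple_root i x : root x -> root (s i x).
Proof. by move=> xr; rewrite simpleE; apply: rs_reflect => //; exact: alpha_root. Qed.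

Lemma simple_alpha i : s i (alpha i) = - alpha i.
Proof.
rewrite simpleE mulfK ?gt_eqF ?alpha_gt0 //.
by rewrite scaler_nat mulr2n opprD addrA subrr add0r.
Qed.

Lemma simpleK i x : s i (s i x) = x.
Proof.
rewrite {1}(simpleE i x) linearB linearZ /= simple_alpha simpleE scalerN opprK.
by rewrite subrK.
Qed.

Lemma simple_inj i : injective (s i). Proof. exact: can_inj (simpleK i). Qed.

Lemma co_simple i j x : j != i -> co j (s i x) = co j x.
Proof.
by move=> ji; rewrite simpleE linearB linearZ /= co_alpha eq_sym (negbTE ji) mulr0 subr0.
Qed.

Lemma root_opp x : root x -> root (- x).
Proof.
move=> xr; have := rs_reflect xr xr.
have x0 := rs_form_gt0 Phi (root_neq0 xr).
by rewrite mulfK ?gt_eqF // scaler_nat mulr2n opprD addrA subrr add0r.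
Qed.

Lemma rootP x : root x -> pos x \/ pos (- x).
Proof.
move=> xr; have [H|H] := rs_simple_sign xr; [left|right]; rewrite /pos_root ?xr ?root_opp //=.
  by apply/forallP => i; have /natrP[m ->] := H i; rewrite ler0n.
by apply/forallP => i; have /natrP[m ->] := H i; rewrite ler0n.
Qed.

Lemma pos_root_root x : pos x -> root x. Proof. by case/andP. Qed.
Lemma pos_co i x : pos x -> 0 <= co i x. Proof. by case/andP => _ /forallP. Qed.

Lemma pos_anti x : pos x -> pos (- x) -> False.
Proof.
move=> px pnx; have /root_neq0/eqP := pos_root_root px; apply; apply: co_ext => i; rewrite linear0.
by apply/eqP; rewrite eq_le (pos_co _ px) -oppr_ge0 -linearN (pos_co _ pnx).
Qed.

Lemma pos_ex x : pos x -> exists i, 0 < co i x.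
Proof.
move=> px; apply: contrapT => H; have /root_neq0/eqP := pos_root_root px; apply.
apply: co_ext => i; rewrite linear0; apply/eqP; rewrite eq_le (pos_co _ px) andbT leNgt.
by apply/negP => H'; apply: H; exists i.
Qed.

Lemma pos_of_co i x : root x -> 0 < co i x -> pos x.
Proof.
move=> xr xi; have [//|pnx] := rootP xr; have := pos_co i pnx.
by rewrite linearN oppr_ge0 leNgt xi.
Qed.

Lemma pos_prop x y t : pos x -> pos y -> 0 < t -> x = t *: y -> x = y.
Proof.
move=> px py t0 E; have [|t1|t1] := rs_reduced (a := t) (pos_root_root py).
- by rewrite -E pos_root_root.
- by rewrite E t1 scale1r.
by move: t0; rewrite t1 oppr_gt0 ltNge ler01.
Qed.

Lemma pos_simple i x : pos x -> x != alpha i -> pos (s i x).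
Proof.
move=> px xi; have [j [ji xj]] : exists j, j != i /\ 0 < co j x.
  apply: contrapT => H; case/eqP: xi.
  have E : x = co i x *: alpha i.
    apply: co_ext => j; rewrite linearZ /= co_alpha; have [<-|ij] := eqVneq i j; first by rewrite mulr1.
    rewrite mulr0; apply/eqP; rewrite eq_le (pos_co _ px) andbT leNgt; apply/negP => xj.
    by apply: H; exists j; rewrite eq_sym.
  apply: (pos_prop px (pos_alpha i) _ E).
  have [k xk] := pos_ex px; have := xk; rewrite {1}E linearZ /= co_alpha.
  by case: eqP => [->|_]; rewrite ?mulr0 ?ltxx.
by apply: (@pos_of_co j); [exact/simple_root/pos_root_root | rewrite co_simple].
Qed.

Lemma cartan_co i j : (cartan Phi i j)%:~R = 2 * B (alpha i) (alpha j) / B (alpha i) (alpha i).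
Proof. by rewrite mxE floorK // rs_integral ?alpha_root. Qed.
Lemma simple_alphaE i j : s i (alpha j) = alpha j - (cartan Phi i j)%:~R *: alpha i.
Proof. exact: simple_reflE. Qed.

Lemma co_simple_i i x : co i (s i x) = - co i x - \sum_(j | j != i) (cartan Phi i j)%:~R * co j x.
Proof.
rewrite {1}(co_sum x) !linear_sum /= (bigD1 i) //= !linearZ /= simple_alpha linearN /= co_alpha eqxx.
rewrite mulrN1 -sumrN; congr (_ + _); apply: eq_bigr => j ji.
rewrite !linearZ /= simple_alphaE linearB linearZ /= !co_alpha (negbTE ji) eqxx mulr1 sub0r.
by rewrite mulrN mulrC.
Qed.

Lemma cartan_le0 i j : i != j -> cartan Phi i j <= 0.
Proof.
move=> ij; have ps : pos (s i (alpha j)).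
  by apply: pos_simple (pos_alpha j) _; apply: contra ij => /eqP/alpha_inj ->.
have := pos_co i ps; rewrite simple_alphaE linearB linearZ /= !co_alpha eqxx eq_sym (negbTE ij).
by rewrite mulr1 sub0r oppr_ge0 lerz0.
Qed.

(* Cauchy-Schwarz *)
Lemma cartan_lt4 i j : i != j -> cartan Phi i j * cartan Phi j i < 4.
Proof.
move=> ij; rewrite -(ltr_int R) rmorphM /= !cartan_co (rs_formC _ (alpha j) (alpha i)).
have gi := alpha_gt0 i; have gj := alpha_gt0 j.
set b := B (alpha i) (alpha j); set p := B (alpha i) (alpha i) in gi *.
set q := B (alpha j) (alpha j) in gj *.
have : 0 < B (p *: alpha j - b *: alpha i) (p *: alpha j - b *: alpha i).
  apply: rs_form_gt0; rewrite subr_eq0; apply/eqP => /(congr1 (fun x => co j x)).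
  rewrite !linearZ /= !co_alpha eqxx (negbTE ij) mulr0 mulr1 => E; by rewrite E ltxx in gi.
rewrite !(formBl, formBr, formZ, formZr) (rs_formC _ (alpha j) (alpha i)) -/b -/p -/q => H.
have H2 : 0 < p * q - b * b.
  rewrite -(pmulr_rgt0 _ gi); move: H; congr (0 < _); ring.
rewrite mulf_div -ltr_pdivlMr ?invr_gt0 ?mulr_gt0 // invrK.
by rewrite (_ : 4%:~R = 4 :> R) //; lra.
Qed.

Lemma cartan0 i j : cartan Phi i j = 0 -> cartan Phi j i = 0.
Proof.
move=> /(congr1 (fun z : int => z%:~R : R)); rewrite cartan_co => /eqP.
rewrite !mulf_eq0 pnatr_eq0 invr_eq0 (gt_eqF (alpha_gt0 i)) orbF /= => /eqP E.
by apply: (@intr_inj R); rewrite cartan_co rs_formC E mulr0 mul0r.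
Qed.

Lemma simple_commute i j : i != j ->
  (s i \o s j == s j \o s i)%VF = (cartan Phi i j == 0).
Proof.
move=> ij; apply/eqP/eqP => [E|cij].
  have := congr1 (fun f : 'End(V) => co i (f (alpha j))) E.
  rewrite !comp_lfunE simple_alpha linearN /= simple_alphaE !linearN linearB !linearB /= !linearZ /=.
  rewrite simple_alpha simple_alphaE !linearN !linearB !linearZ /= !co_alpha eqxx eq_sym (negbTE ij) => H.
  apply: (@intr_inj R); move: H; set t := (cartan Phi i j)%:~R; rewrite /=; move: t => t; lra.
have cji := cartan0 cij; apply/lfunP => x; rewrite !comp_lfunE !simpleE.
have Bij : B (alpha i) (alpha j) = 0.
  move: (cartan_co i j); rewrite cij => /esym/eqP.
  by rewrite !mulf_eq0 pnatr_eq0 invr_eq0 (gt_eqF (alpha_gt0 i)) orbF /= => /eqP.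
rewrite !formBr !formZr Bij (rs_formC _ (alpha j) (alpha i)) Bij !mulr0 !subr0.
by rewrite addrAC.
Qed.

Notation w a := (wprod Phi a).

Lemma wprod_cons i a x : w (i :: a) x = s i (w a x).
Proof. by rewrite /= comp_lfunE. Qed.
Lemma wprod_cat a b x : w (a ++ b) x = w a (w b x).
Proof. by elim: a => [|i a IH] /=; rewrite ?id_lfunE // !comp_lfunE IH. Qed.
Lemma wprod_rcons a i x : w (rcons a i) x = w a (s i x).
Proof. by rewrite -cats1 wprod_cat wprod_cons id_lfunE. Qed.

Lemma wprodK a : cancel (w a) (w (rev a)).
Proof.
by elim: a => [|i a IH] x; rewrite ?id_lfunE // rev_cons wprod_rcons wprod_cons simpleK IH.
Qed.

Lemma wprodKV a : cancel (w (rev a)) (w a).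
Proof. by move=> x; rewrite -{1}(revK a) wprodK. Qed.
Lemma wprod_inj a : injective (w a). Proof. exact: can_inj (wprodK a). Qed.

Lemma wprod_inv a x : ((w a)^-1)%VF x = w (rev a) x.
Proof.
apply: (@wprod_inj a); rewrite wprodKV limg_lfunVK //.
by apply/memv_imgP; exists (w (rev a) x); rewrite ?memvf // wprodKV.
Qed.

Lemma wprod_root a x : root x -> root (w a x).
Proof. by elim: a => [|i a IH] xr; rewrite ?id_lfunE // wprod_cons simple_root ?IH. Qed.

(** Left multiplication by s_i lengthens w exactly when w^-1(alpha_i) is positive; [reduced_wordP]
    identifies this recursion with minimal length. *)
Fixpoint red a := if a is i :: a' then red a' && pos (w (rev a') (alpha i)) else true.

Fixpoint invl a := if a is i :: a' then alpha i :: map (s i) (invl a') else [::].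

Lemma size_invl a : size (invl a) = size a.
Proof. by elim: a => //= i a <-; rewrite size_map. Qed.

Lemma invl_pos a : red a -> forall x, x \in invl a -> pos x && pos (- w (rev a) x).
Proof.
elim: a => //= i a IH /andP[/IH{}IH ai] x; rewrite in_cons => /orP[/eqP ->|/mapP[y /IH/andP[py pny] ->]].
  by rewrite pos_alpha rev_cons wprod_rcons simple_alpha linearN opprK.
rewrite rev_cons wprod_rcons simpleK pny andbT; apply: pos_simple => //.
by apply/eqP => E; apply: (pos_anti ai); rewrite -E.
Qed.

Lemma invl_inv a x : red a -> pos x -> pos (- w (rev a) x) -> x \in invl a.
Proof.
elim: a x => [|i a IH] x /=; first by rewrite id_lfunE => _ /pos_anti H /H.
move=> /andP[ra ai] px; rewrite rev_cons wprod_rcons => pnx.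
have [->|xi] := eqVneq x (alpha i); first by rewrite mem_head.
rewrite in_cons; apply/orP; right; apply/mapP; exists (s i x); last by rewrite simpleK.
by apply: IH => //; exact: pos_simple.
Qed.

Lemma inversionsE a : red a -> inversions Phi (w a) = [set` invl a]%classic.
Proof.
move=> ra; apply/seteqP; split=> x; rewrite /inversions /= wprod_inv.
  by move=> [px pnx]; exact: invl_inv.
by move=> /(invl_pos ra)/andP[].
Qed.

Lemma invl_uniq a : red a -> uniq (invl a).
Proof.
elim: a => //= i a IH /andP[ra ai]; rewrite map_inj_uniq ?IH ?andbT //; last exact: simple_inj.
apply/negP => /mapP[y /(invl_pos ra)/andP[py _] E].
apply: (pos_anti py); rewrite -(simpleK i y) -E simple_alpha opprK; exact: pos_alpha.
Qed.

Lemma invlP a x : x \in invl a -> exists u j v, a = u ++ j :: v /\ x = w u (alpha j).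
Proof.
elim: a x => //= i a IH x; rewrite in_cons => /orP[/eqP ->|/mapP[y /IH[u [j [v [-> ->]]]] ->]].
  by exists [::], i, a; rewrite id_lfunE.
by exists (i :: u), j, v; rewrite wprod_cons.
Qed.

Lemma mem_invl u j v : w u (alpha j) \in invl (u ++ j :: v).
Proof.
elim: u => [|i u IH]; first by rewrite id_lfunE mem_head.
by rewrite wprod_cons /= in_cons map_f ?orbT.
Qed.

Lemma form_simple i x y : B (s i x) (s i y) = B x y.
Proof.
rewrite !simpleE !(formBl, formBr, formZ, formZr) (rs_formC _ x (alpha i)).
have := alpha_gt0 i; set q := B (alpha i) (alpha i) => q0.
have : q != 0 by rewrite gt_eqF.
by move=> q1; field.
Qed.

Lemma form_wprod a x y : B (w a x) (w a y) = B x y.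
Proof. by elim: a => [|i a IH]; rewrite ?id_lfunE // !wprod_cons form_simple. Qed.
Lemma conj_refl u j i x : w u (alpha j) = alpha i -> s i (w u x) = w u (s j x).
Proof. by move=> E; rewrite (simpleE j) linearB linearZ /= simpleE -E !form_wprod. Qed.

(** Unlike [invl], this depends on the group element alone; its size is the Coxeter length, by which
    words are compared. *)
Definition Inv a := [seq x <- undup (rs_root Phi) | pos x && pos (- w (rev a) x)].

Lemma mem_Inv a x : (x \in Inv a) = pos x && pos (- w (rev a) x).
Proof.
rewrite mem_filter mem_undup; case: (boolP (pos x)) => //= px.
by rewrite (pos_root_root px) andbT.
Qed.

Lemma rev_eq a b : w a = w b -> w (rev a) = w (rev b).
Proof.
move=> E; apply/lfunP => x; apply: (@wprod_inj a).
by rewrite wprodKV E wprodKV.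
Qed.

Lemma Inv_eq a b : w a = w b -> Inv a = Inv b.
Proof. by move=> /rev_eq E; rewrite /Inv E. Qed.
Lemma wprod_ii i a : w (i :: i :: a) = w a.
Proof. by apply/lfunP => x; rewrite !wprod_cons simpleK. Qed.

Lemma size_Inv_cons i a : pos (w (rev a) (alpha i)) -> size (Inv (i :: a)) = (size (Inv a)).+1.
Proof.
move=> ai; have /perm_size -> : perm_eq (Inv (i :: a)) (alpha i :: map (s i) (Inv a)).
  apply: uniq_perm; first exact/filter_uniq/undup_uniq.
    rewrite /= map_inj_uniq ?filter_uniq ?undup_uniq ?andbT //; last exact: simple_inj.
    apply/negP => /mapP[y]; rewrite mem_Inv => /andP[py _] E.
    apply: (pos_anti py); rewrite -(simpleK i y) -E simple_alpha opprK; exact: pos_alpha.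
  move=> x; rewrite mem_Inv rev_cons wprod_rcons in_cons.
  have [->|xi] /= := eqVneq x (alpha i).
    by rewrite pos_alpha simple_alpha linearN opprK.
  apply/andP/mapP => [[px pnx]|[y]].
    by exists (s i x); rewrite ?simpleK // mem_Inv pos_simple.
  rewrite mem_Inv => /andP[py pny] ->; rewrite simpleK pny pos_simple //.
  by apply/eqP => E; apply: (pos_anti ai); rewrite -E.
by rewrite /= size_map.
Qed.

Lemma size_Inv_consN i a : ~~ pos (w (rev a) (alpha i)) -> size (Inv a) = (size (Inv (i :: a))).+1.
Proof.
move=> ai; rewrite -(Inv_eq (wprod_ii i a)) size_Inv_cons //.
rewrite rev_cons wprod_rcons simple_alpha linearN.
by have [pa|] := rootP (wprod_root (rev a) (alpha_root i)); first by rewrite pa in ai.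
Qed.

Lemma size_Inv a : (size (Inv a) <= size a)%N /\ (size (Inv a) == size a) = red a.
Proof.
elim: a => [|i a [IH1 IH2]] /=.
  suff -> : Inv [::] = [::] by [].
  apply/eqP; rewrite -[_ == _]negbK -has_filter; apply/negP => /hasP[x _ /andP[px]].
  by rewrite id_lfunE; exact: pos_anti.
have [ai|ai] := boolP (pos _); first by rewrite size_Inv_cons // ltnS eqSS IH2 andbT.
by rewrite andbF; have := size_Inv_consN ai; lia.
Qed.

Lemma red_eq a b : w a = w b -> size a = size b -> red a = red b.
Proof. by move=> E S; rewrite -(size_Inv a).2 -(size_Inv b).2 (Inv_eq E) S. Qed.

Lemma red_leq a b : red a -> w b = w a -> (size a <= size b)%N.
Proof.
by move=> ra E; rewrite -(eqP (etrans (size_Inv a).2 ra)) -(Inv_eq E); exact: (size_Inv b).1.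
Qed.

(** An inversion alpha_i of b has the form w_u(alpha_j); conjugating s_j by w_u gives s_i, so the
    letter j can be moved to the front as i. *)
Lemma exchange i b : red b -> alpha i \in invl b -> exists u j v,
  [/\ b = u ++ j :: v, w b = w (i :: u ++ v), red (i :: u ++ v) & size b = (size (u ++ v)).+1].
Proof.
move=> rb /invlP[u [j [v [bE E]]]]; exists u, j, v.
have wE : w b = w (i :: u ++ v).
  apply/lfunP => x; rewrite bE wprod_cons !wprod_cat wprod_cons.
  by rewrite (conj_refl _ (esym E)).
have sE : size b = (size (u ++ v)).+1 by rewrite bE !size_cat /= addnS.
by split=> //; rewrite -(red_eq wE sE).
Qed.

Lemma red_ex a : exists2 b, red b & w b = w a.
Proof.
elim: a => [|i a [b rb E]]; first by exists [::].
have [bi|bi] := boolP (pos (w (rev b) (alpha i))).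
  by exists (i :: b); rewrite /= ?rb ?bi // E.
have pnb : pos (- w (rev b) (alpha i)).
  by have [pb|] := rootP (wprod_root (rev b) (alpha_root i)); first by rewrite pb in bi.
have [u [j [v [bE wE ru sE]]]] := exchange rb (invl_inv rb (pos_alpha i) pnb).
exists (u ++ v); first by case/andP: ru.
by apply/lfunP => x; rewrite wprod_cons -E wE wprod_cons simpleK.
Qed.

Lemma reduced_wordP f a : reduced_word Phi f a <-> red a /\ w a = f.
Proof.
split=> [[<- amin]|[ra <-]]; last by split=> // b; exact: red_leq.
split=> //; have [b rb E] := red_ex a; rewrite -(size_Inv a).2 eqn_leq (size_Inv a).1 /=.
by rewrite -(Inv_eq E) (eqP (etrans (size_Inv b).2 rb)) amin.
Qed.

Lemma invl_eq a b : red a -> red b -> w a = w b -> invl a =i invl b.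
Proof.
move=> ra rb E x; apply/idP/idP => /(invl_pos _)/andP[]// px.
  by rewrite (rev_eq E); exact: invl_inv.
by rewrite -(rev_eq E); exact: invl_inv.
Qed.

(** The first letter of a gives an inversion of b, so by [exchange] b can be rewritten to begin with
    it, and the letter is cancelled. *)
Lemma red_inv_inj a b : red a -> red b -> invl a =i invl b -> w a = w b.
Proof.
elim: a b => [|i a IH] b ra rb ab.
  have : size (invl b) = 0%N by apply/eqP; rewrite size_eq0; case: (invl b) ab => // x l /(_ x); rewrite mem_head.
  by rewrite size_invl; case: b {rb ab}.
have [|u [j [v [bE wE rv sE]]]] := @exchange i b rb; first by rewrite -ab mem_head.
have bE' := invl_eq rb rv wE.
have ra' : red a by case/andP: ra.
have rv' : red (u ++ v) by case/andP: rv.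
rewrite wE; apply/lfunP => x; rewrite !wprod_cons; congr (s i _); congr (fun_of_lfun _ x).
apply: IH => // y; have := ab (s i y); rewrite bE' /= !in_cons !mem_map; try exact: simple_inj.
case: eqP => //= E _; have yE : y = - alpha i by rewrite -(simpleK i y) E simple_alpha.
apply/idP/idP => /invl_pos H; have /andP[py _] := H ltac:(done);
  by case: (pos_anti (pos_alpha i)); rewrite -yE.
Qed.

Lemma size_red_le a : red a -> (size a <= size (undup (rs_root Phi)))%N.
Proof.
rewrite -(size_Inv a).2 => /eqP <-.
by rewrite size_filter count_size.
Qed.

Lemma red_rcons b i : red b -> pos (w b (alpha i)) -> red (rcons b i).
Proof.
elim: b => [|k b IH] /=; first by rewrite id_lfunE pos_alpha.
move=> /andP[rb bk]; rewrite comp_lfunE => kbi.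
have bi : pos (w b (alpha i)).
  have [//|nbi] := rootP (wprod_root b (alpha_root i)).
  have [E|ne] := eqVneq (- w b (alpha i)) (alpha k).
    case: (pos_anti (pos_alpha i)); rewrite -(wprodK b (- alpha i)) linearN E; exact: bk.
  by have := pos_simple nbi ne; rewrite linearN => /(pos_anti kbi).
rewrite IH //= rev_rcons wprod_cons pos_simple //; apply/eqP => E.
have Ek : w b (alpha i) = alpha k by rewrite -E wprodKV.
by move: kbi; rewrite Ek simple_alpha => /(pos_anti (pos_alpha k)).
Qed.

Lemma co_wprod i a x : i \notin a -> co i (w a x) = co i x.
Proof.
elim: a => [|j a IH]; first by rewrite id_lfunE.
by rewrite in_cons negb_or => /andP[ij ia]; rewrite wprod_cons co_simple // IH.
Qed.

Fixpoint clpos a := if a is i :: a' then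
  (if i \in a' then [::] else [:: alpha i]) ++ map (s i) (clpos a') else [::].

Lemma clposP a x : reflect (exists u j v, [/\ a = u ++ j :: v, j \notin v & x = w u (alpha j)])
  (x \in clpos a).
Proof.
apply: (iffP idP).
  elim: a x => //= i a IH x; rewrite mem_cat => /orP[|/mapP[y /IH[u [j [v [-> jv ->]]]] ->]].
    case: ifP => // ia; rewrite mem_seq1 => /eqP ->.
    by exists [::], i, a; rewrite ia id_lfunE.
  by exists (i :: u), j, v; rewrite wprod_cons.
elim: a x => [|i a IH] x; first by case=> -[|? ?] [j [v []]].
case=> -[|k u] [j [v [/= [-> E] jv ->]]]; rewrite mem_cat.
  by rewrite E (negbTE jv) id_lfunE mem_head.
by rewrite comp_lfunE map_f ?orbT //; apply: IH; exists u, j, v.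
Qed.

Lemma clpos_invl a : {subset clpos a <= invl a}.
Proof. by move=> x /clposP[u [j [v [-> _ ->]]]]; exact: mem_invl. Qed.

(** Dual form of the fact that the positive roots of the cluster span the simple roots of the
    letters of a; linear forms can be composed with s_i in the induction. *)
Lemma clpos_span a (phi : {linear V -> R^o}) : (forall x, x \in clpos a -> phi x = 0) ->
  forall j, j \in a -> phi (alpha j) = 0.
Proof.
elim: a phi => //= i a IH phi H.
have key j : j \in a -> phi (s i (alpha j)) = 0.
  apply: (IH (phi \o s i)) => x xa /=; apply: H.
  by rewrite mem_cat map_f ?orbT.
have ai : phi (alpha i) = 0.
  have [ia|ia] := boolP (i \in a).
    by have := key i ia; rewrite simple_alpha linearN => /eqP; rewrite oppr_eq0 => /eqP.
  by apply: H; rewrite (negbTE ia) mem_cat mem_head.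
move=> j; rewrite in_cons => /orP[/eqP -> //|/key].
by rewrite simple_alphaE linearB linearZ /= ai scaler0 subr0.
Qed.

End Roots.

(** * Torsion classes of words *)

Section CartanData.
Variables (R : realType) (V : vectType R) (n : nat) (Phi : root_system V n).
Variables (d : 'I_n -> nat).
Hypothesis hd : is_symmetrizer Phi d.
Notation C := (cartan Phi).

Definition cox_p (i j : 'I_n) : nat := if i == j then 0%N else `|C i j|%N.

Lemma symmetrizerE i j : (d i)%:Z * C i j = (d j)%:Z * C j i.
Proof.
by have [_ /matrixP/(_ j i)] := hd; rewrite mul_diag_mx !mxE.
Qed.

Lemma cox_pE i j : i != j -> (cox_p i j)%:Z = - C i j.
Proof.
by move=> ij; rewrite /cox_p (negbTE ij) abszE ler0_norm ?cartan_le0.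
Qed.

Lemma cox_p_sym i j : (d i * cox_p i j = d j * cox_p j i)%N.
Proof.
rewrite /cox_p eq_sym; case: (eqVneq i j) => [->|ij]; first by [].
have := congr1 absz (symmetrizerE i j); by rewrite !abszM.
Qed.

(** By Cauchy-Schwarz p_ij p_ji < 4, hence one of them is 1; k is then d_i or d_j. *)
Lemma cox_p_d i j : (0 < cox_p i j)%N ->
  exists k, d i = (k * cox_p j i)%N /\ d j = (k * cox_p i j)%N.
Proof.
have [ij|ij] := eqVneq i j; first by rewrite ij /cox_p eqxx.
move=> p0; have di := hd.1 i; have dj := hd.1 j; have S := cox_p_sym i j.
have q0 : (0 < cox_p j i)%N by move: (muln_gt0 (d j) (cox_p j i)); rewrite -S muln_gt0 di p0 dj.
have : (cox_p i j * cox_p j i < 4)%N.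
  rewrite -ltz_nat PoszM cox_pE // cox_pE 1?eq_sym // mulrNN; exact: cartan_lt4.
have [E _|/eqP E] := eqVneq (cox_p j i) 1%N; first by exists (d i); rewrite E muln1 S E muln1.
move=> lt4; have E1 : cox_p i j = 1%N by nia.
by exists (d j); rewrite E1 muln1 -S E1 muln1.
Qed.

Lemma cox_pii i : cox_p i i = 0%N. Proof. by rewrite /cox_p eqxx. Qed.

Definition cox_data : gdata n := GData hd.1 cox_pii cox_p_d.

Lemma cox_p0 i j : i != j -> (0 < cox_p i j)%N = (C i j != 0).
Proof. by move=> ij; rewrite /cox_p (negbTE ij) absz_gt0. Qed.

Definition cox_arr (c : seq 'I_n) (j k : 'I_n) := (index j c < index k c)%N && (0 < cox_p j k)%N.

Lemma cox_mem (c : seq 'I_n) (j : 'I_n) : coxeter_word c -> j \in c.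
Proof. by move=> hc; rewrite (perm_mem hc) mem_enum. Qed.
Lemma cox_uniq (c : seq 'I_n) : coxeter_word c -> uniq c.
Proof. by move=> hc; rewrite (perm_uniq hc) enum_uniq. Qed.
Lemma cox_rot (i : 'I_n) (c : seq 'I_n) : coxeter_word (i :: c) -> coxeter_word (rcons c i).
Proof. by rewrite /coxeter_word perm_rcons. Qed.

Lemma cox_source (i : 'I_n) (c : seq 'I_n) : coxeter_word (i :: c) -> source_at cox_data i (cox_arr (i :: c)) (cox_arr (rcons c i)).
Proof.
move=> hc; have /= /andP[ic uc] := cox_uniq hc.
have mc j : j != i -> j \in c by move=> ji; have := cox_mem j hc; rewrite in_cons (negbTE ji).
have idx j : j != i -> index j (rcons c i) = index j c.
  by move=> ji; rewrite -cats1 index_cat mc.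
have idi : index i (rcons c i) = size c by rewrite -cats1 index_cat (negbTE ic) /= eqxx addn0.
split=> [j|j|j|j|j k ji ki]; rewrite /cox_arr /=.
- by rewrite eqxx; have [->|ji] := eqVneq i j; rewrite ?cox_pii.
- by rewrite eqxx ltn0.
- rewrite -(p_sym cox_data j i) /=; have [->|ji] := eqVneq j i; first by rewrite cox_pii andbF.
  by rewrite idi idx // index_mem mc.
- have [->|ji] := eqVneq j i; first by rewrite cox_pii andbF.
  by rewrite idi idx // ltnNge index_size.
by rewrite !(eq_sym i) (negbTE ji) (negbTE ki) ltnS !idx.
Qed.

Variable K : fieldType.
Notation rep := (rep K (gen n)).
Notation D := cox_data.
Notation rfl i c := (refl D i (cox_arr (i :: c)) (cox_arr (rcons c i))).
Notation alpha := (alpha Phi).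
Notation sr i := (simple_refl Phi i).
Notation co j x := (coord (rs_simple Phi) j x).
Notation pos := (pos_root Phi).
Notation wp a := (wprod Phi a).
Notation cls c J := (inC D (cox_arr c) J).
Notation e i v := (act _ (Ge i) v).
Implicit Types M N X Y Z : rep.
Implicit Types a b c : seq 'I_n.
Implicit Types T : rep -> Prop.

(** The dimension vector divided by the symmetrizer: the rank vector of a locally free module and,
    for bricks, a positive multiple of a root. *)
Definition rt M : V := \sum_j ((vdim j M)%:R / (d j)%:R) *: alpha j.

Lemma co_rt j M : co j (rt M) = (vdim j M)%:R / (d j)%:R.
Proof.
rewrite /rt linear_sum (bigD1 j) //= linearZ /= co_alpha eqxx mulr1 big1 ?addr0 // => k kj.
by rewrite linearZ /= co_alpha (negbTE kj) mulr0.
Qed.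

Lemma d_neq0 j : (d j)%:R != 0 :> R.
Proof. by rewrite pnatr_eq0 -lt0n; exact: hd.1. Qed.
Lemma co_rt_ge0 j M : 0 <= co j (rt M).
Proof. by rewrite co_rt divr_ge0 ?ler0n. Qed.
Lemma rt_iso o M N : crep D o M -> crep D o N -> iso M N -> rt M = rt N.
Proof. by move=> cM cN MN; apply: eq_bigr => j _; rewrite (vdim_iso j cM cN MN). Qed.

Lemma rt_srep i : rt (srep K i) = (d i)%:R^-1 *: alpha i.
Proof.
apply: (co_ext (Phi := Phi)) => j; rewrite co_rt linearZ /= co_alpha vdim_srep eq_sym.
by case: eqP => [->|_]; rewrite ?mul1r ?mulr1 // mul0r mulr0.
Qed.

Lemma rt_erep i : rt (erep K D i) = alpha i.
Proof.
apply: (co_ext (Phi := Phi)) => j; rewrite co_rt co_alpha vdim_erep eq_sym.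
by case: eqP => [->|_]; rewrite ?mul1n ?mulfV ?d_neq0 // mul0n mul0r.
Qed.

(** This is [refl_vdim] divided by d_i; the symmetrizer gives p_ji / d_i = p_ij / d_j, which matches
    the coefficients of s_i. *)
Lemma rt_refl i c M N : rfl i c M N -> rt N = sr i (rt M).
Proof.
move=> rMN; apply: (co_ext (Phi := Phi)) => j; have [->|ji] := eqVneq j i; last first.
  by rewrite co_simple // !co_rt (refl_vdim_off rMN).
rewrite co_simple_i !co_rt; have := refl_vdim rMN => /(congr1 (fun m : nat => m%:R : R)).
rewrite natrD natr_sum (bigD1 i) //= cox_pii mul0n add0r => E.
have -> : (vdim i N)%:R = \sum_(j | j != i) (cox_p j i * vdim j M)%:R - (vdim i M)%:R :> R.
  by rewrite -E addrC addKr.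
rewrite mulrBl addrC -mulNr; congr (_ + _); rewrite mulr_suml -sumrN; apply: eq_bigr => k ki.
rewrite co_rt -mulNr -mulrNz -cox_pE 1?eq_sym // natrM.
have := congr1 (fun m : nat => m%:R : R) (cox_p_sym i k); rewrite !natrM -pmulrn => S.
have dk := d_neq0 k; have di := d_neq0 i.
have -> : (cox_p k i)%:R = (d i)%:R * (cox_p i k)%:R / (d k)%:R :> R by rewrite S mulrC mulKf.
by field; rewrite dk di.
Qed.

Lemma rt0 o M : crep D o M -> rt M = 0 -> rep0 M.
Proof.
move=> cM E v; rewrite -(crep_1 cM v) big1 // => j _; apply: vdim_eq0 cM _ v.
have := co_rt j M; rewrite E linear0 => /esym/eqP; rewrite mulf_eq0 invr_eq0 (negbTE (d_neq0 j)) orbF.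
by rewrite pnatr_eq0 => /eqP.
Qed.

Lemma rt_co0 o M j : crep D o M -> co j (rt M) = 0 <-> forall v : M, e j v = 0.
Proof.
move=> cM; rewrite co_rt; split=> [/eqP|M0]; last by rewrite vdim0 // mul0r.
rewrite mulf_eq0 invr_eq0 (negbTE (d_neq0 j)) orbF pnatr_eq0 => /eqP; exact: vdim_eq0 cM.
Qed.

Section Src.
Variables (i : 'I_n) (c : seq 'I_n).
Hypothesis hc : coxeter_word (i :: c).
Let Hs := cox_source hc.
Let hc' := cox_rot hc.

Lemma crep_rot M : (forall v : M, e i v = 0) ->
  crep D (cox_arr (i :: c)) M <-> crep D (cox_arr (rcons c i)) M.
Proof.
move=> M0; split=> -[H1 H2 H3 H4 H5 H6]; split=> // j k v ojk.
  have [->|ji] := eqVneq j i; first by rewrite M0 !linear0.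
  have [->|ki] := eqVneq k i; first by rewrite M0.
  by apply: H5; rewrite (src_eq Hs).
have [->|ji] := eqVneq j i; first by rewrite M0 !linear0.
have [->|ki] := eqVneq k i; first by rewrite M0.
by apply: H5; rewrite -(src_eq Hs).
Qed.

Lemma cls_rot J M : cls (rcons c i) (J :\ i) M <-> cls (i :: c) J M /\ forall v : M, e i v = 0.
Proof.
split=> [[cM H]|[[cM H] M0]].
  have M0 (v : M) : e i v = 0 by apply: H; rewrite !inE eqxx.
  split=> //; split; first exact/crep_rot.
  by move=> j jJ; apply: H; rewrite !inE negb_and jJ orbT.
split; first exact/(crep_rot M0).
by move=> j; rewrite !inE negb_and negbK => /orP[/eqP ->|/H].
Qed.

Lemma tors_drop J T : tors (cls (rcons c i) (J :\ i)) T -> tors (cls (i :: c) J) T.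
Proof.
move=> [TC T0 Tq Te]; split=> // [M /TC/cls_rot[]//|L M N u q s CM TL TN].
apply: (Te _ _ _ u q s _ TL TN); apply/cls_rot; split=> // v.
have [uh um qh qe ex] := s.
have /ex[w wE] : q (e i v) = 0 by rewrite qh; have /cls_rot[_ ->] := TC _ TN.
by rewrite -(crep_eii _ _ CM.1) wE -uh; have /cls_rot[_ ->] := TC _ TL; rewrite linear0.
Qed.

(** Were M_i nonzero for some M in T, the source i would give M the quotient S_i. *)
Lemma tors_undrop J T : tors (cls (i :: c) J) T -> ~ T (srep K i) ->
  tors (cls (rcons c i) (J :\ i)) T.
Proof.
move=> [TC T0 Tq Te] Ti; split=> // [M TM|L M N u q s /cls_rot[CM _]]; last exact: Te s CM.
apply/cls_rot; split; first exact: TC.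
move=> v; apply: contrapT => /eqP ev; apply: Ti.
by have [f [fh fe]] := src_top Hs (TC _ TM).1 ev; exact: Tq fh fe TM.
Qed.

(** An extension of two modules of T lies in T, so it vanishes at i, and both ambient categories
    admit the same extensions. *)
Lemma extproj_drop J T X : tors (cls (rcons c i) (J :\ i)) T ->
  extproj (cls (rcons c i) (J :\ i)) T X <-> extproj (cls (i :: c) J) T X.
Proof.
move=> Tt; have Tt2 := tors_drop Tt; have [TC T0 Tq Te] := Tt.
split=> -[TX Xl]; last first.
  by split=> // L E Q u q f sq /cls_rot[CE _] TL fh; exact: (Xl _ _ _ _ _ _ sq CE TL fh).
apply: (extproj_split (@crep_amb K n D (cox_arr (i :: c)) J) Tt2) => // L E u q sq CE TL.
have TE : T E by have [_ _ _ Te2] := Tt2; exact: Te2 sq CE TL TX.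
have [h [hh hE]] := Xl _ _ _ _ _ _ sq (TC _ TE) TL (@hom1 _ _ X).
by exists h; split=> // v; rewrite hE id_lfunE.
Qed.

(** If X had a reflection, s_i would negate its only coordinate and produce a negative dimension. *)
Lemma srep_vertex X : crep D (cox_arr (i :: c)) X -> brick X -> (forall j, j != i -> co j (rt X) = 0) ->
  iso X (srep K i).
Proof.
move=> cX bX X0; have [//|[Y rXY]] := src_brick Hs cX bX.
have [P rP] := rXY; case: bX => X1 _; case: X1; apply: (rt0 cX).
have E : rt X = co i (rt X) *: alpha i.
  apply: (co_ext (Phi := Phi)) => j; rewrite linearZ /= co_alpha; case: eqP => [->|/eqP ji]; first by rewrite mulr1.
  by rewrite mulr0 X0 // eq_sym.
have := co_rt_ge0 i Y; rewrite (rt_refl rXY) E linearZ /= simple_alpha linearZ linearN /= co_alpha eqxx.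
rewrite mulrN1 oppr_ge0 => le0; have -> : co i (rt X) = 0; last by rewrite scale0r.
by apply/eqP; rewrite eq_le le0 co_rt_ge0.
Qed.

End Src.

(* The torsion class built from a word: at the source i of c either the simple S_i is
   not in it (and then nothing in it is supported at i), or it contains S_i and is
   obtained by reflecting a torsion class for the rotated word. *)
Inductive TD : seq 'I_n -> {set 'I_n} -> seq 'I_n -> (rep -> Prop) -> Prop :=
| TD0 c : TD c finset.set0 [::] (@rep0 K (gen n))
| TDdrop i c J a T : TD (rcons c i) (J :\ i) a T -> TD (i :: c) J a T
| TDtake i c (J : {set 'I_n}) a T : i \in J -> TD (rcons c i) J a T -> ~ T (srep K i) ->
    TD (i :: c) J (i :: a) (down D i (cox_arr (i :: c)) (cox_arr (rcons c i)) J T).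

Lemma TD_tors c J a T : TD c J a T -> coxeter_word c -> tors (cls c J) T.
Proof.
elim=> {c J a T} [c|i c J a T _ IH|i c J a T iJ _ IH _] hc.
- split=> // [M M0|M N f fh fe M0 y|L M N u q [uh um qh qe ex] CM L0 N0 v].
  + by have [C0 _ _] := crep_amb K D (cox_arr c) finset.set0; exact: C0.
  + by have [v <-] := fe y; rewrite (M0 v) linear0.
  by have /ex[w ->] := N0 (q v); rewrite (L0 w) linear0.
- by apply: (tors_drop hc); apply/IH/cox_rot.
exact: down_tors.
Qed.

(** A brick is S_i, which accounts for alpha_i, or reflects to a brick for the shorter word. The
    scalar t is there because bricks need not be locally free: for S_i it is 1 / d_i. *)
Lemma TD_bricks c J a T : TD c J a T -> coxeter_word c ->
  forall X, brick X -> T X -> exists t r, [/\ 0 < t, r \in invl Phi a & rt X = t *: r].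
Proof.
elim=> {c J a T} [c|i c J a T _ IH|i c J a T iJ td IH Ti] hc X bX TX.
- by case: bX.
- exact: IH (cox_rot hc) _ bX TX.
have Tt := TD_tors td (cox_rot hc); have CX := TX.1.
have [XS|[Y rXY]] := src_brick (cox_source hc) CX.1 bX.
  exists (d i)%:R^-1, (alpha i); rewrite mem_head invr_gt0 ltr0n hd.1; split=> //.
  by rewrite (rt_iso CX.1 (srep_in K D (cox_arr (i :: c)) iJ).1 XS) rt_srep.
have [||t [r [t0 rI E]]] := IH (cox_rot hc) Y; first exact/(refl_brick rXY).
  exact/(down_compat (cox_source hc) iJ Tt rXY).
exists t, (sr i r); split=> //; first by rewrite in_cons map_f ?orbT.
by rewrite -[LHS](simpleK Phi i) -(rt_refl rXY) E linearZ.
Qed.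

Lemma TD_bricks_ex c J a T : TD c J a T -> coxeter_word c ->
  forall r, r \in invl Phi a -> exists X t, [/\ brick X, T X, 0 < t & rt X = t *: r].
Proof.
elim=> {c J a T} [c|i c J a T _ IH|i c J a T iJ td IH Ti] hc r //; first exact: IH (cox_rot hc) r.
have Tt := TD_tors td (cox_rot hc).
rewrite in_cons => /orP[/eqP ->|/mapP[r' rI ->]].
  exists (srep K i), (d i)%:R^-1; rewrite rt_srep invr_gt0 ltr0n hd.1; split=> //; first exact: srep_brick.
  exact: down_srep.
have [Y [t [bY TY t0 E]]] := IH (cox_rot hc) r' rI.
have [X rXY] := snk_refl (cox_source hc) (let: And4 TC _ _ _ := Tt in TC _ TY).1 (tors_srep_free Tt Ti TY).
exists X, t; split=> //; first exact/(refl_brick rXY).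
  exact/(down_compat (cox_source hc) iJ Tt rXY).
by rewrite -[LHS](simpleK Phi i) -(rt_refl rXY) E linearZ.
Qed.

Lemma crep_single i o o' M : o i i = false -> (forall j (v : M), j != i -> e j v = 0) ->
  crep D o M -> crep D o' M.
Proof.
move=> oii M0 [H1 H2 H3 H4 H5 H6]; split=> // j k v _.
have [->|ji] := eqVneq j i; last by rewrite (M0 j) // !linear0.
have [->|ki] := eqVneq k i; last by rewrite (M0 k).
by apply: H5; rewrite oii.
Qed.

(** If prefixing i destroyed reducedness, alpha_i would be an inversion of a, hence proportional to
    [rt] of a brick in T; that brick would be S_i. *)
Lemma TD_red c J a T : TD c J a T -> coxeter_word c -> red Phi a.
Proof.
elim=> {c J a T} [c|i c J a T _ IH|i c J a T iJ td IH Ti] hc //; first exact/IH/cox_rot.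
have hc' := cox_rot hc; have ra := IH hc'; have Tt := TD_tors td hc'; rewrite /= ra /=.
have [//|pn] := rootP (wprod_root (rev a) (alpha_root Phi i)).
case: Ti; have [X [t [bX TX t0 E]]] := TD_bricks_ex td hc' (invl_inv ra (pos_alpha Phi i) pn).
have [TC _ _ _] := Tt; have CX := TC _ TX.
have X0 j : j != i -> co j (rt X) = 0.
  by move=> ji; rewrite E linearZ /= co_alpha eq_sym (negbTE ji) mulr0.
apply: (tors_iso Tt _ TX); apply: (srep_vertex hc) => //.
apply: (@crep_single i (cox_arr (rcons c i))) => //; first by rewrite /cox_arr ltnn.
  by move=> j v ji; apply/(rt_co0 j CX.1).1/X0.
exact: CX.1.
Qed.

Lemma rt_alpha i c X Y t : coxeter_word (i :: c) -> rfl i c X Y -> rt X = t *: alpha i -> rep0 X.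
Proof.
move=> hc rXY E; have [P rP] := rXY; apply: (rt0 (rfM rP)).
have := co_rt_ge0 i Y; have := co_rt_ge0 i X.
rewrite (rt_refl rXY) E !linearZ /= simple_alpha linearN /= co_alpha eqxx mulr1 mulrN1 => t0.
by rewrite oppr_ge0 => t1; have -> : t = 0; [apply/eqP; rewrite eq_le t0 t1 | rewrite scale0r].
Qed.

(** Membership in T is assumed of X and deduced for Y from its root alone; this is how bricks of one
    torsion class are found in another in [TD_le]. *)
Lemma TD_brick_iso c J a T : TD c J a T -> coxeter_word c ->
  forall X Y t, brick X -> T X -> brick Y -> cls c J Y -> 0 < t -> rt Y = t *: rt X -> iso X Y.
Proof.
elim=> {c J a T} [c|i c J a T td IH|i c J a T iJ td IH Ti] hc X Y t bX TX bY CY t0 E.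
- by case: bX.
- have [TC _ _ _] := TD_tors td (cox_rot hc); have /(cls_rot hc)[CX X0] := TC _ TX.
  apply: (IH (cox_rot hc) X Y t) => //; apply/(cls_rot hc); split=> // v.
  move: v; apply/(rt_co0 i CY.1); rewrite E linearZ /=.
  by have /(rt_co0 i CX.1) -> := X0; rewrite mulr0.
have Tt := TD_tors td (cox_rot hc); have CX := TX.1; have hs := cox_source hc.
have CS := srep_in K D (cox_arr (i :: c)) iJ.
have [XS|[X' rX]] := src_brick hs CX.1 bX; have [YS|[Y' rY]] := src_brick hs CY.1 bY.
- exact: iso_trans XS (iso_sym YS).
- case: bY => /(_ (@rt_alpha _ _ _ _ (t * (d i)%:R^-1) hc rY _)) [].
  by rewrite E (rt_iso CX.1 CS.1 XS) rt_srep scalerA.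
- case: bX => /(_ (@rt_alpha _ _ _ _ (t^-1 * (d i)%:R^-1) hc rX _)) [].
  by rewrite -scalerA -rt_srep -(rt_iso CY.1 CS.1 YS) E scalerA mulVf ?scale1r // gt_eqF.
apply/(refl_iso rX rY); apply: (IH (cox_rot hc) X' Y' t) => //.
- exact/(refl_brick rX).
- exact/(down_compat hs iJ Tt rX).
- exact/(refl_brick rY).
- exact/(refl_inC iJ rY).
by rewrite (rt_refl rX) (rt_refl rY) E linearZ.
Qed.

Lemma TD_le c J a T b T2 : coxeter_word c -> TD c J a T -> TD c J b T2 ->
  (forall M, T M -> T2 M) <-> {subset invl Phi a <= invl Phi b}.
Proof.
move=> hc td td2; have Tt := TD_tors td hc; have Tt2 := TD_tors td2 hc.
have ra := TD_red td hc; have rb := TD_red td2 hc; split=> H.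
  move=> r rI; have [X [t [bX TX t0 E]]] := TD_bricks_ex td hc rI.
  have [t' [r' [t'0 r'I E']]] := TD_bricks td2 hc bX (H _ TX).
  suff -> : r = r' by [].
  have /andP[pr _] := invl_pos ra rI; have /andP[pr' _] := invl_pos rb r'I.
  apply: (@pos_prop _ _ _ Phi _ _ (t^-1 * t') pr pr'); first by rewrite mulr_gt0 ?invr_gt0.
  by rewrite -scalerA -E' E scalerA mulVf ?scale1r // gt_eqF.
apply: (tors_brick_le (@crep_amb K n D (cox_arr c) J) Tt Tt2) => X bX TX.
have [t [r [t0 /H rI E]]] := TD_bricks td hc bX TX.
have [Y [t' [bY TY t'0 E']]] := TD_bricks_ex td2 hc rI.
have [TC _ _ _] := Tt.
apply: (tors_iso Tt2 _ TY); apply: (TD_brick_iso td2 hc (t := t * t'^-1) bY TY bX (TC _ TX)).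
  by rewrite mulr_gt0 ?invr_gt0.
by rewrite E' scalerA mulfVK // gt_eqF.
Qed.

Lemma TD_uniq c J a T b T2 : coxeter_word c -> TD c J a T -> TD c J b T2 ->
  wp a = wp b -> T = T2.
Proof.
move=> hc td td2 ab; have E := invl_eq (TD_red td hc) (TD_red td2 hc) ab.
apply/funext => M; apply/propext; split.
  by move: M; apply/(TD_le hc td td2) => x; rewrite E.
by move: M; apply/(TD_le hc td2 td) => x; rewrite E.
Qed.

Lemma TD_supp0 c J a T j : TD c J a T -> coxeter_word c -> j \notin a ->
  forall M, T M -> forall v : M, e j v = 0.
Proof.
elim=> {c J a T} [c|i c J a T td IH|i c J a T iJ td IH Ti] hc.
- by move=> _ M M0 v; rewrite (M0 v) linear0.
- exact: IH (cox_rot hc).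
rewrite in_cons negb_or => /andP[ji ja] M TM v; have hs := cox_source hc.
have Tt := TD_tors td (cox_rot hc); have CM := TM.1.
have [U [M1 [u [q [[uh um qh qe ex] [CU Ue] CM1 [N rN]]]]]] := src_decomp hs iJ CM.
have [_ _ Tq _] := down_tors D i (cox_arr (i :: c)) (cox_arr (rcons c i)) J T.
have TN : T N by apply/(down_compat hs iJ Tt rN); apply: Tq qh qe TM.
have M1j (w : M1) : e j w = 0.
  apply: (vdim_eq0 CM1.1); rewrite -(refl_vdim_off rN) //.
  exact/vdim0/(IH (cox_rot hc) ja _ TN).
have /ex[w wE] : q (e j v) = 0 by rewrite qh M1j.
by rewrite -(crep_eii _ _ CM.1) wE [w]Ue uh (crep_eij _ CM.1) // eq_sym.
Qed.

Lemma TD_supp_ex c J a T j : TD c J a T -> coxeter_word c -> j \in a ->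
  exists M, T M /\ exists v : M, e j v != 0.
Proof.
(* Cut at the first occurrence of j: the inversion w_u(alpha_j) has coefficient 1 at alpha_j because
   u does not contain j. *)
move=> td hc ja; set u := take (index j a) a; set v := drop (index j a).+1 a.
have aE : a = u ++ j :: v.
  by rewrite -[LHS](cat_take_drop (index j a)) (drop_nth j) ?index_mem // nth_index.
have ju : j \notin u by rewrite in_take_leq ?index_size // ltnn.
have [X [t [bX TX t0 E]]] := TD_bricks_ex td hc (r := wp u (alpha j)) ltac:(rewrite aE; exact: mem_invl).
exists X; split=> //; apply: contrapT => H.
have [TC _ _ _] := TD_tors td hc.
have : co j (rt X) = 0.
  apply/(rt_co0 j (TC _ TX).1) => x; apply/eqP/negPn/negP => H'; apply: H; by exists x.
rewrite E linearZ /= co_wprod // co_alpha eqxx mulr1 => E0.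
by rewrite E0 ltxx in t0.
Qed.

(** The four facts are proved together, since local freeness for the shorter word is what allows
    Ext-projectives to be lifted. The recursion of [clpos] adds alpha_i exactly when i is not a
    later letter, that is, when the smaller torsion class vanishes at i, which is also when [erep]
    is Ext-projective. *)
Lemma TD_extproj c J a T : TD c J a T -> coxeter_word c ->
  [/\ forall X, extproj (cls c J) T X -> locfree D X,
      forall X, extproj (cls c J) T X -> indec X -> rt X \in clpos Phi a,
      forall X Y, extproj (cls c J) T X -> indec X -> extproj (cls c J) T Y -> indec Y ->
        rt X = rt Y -> iso X Y
    & forall x, x \in clpos Phi a -> exists X, [/\ extproj (cls c J) T X, indec X & rt X = x] ].
Proof.
elim=> {c J a T} [c|i c J a T td IH|i c J a T iJ td IH Ti] hc.
- split=> // [X [X0 _] j|X [X0 _] []//|X Y [X0 _] []//].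
  exists 0; split=> [v|v _]; last by rewrite (X0 v) [RHS]X0.
  by rewrite zero_lfunE linear0.
- have [IH1 IH2 IH3 IH4] := IH (cox_rot hc); have ed := extproj_drop hc _ (TD_tors td (cox_rot hc)).
  split=> [X /ed|X /ed|X Y /ed eX iX /ed|x /IH4[X [/ed]]]; [exact: IH1|exact: IH2|exact: IH3|].
  by exists X.
have hs := cox_source hc; have hc' := cox_rot hc; have Tt' := TD_tors td hc'.
pose T1 := down D i (cox_arr (i :: c)) (cox_arr (rcons c i)) J T.
have Tt : tors (cls (i :: c) J) T1 by exact: down_tors.
have T1i : T1 (srep K i) by exact: down_srep.
have mt M N : rfl i c M N -> T1 M <-> T N by move=> r; exact: down_compat r.
have [IH1 IH2 IH3 IH4] := IH hc'.
have ia : (forall N, T N -> forall v : N, e i v = 0) -> i \notin a.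
  move=> T0; apply/negP => /(TD_supp_ex td hc')[M [TM [v]]].
  by rewrite (T0 _ TM) eqxx.
have main X : extproj (cls (i :: c) J) T1 X -> indec X -> _ :=
  fun eX iX => extproj_indec hs iJ Tt Tt' T1i Ti mt eX iX IH1.
have CE := erep_in K D (i := i) (cox_arr (i :: c)) iJ.
have T1C X : T1 X -> cls (i :: c) J X by case.
split.
- move=> X eX; have CX := T1C _ eX.1.
  have [U [M1 [u [q [uq [CU Ue] CM1 [N rN]]]]]] := src_decomp hs iJ CX.
  have eN := extproj_down hs Tt Tt' Ti mt eX uq Ue rN.
  exact: (extproj_locfree hs iJ Tt T1i eX uq Ue rN (IH1 _ eN)).
- move=> X eX iX; have CX := T1C _ eX.1; rewrite /= mem_cat.
  have [_ [[N [rXN eN]]|[XE /ia ia']]] := main X eX iX.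
    rewrite -[rt X](simpleK Phi i) -(rt_refl rXN) map_f ?orbT //.
    by apply: IH2 eN _; exact/(refl_indec rXN).
  by rewrite (negbTE ia') -(rt_iso CE.1 CX.1 XE) rt_erep mem_head.
- move=> X Y eX iX eY iY E; have CX := T1C _ eX.1; have CY := T1C _ eY.1.
  have [_ [[X' [rX eX']]|[XE _]]] := main X eX iX; have [_ [[Y' [rY eY']]|[YE _]]] := main Y eY iY.
  + apply/(refl_iso rX rY); apply: IH3 => //; [exact/(refl_indec rX)|exact/(refl_indec rY)|].
    by rewrite (rt_refl rX) (rt_refl rY) E.
  + case: iX => /(_ (@rt_alpha _ _ _ _ 1 hc rX _)) [].
    by rewrite E -(rt_iso CE.1 CY.1 YE) rt_erep scale1r.
  + case: iY => /(_ (@rt_alpha _ _ _ _ 1 hc rY _)) [].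
    by rewrite -E -(rt_iso CE.1 CX.1 XE) rt_erep scale1r.
  exact: iso_trans (iso_sym XE) YE.
move=> x /=; rewrite mem_cat => /orP[|/mapP[y /IH4[N [eN iN E]] ->]].
  case: ifP => // ia'; rewrite mem_seq1 => /eqP ->.
  exists (erep K D i); split; [|exact: erep_indec|exact: rt_erep].
  apply: (erep_up hs iJ Tt T1i mt) => N TN; exact: TD_supp0 td hc' (negbT ia') N TN.
have [M [rM TM]] := tors_refl_back hs Tt' Ti mt eN.1.
exists M; split; [exact: (extproj_up hs iJ Tt Tt' mt eN (IH1 _ eN) rM) | exact/(refl_indec rM) |].
by rewrite -[LHS](simpleK Phi i) -(rt_refl rM) E.
Qed.

(** When i is taken, T2 contains S_i because some Ext-projective is nonzero at the source i; then
    [up] of T2 contains the Ext-projectives of the smaller class, and induction applies. *)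
Lemma TD_gen c J a T T2 : TD c J a T -> coxeter_word c -> tors (cls c J) T2 ->
  (forall X, extproj (cls c J) T X -> indec X -> T2 X) -> forall M, T M -> T2 M.
Proof.
move=> td; elim: td T2 => {c J a T} [c|i c J a T td IH|i c J a T iJ td IH Ti] T2 hc Tt2 gT2.
- by move=> M M0; have [_ H _ _] := Tt2; exact: H.
- have Tt := TD_tors td (cox_rot hc); have [TC T0 Tq Te] := Tt; have [TC2 T20 T2q T2e] := Tt2.
  (* T2 is cut down to the modules vanishing at i, a torsion class for the rotated word. *)
  pose T3 M := T2 M /\ forall v : M, e i v = 0.
  suff H M : T M -> T3 M by move=> M /H[].
  move: M; apply: (IH T3 (cox_rot hc)).
    split=> [M [TM M0]|M M0|M N f fh fe [TM M0]|L M N u q sq CM [TL L0] [TN N0]].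
    + by apply/(cls_rot hc); split; [exact: TC2|].
    + by split; [exact: T20 | move=> v; rewrite (M0 v) linear0].
    + by split; [exact: T2q fh fe TM | move=> y; have [v <-] := fe y; rewrite -fh M0 linear0].
    have /(cls_rot hc)[CM' M0] := CM; split=> //; exact: T2e sq CM' TL TN.
  move=> X eX iX; split; last by have /(cls_rot hc)[] := TC _ eX.1.
  by apply: gT2 => //; exact/extproj_drop.
have hs := cox_source hc; have hc' := cox_rot hc; have Tt' := TD_tors td hc'.
have [_ _ _ E4] := TD_extproj (TDtake iJ td Ti) hc.
have T2i : T2 (srep K i).
  have [X [eX iX [v ev]]] : exists X, [/\ extproj (cls (i :: c) J) (down D i (cox_arr (i :: c)) (cox_arr (rcons c i)) J T) X, indec X & exists v : X, e i v != 0].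
    (* Otherwise the i-th coordinate would vanish on the positive roots of the cluster, whose span
       contains alpha_i. *)
    apply: contrapT => H; have := co_alpha Phi i i; rewrite eqxx => E1.
    have [|f fE] := @lin_ex R V R^o (fun x => co i x : R^o).
      by move=> t x y; rewrite linearP.
    have : f (alpha i) = 0.
      apply: (@clpos_span _ _ _ Phi (i :: a)); last by rewrite mem_head.
      move=> x /E4[X [eX iX <-]]; apply: (etrans (fE _)); apply/(rt_co0 i eX.1.1.1) => v.
      by apply/eqP/negPn/negP => ev; apply: H; exists X; split=> //; exists v.
    by rewrite fE E1 => /eqP; rewrite oner_eq0.
  have [f [fh fe]] := src_top hs eX.1.1.1 ev.
  by have [_ _ T2q _] := Tt2; exact: T2q fh fe (gT2 _ eX iX).
have [E1 _ _ _] := TD_extproj td hc'.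
pose T1 := down D i (cox_arr (i :: c)) (cox_arr (rcons c i)) J T.
have Tt : tors (cls (i :: c) J) T1 by exact: down_tors.
have T1i : T1 (srep K i) by exact: down_srep.
have mt M N : rfl i c M N -> T1 M <-> T N by move=> r; exact: down_compat r.
have Tup : forall N, T N -> up D i (cox_arr (i :: c)) (cox_arr (rcons c i)) J T2 N.
  apply: (IH _ hc'); first exact: up_tors.
  move=> N eN iN; have [M [rM TM]] := tors_refl_back hs Tt' Ti mt eN.1.
  apply/(up_compat hs iJ Tt2 T2i rM); apply: gT2; last exact/(refl_indec rM).
  exact: (extproj_up hs iJ Tt Tt' mt eN (E1 _ eN) rM).
apply: (tors_brick_le (@crep_amb K n D (cox_arr (i :: c)) J) Tt Tt2) => X bX TX.
have [XS|[Y rX]] := src_brick hs TX.1.1 bX; first exact: tors_iso Tt2 (iso_sym XS) T2i.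
by apply/(up_compat hs iJ Tt2 T2i rX); apply: Tup; apply/(down_compat hs iJ Tt' rX).
Qed.

(* b records the reflections already performed. *)
Lemma TD_surj_aux m c J T b : coxeter_word c -> tors (cls c J) T -> red Phi b ->
  (forall M, T M -> forall j, 0 <= co j (wp b (rt M))) ->
  (((size (undup (rs_root Phi)) - size b) + #|J|) * n.+1 + find (mem J) c < m)%N ->
  exists a, TD c J a T.
Proof.
(* The measure is lexicographic. A reflection lengthens the reduced word b, whose length is bounded
   by the number of roots; dropping a letter of J shrinks J; dropping any other letter brings the
   first letter of J one place closer to the front of c. *)
elim: m c J T b => // m IH c J T b hc Tt rb bT lt_m.
have [J0|[j0 jJ]] := set_0Vmem J.
  exists [::]; have -> : T = @rep0 K (gen n); last by rewrite J0; constructor.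
  apply/funext => M; apply/propext; split=> [TM v|M0]; last by have [_ H _ _] := Tt; exact: H.
  have [TC _ _ _] := Tt; have [cM H] := TC _ TM.
  by rewrite -(crep_1 cM v) big1 // => j _; apply: H; rewrite J0 inE.
case: c hc Tt lt_m => [|i c] hc Tt lt_m; first by have := cox_mem j0 hc.
have hc' := cox_rot hc; have hs := cox_source hc.
have sz : size (rcons c i) = n by rewrite (perm_size hc') size_enum_ord.
have fc : (find (mem J) (rcons c i) < n)%N.
  suff : (find (mem J) (rcons c i) < size (rcons c i))%N by move=> /leq_trans; apply; rewrite sz.
  by rewrite -has_find; apply/hasP; exists j0 => //; exact: cox_mem.
have [Ti|Ti] := pselect (T (srep K i)).
  have iJ : i \in J.
    have [TC _ _ _] := Tt; have [_ H] := TC _ Ti; apply/negPn/negP => /H/(_ (1 : K^o)).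
    by rewrite /= eqxx id_lfunE => /eqP; rewrite oner_eq0.
  (* w_b sends the positive multiple alpha_i / d_i, which belongs to S_i in T, to a vector with
     nonnegative coordinates; so b can be extended by i. *)
  have pbi : pos (wp b (alpha i)).
    have := wprod_root b (alpha_root Phi i) => /rootP[//|pn].
    have [j pj] := pos_ex pn; have := bT _ Ti j.
    rewrite rt_srep !linearZ /= pmulr_rge0 ?invr_gt0 ?ltr0n ?hd.1 //.
    by move: pj; rewrite linearN oppr_gt0 ltNge => /negbTE ->.
  have rbi := red_rcons rb pbi.
  have [|N TN j||a td] := IH _ J (up D i (cox_arr (i :: c)) (cox_arr (rcons c i)) J T) (rcons b i) hc' _ rbi.
  - exact: up_tors.
  - have [M rM] := snk_refl hs (let: And3 CN _ _ := TN in CN).1 (let: And3 _ H _ := TN in H).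
    rewrite wprod_rcons (rt_refl rM) simpleK; apply: bT.
    exact/(up_compat hs iJ Tt Ti rM).
  - have := size_red_le rbi; rewrite size_rcons => sb.
    have E : (size (undup (rs_root Phi)) - size b = (size (undup (rs_root Phi)) - (size b).+1).+1)%N by lia.
    move: lt_m; rewrite E addSn mulSn; move: fc; lia.
  exists (i :: a); have -> : T = down D i (cox_arr (i :: c)) (cox_arr (rcons c i)) J (up D i (cox_arr (i :: c)) (cox_arr (rcons c i)) J T).
    by apply/funext => M; apply/propext; exact: down_up.
  by constructor=> //; exact: up_srep.
have [|a td] := IH _ (J :\ i) T b hc' (tors_undrop hc Tt Ti) rb bT; last by exists a; constructor.
have [iJ|iJ] := boolP (i \in J).
  have := cardsD1 i J; rewrite iJ add1n => E.
  have fc' : (find (mem (J :\ i)) (rcons c i) <= n)%N.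
    apply: leq_trans (find_size _ _) _; by rewrite sz.
  move: lt_m; rewrite E addnS mulSn; move: fc'.
  set A := ((_ + #|J :\ i|) * n.+1)%N; move: (find _ _) (find _ _) => f1 f2 le1 le2.
  by apply: leq_ltn_trans (_ : A + n < m)%N; rewrite ?leq_add2l //; lia.
have JE : J :\ i = J by apply/setP => k; rewrite !inE; case: eqP => // ->; rewrite (negbTE iJ).
rewrite JE; move: lt_m => /=; rewrite (negbTE iJ).
have -> : find (mem J) (rcons c i) = find (mem J) c; last by rewrite addnS ltnS.
have hJ : has (mem J) c.
  apply/hasP; exists j0 => //; have := cox_mem j0 hc; rewrite in_cons => /orP[/eqP E|//].
  by rewrite -E jJ in iJ.
by rewrite -cats1 find_cat hJ.
Qed.

Lemma TD_surj c J T : coxeter_word c -> tors (cls c J) T -> exists a, TD c J a T.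
Proof.
move=> hc Tt; apply: (@TD_surj_aux _ c J T [::] hc Tt) => // M TM j.
by rewrite id_lfunE co_rt_ge0.
Qed.

End CartanData.

(** * Sortable elements *)

Section Sortable.
Variables (R : realType) (V : vectType R) (n : nat) (Phi : root_system V n).
Notation alpha := (alpha Phi).
Notation co j x := (coord (rs_simple Phi) j x).
Notation wp a := (wprod Phi a).
Notation red := (red Phi).
Notation invl := (invl Phi).
Implicit Types (i j k : 'I_n) (a b : seq 'I_n) (J : {set 'I_n}).

Lemma invl_letters a j : red a -> (j \in a) <-> exists2 r, r \in invl a & co j r != 0.
Proof.
move=> ra; split=> [ja|[r /invlP[u [k [v [-> ->]]]]]].
  exists (wp (take (index j a) a) (alpha j)).
    rewrite -[in invl _](cat_take_drop (index j a) a) (drop_nth j) ?index_mem // nth_index //.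
    exact: mem_invl.
  by rewrite co_wprod ?co_alpha ?eqxx ?oner_eq0 // in_take_leq ?index_size // ltnn.
rewrite mem_cat in_cons; case: (boolP (j \in u)) => //= ju.
by rewrite co_wprod // co_alpha pnatr_eq0 eqb0 negbK eq_sym => ->.
Qed.

Lemma red_letters a b : red a -> red b -> wp a = wp b -> a =i b.
Proof.
move=> ra rb ab j; have E := invl_eq ra rb ab.
apply/idP/idP => [/(invl_letters j ra)|/(invl_letters j rb)] [r rI cr].
  by apply/(invl_letters j rb); exists r; rewrite // -E.
by apply/(invl_letters j ra); exists r; rewrite // E.
Qed.

(** The shape of [TD] without the torsion classes: once the first letter of c is skipped it leaves J
    and can never be used again, which expresses the nesting of the blocks. *)
Inductive deriv : seq 'I_n -> {set 'I_n} -> seq 'I_n -> Prop :=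
| deriv0 c J : deriv c J [::]
| deriv_drop i c J a : deriv (rcons c i) (J :\ i) a -> deriv (i :: c) J a
| deriv_take i c J a : i \in J -> deriv (rcons c i) J a -> red (i :: a) ->
    deriv (i :: c) J (i :: a).

Lemma deriv_red c J a : deriv c J a -> red a.
Proof. by elim. Qed.

Lemma deriv_sub c J a : deriv c J a -> {subset a <= J}.
Proof.
elim=> {c J a} [c J|i c J a _ IH|i c J a iJ _ IH _] j //; first by move=> /IH; rewrite !inE => /andP[].
by rewrite in_cons => /orP[/eqP ->//|/IH].
Qed.

Section Positions.
Variable c : seq 'I_n.
Hypothesis hc : coxeter_word c.

(* The letters of a are taken at the positions ts, all at least t, and a letter which is
   skipped once is never taken afterwards. *)
Inductive pderiv : nat -> {set 'I_n} -> seq 'I_n -> seq nat -> Prop :=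
| pderiv0 t J : pderiv t J [::] [::]
| pderiv_drop i t J a ts : index i c = (t %% n)%N -> pderiv t.+1 (J :\ i) a ts -> pderiv t J a ts
| pderiv_take i t J a ts : index i c = (t %% n)%N -> i \in J -> pderiv t.+1 J a ts ->
    red (i :: a) -> pderiv t J (i :: a) (t :: ts).

Lemma size_c : size c = n. Proof. by rewrite (perm_size hc) size_enum_ord. Qed.
Lemma idx_inj i j : index i c = index j c -> i = j.
Proof. by move=> ij; rewrite -(nth_index i (cox_mem i hc)) ij nth_index // cox_mem. Qed.

Lemma letter_ex t : (0 < n)%N -> exists i, index i c = (t %% n)%N.
Proof.
move=> n0; have i0 := Ordinal n0; exists (nth i0 c (t %% n)).
by rewrite index_uniq ?size_c ?ltn_mod // cox_uniq.
Qed.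

Lemma rot_next i t : index i c = (t %% n)%N ->
  exists c0, rot (t %% n) c = i :: c0 /\ rot (t.+1 %% n) c = rcons c0 i.
Proof.
move=> ic; have n0 : (0 < n)%N by apply: leq_ltn_trans (ltn_ord i).
have tn : (t %% n < size c)%N by rewrite size_c ltn_mod.
have E : rot (t %% n) c = i :: (drop (t %% n).+1 c ++ take (t %% n) c).
  by rewrite /rot (drop_nth i tn) -ic nth_index ?(cox_mem i hc).
exists (drop (t %% n).+1 c ++ take (t %% n) c); split=> //.
have E1 : rot (t %% n).+1 c = rcons (drop (t %% n).+1 c ++ take (t %% n) c) i.
  by rewrite rotS // E rot1_cons.
have -> : (t.+1 %% n = (t %% n).+1 %% n)%N by rewrite -addn1 -modnDml addn1.
have [E2|E2] := eqVneq (t %% n).+1 n; first by rewrite -E1 E2 modnn rot0 rot_oversize ?size_c.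
by rewrite modn_small // ltn_neqAle E2 ltn_mod.
Qed.

Lemma pderiv_deriv t J a ts : pderiv t J a ts -> deriv (rot (t %% n) c) J a.
Proof.
elim=> {t J a ts} [t J|i t J a ts it _ IH|i t J a ts it iJ _ IH ra]; first exact: deriv0.
  by have [c0 [-> E]] := rot_next it; apply: deriv_drop; rewrite -E.
by have [c0 [-> E]] := rot_next it; apply: deriv_take; rewrite -?E.
Qed.

Lemma deriv_pderiv c' J a : deriv c' J a ->
  forall t, c' = rot (t %% n) c -> exists ts, pderiv t J a ts.
Proof.
elim=> {c' J a} [c' J|i c' J a _ IH|i c' J a iJ _ IH ra] t E; first by exists [::]; constructor.
all: have n0 : (0 < n)%N by apply: leq_ltn_trans (ltn_ord i).
all: have [j jt] := letter_ex t n0; have [c0 [E1 E2]] := rot_next jt.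
all: move: E; rewrite E1 => -[ij cc]; subst j c0.
  have [|ts H] := IH t.+1; first by rewrite E2.
  by exists ts; apply: pderiv_drop jt H.
have [|ts H] := IH t.+1; first by rewrite E2.
by exists (t :: ts); apply: pderiv_take jt iJ H ra.
Qed.

Lemma pderiv_red t J a ts : pderiv t J a ts -> red a.
Proof. by move=> /pderiv_deriv/deriv_red. Qed.
Lemma pderiv_sub t J a ts : pderiv t J a ts -> {subset a <= J}.
Proof. by move=> /pderiv_deriv/deriv_sub. Qed.

Lemma pderiv_ge t J a ts : pderiv t J a ts -> all (leq t) ts.
Proof.
elim=> {t J a ts} [t J|i t J a ts _ _ IH|i t J a ts _ _ _ IH _] //=.
  by apply: sub_all IH => u; exact: ltnW.
by rewrite leqnn; apply: sub_all IH => u; exact: ltnW.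
Qed.

Lemma pderiv_embedding t J a ts : pderiv t J a ts -> embedding c a ts.
Proof.
elim=> {t J a ts} [t J|//|i t J a ts it _ H [IH1 IH2] _]; first by split.
split; last by rewrite /= IH2 it.
by rewrite /= path_sortedE ?IH1 ?andbT ?(pderiv_ge H) //; exact: ltn_trans.
Qed.

Lemma pderiv_block t J a ts : pderiv t J a ts ->
  forall u, u \in ts -> (t + n <= u)%N -> (u - n)%N \in ts.
Proof.
elim=> {t J a ts} [t J|i t J a ts it H IH|i t J a ts it iJ H IH _] u //.
  move=> uts; rewrite leq_eqVlt => /orP[/eqP E|]; last by exact: IH.
  have [_ ab] := pderiv_embedding H; have : i \in a.
    have : (u %% n)%N \in [seq (t0 %% n)%N | t0 <- ts] by apply/mapP; exists u.
    by rewrite ab -E modnDr -it => /mapP[j ja] /idx_inj ->.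
  by move=> /(pderiv_sub H); rewrite !inE eqxx.
have n0 : (0 < n)%N by apply: leq_ltn_trans (ltn_ord i).
rewrite in_cons => /orP[/eqP ->|uts]; first by lia.
rewrite leq_eqVlt => /orP[/eqP <-|tu]; first by rewrite addnK mem_head.
by rewrite in_cons IH ?orbT.
Qed.

Lemma pderiv_of_embedding a ts J t m : red a -> embedding c a ts -> all (leq t) ts ->
  (forall i u, u \in ts -> index i c = (u %% n)%N -> i \in J) ->
  (forall u, u \in ts -> (t + n <= u)%N -> (u - n)%N \in ts) ->
  (last 0%N ts - t < m)%N -> pderiv t J a ts.
Proof.
elim: m a ts J t => // m IH a [|u ts] J t ra [us ua] tu tJ bl lt_m.
  by case: a ua ra => // _ _; constructor.
case: a ua ra => [//|i a] /= [ui ua] ra.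
have n0 : (0 < n)%N by apply: leq_ltn_trans (ltn_ord i).
move: tu => /= /andP[tu tus].
have ut : all (ltn u) ts by move: us; rewrite /= path_sortedE; [case/andP | exact: ltn_trans].
have us' : sorted ltn ts by move: us; rewrite /= path_sortedE; [case/andP | exact: ltn_trans].
have [E|ne] := eqVneq t u.
  rewrite -E in ui us ut bl lt_m tJ *; apply: (pderiv_take (esym ui)) => //.
    by apply: (tJ i t); rewrite ?mem_head.
  case/andP: ra => ra _; case: ts ut us' ua bl lt_m tJ {us tus} => [|v ts] ut us' ua bl lt_m tJ.
    by case: a ua ra => // _ _; constructor.
  apply: IH => //.
  - by move=> j w wts; apply: tJ; rewrite in_cons wts orbT.
  - move=> w wts tw; have := bl w; rewrite in_cons wts orbT => /(_ isT (ltnW tw)).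
    by rewrite in_cons => /orP[/eqP E2|//]; move: tw; rewrite -E2; lia.
  move: lt_m => /=; have : (t < last v ts)%N by move/allP: ut; apply; exact: mem_last.
  by lia.
have tu' : (t < u)%N by rewrite ltn_neqAle ne.
have ge : all (leq t.+1) (u :: ts).
  by rewrite /= tu'; apply: sub_all ut => w /= uw; exact: ltn_trans tu' uw.
have tn : t \notin u :: ts by apply/negP => /(allP ge); rewrite /= ltnn.
have [j jt] := letter_ex t n0.
apply: (pderiv_drop jt); apply: IH => //.
- by split=> //=; rewrite ui ua.
- move=> k w wts kw; rewrite !inE (tJ k w wts kw) andbT; apply/eqP => kj.
  rewrite kj jt in kw; case/negP: tn.
  (* Stepping down by n from block to block, a later use of the letter j would force the position t
     itself to be used. *)
  have : forall q w, w \in u :: ts -> (w = t + q * n)%N -> t \in u :: ts.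
    elim=> [|q IHq] x xts xE; first by rewrite -[t]addn0 -{1}(mul0n n) -xE.
    apply: (IHq (x - n)%N); last by rewrite xE mulSn addnCA addKn.
    by apply: bl => //; rewrite xE mulSn addnA leq_addr.
  have tw : (t < w)%N by move/allP: ge; apply.
  have /dvdnP[q qE] : (n %| w - t)%N by rewrite -eqn_mod_dvd ?(ltnW tw) // kw.
  by move=> H; apply: (H q w wts); rewrite -qE subnKC // ltnW.
- by move=> w wts tw; apply: bl => //; lia.
move: lt_m => /=; have : (t < last u ts)%N by move/allP: ge; apply; exact: mem_last.
by lia.
Qed.

(** All reduced words of an element have the same letters. So where this embedding skips a letter
    for good, every competitor must skip it too, and where it uses the position t no competitor
    starts earlier. *)
Lemma pderiv_min t J a ts : pderiv t J a ts -> forall b us, red b -> wp b = wp a ->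
  embedding c b us -> all (leq t) us -> ((ts : seqlexi nat) <= (us : seqlexi nat))%O.
Proof.
elim=> {t J a ts} [t J b us _ _ _ _|i t J a ts it H IH b us rb ba eb tu|i t J a ts it iJ H IH ra b us rb ba].
- by case: us.
- apply: (IH b us) => //; apply/allP => u uus; rewrite ltn_neqAle (allP tu u uus) andbT.
  apply/eqP => E; have [_ ab] := eb; have : i \in b.
    have : (u %% n)%N \in [seq (t0 %% n)%N | t0 <- us] by apply/mapP; exists u.
    by rewrite ab -E -it => /mapP[j ja] /idx_inj ->.
  by rewrite (red_letters rb (pderiv_red H) ba) => /(pderiv_sub H); rewrite !inE eqxx.
have sb : size b = (size a).+1.
  by apply/eqP; rewrite eqn_leq (red_leq rb (esym ba)) (red_leq ra ba).
case: b sb rb ba => // j b _ rb ba; case: us => [[]|u us] //= [us' [uj ub]] /andP[tu tus].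
rewrite lexi_cons leEnat tu /=; apply/implyP => ut.
have E : u = t by apply/eqP; rewrite eqn_leq tu [(u <= t)%N]ut.
have ij : j = i by apply: idx_inj; rewrite -uj E it.
subst j u; apply: (IH b us).
- by case/andP: rb.
- apply/lfunP => x; apply: (@simple_inj _ _ _ Phi i).
  by rewrite -!wprod_cons ba.
- by split=> //; move: us'; rewrite /= path_sortedE; [case/andP | exact: ltn_trans].
by move: us'; rewrite /= path_sortedE; [case/andP | exact: ltn_trans].
Qed.

Lemma pderiv_sorting J a ts : pderiv 0 J a ts -> sorting_embedding Phi c (wp a) a ts.
Proof.
move=> H; have ra := pderiv_red H; have all0 (us : seq nat) : all (leq 0) us by exact/allP.
split; first exact/reduced_wordP.
  by split=> [|us eus]; [exact: pderiv_embedding H | exact: (pderiv_min H ra erefl eus (all0 us))].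
by move=> b us /reduced_wordP[rb wb] [eb _]; exact: (pderiv_min H rb wb eb (all0 us)).
Qed.

Lemma sorting_uniq f a ts b us : sorting_embedding Phi c f a ts -> sorting_embedding Phi c f b us ->
  a = b.
Proof.
move=> [ra la ma] [rb lb mb].
have E : ts = us by apply/(@Order.POrderTheory.le_anti _ (seqlexi nat)); rewrite (ma b us) // (mb a ts).
have [[_ ea] _] := la; have [[_ eb] _] := lb.
apply: (inj_map (f := fun i => index i c)); last by rewrite -ea -eb E.
by move=> i j /idx_inj.
Qed.

Lemma sortableP f : sortable Phi c f <-> exists a, deriv c finset.setT a /\ wp a = f.
Proof.
have rot_c : rot (0 %% n) c = c by rewrite mod0n rot0.
split=> [[_ [a [ts [[/reduced_wordP[ra <-] [ea _] _] bl]]]]|[a [da <-]]].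
  exists a; split=> //; rewrite -rot_c; apply: (@pderiv_deriv _ _ _ ts).
  apply: (@pderiv_of_embedding _ _ _ _ (last 0%N ts).+1) => //.
  - exact/allP.
  - by move=> i u _ _; rewrite inE.
  - move=> u uts; rewrite add0n => nu.
    have n0 : (0 < n)%N.
      case: (a) ea => [[_]|j a' _]; first by case: (ts) uts.
      exact: leq_ltn_trans (ltn_ord j).
    have [i iu] := letter_ex u n0.
    have := bl ((u %/ n).-1) => /fintype.subsetP/(_ i); rewrite !finset.in_set iu.
    have q0 : (0 < u %/ n)%N by rewrite divn_gt0.
    rewrite prednK // -divn_eq uts => /(_ isT).
    by rewrite {3}(divn_eq u n) -{2}(prednK q0) mulSn -addnA addKn.
  by rewrite subn0.
have [|ts H] := @deriv_pderiv _ _ _ da 0%N; first by rewrite rot_c.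
split; first by exists a.
exists a, ts; split; first exact: pderiv_sorting H.
move=> k; apply/fintype.subsetP => i; rewrite !finset.in_set => its.
by have := pderiv_block H its; rewrite mulSn -addnA addKn; apply; lia.
Qed.

Definition clset a : classical_sets.set V :=
  fun x => x \in clpos Phi a \/ exists2 i, i \notin a & x = - alpha i.

Lemma clE a : deriv c finset.setT a -> cl Phi c (wp a) = clset a.
Proof.
move=> da; have rot_c : rot (0 %% n) c = c by rewrite mod0n rot0.
have [|ts H] := @deriv_pderiv _ _ _ da 0%N; first by rewrite rot_c.
have sa := pderiv_sorting H.
apply/seteqP; split=> x.
  move=> [b [i [[us sb] ]]]; rewrite -(sorting_uniq sa sb) => -[[u [v [E iv ->]]]|[ia ->]].
    by left; apply/clposP; exists u, i, v.
  by right; exists i.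
move=> [/clposP[u [i [v [E iv ->]]]]|[i ia ->]]; exists a, i.
  by split; [exists ts | left; exists u, v].
by split; [exists ts | right].
Qed.

End Positions.
End Sortable.

(** * Clusters *)

Section Clusters.
Variables (R : realType) (V : vectType R) (n : nat) (Phi : root_system V n).
Variables (d : 'I_n -> nat).
Hypothesis hd : is_symmetrizer Phi d.
Notation alpha := (alpha Phi).
Notation sr i := (simple_refl Phi i).
Notation co j x := (coord (rs_simple Phi) j x).
Notation pos := (pos_root Phi).
Notation apos := (almost_pos_root Phi).
Notation wp a := (wprod Phi a).
Notation red := (red Phi).
Notation clset := (clset Phi).
Notation p := (cox_p Phi).
Notation sigma := (sigma Phi).
Implicit Types (i j k : 'I_n) (a b c : seq 'I_n) (J : {set 'I_n}) (x y z : V).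

(* The Euler form of the orientation given by c *)
Definition euler c x y : R :=
  \sum_i (d i)%:R * co i x * co i y
  - \sum_i \sum_j ((index i c < index j c)%N)%:R * (d i * p i j)%:R * co i x * co j y.

Definition pairing i y : R := \sum_(j | j != i) (d i * p i j)%:R * co j y.

(** The terms without the index i; neither s_i nor moving i from the front of the word to its end
    changes them. *)
Definition euler_off i c x y : R :=
  \sum_(j | j != i) (d j)%:R * co j x * co j y
  - \sum_(j | j != i) \sum_(k | k != i)
      ((index j c < index k c)%N)%:R * (d j * p j k)%:R * co j x * co k y.

Lemma euler_split i c x y : euler c x y = euler_off i c x y + (d i)%:R * co i x * co i y
  - \sum_(j | j != i) ((index i c < index j c)%N)%:R * (d i * p i j)%:R * co i x * co j y
  - \sum_(j | j != i) ((index j c < index i c)%N)%:R * (d j * p j i)%:R * co j x * co i y.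
Proof.
rewrite /euler /euler_off (bigD1 i) //= (bigD1 i (P := xpredT)) //= (bigD1 i (P := xpredT)) //=.
rewrite ltnn mul0r !mul0r add0r.
have -> : \sum_(j | j != i) \sum_k ((index j c < index k c)%N)%:R * (d j * p j k)%:R * co j x * co k y =
   \sum_(j | j != i) ((index j c < index i c)%N)%:R * (d j * p j i)%:R * co j x * co i y +
   \sum_(j | j != i) \sum_(k | k != i) ((index j c < index k c)%N)%:R * (d j * p j k)%:R * co j x * co k y.
  by rewrite -big_split; apply: eq_bigr => j _; rewrite (bigD1 i).
by ring.
Qed.

Lemma euler_off_rot i c x y : coxeter_word (i :: c) -> euler_off i (rcons c i) x y = euler_off i (i :: c) x y.
Proof.
move=> hc; rewrite /euler_off; congr (_ - _); apply: eq_bigr => j ji; apply: eq_bigr => k ki.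
have idx q : q != i -> index q (rcons c i) = index q c.
  move=> qi; rewrite -cats1 index_cat; case: ifP => // /negP[].
  by have := cox_mem q hc; rewrite in_cons (negbTE qi).
by rewrite !idx //= !(eq_sym i) (negbTE ji) (negbTE ki) ltnS.
Qed.

Lemma euler_src i c x y : coxeter_word (i :: c) ->
  euler (i :: c) x y = euler_off i (i :: c) x y + (d i)%:R * co i x * co i y - co i x * pairing i y.
Proof.
move=> hc; rewrite (euler_split i) [X in _ - X]big1 ?subr0 => [|j ji]; last first.
  by rewrite /= eqxx ltn0 !mul0r.
congr (_ - _); rewrite /pairing mulr_sumr; apply: eq_bigr => j ji.
by rewrite /= eqxx eq_sym (negbTE ji) mul1r mulrAC mulrC.
Qed.

Lemma euler_snk i c x y : coxeter_word (i :: c) ->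
  euler (rcons c i) x y = euler_off i (i :: c) x y + (d i)%:R * co i x * co i y - pairing i x * co i y.
Proof.
move=> hc; have /= /andP[ic _] := cox_uniq hc.
have idi : index i (rcons c i) = size c by rewrite -cats1 index_cat (negbTE ic) /= eqxx addn0.
have idx q : q != i -> (index q (rcons c i) < size c)%N.
  move=> qi; have qc : q \in c by have := cox_mem q hc; rewrite in_cons (negbTE qi).
  by rewrite -cats1 index_cat qc index_mem.
rewrite (euler_split i) euler_off_rot // [X in _ - X - _]big1 ?subr0 => [|j ji]; last first.
  by rewrite idi ltnNge (ltnW (idx _ ji)) !mul0r.
congr (_ - _); rewrite /pairing mulr_suml; apply: eq_bigr => j ji.
by rewrite idi idx // mul1r (cox_p_sym hd).
Qed.

Lemma d_gt0 i : 0 < (d i)%:R :> R. Proof. by rewrite ltr0n hd.1. Qed.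
Lemma d_neq i : (d i)%:R != 0 :> R. Proof. by rewrite gt_eqF ?d_gt0. Qed.

Lemma co_simple_d i x : (d i)%:R * co i (sr i x) = pairing i x - (d i)%:R * co i x.
Proof.
rewrite co_simple_i mulrBr mulrN addrC -mulrN -sumrN mulr_sumr; congr (_ - _).
rewrite /pairing; apply: eq_bigr => j ji.
by rewrite natrM -mulrA -mulNr -mulrNz -cox_pE // eq_sym.
Qed.

Lemma pairing_simple i x : pairing i (sr i x) = pairing i x.
Proof. by apply: eq_bigr => j ji; rewrite co_simple. Qed.

(** Applying s_i turns d_i x_i into [pairing i x] - d_i x_i, which exchanges the formula for a
    source with that for a sink. *)
Lemma euler_step i c x y : coxeter_word (i :: c) ->
  euler (rcons c i) (sr i x) (sr i y) = euler (i :: c) x y.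
Proof.
move=> hc; rewrite euler_src // euler_snk // pairing_simple.
have -> : euler_off i (i :: c) (sr i x) (sr i y) = euler_off i (i :: c) x y.
  by congr (_ - _); apply: eq_bigr => j ji; rewrite ?co_simple //; apply: eq_bigr => k ki; rewrite !co_simple.
have Ex := co_simple_d i x; have Ey := co_simple_d i y.
have -> : co i (sr i x) = (pairing i x - (d i)%:R * co i x) / (d i)%:R by rewrite -Ex mulrC mulKf ?d_neq.
have -> : co i (sr i y) = (pairing i y - (d i)%:R * co i y) / (d i)%:R by rewrite -Ey mulrC mulKf ?d_neq.
by have D0 := d_neq i; field.
Qed.

Lemma euler_off_alphal i c y : euler_off i c (alpha i) y = 0.
Proof.
rewrite /euler_off !big1 ?subr0 // => j ji.
  by rewrite big1 // => k _; rewrite co_alpha eq_sym (negbTE ji) mulr0 mul0r.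
by rewrite co_alpha eq_sym (negbTE ji) mulr0 mul0r.
Qed.

Lemma euler_off_alphar i c x : euler_off i c x (alpha i) = 0.
Proof.
rewrite /euler_off !big1 ?subr0 // => j ji.
  by rewrite big1 // => k ki; rewrite co_alpha eq_sym (negbTE ki) mulr0.
by rewrite co_alpha eq_sym (negbTE ji) mulr0.
Qed.

Lemma pairing_alpha i : pairing i (alpha i) = 0.
Proof. by rewrite /pairing big1 // => j ji; rewrite co_alpha eq_sym (negbTE ji) mulr0. Qed.
Lemma co_alpha1 i : co i (alpha i) = 1.
Proof. by rewrite co_alpha eqxx. Qed.

Section AtSource.
Variables (i : 'I_n) (c : seq 'I_n).
Hypothesis hc : coxeter_word (i :: c).

Lemma euler_src_l y : euler (i :: c) (alpha i) y = - ((d i)%:R * co i (sr i y)).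
Proof. by rewrite euler_src // euler_off_alphal co_alpha1 co_simple_d; ring. Qed.
Lemma euler_src_r y : euler (i :: c) y (alpha i) = (d i)%:R * co i y.
Proof. by rewrite euler_src // euler_off_alphar pairing_alpha co_alpha1; ring. Qed.
Lemma euler_snk_l y : euler (rcons c i) (alpha i) y = (d i)%:R * co i y.
Proof. by rewrite euler_snk // euler_off_alphal pairing_alpha co_alpha1; ring. Qed.
Lemma euler_snk_r y : euler (rcons c i) y (alpha i) = - ((d i)%:R * co i (sr i y)).
Proof. by rewrite euler_snk // euler_off_alphar co_alpha1 co_simple_d; ring. Qed.
Lemma euler_rot0 x y : co i x = 0 -> co i y = 0 -> euler (i :: c) x y = euler (rcons c i) x y.
Proof. by move=> x0 y0; rewrite euler_src // euler_snk // x0 y0; ring. Qed.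
End AtSource.

Lemma aposP x : apos x -> pos x \/ exists i, x = - alpha i.
Proof. by move=> /orP[|/existsP[i /eqP ->]]; [left | right; exists i]. Qed.
Lemma apos_pos x : pos x -> apos x. Proof. by rewrite /almost_pos_root => ->. Qed.
Lemma apos_neg i : apos (- alpha i). Proof. by apply/orP; right; apply/existsP; exists i. Qed.
Lemma neg_inj i j : - alpha i = - alpha j -> i = j.
Proof. by move=> /oppr_inj/alpha_inj. Qed.
Lemma pos_neq_neg x j : pos x -> x != - alpha j.
Proof. by move=> px; apply/eqP => E; apply: (pos_anti (pos_alpha Phi j)); rewrite -E. Qed.

Lemma sigma_pos i x : pos x -> sigma i x = sr i x.
Proof.
move=> px; rewrite /Defs.sigma; case: existsP => // -[j /andP[_ E]].
by have := pos_neq_neg j px; rewrite E.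
Qed.

Lemma sigma_negi i : sigma i (- alpha i) = alpha i.
Proof.
rewrite /Defs.sigma; case: existsP => [[j /andP[ji /eqP/neg_inj E]]|_].
  by rewrite E eqxx in ji.
by rewrite linearN /= simple_alpha opprK.
Qed.

Lemma sigma_alpha i : sigma i (alpha i) = - alpha i.
Proof. by rewrite sigma_pos ?pos_alpha // simple_alpha. Qed.
Lemma sigma_neg i j : j != i -> sigma i (- alpha j) = - alpha j.
Proof. by move=> ji; rewrite /Defs.sigma ifT //; apply/existsP; exists j; rewrite ji eqxx. Qed.

Lemma sigma_cases i x : apos x ->
  [\/ [/\ pos x, x != alpha i & pos (sr i x)], x = alpha i, x = - alpha i | exists2 j, j != i & x = - alpha j].
Proof.
move=> /aposP[px|[j ->]].
  by have [->|xi] := eqVneq x (alpha i); [exact: Or42 | apply: Or41; rewrite pos_simple].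
by have [->|ji] := eqVneq j i; [exact: Or43 | apply: Or44; exists j].
Qed.

Lemma sigma_apos i x : apos x -> apos (sigma i x).
Proof.
move=> /(sigma_cases i)[[px _ px']|->|->|[j ji ->]].
- by rewrite sigma_pos // apos_pos.
- by rewrite sigma_alpha apos_neg.
- by rewrite sigma_negi apos_pos ?pos_alpha.
by rewrite sigma_neg // apos_neg.
Qed.

Lemma sigmaK i x : apos x -> sigma i (sigma i x) = x.
Proof.
move=> /(sigma_cases i)[[px _ px']|->|->|[j ji ->]].
- by rewrite (sigma_pos _ px) sigma_pos // simpleK.
- by rewrite sigma_alpha sigma_negi.
- by rewrite sigma_negi sigma_alpha.
by rewrite !sigma_neg.
Qed.

Local Notation mx := (Num.max 0).

(* A closed formula for the c-compatibility degree *)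
Definition degree c x y : R :=
  if [pick i | x == - alpha i] is Some i then mx (co i y) else
  if [pick j | y == - alpha j] is Some j then (d j)%:R * co j x / euler c x x else
  (mx (- euler c x y) + mx (- euler c y x)) / euler c x x.

Lemma pick_neg i : [pick j | - alpha i == - alpha j] = Some i.
Proof. by case: pickP => [j /eqP/neg_inj ->//|/(_ i)]; rewrite eqxx. Qed.
Lemma pick_pos x : pos x -> [pick j | x == - alpha j] = None.
Proof. by move=> px; case: pickP => // j; rewrite (negbTE (pos_neq_neg j px)). Qed.
Lemma degree_neg c i y : degree c (- alpha i) y = mx (co i y).
Proof. by rewrite /degree pick_neg. Qed.
Lemma degree_posneg c x j : pos x -> degree c x (- alpha j) = (d j)%:R * co j x / euler c x x.
Proof. by move=> px; rewrite /degree pick_pos // pick_neg. Qed.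
Lemma degree_pos c x y : pos x -> pos y ->
  degree c x y = (mx (- euler c x y) + mx (- euler c y x)) / euler c x x.
Proof. by move=> px py; rewrite /degree !pick_pos. Qed.
Lemma max_neg (t : R) : 0 <= t -> mx (- t) = 0.
Proof. by move=> t0; rewrite max_l // oppr_le0. Qed.
Lemma max_mul (t u : R) : 0 < t -> mx (t * u) = t * mx u.
Proof. by move=> t0; rewrite -{1}(mulr0 t) maxr_pMr // ltW. Qed.

(** sigma_i is s_i on positive roots and swaps alpha_i with its negative. Two positive roots other
    than alpha_i are covered by invariance of the Euler form; in the cases with alpha_i, [euler]
    against alpha_i is, up to the factor d_i and a sign, the i-th coordinate before or after s_i. *)
Lemma degree_step i c x y : coxeter_word (i :: c) -> apos x -> apos y ->
  degree (rcons c i) (sigma i x) (sigma i y) = degree (i :: c) x y.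
Proof.
move=> hc ax ay; have D0 := d_gt0 i; have D1 := d_neq i; have pa := pos_alpha Phi.
have E1 := euler_step _ _ hc; have [S1 S2 S3 S4] := And4 (euler_src_l hc) (euler_src_r hc) (euler_snk_l hc) (euler_snk_r hc).
have aa : co i (alpha i) = 1 by rewrite co_alpha eqxx.
have aj j : j != i -> co j (alpha i) = 0 by move=> ji; rewrite co_alpha eq_sym (negbTE ji).
have max00 : mx 0 = 0 :> R by rewrite max_l.
have maxN1 j k : mx (co j (- alpha k)) = 0.
  by rewrite linearN /= co_alpha max_neg // ler0n.
have [[px xi px']|->|->|[j ji ->]] := sigma_cases i ax;
  have [[py yi py']|->|->|[k ki ->]] := sigma_cases i ay;
  rewrite ?sigma_alpha ?sigma_negi ?sigma_neg // ?(sigma_pos _ px) ?(sigma_pos _ py);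
  rewrite ?degree_neg ?degree_posneg ?degree_pos // ?E1 ?maxN1 //.
- rewrite S1 S2 opprK max_neg ?mulr_ge0 ?ler0n ?pos_co // add0r.
  by rewrite max_r ?mulr_ge0 ?ler0n ?pos_co.
- rewrite S4 S3 simpleK opprK (max_neg (t := _ * co i (sr i x))) ?mulr_ge0 ?ler0n ?pos_co // addr0.
  by rewrite max_r ?mulr_ge0 ?ler0n ?pos_co.
- by rewrite co_simple.
- rewrite S1 !S2 opprK max_neg ?mulr_ge0 ?ler0n ?pos_co // addr0 aa mulr1 max_mul //.
  by rewrite mulrC mulKf.
- by rewrite S2 aa mulr1 max_neg ?ler0n // addr0 mul0r.
- by rewrite S2 aa mulr1 divff // max_r.
- by rewrite aj // mulr0 mul0r.
- rewrite S4 !S3 simpleK opprK aa mulr1 max_neg ?mulr_ge0 ?ler0n ?pos_co // add0r max_mul //.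
  by rewrite mulrC mulKf.
- by rewrite S3 aa mulr1 divff // max_r.
- by rewrite S3 aa mulr1 max_neg ?ler0n // addr0 mul0r.
- by rewrite aj // mulr0 mul0r.
- by rewrite co_simple.
- by rewrite aj // max00.
by rewrite aj // max00.
Qed.

Notation tau c := (tau_c Phi c).

Lemma foldr_apos v x : apos x -> apos (foldr sigma x v).
Proof. by move=> ax; elim: v => //= i v; exact: sigma_apos. Qed.

Lemma degree_fold u v x y : coxeter_word (u ++ v) -> apos x -> apos y ->
  degree (v ++ u) (foldr sigma x v) (foldr sigma y v) = degree (u ++ v) x y.
Proof.
elim: v u => [|i v IH] u hc ax ay /=; first by rewrite cats0.
have hc2 : coxeter_word (i :: (v ++ u)) by rewrite /coxeter_word -cat_cons perm_catC.
have E : u ++ i :: v = rcons u i ++ v by rewrite cat_rcons.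
rewrite -degree_step ?sigma_apos ?foldr_apos // !sigmaK ?foldr_apos // rcons_cat IH -?E //.
Qed.

Lemma degree_tau c x y : coxeter_word c -> apos x -> apos y ->
  degree c (tau c x) (tau c y) = degree c x y.
Proof. by move=> hc ax ay; rewrite -[in RHS](cat0s c) -degree_fold // cats0. Qed.

Lemma co_nat i x : pos x -> co i x \is a Num.nat.
Proof.
move=> px; have [//|H] := rs_simple_sign (pos_root_root px).
have /natrP[m E] := H i; suff -> : co i x = 0 by exact: rpred0.
move: E; rewrite linearN /= => E.
by apply/eqP; rewrite eq_le (pos_co _ px) andbT -oppr_ge0 E ler0n.
Qed.

Lemma mx_nat i x : apos x -> mx (co i x) \is a Num.nat.
Proof.
move=> /aposP[px|[j ->]]; first by rewrite max_r ?pos_co // co_nat.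
by rewrite linearN /= co_alpha max_neg ?ler0n.
Qed.

(** A degree function has natural values, so [degree] is truncated. Exactness of the truncation
    matters against negative simple roots, where the value is a coordinate; invariance survives
    truncation. *)
Lemma degree_compat c : coxeter_word c ->
  is_compat_degree Phi c (fun x y => Num.truncn (degree c x y)).
Proof.
move=> hc; split=> [i x ax|x y ax ay]; last by rewrite degree_tau.
by rewrite degree_neg truncnK ?mx_nat.
Qed.

(** The first letter i occurs once and only s_i alters the i-th coordinate; so a fixed vector is
    orthogonal to alpha_i and fixed by the remaining word. *)
Lemma wprod_fixed a v : uniq a -> wp a v = v -> forall i, i \in a -> rs_form Phi (alpha i) v = 0.
Proof.
elim: a => //= i a IH /andP[ia ua]; rewrite comp_lfunE => E.
have E1 : wp a v = sr i v by rewrite -[in RHS]E simpleK.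
have B0 : rs_form Phi (alpha i) v = 0.
  have := co_wprod Phi v ia; rewrite E1 simpleE linearB linearZ /= co_alpha1 mulr1 => /eqP.
  rewrite -subr_eq0 addrAC subrr sub0r oppr_eq0 !mulf_eq0 pnatr_eq0 invr_eq0.
  by rewrite (gt_eqF (alpha_gt0 Phi i)) orbF /= => /eqP.
have E2 : wp a v = v by rewrite E1 simpleE B0 mulr0 mul0r scale0r subr0.
by move=> j; rewrite in_cons => /orP[/eqP -> //|]; exact: IH.
Qed.

Lemma coxeter_fixed c v : coxeter_word c -> wp c v = v -> v = 0.
Proof.
move=> hc E; have B0 i : rs_form Phi (alpha i) v = 0.
  by apply: (wprod_fixed (cox_uniq hc) E); exact: cox_mem.
apply/eqP; apply: contraT => v0; have := rs_form_gt0 Phi v0.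
suff -> : rs_form Phi v v = 0 by rewrite ltxx.
rewrite [X in rs_form _ X _](co_sum Phi); elim/big_rec: _ => [|i x _ IH]; first exact: form0.
by rewrite rs_form_linear B0 mulr0 add0r.
Qed.

Lemma foldr_pos v x : uniq v -> pos x ->
  (foldr sigma x v = wp v x /\ pos (wp v x)) \/ exists2 i, i \in v & foldr sigma x v = - alpha i.
Proof.
move=> uv px; elim: v uv => [|i v IH] /=; first by left; rewrite id_lfunE.
move=> /andP[iv /IH[[-> py]|[j jv ->]]]; last first.
  right; exists j; rewrite ?in_cons ?jv ?orbT // sigma_neg //.
  by apply: contraNneq iv => <-.
rewrite comp_lfunE sigma_pos //; have [->|yi] := eqVneq (wp v x) (alpha i).
  by right; exists i; rewrite ?mem_head // simple_alpha.
by left; split=> //; exact: pos_simple.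
Qed.

(* Otherwise the orbit consists of positive roots permuted by c, and its sum would be a
   nonzero vector fixed by c. *)
Lemma orbit_neg c x : coxeter_word c -> apos x -> exists (k : nat) i, iter k (tau c) x = - alpha i.
Proof.
move=> hc /aposP[px|[i ->]]; last by exists 0%N, i.
apply: contrapT => H.
have key (k : nat) : iter k (tau c) x = iter k (wp c) x /\ pos (iter k (wp c) x).
  elim: k => [|k [IH1 IH2]] //=; rewrite -IH1 in IH2 *.
  have [//|[i _ E]] := foldr_pos (cox_uniq hc) IH2.
  by case: H; exists k.+1, i.
have [k [l [kl E]]] : exists k l : nat, (k < l)%N /\ iter l (wp c) x = iter k (wp c) x.
  pose N := size (undup (rs_root Phi)).
  have : ~~ uniq (traject (wp c) x N.+1).
    apply/negP => u; have := uniq_leq_size u; rewrite size_traject => /(_ (undup (rs_root Phi))).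
    rewrite -/N ltnn => F; suff /F : {subset traject (wp c) x N.+1 <= undup (rs_root Phi)} by [].
    move=> y /trajectP[k _ ->]; rewrite mem_undup.
    exact: pos_root_root (key k).2.
  by rewrite looping_uniq negbK => /loopingP/(_ N)/trajectP[k kN E]; exists k, N.
pose S := \sum_(k <= t < l) iter t (wp c) x.
have S0 : wp c S = S.
  rewrite /S linear_sum /=; have := telescope_sumr (fun t => iter t (wp c) x) (ltnW kl).
  rewrite E subrr sumrB => /eqP; rewrite subr_eq0 => /eqP <-.
  by [].
have [i yi] := pos_ex (key k).2.
have := congr1 (fun v => co i v) (coxeter_fixed hc S0); rewrite /S linear0 linear_sum /=.
rewrite big_ltn // => /eqP; rewrite gt_eqF // ltr_pwDl // sumr_ge0 // => t _.
exact: pos_co (key t).2.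
Qed.

Lemma tau_apos c x (k : nat) : apos x -> apos (iter k (tau c) x).
Proof. by move=> ax; elim: k => //= k; exact: foldr_apos. Qed.

(** Every orbit meets a negative simple root, where the degree is prescribed. Hence compatibility
    can be tested on the closed formula, whichever degree function witnesses it. *)
Lemma degree_uniq c f x y : coxeter_word c -> is_compat_degree Phi c f -> apos x -> apos y ->
  (f x y)%:R = degree c x y.
Proof.
move=> hc [f1 f2] ax ay; have [k [i E]] := orbit_neg hc ax.
have <- : f (iter k (tau c) x) (iter k (tau c) y) = f x y.
  by elim: k {E} => //= k IH; rewrite f2 ?tau_apos.
have <- : degree c (iter k (tau c) x) (iter k (tau c) y) = degree c x y.
  by elim: k {E} => //= k IH; rewrite degree_tau ?tau_apos.
by rewrite E f1 ?tau_apos // degree_neg.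
Qed.

Lemma compatP c x y : coxeter_word c -> apos x -> apos y ->
  c_compatible Phi c x y <-> degree c x y = 0 /\ degree c y x = 0.
Proof.
move=> hc ax ay; split=> [[f [fd f1 f2]]|[g1 g2]].
  by rewrite -(degree_uniq hc fd ax ay) -(degree_uniq hc fd ay ax) f1 f2.
exists (fun x y => Num.truncn (degree c x y)); split; first exact: degree_compat.
  by rewrite g1 truncn0.
by rewrite g2 truncn0.
Qed.

Lemma clset_apos a x : red a -> clset a x -> apos x.
Proof.
move=> ra [/clpos_invl/(invl_pos ra)/andP[px _]|[i _ ->]]; [exact: apos_pos | exact: apos_neg].
Qed.

(** Together with [clset_unsigma], sigma_i is a bijection between the clusters of a and i :: a, so
    [degree_step] transports compatibility along the word. *)
Lemma clset_sigma i a x : red (i :: a) -> clset a x -> clset (i :: a) (sigma i x).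
Proof.
move=> /= /andP[ra _] [xa|[j ja ->]].
  left; have /andP[px _] := invl_pos ra (clpos_invl xa).
  by rewrite sigma_pos //= mem_cat map_f ?orbT.
have [ji|ji] := eqVneq j i.
  by left; rewrite ji sigma_negi /= -ji (negbTE ja) mem_cat mem_head.
by right; exists j; rewrite ?sigma_neg // in_cons negb_or ji.
Qed.

Lemma clset_unsigma i a x : red (i :: a) -> clset (i :: a) x -> clset a (sigma i x).
Proof.
move=> ra [xa|[j ja ->]]; last first.
  by move: ja; rewrite in_cons negb_or => /andP[ji ja]; right; exists j; rewrite ?sigma_neg.
have /andP[px _] := invl_pos ra (clpos_invl xa); rewrite sigma_pos //.
move: xa; rewrite /= mem_cat => /orP[|/mapP[y ya ->]]; last by left; rewrite simpleK.
case: ifP => // ia; rewrite mem_seq1 => /eqP ->; right; exists i; rewrite ?ia //.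
exact: simple_alpha.
Qed.

Lemma clpos_co0 a x i : x \in clpos Phi a -> i \notin a -> co i x = 0.
Proof.
move=> /clposP[u [j [v [-> _ ->]]]]; rewrite mem_cat in_cons !negb_or => /and3P[iu ij _].
by rewrite co_wprod // co_alpha eq_sym (negbTE ij).
Qed.

Lemma degree_rot i c x y : coxeter_word (i :: c) -> apos x -> apos y ->
  co i x = 0 -> co i y = 0 -> degree (i :: c) x y = degree (rcons c i) x y.
Proof.
move=> hc /aposP[px|[j ->]] ay x0 y0; last by rewrite !degree_neg.
have [py|[j ->]] := aposP ay; first by rewrite !degree_pos // !(euler_rot0 hc).
by rewrite !degree_posneg // !(euler_rot0 hc).
Qed.

(** When i is skipped, -alpha_i belongs to the set and all other members vanish at i, where the
    degree does not see the arrows at i. When i is taken, [degree_step] applies. *)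
Lemma clset_compat c J a : deriv Phi c J a -> coxeter_word c ->
  forall x y, clset a x -> clset a y -> degree c x y = 0.
Proof.
elim=> {c J a} [c J|i c J a da IH|i c J a iJ da IH ra] hc x y xa ya.
- case: xa => // -[i _ ->]; case: ya => // -[j _ ->].
  by rewrite degree_neg linearN /= co_alpha max_neg ?ler0n.
- have ra := deriv_red da; have ax := clset_apos ra xa; have ay := clset_apos ra ya.
  have ia : i \notin a by apply/negP => /(deriv_sub da); rewrite !inE eqxx.
  have coi z : clset a z -> co i z = 0 \/ z = - alpha i.
    move=> [za|[j ja ->]]; first by left; exact: clpos_co0 za ia.
    have [->|ji] := eqVneq j i; [by right | left].
    by rewrite linearN /= co_alpha (negbTE ji) oppr0.
  have [x0|->] := coi _ xa; last first.
    rewrite degree_neg; have [->|->] := coi _ ya; first by rewrite max_l.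
    by rewrite linearN /= co_alpha1 max_neg ?ler01.
  have [y0|E] := coi _ ya; first by rewrite degree_rot // (IH (cox_rot hc)).
  case: xa => [/clpos_invl/(invl_pos ra)/andP[px _]|[j _ ->]].
    by rewrite E degree_posneg // x0 mulr0 mul0r.
  by rewrite E degree_neg linearN /= co_alpha max_neg ?ler0n.
have ax := clset_apos ra xa; have ay := clset_apos ra ya.
by rewrite -degree_step // (IH (cox_rot hc)) //; exact: clset_unsigma.
Qed.

(** For a positive root, degree zero against -alpha_i means that the coordinate at i vanishes; this
    settles the empty word and the skipped letters, and sigma_i settles the letters taken. *)
Lemma clset_max c J a : deriv Phi c J a -> coxeter_word c ->
  forall z, apos z -> (forall x, clset a x -> degree c x z = 0) -> clset a z.
Proof.
elim=> {c J a} [c J|i c J a da IH|i c J a iJ da IH ra] hc z az H.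
- have [pz|[i ->]] := aposP az; last by right; exists i.
  have [i zi] := pos_ex pz; have := H (- alpha i); rewrite degree_neg max_r ?(ltW zi) // => H0.
  by move: zi; rewrite H0 ?ltxx //; right; exists i.
- have ra := deriv_red da.
  have ia : i \notin a by apply/negP => /(deriv_sub da); rewrite !inE eqxx.
  have Hi := H (- alpha i) (or_intror (ex_intro2 _ _ i ia erefl)).
  have z0 : co i z = 0 \/ z = - alpha i.
    have [pz|[j ->]] := aposP az.
      by left; move: Hi; rewrite degree_neg max_r ?pos_co.
    have [->|ji] := eqVneq j i; [by right | left].
    by rewrite linearN /= co_alpha (negbTE ji) oppr0.
  have [{}z0|->] := z0; last by right; exists i.
  apply: (IH (cox_rot hc)) => // x xa; have ax := clset_apos ra xa.
  have [px|[j E]] := aposP ax; last by have := H x xa; rewrite E !degree_neg.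
  rewrite -degree_rot // ?H //; case: xa => [xa|[j _ E]]; first exact: clpos_co0 xa ia.
  by have := pos_neq_neg j px; rewrite E eqxx.
rewrite -(sigmaK i az); apply: clset_sigma => //.
apply: (IH (cox_rot hc)); first exact: sigma_apos.
move=> x xa; have ax := clset_apos (deriv_red da) xa.
by rewrite -(sigmaK i ax) degree_step ?sigma_apos //; apply: H; exact: clset_sigma.
Qed.

Lemma clset_cluster c a J : deriv Phi c J a -> coxeter_word c -> c_cluster Phi c (clset a).
Proof.
move=> da hc; have ra := deriv_red da; split.
  split=> [x|x y xa ya]; first exact: clset_apos.
  by apply/compatP => //; [exact: clset_apos xa|exact: clset_apos ya|split; exact: clset_compat da hc _ _ _ _].
move=> C' [C1 C2] sub; apply/seteqP; split=> z; last exact: sub.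
move=> Cz; apply: (clset_max da hc (C1 _ Cz)) => x xa.
by have /compatP[||//|] := C2 x z (sub _ xa) Cz; [exact: hc|exact: clset_apos xa|exact: C1|].
Qed.

Lemma deriv_inv i c J b : deriv Phi (i :: c) J b ->
  [\/ b = [::], deriv Phi (rcons c i) (J :\ i) b |
      exists b', [/\ b = i :: b', deriv Phi (rcons c i) J b' & red (i :: b')]].
Proof.
by move=> H; inversion H; subst; [exact: Or31 | exact: Or32 | apply: Or33; eexists].
Qed.

(** -alpha_i is in the cluster exactly when i does not occur in the word, so the set shows whether
    the first letter of c is skipped or taken. *)
Lemma clset_inj c J a b : deriv Phi c J a -> coxeter_word c -> deriv Phi c J b ->
  clset a = clset b -> a = b.
Proof.
move=> da; elim: da b => {c J a} [c J|i c J a da IH|i c J a iJ da IH ra] b hc db ab.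
- case: b db ab => // i b db ab.
  have : clset [::] (- alpha i) by right; exists i.
  rewrite ab => -[/clpos_invl/(invl_pos (deriv_red db))/andP[px _]|[j jb /neg_inj E]].
    by case: (pos_anti (pos_alpha Phi i) px).
  by rewrite E mem_head in jb.
- have ia : i \notin a by apply/negP => /(deriv_sub da); rewrite !inE eqxx.
  have ni : clset a (- alpha i) by right; exists i.
  have ib : i \notin b.
    move: ni; rewrite ab => -[/clpos_invl/(invl_pos (deriv_red db))/andP[px _]|[j jb /neg_inj -> //]].
    by case: (pos_anti (pos_alpha Phi i) px).
  have [E|db'|[b' [E _ _]]] := deriv_inv db; last by rewrite E mem_head in ib.
    by apply: (IH _ (cox_rot hc)) => //; rewrite E; constructor.
  exact: (IH _ (cox_rot hc)).
have nni : ~ clset (i :: a) (- alpha i).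
  move=> [/clpos_invl/(invl_pos ra)/andP[px _]|[j jb /neg_inj E]].
    by case: (pos_anti (pos_alpha Phi i) px).
  by rewrite E mem_head in jb.
have [E|db'|[b' [E db' rb]]] := deriv_inv db.
- by case: nni; rewrite ab E; right; exists i.
- case: nni; rewrite ab; right; exists i => //.
  by apply/negP => /(deriv_sub db'); rewrite !inE eqxx.
rewrite E; rewrite E in ab; congr (_ :: _); apply: (IH _ (cox_rot hc)) => //; apply/seteqP; split=> x xa.
  have ax := clset_apos (deriv_red da) xa.
  by rewrite -(sigmaK i ax); apply: clset_unsigma => //; rewrite -ab; exact: clset_sigma.
have ax := clset_apos (deriv_red db') xa.
by rewrite -(sigmaK i ax); apply: clset_unsigma => //; rewrite ab; exact: clset_sigma.
Qed.

End Clusters.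

(** * The path algebra *)

Section PathElements.
Variables (Q : quiver) (K : fieldType).
Notation pe := (@path_elt Q K).
Implicit Types x y : path_alg Q K.

Lemma peE v p r : pe v p r = ((r == (v, p)) && composable v p)%:R. Proof. by []. Qed.
Lemma mulE x y r : (x * y) r = pmul_fun x y r. Proof. by []. Qed.
Lemma pe0 v p : ~~ composable v p -> pe v p = 0.
Proof. by move=> /negbTE vp; apply: pcoef_inj => u q; rewrite peE vp andbF. Qed.

Lemma pe_mull v p x u q : composable v p -> (pe v p * x) (u, q) =
  if (u == v) && (take (size p) q == p) then x (path_end v p, drop (size p) q) else 0.
Proof.
move=> vp; rewrite mulE /pmul_fun /=; case: ifP => [/andP[/eqP -> /eqP E]|ne].
  have sp : (size p < (size q).+1)%N by rewrite ltnS -{1}E size_take_min geq_minr.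
  rewrite (bigD1 (Ordinal sp)) //= E eqxx vp mul1r big1 ?addr0 // => k kp.
  case: eqP => [[Ek]|]; rewrite ?mul0r //; case/eqP: kp; apply: val_inj => /=.
  by rewrite -Ek size_take_min; apply/esym/minn_idPl; rewrite -ltnS.
rewrite big1 // => k _; case: eqP => [[Eu Ek]|]; rewrite ?mul0r //.
move: ne; rewrite Eu eqxx /= -{2}Ek -Ek size_take_min.
by rewrite (minn_idPl _) ?eqxx // -ltnS.
Qed.

Lemma pe_mul v p u q : composable v p ->
  pe v p * pe u q = if path_end v p == u then pe v (p ++ q) else 0.
Proof.
move=> vp; apply: pcoef_inj => v' p'; rewrite pe_mull // peE; case: ifP => [/andP[/eqP -> /eqP E]|ne].
  rewrite xpair_eqE; case: ifP => [/eqP <-|_] //=.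
  rewrite composable_cat vp xpair_eqE eqxx -[in RHS](cat_take_drop (size p) p') E.
  by rewrite eqseq_cat // eqxx.
case: ifP => // _; rewrite peE xpair_eqE; case: (eqVneq v' v) ne => //= _ ne.
case: eqP => //= E; by rewrite E take_size_cat ?eqxx in ne.
Qed.

Lemma pe_cons v a p : source a = v -> pe v (a :: p) = pe v [:: a] * pe (target a) p.
Proof. by move=> av; rewrite pe_mul /= ?av eqxx. Qed.

Lemma pe_sum x : exists s : seq (route Q),
  x = \sum_(r <- s) path_const Q (x r) * pe r.1 r.2.
Proof.
have [/finite_seqP[s sE] xc] := path_algP x; exists (undup s); apply: pcoef_inj => v p.
have co (I : Type) (t : seq I) (F : I -> path_alg Q K) r :
    (\sum_(i <- t) F i) r = \sum_(i <- t) F i r.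
  by elim: t => [|i t IH]; rewrite ?big_nil // !big_cons /= -IH.
rewrite co; have E0 (r : route Q) : (path_const Q (x r) * pe r.1 r.2) (v, p) = if r == (v, p) then x (v, p) else 0.
  rewrite path_constMl peE -surjective_pairing; have [<-|ne] := eqVneq r (v, p); last by rewrite mulr0.
  case: (boolP (composable _ _)) => [_|nc]; first by rewrite mulr1.
  rewrite mulr0; apply/esym/eqP/negPn/negP => xr; case/negP: nc; apply: xc.
  by rewrite -surjective_pairing.
under eq_bigr => r _ do rewrite E0.
have [x0|x0] := eqVneq (x (v, p)) 0; first by rewrite x0 big1 // => r _; case: ifP.
have vs : (v, p) \in undup s by rewrite mem_undup; have : [set` s]%classic (v, p) by rewrite -sE.
by rewrite (bigD1_seq (v, p)) ?undup_uniq //= eqxx big1 ?addr0 // => r /negbTE ->.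
Qed.

End PathElements.

Section GLS.
Variables (R : realType) (V : vectType R) (n : nat) (Phi : root_system V n).
Variables (c : seq 'I_n) (d : 'I_n -> nat) (K : fieldType).
Hypothesis hc : coxeter_word c.
Hypothesis hd : is_symmetrizer Phi d.
Notation A := (gls Phi c d K).
Notation Q := (gls_quiver Phi c).
Notation pe := (@path_elt Q K).
Notation pr := (@gls_proj R V n Phi c d K).
Notation io := (@gls_scalar R V n Phi c d K).
Notation E := (@gls_idem R V n Phi c d K).
Notation p := (cox_p Phi).

Lemma prM x y : pr (x * y) = pr x * pr y. Proof. exact: rmorphM. Qed.
Lemma prD x y : pr (x + y) = pr x + pr y. Proof. exact: rmorphD. Qed.
Lemma pr0 : pr 0 = 0. Proof. exact: rmorph0. Qed.
Lemma pr1 : pr 1 = 1. Proof. exact: rmorph1. Qed.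
Lemma pr_sum (I : Type) (s : seq I) (P : pred I) F :
  pr (\sum_(i <- s | P i) F i) = \sum_(i <- s | P i) pr (F i).
Proof. exact: rmorph_sum. Qed.
Lemma prX x k : pr (x ^+ k) = pr x ^+ k. Proof. exact: rmorphXn. Qed.
Lemma pr_surj (a : A) : exists x, a = pr x.
Proof. by exists (quot_repr a); rewrite /gls_proj quot_reprK. Qed.
Lemma pr_rel x : @gls_relations R V n Phi c d K x -> pr x = 0.
Proof.
move=> xr; rewrite -pr0; apply/quot_projP; rewrite subr0.
by apply/asboolP => I _ SI; exact: SI.
Qed.

Definition Lp i : A := pr (loop Phi c K i).
Definition Lt : A := \sum_i Lp i.
Definition At : A := \sum_(ij : {ij | has_arrow Phi c ij}) pr (arr K ij).

Lemma io_comm k (a : A) : io k * a = a * io k.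
Proof. by have [x ->] := pr_surj a; rewrite -[io k]/(pr _) -!prM path_constC. Qed.
Lemma E_E i j : E i * E j = if i == j then E i else 0.
Proof. by rewrite /gls_idem -prM pe_mul //= /path_end /=; case: ifP => _; rewrite ?pr0. Qed.

Lemma E_sum : \sum_i E i = 1.
Proof.
rewrite -pr1 /gls_idem -pr_sum; congr (pr _); apply: pcoef_inj => v q.
have co (F : 'I_n -> path_alg Q K) r : (\sum_i F i) r = \sum_i F i r.
  by elim/big_rec2: _ => // i y z _ <-.
rewrite co (bigD1 v) //= xpair_eqE eqxx /= andbT big1 ?addr0 // => i iv.
by rewrite xpair_eqE eq_sym (negbTE iv).
Qed.

Lemma E_Lp i j : E i * Lp j = if i == j then Lp j else 0.
Proof.
rewrite /gls_idem /Lp -prM pe_mul //= /path_end /=; case: (eqVneq i j) => [->//|_]; exact: pr0.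
Qed.

Lemma Lp_E i j : Lp j * E i = if i == j then Lp j else 0.
Proof.
by rewrite /gls_idem /Lp /loop -prM pe_mul /= ?eqxx // /path_end /= eq_sym; case: (eqVneq i j) => [_|_]; rewrite ?pr0.
Qed.

Lemma E_Lt i : E i * Lt = Lp i.
Proof.
rewrite /Lt mulr_sumr (bigD1 i) //= E_Lp eqxx big1 ?addr0 // => j ji.
by rewrite E_Lp eq_sym (negbTE ji).
Qed.

Lemma Lt_E i : Lt * E i = Lp i.
Proof.
rewrite /Lt mulr_suml (bigD1 i) //= Lp_E eqxx big1 ?addr0 // => j ji.
by rewrite Lp_E eq_sym (negbTE ji).
Qed.

Lemma E_Ltk i k : (0 < k)%N -> E i * Lt ^+ k = Lp i ^+ k.
Proof.
case: k => // k _; elim: k => [|k IH]; first by rewrite !expr1 E_Lt.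
rewrite exprSr mulrA IH [RHS]exprSr exprSr -!mulrA; congr (_ * _).
have LE : Lp i * E i = Lp i by rewrite Lp_E eqxx.
by rewrite -{1}LE -mulrA E_Lt.
Qed.

Lemma arr_E (ij : {ij | has_arrow Phi c ij}) k l :
  E k * pr (arr K ij) * E l = if (k == (val ij).1) && (l == (val ij).2) then pr (arr K ij) else 0.
Proof.
rewrite /gls_idem /arr -!prM pe_mul // /path_end /=; case: (eqVneq k (val ij).1) => [->|_] /=; last first.
  by rewrite mul0r pr0.
by rewrite pe_mul /= ?eqxx // /path_end /= eq_sym; case: ifP => _; rewrite ?pr0.
Qed.

Lemma E_At i j : E i * At * E j =
  if [pick ij : {ij | has_arrow Phi c ij} | val ij == (i, j)] is Some ij then pr (arr K ij) else 0.
Proof.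
rewrite /At mulr_sumr mulr_suml; case: pickP => [ij /eqP E0|none].
  rewrite (bigD1 ij) //= arr_E E0 !eqxx big1 ?addr0 // => kl ne.
  rewrite arr_E; case: ifP => // /andP[/eqP i1 /eqP j1]; case/eqP: ne; apply: val_inj.
  by rewrite E0 [LHS]surjective_pairing -i1 -j1.
rewrite big1 // => kl _; rewrite arr_E; case: ifP => // /andP[/eqP i1 /eqP j1].
by have := none kl; rewrite [val kl]surjective_pairing -i1 -j1 eqxx.
Qed.

Lemma has_arrowE i j : has_arrow Phi c (i, j) = cox_arr Phi c i j.
Proof.
rewrite /has_arrow /cox_arr /=; have [->|ij] := eqVneq i j; first by rewrite ltnn.
by rewrite simple_commute // cox_p0.
Qed.

Lemma E_At0 i j : ~~ cox_arr Phi c i j -> E i * At * E j = 0.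
Proof.
rewrite E_At -has_arrowE; case: pickP => // -[kl h] /= /eqP E0; by rewrite -E0 h.
Qed.

Lemma Lp_d i : Lp i ^+ d i = 0.
Proof. by rewrite /Lp -prX; apply: pr_rel; left; exists i. Qed.

Lemma E_rel i j : Lp i ^+ p j i * (E i * At * E j) = E i * At * E j * Lp j ^+ p i j.
Proof.
rewrite E_At; case: pickP => [[[k l] h] /= /eqP E0|_]; last by rewrite mulr0 mul0r.
case: E0 h => -> -> h.
have ij : i != j by apply: contraTneq h => ->; rewrite /has_arrow /= ltnn.
apply/eqP; rewrite -subr_eq0 /Lp -!prX -!prM -[_ - _](rmorphB (@gls_proj R V n Phi c d K)); apply/eqP/pr_rel; right.
exists (exist _ (i, j) h) => //=.
by rewrite /cox_p eq_sym (negbTE ij).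
Qed.

Lemma io0 : io 0 = 0. Proof. exact: rmorph0. Qed.
Lemma ioD k l : io (k + l) = io k + io l. Proof. exact: rmorphD. Qed.
Lemma ioM k l : io (k * l) = io k * io l. Proof. exact: rmorphM. Qed.
Lemma io1 : io 1 = 1. Proof. exact: rmorph1. Qed.

(** A single loop is E_i [Lt] and a single arrow is E_i [At] E_j, so scalars, idempotents and the
    two sums generate the algebra. *)
Lemma gls_elt_ind (P : A -> Prop) : (forall k, P (io k)) -> (forall i, P (E i)) -> P Lt -> P At ->
  (forall a b, P a -> P b -> P (a + b)) -> (forall a b, P a -> P b -> P (a * b)) -> forall a, P a.
Proof.
move=> Pk PE PL PA PD PM a; have [x ->] := pr_surj a; have [s ->] := pe_sum x.
rewrite pr_sum; elim: s => [|r s IH]; first by rewrite big_nil -io0.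
rewrite big_cons; apply: (PD _ _ _ IH); rewrite prM; apply: (PM); first exact: Pk.
case: r => v q /=; have [vq|/pe0 ->] := boolP (composable v q); last first.
  by rewrite pr0 -io0.
elim: q v vq => [|b q IHq] v /=; first by move=> _; exact: PE.
move=> /andP[/eqP sb tq]; rewrite pe_cons // prM; apply: (PM _ _ _ (IHq _ tq)).
rewrite -sb; case: b {sb tq IHq} => [i|ij].
  by rewrite -[pr _]/(Lp i) -E_Lt; exact: PM.
have <- : E (val ij).1 * At * E (val ij).2 = pr (arr K ij).
  rewrite E_At; case: pickP => [kl /eqP E0|/(_ ij)]; last by rewrite -surjective_pairing eqxx.
  by congr (pr (arr K _)); apply: val_inj; rewrite E0 -surjective_pairing.
by apply: (PM _ _ (PM _ _ _ _)).
Qed.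

Lemma loops_zero (v : 'I_n) k (q : seq (arrow Q)) : (d v <= k)%N ->
  pr (pe v (nseq k (inl v : arrow Q) ++ q)) = 0.
Proof.
move=> dk; have cl m : @composable Q v (nseq m (inl v : arrow Q)) by elim: m => //= m ->; rewrite eqxx.
have el m : @path_end Q v (nseq m (inl v : arrow Q)) = v by elim: m => //= m; rewrite /path_end /= => ->.
have lX m : loop Phi c K v ^+ m.+1 = pe v (nseq m.+1 (inl v : arrow Q)).
  elim: m => [|m IH]; first by rewrite expr1.
  by rewrite exprS IH /loop pe_mul /= ?eqxx // /path_end /= eqxx.
rewrite -(subnKC dk) nseqD -catA.
have -> : pe v (nseq (d v) (inl v : arrow Q) ++ (nseq (k - d v) (inl v : arrow Q) ++ q)) =
    pe v (nseq (d v) (inl v : arrow Q)) * pe v (nseq (k - d v) (inl v : arrow Q) ++ q).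
  by rewrite pe_mul // el eqxx.
have d0 := hd.1 v; rewrite prM -(prednK d0) -lX prednK // prX.
by rewrite [X in X * _]Lp_d mul0r.
Qed.

(* A path of nonzero image contains fewer than d_i consecutive loops at each of the
   vertices it visits, and visits the vertices in increasing order. *)
Lemma long_zero : exists N, forall v q, (N <= size q)%N -> pr (pe v q) = 0.
Proof.
pose M := (\sum_i d i)%N; have dM i : (d i <= M)%N by rewrite /M (bigD1 i) //= leq_addr.
exists ((n * M).+1)%N => v q sq.
(* k counts the loops already passed at v. In a path of nonzero image the loops at a vertex and the
   arrow leaving it take at most M letters, and at most n - index v c vertices remain. *)
suff key k : ((n - index v c) * M < k + size q)%N -> pr (pe v (nseq k (inl v : arrow Q) ++ q)) = 0.
  by apply: (key 0%N); apply: leq_ltn_trans sq; rewrite leq_mul2r leq_subr orbT.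
have idn (i : 'I_n) : (index i c < n)%N by rewrite -[X in (_ < X)%N](size_enum_ord n) -(perm_size hc) index_mem cox_mem.
elim: q v k {sq} => [|b q IH] v k sk.
  apply: loops_zero; apply: leq_trans (dM v) _; move: sk; rewrite addn0 => /ltnW; apply: leq_trans.
  by rewrite leq_pmull // subn_gt0 idn.
have [bv|bv] := boolP (composable v (b :: q)); last first.
  rewrite (@pe0 Q) ?pr0 //; apply: contra bv => /=; rewrite composable_cat => /andP[_].
  suff -> : @path_end Q v (nseq k (inl v : arrow Q)) = v by [].
  by elim: k {sk} => //= k; rewrite /path_end /= => ->.
case: b bv sk => [i|ij] /= /andP[/eqP sb bq] sk.
  have {sb} E0 : i = v by exact: sb. 
  rewrite -E0 -[inl i :: q](cat1s (inl i : arrow Q)) catA -[[:: _]]/(nseq 1 (inl i : arrow Q)) -nseqD addn1.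
  by apply: IH; rewrite E0 addSnnS.
have [dk|kd] := leqP (d v) k; first exact: loops_zero.
have cl m : @composable Q v (nseq m (inl v : arrow Q)) by elim: m => //= m ->; rewrite eqxx.
have el m : @path_end Q v (nseq m (inl v : arrow Q)) = v by elim: m => //= m; rewrite /path_end /= => ->.
have -> : pe v (nseq k (inl v : arrow Q) ++ (inr ij : arrow Q) :: q) =
    pe v (nseq k (inl v : arrow Q)) * pe v ((inr ij : arrow Q) :: q).
  by rewrite pe_mul // el eqxx.
rewrite pe_cons // !prM; have -> : pr (@path_elt Q K (@target Q (inr ij)) q) = 0; last by rewrite !mulr0.
apply: (IH _ 0%N); have := valP ij; rewrite /has_arrow => /andP[lt _].
move: sk; rewrite -sb /= => sk; rewrite add0n.
have := idn (val ij).2; move: lt; set x := index (val ij).1 c; set y := index (val ij).2 c => xy yn.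
have E1 : ((n - x) * M = (n - y) * M + (y - x) * M)%N by rewrite -mulnDl; congr (_ * _)%N; lia.
have E2 : (M <= (y - x) * M)%N by rewrite leq_pmull // subn_gt0.
have := leq_trans kd (dM v); move: sk; rewrite E1; lia.
Qed.

Lemma fin_span : exists s : seq A, forall a, exists k : nat -> K,
  a = \sum_(t < size s) s`_t * io (k t).
Proof.
have [N Nz] := long_zero.
pose qs := flatten [seq [seq tval q | q <- enum {: m.-tuple (arrow Q)}] | m <- iota 0 N].
pose s : seq A := [seq pr (pe v q) | v <- enum 'I_n, q <- qs].
have qsP q : (size q < N)%N -> q \in qs.
  move=> qN; apply/flattenP; exists [seq tval q' | q' <- enum {: (size q).-tuple (arrow Q)}].
    by apply/mapP; exists (size q); rewrite // mem_iota.
  by apply/mapP; exists (in_tuple q); rewrite // mem_enum.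
pose Sp (a : A) := exists k : nat -> K, a = \sum_(t < size s) s`_t * io (k t).
have Sp0 : Sp 0 by exists (fun=> 0); rewrite big1 // => t _; rewrite io0 mulr0.
have SpD a b : Sp a -> Sp b -> Sp (a + b).
  move=> [k ->] [k' ->]; exists (fun t => k t + k' t); rewrite -big_split; apply: eq_bigr => t _.
  by rewrite ioD mulrDr.
exists s => a; have [x ->] := pr_surj a; have [u ->] := pe_sum x; rewrite pr_sum.
elim: u => [|r u IH]; first by rewrite big_nil.
rewrite big_cons; apply: SpD IH; rewrite prM; case: r => v q /=.
have [qN|qN] := leqP N (size q); first by rewrite Nz // mulr0.
have /(nthP 0)[t ts tE] : pr (pe v q) \in s.
  by apply/allpairsP; exists (v, q); rewrite mem_enum qsP.
exists (fun t' => if t' == t then x (v, q) else 0).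
rewrite (bigD1 (Ordinal ts)) //= eqxx tE big1 ?addr0 => [|t' t't].
  by rewrite -[pr (path_const _ _)]/(io _) io_comm.
rewrite ifF ?io0 ?mulr0 //; apply/negbTE; apply: contra t't => /eqP E0; exact/eqP/val_inj.
Qed.

End GLS.

(** * The properties of the algebra on which the module theory rests *)

Section Presentation.
Variables (n : nat) (D : gdata n) (o : rel 'I_n) (K : fieldType).
Notation rep := (rep K (gen n)).
Notation e i v := (act _ (Ge i) v).
Notation l v := (act _ Gl v).
Notation a v := (act _ Ga v).
Notation p := (gp D).
Notation d := (gd D).

(* What is used of the path algebra: it is finite-dimensional, generated by scalars,
   idempotents and two elements, satisfies the relations of crep and acts on every crep. *)
Record gls_like (A : pzRingType) (io : {rmorphism K -> A}) (E : 'I_n -> A) (Lt At : A) : Prop := {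
  ga_comm : forall k x, io k * x = x * io k;
  ga_EE : forall i j, E i * E j = if i == j then E i else 0;
  ga_E1 : \sum_i E i = 1;
  ga_EL : forall i, E i * Lt = Lt * E i;
  ga_Ld : forall i, E i * Lt ^+ d i = 0;
  ga_o : forall i j, ~~ o i j -> E i * At * E j = 0;
  ga_rel : forall i j, E i * Lt ^+ p j i * At * E j = E i * At * E j * Lt ^+ p i j;
  ga_ind : forall P : A -> Prop, (forall k, P (io k)) -> (forall i, P (E i)) -> P Lt -> P At ->
    (forall x y, P x -> P y -> P (x + y)) -> (forall x y, P x -> P y -> P (x * y)) -> forall x, P x;
  ga_span : exists s : seq A, forall x, exists k : nat -> K, x = \sum_(t < size s) s`_t * io (k t);
  ga_corner : forall i x, exists k : nat -> K, E i * x * E i = \sum_(t < d i) E i * Lt ^+ t * io (k t);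
  ga_act : forall X : rep, crep D o X -> exists r : A -> X -> X,
    [/\ forall x k u v, r x (k *: u + v) = k *: r x u + r x v,
        forall x y v, r (x + y) v = r x v + r y v,
        forall x y v, r (x * y) v = r y (r x v),
        forall k v, r (io k) v = k *: v
      & [/\ forall i v, r (E i) v = e i v, forall v, r Lt v = l v & forall v, r At v = a v] ] }.

End Presentation.

(** * Action of the path algebra on representations *)

Section GLS.
Variables (R : realType) (V : vectType R) (n : nat) (Phi : root_system V n).
Variables (c : seq 'I_n) (d : 'I_n -> nat) (K : fieldType).
Hypothesis hc : coxeter_word c.
Hypothesis hd : is_symmetrizer Phi d.
Notation A := (gls Phi c d K).
Notation Q := (gls_quiver Phi c).
Notation pe := (@path_elt Q K).
Notation pr := (@gls_proj R V n Phi c d K).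
Notation io := (@gls_scalar R V n Phi c d K).
Notation E := (@gls_idem R V n Phi c d K).
Notation Lp := (@Lp R V n Phi c d K).
Notation Lt := (@Lt R V n Phi c d K).
Notation At := (@At R V n Phi c d K).
Notation p := (cox_p Phi).
Notation D := (cox_data hd).
Notation e i v := (act _ (Ge i) v).
Notation l v := (act _ Gl v).
Notation a v := (act _ Ga v).

Section Action.
Variable X : rep K (gen n).
Hypothesis cX : crep D (cox_arr Phi c) X.

Definition src (b : arrow Q) : 'I_n := @source Q b.
Definition tgt (b : arrow Q) : 'I_n := @target Q b.

Definition arrow_op (b : arrow Q) (v : X) : X :=
  match b with inl i => l (e i v) | inr ij => e (val ij).2 (a (e (val ij).1 v)) end.

Lemma arrow_opP b k u v : arrow_op b (k *: u + v) = k *: arrow_op b u + arrow_op b v.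
Proof. by case: b => [i|ij] /=; rewrite !linearP. Qed.

Lemma arrow_op_e b i v : arrow_op b (e i v) = if i == src b then arrow_op b v else 0.
Proof.
by rewrite /src; case: b => [j|ij] /=; rewrite (crep_ee cX); case: eqP => [->|_]; rewrite ?linear0 // !linear0.
Qed.

Lemma e_arrow_op b v : e (tgt b) (arrow_op b v) = arrow_op b v.
Proof. by rewrite /tgt; case: b => [j|ij] /=; rewrite ?(crep_el cX) (crep_eii _ _ cX). Qed.

(** f is a function on the paths starting at u, and m bounds the length of the paths taken into
    account. The recursion peels off the first arrow, in step with [pmul_cons]. *)
Fixpoint pact m (u : 'I_n) (f : seq (arrow Q) -> K) (v : X) : X :=
  if m is m'.+1 then f [::] *: e u v +
    \sum_(b : arrow Q | src b == u) pact m' (tgt b) (fun q => f (b :: q)) (arrow_op b v)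
  else 0.

Lemma pactP m u f k v w : pact m u f (k *: v + w) = k *: pact m u f v + pact m u f w.
Proof.
elim: m u f v w => [|m IH] u f v w /=; first by rewrite scaler0 addr0.
rewrite linearP /= scalerDr scalerA mulrC -scalerA scalerDr -!addrA; congr (_ + _).
rewrite addrCA; congr (_ + _); rewrite scaler_sumr -big_split; apply: eq_bigr => b _.
by rewrite arrow_opP IH.
Qed.

Lemma pact_0 m u f : pact m u f 0 = 0.
Proof. by have := pactP m u f (-1) 0 0; rewrite scaler0 addr0 => ->; rewrite scaleN1r addNr. Qed.

Lemma pactPf m u f g k v :
  pact m u (fun q => k * f q + g q) v = k *: pact m u f v + pact m u g v.
Proof.
elim: m u f g v => [|m IH] u f g v /=; first by rewrite scaler0 addr0.
rewrite scalerDl scalerDr scalerA -!addrA; congr (_ + _); rewrite addrCA; congr (_ + _).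
by rewrite scaler_sumr -big_split; apply: eq_bigr => b _; rewrite IH.
Qed.

Lemma pact_f0 m u f v : (forall q, f q = 0) -> pact m u f v = 0.
Proof.
elim: m u f v => //= m IH u f v f0; rewrite f0 scale0r add0r big1 // => b _.
by rewrite IH.
Qed.

Lemma pact_stab m u f v j : (forall q, (m <= size q)%N -> f q = 0) -> pact (m + j) u f v = pact m u f v.
Proof.
elim: m u f v => [|m IH] u f v fm; first by rewrite pact_f0 // => q; apply: fm.
rewrite addSn /=; congr (_ + _); apply: eq_bigr => b _; rewrite IH // => q qm.
by rewrite fm.
Qed.

Lemma pact_e m u f i v : pact m u f (e i v) = if i == u then pact m u f v else 0.
Proof.
case: m => [|m] /=; first by rewrite if_same.
case: (boolP (i == u)) => [/eqP ->|iu]; last first.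
  rewrite (crep_eij _ cX) // scaler0 add0r big1 // => b /eqP bu.
  by rewrite arrow_op_e bu (negbTE iu) pact_0.
rewrite (crep_eii _ _ cX); congr (_ + _); apply: eq_bigr => b /eqP bu.
by rewrite arrow_op_e bu eqxx.
Qed.

Lemma pact_sum m u f (I : Type) (s : seq I) (P : pred I) F :
  pact m u f (\sum_(i <- s | P i) F i) = \sum_(i <- s | P i) pact m u f (F i).
Proof.
elim/big_rec2: _ => [|i x y _ <-]; first exact: pact_0.
by rewrite -[F i]scale1r pactP !scale1r.
Qed.

Definition conv u (f : seq (arrow Q) -> K) (g : route Q -> K) q : K :=
  pmul_fun (fun r => f r.2) g (u, q).

Lemma pact_conv m m' u f g v : (forall q, (m <= size q)%N -> f q = 0) ->
  (forall w q, (m' <= size q)%N -> g (w, q) = 0) ->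
  pact (m + m') u (conv u f g) v = \sum_w pact m' w (fun q => g (w, q)) (pact m u f v).
Proof.
move=> fm gm; elim: m u f v fm => [|m IH] u f v fm.
  rewrite pact_f0 => [|q]; first by rewrite big1 // => w _; exact: pact_0.
  by rewrite /conv /pmul_fun big1 // => k _ /=; rewrite fm ?mul0r.
have E1 : \sum_w pact m' w (fun q => g (w, q)) (e u v) = g (u, [::]) *: e u v +
    \sum_(b : arrow Q | src b == u) pact (m + m') (tgt b) (fun q => g (u, b :: q)) (arrow_op b v).
  rewrite (bigD1 u) //= pact_e eqxx big1 ?addr0 => [|w wu]; last first.
    by rewrite pact_e eq_sym (negbTE wu).
  by rewrite -[RHS]/(pact (m + m').+1 u (fun q => g (u, q)) v) -addSn addnC pact_stab //; exact: gm.
have E2 : \sum_w pact m' w (fun q => g (w, q)) (pact m.+1 u f v) =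
   f [::] *: \sum_w pact m' w (fun q => g (w, q)) (e u v) +
   \sum_(b : arrow Q | src b == u) \sum_w pact m' w (fun q => g (w, q))
      (pact m (tgt b) (fun q => f (b :: q)) (arrow_op b v)).
  rewrite exchange_big scaler_sumr -big_split; apply: eq_bigr => w _ /=.
  by rewrite pactP pact_sum.
rewrite E2 E1 addSn /= scalerDr -addrA {1}/conv pmul_nil scalerA; congr (_ + _).
rewrite scaler_sumr -big_split; apply: eq_bigr => b /eqP bu /=.
rewrite -IH => [|q qm]; last exact: fm.
rewrite -pactPf; congr (pact _ _ _ _); apply/funext => q.
by rewrite /conv pmul_cons.
Qed.

Definition bounded m (x : path_alg Q K) := forall u q, (m <= size q)%N -> x (u, q) = 0.

Lemma bounded_ex x : exists m, bounded m x.
Proof.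
have [/finite_seqP[s sE] _] := path_algP x.
exists (\max_(r <- s) size r.2).+1 => u q; apply: contraTeq => xuq; rewrite -leqNgt.
have us : (u, q) \in s.
  have : [set` s]%classic (u, q) by rewrite -sE.
  by [].
exact: (@leq_bigmax_seq _ s xpredT (fun r => size r.2) (u, q)).
Qed.

Definition pa (x : path_alg Q K) (v : X) : X :=
  \sum_u pact (projT1 (cid (bounded_ex x))) u (fun q => x (u, q)) v.

Lemma pa_bound x m v : bounded m x -> pa x v = \sum_u pact m u (fun q => x (u, q)) v.
Proof.
move=> xm; rewrite /pa; case: cid => m' /= xm'; apply: eq_bigr => u _.
rewrite -(@pact_stab m' u _ v m) => [|q]; last exact: xm'.
by rewrite addnC pact_stab // => q; exact: xm.
Qed.

Lemma paP x k v w : pa x (k *: v + w) = k *: pa x v + pa x w.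
Proof. by rewrite /pa scaler_sumr -big_split; apply: eq_bigr => u _; rewrite pactP. Qed.
Lemma pa_0 x : pa x 0 = 0.
Proof. by rewrite /pa big1 // => u _; exact: pact_0. Qed.
Lemma pa_sum x (I : Type) (s : seq I) (P : pred I) F :
  pa x (\sum_(i <- s | P i) F i) = \sum_(i <- s | P i) pa x (F i).
Proof. by rewrite /pa exchange_big; apply: eq_bigr => u _; rewrite pact_sum. Qed.
Lemma boundedW m m' x : (m <= m')%N -> bounded m x -> bounded m' x.
Proof. by move=> mm xm u q mq; apply: xm; apply: leq_trans mq. Qed.

Lemma paD x y v : pa (x + y) v = pa x v + pa y v.
Proof.
have [m xm] := bounded_ex x; have [m' ym] := bounded_ex y.
rewrite (@pa_bound x (m + m')) ?(@pa_bound y (m + m')) ?(@pa_bound (x + y) (m + m')).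
- rewrite -big_split; apply: eq_bigr => u _.
  have := pactPf (m + m') u (fun q => x (u, q)) (fun q => y (u, q)) 1 v; rewrite scale1r => E0.
  rewrite -[RHS]E0.
  by congr (pact _ _ _ _); apply/funext => q; rewrite mul1r.
- by move=> u q mq /=; rewrite xm ?ym ?addr0 // (leq_trans _ mq) // ?leq_addl ?leq_addr.
- by apply: boundedW ym; rewrite leq_addl.
by apply: boundedW xm; rewrite leq_addr.
Qed.

Lemma paM x y v : pa (x * y) v = pa y (pa x v).
Proof.
have [m xm] := bounded_ex x; have [m' ym] := bounded_ex y.
rewrite (@pa_bound (x * y) (m + m')); last first.
  move=> u q mq; rewrite mulE /pmul_fun big1 // => k _ /=.
  have [mk|mk] := leqP m (size (take k q)); first by rewrite xm ?mul0r.
  rewrite ym ?mulr0 // size_drop; move: mk; rewrite size_take; have [kq|kq] /= := ltnP k (size q) => mk; first by apply: (leq_trans _ (leq_sub2r k mq)); rewrite -addnBAC ?leq_addl // ltnW.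
  by have := leq_ltn_trans (leq_trans (leq_addr m' m) mq) mk; rewrite ltnn.
rewrite (pa_bound _ ym) (pa_bound _ xm).
transitivity (\sum_u \sum_w pact m' w (fun q => y (w, q)) (pact m u (fun q => x (u, q)) v)).
  apply: eq_bigr => u _; rewrite -pact_conv => [|q|w q]; [|exact: xm|exact: ym].
  by congr (pact _ _ _ _).
by rewrite exchange_big; apply: eq_bigr => w _; rewrite pact_sum.
Qed.

Lemma pact1 u f v : pact 1 u f v = f [::] *: e u v.
Proof. by rewrite /= big1 ?addr0. Qed.

Lemma pa_const k v : pa (path_const Q k) v = k *: v.
Proof.
rewrite (@pa_bound _ 1) => [|u [|b q]] //.
rewrite -{2}(crep_1 cX v) scaler_sumr; apply: eq_bigr => u _; exact: pact1.
Qed.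

Lemma pa_1 v : pa 1 v = v.
Proof.
rewrite (@pa_bound _ 1) => [|u [|b q]] //.
rewrite -[RHS](crep_1 cX v); apply: eq_bigr => u _; rewrite pact1 /= ; exact: scale1r.
Qed.

Lemma pa_e i v : pa (pe i [::]) v = e i v.
Proof.
rewrite (@pa_bound _ 1) => [|u [|b q]] //; last first.
  by move=> _; rewrite peE; case: eqP => //= -[].
rewrite (bigD1 i) // big1 ?addr0 => [|u ui]; rewrite pact1 peE.
  by rewrite eqxx scale1r; exact: addr0.
by rewrite xpair_eqE; move: ui => /= /negbTE ->; rewrite scale0r.
Qed.

Lemma pa_arrow b v : pa (pe (src b) [:: b]) v = arrow_op b v.
Proof.
rewrite (@pa_bound _ 2) => [|u q]; last first.
  by case: q => [|? [|? ?]] // _; rewrite peE; case: eqP => //= -[].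
have pE u q : pe (src b) [:: b] (u, q) = ((u == src b) && (q == [:: b]))%:R.
  by rewrite peE /= /src eqxx !andbT xpair_eqE.
have p2 u f w : pact 2 u f w = f [::] *: e u w + \sum_(b' : arrow Q | src b' == u) f [:: b'] *: e (tgt b') (arrow_op b' w).
  by rewrite -[LHS]/(_ *: _ + \sum_(b' : arrow Q | src b' == u) pact 1 (tgt b') _ _); congr (_ + _); apply: eq_bigr => b' _; rewrite pact1.
rewrite (bigD1 (src b)) // big1 ?addr0 => [|u ub]; rewrite p2 pE.
  rewrite [LHS]addr0 andbF scale0r add0r (bigD1 b) ?eqxx // big1 ?addr0 => [|b' /andP[_ bb']]; rewrite pE.
    by rewrite !eqxx scale1r e_arrow_op; exact: addr0.
  by rewrite eqseq_cons (negbTE bb') andbF scale0r.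
rewrite (negbTE ub) scale0r add0r big1 // => b' _.
by rewrite pE (negbTE ub) scale0r.
Qed.

Lemma pa_loop i v : pa (loop Phi c K i) v = l (e i v).
Proof. exact: (pa_arrow (inl i)). Qed.
Lemma pa_arr ij v : pa (arr K ij) v = e (val ij).2 (a (e (val ij).1 v)).
Proof. exact: (pa_arrow (inr ij)). Qed.

Lemma e_loop i k v : e i (pa (loop Phi c K i ^+ k) v) = lk k (e i v).
Proof.
elim: k v => [|k IH] v; first by rewrite expr0 pa_1.
by rewrite exprS paM IH pa_loop (crep_el cX) (crep_eii _ _ cX) iterSr.
Qed.

Lemma loop_e i k v : pa (loop Phi c K i ^+ k) (e i v) = lk k (e i v).
Proof.
elim: k v => [|k IH] v; first by rewrite expr0 pa_1.
by rewrite exprS paM pa_loop (crep_eii _ _ cX) -(crep_el cX) IH (crep_el cX) iterSr.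
Qed.

Lemma pa_rel x v : @gls_relations R V n Phi c d K x -> pa x v = 0.
Proof.
have paN y w : pa (- y) w = - pa y w.
  apply/eqP; rewrite -addr_eq0 -paD addNr.
  by have := pa_const 0 w; rewrite rmorph0 scale0r => ->.
case=> [[i _ <-]|[[[i j] ij] _ <-]] /=.
  rewrite -(prednK (hd.1 i)) exprSr paM pa_loop e_loop -iterS prednK ?hd.1 //; exact: (crep_ld cX).
rewrite paD paN !paM !pa_arr e_loop loop_e /=.
have /andP[ii _] := ij.
have ne : i != j by apply: contraTneq ii => -> /=; rewrite ltnn.
apply/eqP; rewrite subr_eq0; apply/eqP; have := crep_rel cX i j v.
by rewrite /= /cox_p (negbTE ne) eq_sym (negbTE ne).
Qed.

(** The elements acting by zero form a two-sided ideal that contains the relations. *)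
Lemma pa_ideal x v : x \in ideal_gen (@gls_relations R V n Phi c d K) -> pa x v = 0.
Proof.
move=> /asboolP Ix; have: forall w, pa x w = 0; last exact.
apply: (Ix (fun y => forall w, pa y w = 0)) => [|y Ry w]; last exact: pa_rel.
split=> [w|y z y0 z0 w|y z b y0 w]; first by rewrite -[0 in LHS](rmorph0 (@path_const Q K)) pa_const scale0r.
  have := paD (y - z) z w; by rewrite subrK y0 z0 addr0 => <-.
by rewrite !paM y0 pa_0.
Qed.

Lemma gls_act : exists r : A -> X -> X,
    [/\ forall x k u v, r x (k *: u + v) = k *: r x u + r x v,
        forall x y v, r (x + y) v = r x v + r y v,
        forall x y v, r (x * y) v = r y (r x v),
        forall k v, r (io k) v = k *: v
      & [/\ forall i v, r (E i) v = e i v, forall v, r Lt v = l v & forall v, r At v = a v] ].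
Proof.
pose r (x : A) v := pa (quot_repr x) v.
have rpr x v : r (pr x) v = pa x v.
  have /pa_ideal-/(_ v) : quot_repr (pr x) - x \in ideal_gen (@gls_relations R V n Phi c d K).
    by apply/quot_projP; rewrite quot_reprK.
  by have := paD (quot_repr (pr x) - x) x v; rewrite subrK => E1 E2; rewrite -[RHS]add0r -E2 -E1.
have rD x y v : r (x + y) v = r x v + r y v.
  by have [x' ->] := pr_surj x; have [y' ->] := pr_surj y; rewrite -prD !rpr paD.
have rM x y v : r (x * y) v = r y (r x v).
  by have [x' ->] := pr_surj x; have [y' ->] := pr_surj y; rewrite -prM !rpr paM.
have rL x k u v : r x (k *: u + v) = k *: r x u + r x v by exact: paP.
have r0 v : r 0 v = 0 by rewrite -(@pr0 _ _ _ Phi c d K) rpr -[0](rmorph0 (@path_const Q K)) pa_const scale0r.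
have rS (I : Type) (s : seq I) F v : r (\sum_(i <- s) F i) v = \sum_(i <- s) r (F i) v.
  by elim/big_rec2: _ => [|i x y _ <-]; rewrite ?r0.
have rE i v : r (E i) v = e i v by rewrite /E rpr pa_e.
have rLt v : r Lt v = l v.
  by rewrite /Lt rS -[in RHS](crep_1 cX v) linear_sum; apply: eq_bigr => i _; rewrite rpr pa_loop.
exists r; split=> // [k v|]; first by rewrite rpr pa_const.
split=> // v.
have key i j (w : X) : e j (r At (e i w)) = e j (a (e i w)).
  rewrite -(rE j) -(rE i) -!rM mulrA E_At; case: pickP => [ij /eqP ijE|none].
    by rewrite rpr pa_arr ijE /= !rE.
  rewrite r0 rE; have [ij|/(crep_o cX)->//] := boolP (cox_arr Phi c i j).
  by move: ij; rewrite -has_arrowE // => ij; have := none (exist _ (i, j) ij); rewrite /= eqxx.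
rewrite -[LHS](crep_1 cX) -[RHS](crep_1 cX); apply: eq_bigr => j _.
have rsum (F : 'I_n -> X) : r At (\sum_i F i) = \sum_i r At (F i).
  by rewrite /r pa_sum.
rewrite -{1}(crep_1 cX v) -{2}(crep_1 cX v) rsum [LHS]linear_sum [in RHS]linear_sum [RHS]linear_sum.
by apply: eq_bigr => i _; exact: key.
Qed.

End Action.

(** Arrows between different vertices increase the position in c, so a closed path consists of
    loops. Hence the corner at i is spanned by powers of the loop. *)
Lemma path_loops i q : @composable Q i q -> @path_end Q i q = i -> q = nseq (size q) (inl i).
Proof.
have ends (u : 'I_n) p : @composable Q u p -> (index u c <= index (@path_end Q u p : 'I_n) c)%N.
  elim: p u => [|b p IH] u //= /andP[/eqP bu /IH /=]; apply: leq_trans.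
  by rewrite -bu; case: b {IH bu} => [j|[[j k] jk]] //=; case/andP: jk => /ltnW.
elim: q i => [|[j|[[j k] jk]] q IH] i //=.
  by move=> /andP[/eqP -> cq] qe; rewrite -{1}(IH _ cq qe).
move=> /andP[/eqP /= ji cq] qe; have := ends _ _ cq; have /andP[jk' _] := jk.
by rewrite -[path_end _ _]/(@path_end Q i (inr (exist _ (j, k) jk) :: q)) qe -ji leqNgt jk'.
Qed.

Lemma pr_loops i k : pr (pe i (nseq k (inl i : arrow Q))) = E i * Lt ^+ k.
Proof.
elim: k => [|k IH]; first by rewrite expr0 mulr1.
rewrite (@pe_cons Q K i (inl i)) // prM IH exprS mulrA mulrA -[pr _]/(Lp i).
by rewrite E_Lt Lp_E eqxx.
Qed.

Lemma gls_corner i x : exists k : nat -> K, E i * x * E i = \sum_(t < d i) E i * Lt ^+ t * io (k t).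
Proof.
have [{}x ->] := pr_surj x; have [s {1}->] := pe_sum x; move: (x : route Q -> K) => f {x}.
elim: s => [|[u q] s [k IH]].
  by exists (fun=> 0); rewrite big_nil pr0 mulr0 mul0r big1 // => t _; rewrite io0 mulr0.
rewrite big_cons prD mulrDr mulrDl IH prM -[pr (path_const _ _)]/(io _) -!mulrA mulrA -io_comm -mulrA [E i * _]mulrA /=.
suff [k' kE] : exists k' : nat -> K, E i * pr (pe u q) * E i = \sum_(t < d i) E i * Lt ^+ t * io (k' t).
  exists (fun t => f (u, q) * k' t + k t) => /=; rewrite kE mulr_sumr -big_split.
  by apply: eq_bigr => t _ /=; rewrite ioD mulrDr ioM; congr (_ + _); rewrite [in LHS]io_comm [in RHS](io_comm (f (u, q)) (io (k' t))) -!mulrA.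
have z : exists k' : nat -> K, 0 = \sum_(t < d i) E i * Lt ^+ t * io (k' t).
  by exists (fun=> 0); rewrite big1 // => t _; rewrite io0 mulr0.
have [cq|ncq] := boolP (@composable Q u q); last first.
  by rewrite pe0 // pr0 mulr0 mul0r.
rewrite {1 2}/gls_idem -!prM pe_mul //=; case: eqP => [ui|_]; last by rewrite mul0r pr0.
subst u; rewrite pe_mul //=; case: eqP => [qi|_]; last by rewrite pr0.
rewrite cats0 (path_loops cq qi) pr_loops.
have [qd|dq] := ltnP (size q) (d i).
  exists (fun t => (t == size q)%:R); rewrite (bigD1 (Ordinal qd)) //= eqxx io1 mulr1 big1 ?addr0 // => t.
  by rewrite -val_eqE /= => /negbTE ->; rewrite io0 mulr0.
rewrite E_Ltk ?(leq_trans (hd.1 i)) // -(subnK dq) exprD Lp_d // mulr0; exact: z.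
Qed.

Lemma gls_is_like : gls_like D (cox_arr Phi c) io E Lt At.
Proof.
have EL i : E i * Lt = Lt * E i by rewrite E_Lt Lt_E.
have EEL i k : E i * Lt ^+ k = Lt ^+ k * E i.
  by elim: k => [|k IH]; rewrite ?expr0 ?mulr1 ?mul1r // exprSr mulrA IH -!mulrA EL.
split=> //.
- exact: io_comm.
- exact: E_E.
- exact: E_sum.
- by move=> i /=; rewrite E_Ltk ?hd.1 // Lp_d.
- exact: E_At0.
- move=> i j /=.
  have -> k : E i * Lt ^+ k * At * E j = Lp i ^+ k * (E i * At * E j).
    have [->|k0] := posnP k; first by rewrite !expr0 mulr1 mul1r.
    by rewrite -E_Ltk // !mulrA -[_ * E i]mulrA -EEL !mulrA E_E eqxx.
  rewrite E_rel //; have [->|k0] := posnP (p i j); first by rewrite !expr0.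
  by rewrite -E_Ltk // !mulrA -[_ * E j * E j]mulrA E_E eqxx.
- exact: gls_elt_ind.
- exact: fin_span.
- exact: gls_corner.
- exact: gls_act.
Qed.

End GLS.

(** * Modules as representations *)

Section Models.
Variables (n : nat) (D : gdata n) (o : rel 'I_n) (K : fieldType).
Variables (A : pzRingType) (io : {rmorphism K -> A}) (E : 'I_n -> A) (Lt At : A).
Hypothesis ga : gls_like D o io E Lt At.
Notation rep := (rep K (gen n)).
Notation mdl := (lmodType A^c).
Notation e i v := (act _ (Ge i) v).
Notation l v := (act _ Gl v).
Notation a v := (act _ Ga v).
Implicit Types (M N P : mdl) (X Y Z : rep).

Lemma rmulD M (m : M) (x y : A) : rmul m (x + y) = rmul m x + rmul m y.
Proof. exact: scalerDl. Qed.
Lemma rmul_Dl M (m m' : M) (x : A) : rmul (m + m') x = rmul m x + rmul m' x.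
Proof. exact: scalerDr. Qed.
Lemma rmulM M (m : M) (x y : A) : rmul m (x * y) = rmul (rmul m x) y.
Proof. by rewrite /rmul scalerA. Qed.
Lemma rmul1 M (m : M) : rmul m 1 = m.
Proof. exact: scale1r. Qed.
Lemma rmulx0 M (m : M) : rmul m 0 = 0.
Proof. exact: scale0r. Qed.
Lemma rmul0x M (x : A) : rmul (0 : M) x = 0.
Proof. exact: scaler0. Qed.
Lemma rmul_suml M (I : Type) (s : seq I) (Q : pred I) (F : I -> M) (x : A) :
  rmul (\sum_(i <- s | Q i) F i) x = \sum_(i <- s | Q i) rmul (F i) x.
Proof. exact: scaler_sumr. Qed.
Lemma rmul_sum M (I : Type) (s : seq I) (Q : pred I) (m : M) (F : I -> A) :
  rmul m (\sum_(i <- s | Q i) F i) = \sum_(i <- s | Q i) rmul m (F i).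
Proof. exact: scaler_suml. Qed.
Lemma rmul_lin M N (f : {linear M -> N}) m (x : A) : f (rmul m x) = rmul (f m) x.
Proof. exact: linearZ. Qed.

Lemma mlin_ex M N (h : M -> N) : (forall x u v, h (rmul u x + v) = rmul (h u) x + h v) ->
  exists f : {linear M -> N}, forall m, f m = h m.
Proof.
move=> lh; pose L := GRing.isLinear.Build A^c M N _ h lh.
by pose h' : {linear M -> N} := HB.pack h L; exists h'.
Qed.

(* X is the K-linear shape of the right module M *)
Record model X M (b : X -> M) : Prop := Model {
  md_lin : forall k u v, b (k *: u + v) = rmul (b u) (io k) + b v;
  md_inj : injective b;
  md_surj : forall m, exists v, b v = m;
  md_e : forall i v, b (e i v) = rmul (b v) (E i);
  md_l : forall v, b (l v) = rmul (b v) Lt;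
  md_a : forall v, b (a v) = rmul (b v) At }.

Section OneModel.
Variables (X : rep) (M : mdl) (b : X -> M).
Hypothesis bP : model b.

Lemma md_D u v : b (u + v) = b u + b v.
Proof. by have := md_lin bP 1 u v; rewrite scale1r rmorph1 rmul1. Qed.
Lemma md_0 : b 0 = 0.
Proof. by apply: (addrI (b 0)); rewrite -md_D !addr0. Qed.
Lemma md_Z k v : b (k *: v) = rmul (b v) (io k).
Proof. by have := md_lin bP k v 0; rewrite !addr0 md_0 addr0. Qed.
Lemma md_sum (I : Type) (s : seq I) (Q : pred I) (F : I -> X) :
  b (\sum_(i <- s | Q i) F i) = \sum_(i <- s | Q i) b (F i).
Proof. by elim/big_rec2: _ => [|i x y _ <-]; rewrite ?md_0 ?md_D. Qed.
Lemma md_B u v : b (u - v) = b u - b v.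
Proof. by apply: (addIr (b v)); rewrite -md_D !subrK. Qed.
Lemma md_eq0 v : b v = 0 -> v = 0.
Proof. by rewrite -md_0 => /(md_inj bP). Qed.
Lemma md_lk k v : b (lk k v) = rmul (b v) (Lt ^+ k).
Proof.
elim: k => [|k IH]; first by rewrite expr0 rmul1.
by rewrite iterS (md_l bP) IH exprSr rmulM.
Qed.

Lemma model_crep : crep D o X.
Proof.
have inj := md_inj bP.
have EL i k : E i * Lt ^+ k = Lt ^+ k * E i.
  by elim: k => [|k IH]; rewrite ?expr0 ?mulr1 ?mul1r // exprSr mulrA IH -!mulrA (ga_EL ga).
split=> [i j v|v|i v|i v|i j v oij|i j v]; apply: inj.
- by rewrite !(md_e bP) -rmulM (ga_EE ga); case: eqP => _; rewrite ?(md_e bP) ?md_0 ?rmulx0.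
- rewrite md_sum -[RHS]rmul1 -(ga_E1 ga) rmul_sum; apply: eq_bigr => i _; exact: (md_e bP).
- by rewrite (md_e bP) !(md_l bP) (md_e bP) -!rmulM (ga_EL ga).
- by rewrite md_lk (md_e bP) -rmulM (ga_Ld ga) rmulx0 md_0.
- by rewrite (md_e bP) (md_a bP) (md_e bP) -!rmulM !mulrA (ga_o ga oij) rmulx0 md_0.
rewrite (md_e bP) (md_a bP) md_lk (md_e bP) -!rmulM !mulrA (ga_rel ga).
by rewrite md_lk (md_e bP) (md_a bP) (md_e bP) -!rmulM !mulrA.
Qed.

Lemma model_fg : fin_gen M.
Proof.
exists (\dim {:X}), (fun i => b (vbasis {:X})`_i) => m.
have [v <-] := md_surj bP m; exists (fun i => io (coord (vbasis {:X}) i v)).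
by rewrite {1}(coord_vbasis (memvf v)) md_sum; apply: eq_bigr => i _; rewrite md_Z.
Qed.

End OneModel.

Lemma rep_of_lin (V : vectType K) M (b : V -> M) :
  (forall k u v, b (k *: u + v) = rmul (b u) (io k) + b v) -> injective b ->
  (forall m, exists v, b v = m) -> exists X (b' : X -> M), model b'.
Proof.
move=> bl bi bs; have [h hE] := choice bs.
have op x : exists f : 'End(V), forall v, b (f v) = rmul (b v) x.
  have [|f fE] := @lin_ex K V V (fun v => h (rmul (b v) x)); last by exists f => v; rewrite fE hE.
  move=> k u v; apply: bi; rewrite hE !bl !hE rmul_Dl -!rmulM.
  by rewrite (ga_comm ga).
have [f fE] := choice op.
exists (Rep (fun g => match g with Ge i => f (E i) | Gl => f Lt | Ga => f At end)), b.
by split=> // *; exact: fE.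
Qed.

(** A module with k generators is spanned over K by k |s| elements, where s spans the algebra; its
    K-linear shape is the quotient of K^(k |s|) by the kernel of this parametrisation. *)
Lemma rep_ex M : fin_gen M -> exists X (b : X -> M), model b.
Proof.
move=> [k [g gP]]; have [s sP] := ga_span ga.
pose V := {ffun 'I_k * 'I_(size s) -> K^o}.
pose b0 (v : V) := \sum_(t : 'I_k * 'I_(size s)) rmul (rmul (g t.1) s`_t.2) (io (v t)).
have b0l c u v : b0 (c *: u + v) = rmul (b0 u) (io c) + b0 v.
  rewrite /b0 rmul_suml -big_split; apply: eq_bigr => t _ /=.
  have -> : io ((c *: u + v) t) = io (u t) * io c + io (v t).
    by rewrite !ffunE rmorphD -(ga_comm ga); congr (_ + _); exact: (rmorphM io c (u t)).
  by rewrite rmulD !rmulM.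
have b0s m : exists v, b0 v = m.
  have [x ->] := gP m; have [f fP] := choice (fun i => sP (x i)).
  exists [ffun t : 'I_k * 'I_(size s) => f t.1 t.2]; rewrite /b0.
  transitivity (\sum_i \sum_(j < size s) rmul (rmul (g i) s`_j) (io (f i j))).
    by rewrite pair_bigA; apply: eq_bigr => t _; rewrite ffunE.
  apply: eq_bigr => i _; rewrite [in RHS]fP rmul_sum; apply: eq_bigr => j _.
  by rewrite rmulM.
have b00 : b0 0 = 0 by rewrite /b0 big1 // => t _; rewrite ffunE rmorph0 rmulx0.
(* With no operators, [quotrep_ex] is the quotient of a vector space. *)
pose W := @Rep K void V (fun g => match g with end).
have [| |Q [q [_ qe qk]]] := @quotrep_ex K void W (fun v => b0 v = 0).
- by split=> // c u v u0 v0; rewrite b0l u0 v0 rmul0x addr0.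
- by case.
have [r rE] := choice qe.
have b0N u v : q u = q v -> b0 u = b0 v.
  move=> quv; have : q (u - v) = 0 by rewrite linearB /= quv subrr.
  move=> /qk; rewrite -scaleN1r addrC b0l rmorphN1 /rmul scaleN1r => /eqP.
  by rewrite addrC subr_eq0 => /eqP.
apply: (@rep_of_lin Q M (fun v => b0 (r v))).
- move=> c u v; rewrite -b0l; apply: b0N; rewrite rE -{1}(rE u) -{1}(rE v); exact: (esym (linearP q c (r u) (r v))).
- move=> u v uv; rewrite -(rE u) -(rE v); apply/eqP; rewrite -subr_eq0.
  have -> : q (r u) - q (r v) = q (r u - r v) by exact: (esym (linearB q (r u) (r v))).
  by apply/eqP/qk; rewrite -scaleN1r addrC b0l uv rmorphN1 /rmul scaleN1r addNr.
by move=> m; have [v <-] := b0s m; exists (q v); apply: b0N; rewrite rE.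
Qed.

Lemma module_ex X : crep D o X -> exists M (b : X -> M), model b.
Proof.
move=> /(ga_act ga)[r [rl rD rM rio [rE rL rA]]].
have rDr x u v : r x (u + v) = r x u + r x v by have := rl x 1 u v; rewrite !scale1r.
have r1 v : r 1 v = v by rewrite -(rmorph1 io) rio scale1r.
have scA (x y : A^c) v : r x (r y v) = r (x * y) v by rewrite -rM.
have scD : {morph (fun x : A^c => r x) : x y / x + y >-> (fun v => x v + y v)}.
  by move=> x y; apply/funext => v; exact: rD.
pose m := GRing.Zmodule_isLmodule.Build A^c X (scale := fun (x : A^c) v => r x v) scA r1 (fun x u v => rDr x u v)
  (fun v x y => rD x y v).
pose M : lmodType A^c := HB.pack (X : Type) (GRing.Zmodule.class X) m.
exists M, id; split=> //.
- by move=> k u v; rewrite /rmul /GRing.scale /= rio.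
- by move=> v; exists v.
- by move=> i v; rewrite -rE.
- by move=> v; rewrite -rL.
by move=> v; rewrite -rA.
Qed.

Lemma hom_mlin X Y M N (b : X -> M) (b' : Y -> N) (f : {linear M -> N}) : model b -> model b' ->
  exists h : 'Hom(X, Y), hom h /\ forall v, b' (h v) = f (b v).
Proof.
move=> bP bP'; have [g gE] := choice (fun v => md_surj bP' (f (b v))).
have [k u v|h hE] := @lin_ex K X Y g.
  by apply: (md_inj bP'); rewrite (md_lin bP') !gE (md_lin bP) linearD rmul_lin.
exists h; split=> [x v|v]; last by rewrite hE.
apply: (md_inj bP'); rewrite !hE gE.
by case: x => [i||]; rewrite ?(md_e bP, md_l bP, md_a bP) ?(md_e bP', md_l bP', md_a bP') gE rmul_lin.
Qed.

(** Compatibility with the generators of A propagates to all of A by [ga_ind]. *)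
Lemma mlin_hom X Y M N (b : X -> M) (b' : Y -> N) (h : 'Hom(X, Y)) : model b -> model b' -> hom h ->
  exists f : {linear M -> N}, forall v, f (b v) = b' (h v).
Proof.
move=> bP bP' hh; have [g gE] := choice (md_surj bP).
have gb v : g (b v) = v by apply: (md_inj bP).
have key x : forall m, b' (h (g (rmul m x))) = rmul (b' (h (g m))) x.
  apply: (ga_ind ga (P := fun x => forall m, b' (h (g (rmul m x))) = rmul (b' (h (g m))) x)) => {x}.
  - by move=> k m; rewrite -{1}(gE m) -(md_Z bP) gb linearZ (md_Z bP').
  - by move=> i m; rewrite -{1}(gE m) -(md_e bP) gb hh (md_e bP').
  - by move=> m; rewrite -{1}(gE m) -(md_l bP) gb hh (md_l bP').
  - by move=> m; rewrite -{1}(gE m) -(md_a bP) gb hh (md_a bP').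
  - move=> x y xP yP m; rewrite !rmulD -xP -yP -(md_D bP') -linearD; congr (b' (h _)).
    by apply: (md_inj bP); rewrite (md_D bP) !gE.
  by move=> x y xP yP m; rewrite !rmulM -xP -yP.
have [x u v|f fE] := @mlin_ex M N (fun m => b' (h (g m))); last by exists f => v; rewrite fE gb.
rewrite -key -(md_D bP') -linearD; congr (b' (h _)).
by apply: (md_inj bP); rewrite (md_D bP) !gE.
Qed.

Lemma model_iso X Y M N (b : X -> M) (b' : Y -> N) : model b -> model b' -> (isom M N <-> iso X Y).
Proof.
move=> bP bP'; split.
  move=> [f [g fK gK]]; have [h [hh hE]] := hom_mlin f bP bP'.
  exists h; split=> // [v hv|w].
    apply: (md_eq0 bP); apply: (can_inj fK); by rewrite -hE hv (md_0 bP') linear0.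
  have [v vE] := md_surj bP (g (b' w)); exists v; apply: (md_inj bP'); by rewrite hE vE gK.
move=> [h [hh hm he]]; have [k [kh hK kK]] := hom_inv hh hm he.
have [f fE] := mlin_hom bP bP' hh; have [g gE] := mlin_hom bP' bP kh.
exists f, g => m; first by have [v <-] := md_surj bP m; rewrite fE gE hK.
by have [v <-] := md_surj bP' m; rewrite gE fE kK.
Qed.

Lemma model_zero X M (b : X -> M) : model b -> (zero_module M <-> rep0 X).
Proof.
move=> bP; split=> z; first by move=> v; apply: (md_eq0 bP); exact: z.
by move=> m; have [v <-] := md_surj bP m; rewrite (z v) (md_0 bP).
Qed.

Lemma model_transfer X M N (b : X -> M) (f : {linear M -> N}) : model b -> bijective f ->
  model (fun v => f (b v)).
Proof.
move=> bP [g fK gK]; split.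
- by move=> k u v; rewrite (md_lin bP) linearD rmul_lin.
- by move=> u v /(can_inj fK)/(md_inj bP).
- by move=> m; have [v vE] := md_surj bP (g m); exists v; rewrite vE gK.
- by move=> i v; rewrite (md_e bP) rmul_lin.
- by move=> v; rewrite (md_l bP) rmul_lin.
by move=> v; rewrite (md_a bP) rmul_lin.
Qed.

Definition Tg (S : rep -> Prop) M := exists X (b : X -> M), model b /\ S X.

Notation C := (inC D o finset.setT).

Lemma inC_setT X : C X <-> crep D o X.
Proof. by split=> [[]//|cX]; split=> // j; rewrite finset.in_setT. Qed.

Lemma crep_sub X Y (h : 'Hom(X, Y)) : hom h -> mono h -> crep D o Y -> crep D o X.
Proof.
move=> hh hm cY; apply/(inC_setT X)/(ambient_sub (crep_amb K D o finset.setT) hh hm).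
exact/(inC_setT Y).
Qed.

Lemma Tg_model S X M (b : X -> M) : (forall Y Z, iso Y Z -> S Y -> S Z) -> model b -> (Tg S M <-> S X).
Proof.
move=> Siso bP; split=> [[Y [b' [bP' SY]]]|SX]; last by exists X, b.
apply: Siso SY; apply/(model_iso bP' bP); exists idfun; by exists id.
Qed.

Lemma Tg_torsion T : tors C T -> torsion_class (Tg T).
Proof.
move=> tT; have Tiso Y Z : iso Y Z -> T Y -> T Z by exact: tors_iso tT.
have [TC T0 Tq Te] := tT; split.
- by move=> M [X [b [bP _]]]; exact: model_fg bP.
- move=> M M0; have [|X [b bP]] := @rep_ex M.
    by exists 0%N, (fun=> 0) => m; exists (fun=> 0); rewrite big_ord0; exact: M0.
  by exists X, b; split=> //; apply: T0; apply/(model_zero bP).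
- move=> M N f [X [b [bP TX]]] fs.
  have [k [g gP]] := model_fg bP; have [|Y [b' bP']] := @rep_ex N.
    exists k, (fun i => f (g i)) => m; have [u <-] := fs m; have [x ->] := gP u.
    by exists x; rewrite linear_sum; apply: eq_bigr => i _; rewrite rmul_lin.
  exists Y, b'; split=> //; have [h [hh hE]] := hom_mlin f bP bP'.
  apply: Tq TX; first exact: hh.
  move=> w; have [u uE] := fs (b' w); have [v vE] := md_surj bP u.
  by exists v; apply: (md_inj bP'); rewrite hE vE.
move=> L M N f g fi fg gs [X [b [bP TX]]] [Z [b' [bP' TZ]]].
(* The middle term is generated by the generators of L and lifts of those of N. *)
have [|Y [bY bYP]] := @rep_ex M.
  have [k [x xP]] := model_fg bP; have [k' [y yP]] := model_fg bP'.
  have [z zP] := choice (fun j => gs (y j)).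
  exists (k + k')%N, (fun t => match fintype.split t with inl i => f (x i) | inr j => z j end) => m.
  have [s sE] := yP (g m).
  have : g (m - \sum_(j < k') rmul (z j) (s j)) = 0.
    rewrite linearB sE linear_sum -sumrB big1 // => j _.
    by rewrite rmul_lin zP subrr.
  move=> /fg[w wE]; have [r rE] := xP w.
  exists (fun t => match fintype.split t with inl i => r i | inr j => s j end).
  rewrite big_split_ord -[LHS](subrK (\sum_(j < k') rmul (z j) (s j))) -wE rE linear_sum.
  congr (_ + _); apply: eq_bigr => t _; first by rewrite (unsplitK (inl t)) rmul_lin.
  by rewrite (unsplitK (inr t)).
exists Y, bY; split=> //.
have [i [ih iE]] := hom_mlin f bP bYP; have [q [qh qE]] := hom_mlin g bYP bP'.
apply: (Te X Y Z i q) => //; last exact/inC_setT/(model_crep bYP).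
split=> // [v iv|w|v].
- by apply: (md_eq0 bP); apply: fi; rewrite -iE iv (md_0 bYP) linear0.
- have [u uE] := gs (b' w); have [v vE] := md_surj bYP u.
  by exists v; apply: (md_inj bP'); rewrite qE vE.
split=> [qv|[w ->]].
  have /fg[u uE] : g (bY v) = 0 by rewrite -qE qv (md_0 bP').
  by have [w wE] := md_surj bP u; exists w; apply: (md_inj bYP); rewrite iE wE.
by apply: (md_eq0 bP'); rewrite qE iE; apply/fg; exists (b w).
Qed.

Lemma torsion_Tg (S : mdl -> Prop) : torsion_class S -> exists T, tors C T /\ S = Tg T.
Proof.
move=> [Sf S0 Sq Se].
have Siso M N : isom M N -> S M -> S N by move=> [f [g fK gK]] SM; apply: (Sq M N f) => // y; exists (g y).
pose T X := exists M (b : X -> M), model b /\ S M.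
have TS X M (b : X -> M) : model b -> T X -> S M.
  move=> bP [M' [b' [bP' SM]]]; apply: Siso SM; apply/(model_iso bP' bP); exact: iso_refl.
exists T; split.
  split.
  - by move=> X [M [b [bP _]]]; apply/inC_setT/(model_crep bP).
  - move=> X X0; have [|M [b bP]] := @module_ex X.
      have z : forall u v : X, u = v by move=> u v; rewrite (X0 u) (X0 v).
      by split=> *; apply: z.
    by exists M, b; split=> //; apply: S0; apply/(model_zero bP).
  - move=> X Y f fh fe [M [b [bP SM]]].
    have [N [b' bP']] := module_ex (crep_quot fh fe (model_crep bP)).
    exists N, b'; split=> //; have [g gE] := mlin_hom bP bP' fh.
    apply: (Sq M N g) => // m; have [w <-] := md_surj bP' m; have [v <-] := fe w.
    by exists (b v); rewrite gE.
  move=> X Y Z i q [ih im qh qe iq] /inC_setT cY TX TZ.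
  have [N [bY bYP]] := module_ex cY.
  have [L [bX [bXP SL]]] := TX; have [M [bZ [bZP SM]]] := TZ.
  have [f fE] := mlin_hom bXP bYP ih; have [g gE] := mlin_hom bYP bZP qh.
  exists N, bY; split=> //; apply: (Se L N M f g) => //.
  - move=> u u' ; have [v <-] := md_surj bXP u; have [v' <-] := md_surj bXP u'.
    by rewrite !fE => /(md_inj bYP)/(mono_inj im) ->.
  - move=> y; have [w <-] := md_surj bYP y; rewrite gE; split.
      by move=> /(md_eq0 bZP)/iq[v ->]; exists (bX v); rewrite fE.
    move=> [x]; have [v <-] := md_surj bXP x; rewrite fE => /(md_inj bYP) <-.
    by have /iq -> : exists u, i v = i u; [exists v | rewrite (md_0 bZP)].
  move=> m; have [z <-] := md_surj bZP m; have [w <-] := qe z.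
  by exists (bY w); rewrite gE.
apply/funext => M; apply/propext; split; last by move=> [X [b [bP TX]]]; exact: (TS _ _ _ bP TX).
by move=> SM; have [X [b bP]] := rep_ex (Sf _ SM); exists X, b; split=> //; exists M, b.
Qed.

Lemma Tg_sub S T : (forall X, S X -> crep D o X) -> (forall Y Z, iso Y Z -> T Y -> T Z) ->
  (subclass (Tg S) (Tg T) <-> forall X, S X -> T X).
Proof.
move=> Sc Tiso; split=> [ST X SX|ST M [X [b [bP SX]]]]; last by exists X, b; split=> //; apply: ST.
have [M [b bP]] := module_ex (Sc _ SX).
by apply/(Tg_model Tiso bP); apply: ST; exists X, b.
Qed.

End Models.

(** * Fitting's lemma *)

Section Fitting.
Variables (K : fieldType) (G : Type).
Implicit Types M I : rep K G.

Lemma hom_iter M (f : 'End(M)) : hom f -> forall k, exists g : 'End(M), hom g /\ forall v, g v = iter k f v.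
Proof.
move=> hf; elim=> [|k [g [hg gE]]]; first by exists \1%VF; split=> [|v]; [exact: hom1 | rewrite id_lfunE].
by exists (f \o g)%VF; split=> [|v]; [exact: hom_comp | rewrite comp_lfunE gE].
Qed.

(** Take k with ker f^k of largest dimension. I is the image of f^(k+1), embedded by i, and r is
    f^(k+1) onto it; r i is injective because the kernels no longer grow. *)
Lemma fitting M (f : 'End(M)) : hom f -> exists k I (i : 'Hom(I, M)) (r : 'Hom(M, I)),
  [/\ hom i, hom r, mono i, forall v, i (r v) = iter k.+1 f v & forall v, r (i v) = 0 -> v = 0].
Proof.
move=> hf; have [pw pwP] := choice (hom_iter hf).
have ker_le k m : (lker (pw k) <= lker (pw (m + k)%N))%VS.
  apply/subvP => v; rewrite !memv_ker => /eqP kv; have pv : iter k f v = 0 by rewrite -(pwP k).2.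
  rewrite (pwP _).2 iterD pv; apply/eqP; elim: m => //= m ->; exact: linear0.
pose good t := `[< exists k, \dim (lker (pw k)) = t >].
have ex0 : exists t, good t by exists (\dim (lker (pw 0%N))); apply/asboolP; exists 0%N.
have bnd t : good t -> (t <= \dim {:M})%N by move=> /asboolP[k <-]; rewrite dimvS ?subvf.
case: (ex_maxnP ex0 bnd) => t /asboolP[k kt] tmax.
have [I [r [i [hr re hi im ir]]]] := image_ex (pwP k.+1).1.
exists k, I, i, r; split=> // [v|w riw]; first by rewrite -ir (pwP _).2.
have [v vE] := re w.
have E1 : lker (pw k.+1) = lker (pw (k.+1 + k.+1)%N).
  apply/eqP; rewrite eqEdim ker_le; apply: (@leq_trans (\dim (lker (pw k)))).
    by rewrite kt; apply: tmax; apply/asboolP; exists (k.+1 + k.+1)%N.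
  by rewrite dimvS // -addn1 addnC ker_le.
have : v \in lker (pw k.+1).
  rewrite E1 memv_ker (pwP _).2 iterD -!(pwP k.+1).2 !ir vE riw; exact/eqP/linear0.
rewrite memv_ker ir vE => /eqP/im //.
Qed.

End Fitting.

(** * Tau-rigid modules *)

Section TauRigid.
Variables (n : nat) (D : gdata n) (o : rel 'I_n) (K : fieldType).
Variables (A : pzRingType) (io : {rmorphism K -> A}) (E : 'I_n -> A) (Lt At : A).
Hypothesis ga : gls_like D o io E Lt At.
Notation rep := (rep K (gen n)).
Notation mdl := (lmodType A^c).
Notation model := (@model n K A io E Lt At _ _).
Implicit Types (M N P : mdl) (X Y Z : rep).

Notation free k := ({ffun 'I_k -> (A^c)^o} : mdl).

Lemma ffun_delta k (x : free k) : x = \sum_i rmul ([ffun j => ((i == j)%:R : A)] : free k) (x i : A).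
Proof.
apply/ffunP => j; rewrite sum_ffunE (bigD1 j) //= big1 ?addr0 => [|i ij]; rewrite !ffunE.
  by rewrite eqxx /GRing.scale /= ; exact: (esym (mul1r (x j : A))).
by rewrite (negbTE ij); exact: (mul0r (x i : A)).
Qed.

Lemma free_gen k : fin_gen (free k).
Proof. by exists k, (fun i => [ffun j => ((i == j)%:R : A)]) => x; exists x; exact: ffun_delta. Qed.

Lemma free_map k N (y : 'I_k -> N) : exists h : {linear free k -> N}, forall x, h x = \sum_i rmul (y i) (x i : A).
Proof.
apply: (@mlin_ex A) => x u v; rewrite rmul_suml -big_split; apply: eq_bigr => i _.
by rewrite !ffunE rmulD; congr (_ + _); exact: rmulM.
Qed.

Lemma free_proj k : projective (free k).
Proof.
move=> M N f g fs; pose dl i : free k := [ffun j => ((i == j)%:R : A)].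
have [y yE] := choice (fun i => fs (g (dl i))).
have [h hE] := free_map y; exists h => x; rewrite hE linear_sum [in RHS](ffun_delta x) linear_sum.
by apply: eq_bigr => i _; rewrite !rmul_lin yE.
Qed.

Lemma fin_gen_cover M : fin_gen M -> exists k (f : {linear free k -> M}), Defs.surj f.
Proof.
move=> [k [g gP]]; have [h hE] := free_map g; exists k, h => m; have [x ->] := gP m.
exists [ffun i => x i]; rewrite hE; by apply: eq_bigr => i _; rewrite ffunE.
Qed.

Lemma fin_gen_quot M N (f : {linear M -> N}) : Defs.surj f -> fin_gen M -> fin_gen N.
Proof.
move=> fs [k [g gP]]; exists k, (fun i => f (g i)) => m; have [u <-] := fs m; have [x ->] := gP u.
by exists x; rewrite linear_sum; apply: eq_bigr => i _; rewrite rmul_lin.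
Qed.

Lemma dual_basis P : fin_gen P -> projective P -> exists k (x : 'I_k -> P) (phi : 'I_k -> {linear P -> (A^c)^o}),
  forall y, y = \sum_i rmul (x i) (phi i y : A).
Proof.
move=> [k [g gP]] pP; have [f fE] := free_map g.
have [|h hE] := pP _ _ f idfun.
  move=> m; have [x ->] := gP m.
  by exists [ffun i => x i]; rewrite fE; apply: eq_bigr => i _; rewrite ffunE.
have phi i : exists phi : {linear P -> (A^c)^o}, forall y, phi y = h y i.
  by apply: (@mlin_ex A) => x u v; rewrite linearD rmul_lin !ffunE.
have [ph phE] := choice phi; exists k, g, ph => y; rewrite -[LHS]/(idfun y) -hE fE.
by apply: eq_bigr => i _; rewrite phE.
Qed.

Lemma mlin0 M N : exists z : {linear M -> N}, forall m, z m = 0.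
Proof. by apply: (@mlin_ex A) => x u v; rewrite rmul0x addr0. Qed.

Lemma retract_proj P M (u : {linear M -> P}) (r : {linear P -> M}) : (forall m, r (u m) = m) ->
  projective P -> projective M.
Proof.
move=> ru pP X Y f g fs; have [h hE] := pP X Y f (g \o r) fs.
by exists (h \o u) => m; rewrite /= hE /= ru.
Qed.

Lemma ker_ex M N (f : {linear M -> N}) : fin_gen M -> fin_gen N -> exists (L : mdl) (j : {linear L -> M}),
  [/\ fin_gen L, injective j & forall m, f m = 0 <-> exists x, j x = m].
Proof.
move=> fM fN; have [X [b bP]] := rep_ex ga fM; have [Y [b' bP']] := rep_ex ga fN.
have [h [hh hE]] := hom_mlin f bP bP'.
have [Z [i [ih im iP]]] := subrep_ex (lin_pred_ker h) (stable_ker hh).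
have [L [bL bLP]] := module_ex ga (crep_sub ih im (model_crep ga bP)); have [j jE] := mlin_hom ga bLP bP ih.
exists L, j; split=> [|x y|m]; first exact: model_fg bLP.
  have [w <-] := md_surj bLP x; have [w' <-] := md_surj bLP y.
  by rewrite !jE => /(md_inj bP)/(mono_inj im) ->.
have [v <-] := md_surj bP m; rewrite -hE; split.
  by move=> /(md_eq0 bP')/iP[w ->]; exists (bL w); rewrite jE.
move=> [x]; have [w <-] := md_surj bLP x; rewrite jE => /(md_inj bP) <-.
by have /iP -> : exists u, i w = i u; [exists w | rewrite (md_0 bP')].
Qed.

(** P is a finite-dimensional projective of least dimension mapping onto M. If q g is onto, lift q
    through it to s and put f = g s, so that q f = q. Fitting's image of f is a projective summand
    of P that still maps onto M, so it is all of P; hence a power of f, and therefore g, is onto. *)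
Lemma proj_cover M : fin_gen M -> exists P (q : {linear P -> M}),
  [/\ fin_gen P, projective P, Defs.surj q
    & forall N (g : {linear N -> P}), Defs.surj (q \o g) -> Defs.surj g].
Proof.
move=> fM; pose good t := `[< exists P (q : {linear P -> M}) X (b : X -> P),
  [/\ model b, projective P, Defs.surj q & rdim X = t] >].
have ex0 : exists t, good t.
  have [k [f fs]] := fin_gen_cover fM; have [X [b bP]] := rep_ex ga (free_gen k).
  by exists (rdim X); apply/asboolP; exists (free k), f, X, b; split=> //; exact: free_proj.
case: (ex_minnP ex0) => t /asboolP[P [q [X [b [bP pP qs Xt]]]]] tmin.
exists P, q; split=> //; first exact: model_fg bP.
move=> N g qg; have [s sE] := pP N M (q \o g) q qg.
have [f [fh fE]] := hom_mlin (g \o s) bP bP.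
have [k [I [i [r [hi hr im irE ri]]]]] := fitting fh.
have cI : crep D o I.
  have [F Fi re] : exists2 F : 'Hom(X, I), hom F & epi F.
    exists r => // w.
    have : epi (r \o i)%VF.
      by apply: mono_epi => // v; rewrite comp_lfunE; exact: ri.
    by move=> /(_ w)[v <-]; exists (i v); rewrite comp_lfunE.
  exact: crep_quot Fi re (model_crep ga bP).
have [Q [b' bP']] := module_ex ga cI.
have rih : hom (r \o i)%VF by exact: hom_comp.
have [j [jh jK _]] : exists j : 'Hom(I, I), [/\ hom j, cancel (r \o i)%VF j & cancel j (r \o i)%VF].
  by apply: hom_inv => //; [|apply: mono_epi => //] => v; rewrite comp_lfunE; exact: ri.
have jK' v : j (r (i v)) = v by have := jK v; rewrite comp_lfunE.
have [ii iiE] := mlin_hom ga bP' bP hi.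
have [rr rrE] := mlin_hom ga bP bP' (hom_comp jh hr).
have pQ : projective Q.
  apply: (retract_proj (u := ii) (r := rr) _ pP) => m.
  by have [v <-] := md_surj bP' m; rewrite iiE rrE comp_lfunE jK'.
have qf k' v : q (b (iter k' f v)) = q (b v).
  by elim: k' => //= k' IH; rewrite fE /= -[q (g _)]/((q \o g) (s _)) sE.
have tI : (rdim X <= rdim I)%N.
  rewrite Xt; apply: tmin; apply/asboolP; exists Q, (q \o ii), I, b'; split=> // m.
  have [y <-] := qs m; have [v <-] := md_surj bP y.
  by exists (b' (r v)); rewrite /= iiE irE qf.
have ie := mono_epi im tI.
move=> y; have [v <-] := md_surj bP y; have [w <-] := ie v.
have re : epi r.
  have : epi (r \o i)%VF by apply: mono_epi => // u; rewrite comp_lfunE; exact: ri.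
  by move=> h u; have [u' <-] := h u; exists (i u'); rewrite comp_lfunE.
have [u <-] := re w; rewrite irE iterS fE /=; by exists (s (b (iter k f u))).
Qed.

(** Finite generation is a consequence of minimality: a map from a finite free module that covers M,
    respectively ker q, is onto P0, respectively P1. *)
Lemma pres_fin_gen M P1 P0 (p : {linear P1 -> P0}) (q : {linear P0 -> M}) :
  fin_gen M -> min_proj_presentation p q -> fin_gen P0 /\ fin_gen P1.
Proof.
move=> fM [[pP0 pP1] qs qmin kq pmin].
have f0 : fin_gen P0.
  have [k [f fs]] := fin_gen_cover fM.
  have [h hE] := @free_proj k _ _ q f qs.
  apply: (fin_gen_quot (f := h)); last exact: free_gen.
  by apply: qmin => m; have [x <-] := fs m; exists x; rewrite /= hE.
split=> //.
have [Om [j [fO ji kj]]] := ker_ex q f0 fM; have [k [c cs]] := fin_gen_cover fO.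
pose y t := j (c ([ffun s => ((t == s)%:R : A)] : free k)).
have [x xE] := choice (fun t : 'I_k => (kq (y t)).1 ((kj (y t)).2 (ex_intro _ _ erefl))).
have [h hE] := free_map x.
apply: (fin_gen_quot (f := h)); last exact: free_gen.
apply: pmin => z /kj[m <-]; have [u <-] := cs m; exists u.
rewrite hE linear_sum {2}(ffun_delta u) !linear_sum; apply: eq_bigr => t _.
by rewrite !rmul_lin xE.
Qed.

(** * The Auslander-Reiten formula *)

Section Factor.
Variables (M N P1 P0 : mdl) (p : {linear P1 -> P0}) (q : {linear P0 -> M}) (T : lmodType A).
Variable pr : {linear P1 -> (A^c)^o} -> T.
Hypotheses (f1 : fin_gen P1) (f0 : fin_gen P0) (pP1 : projective P1) (pP0 : projective P0).
Hypothesis pr_lin : forall (x : A) (f g h : {linear P1 -> (A^c)^o}),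
  (forall v, h v = x * (f v : A) + (g v : A) :> A) -> pr h = x *: pr f + pr g.
Hypothesis pr_s : Defs.surj pr.
Hypothesis pr_ker : forall f, pr f = 0 <-> exists g : {linear P0 -> (A^c)^o}, forall x, f x = g (p x).
Variable th : N -> T -> K.
Hypothesis th_lin : forall x, K_linear_form io (th x).
Hypothesis th_act : forall (x : A) u v t, th (rmul u x + v) t = th u (x *: t) + th v t.
Hypothesis th_ex : forall phi, K_linear_form io phi -> exists! x, forall t, th x t = phi t.
Variable Y : mdl.
Hypothesis fY : fin_gen Y.

Lemma th0 t : th 0 t = 0.
Proof.
have := th_act 1 0 0 t; rewrite rmul1 addr0 scale1r => /eqP.
by rewrite eq_sym -subr_eq0 addrK => /eqP.
Qed.

Lemma th_sum (I : finType) (u : I -> N) t : th (\sum_i u i) t = \sum_i th (u i) t.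
Proof.
elim/big_rec2: _ => [|i s v _ <-]; first exact: th0.
by rewrite -{1}[u i]rmul1 th_act scale1r.
Qed.

Lemma th_sumr u (I : finType) (t : I -> T) : th u (\sum_i t i) = \sum_i th u (t i).
Proof.
elim/big_rec2: _ => [|i s v _ <-].
  have := th_lin u 1 0 0; rewrite rmorph1 scale1r addr0 mul1r => /eqP.
  by rewrite eq_sym -subr_eq0 addrK => /eqP.
by rewrite -{1}[t i]scale1r -(rmorph1 io) (th_lin u) mul1r.
Qed.

Lemma pr_comb (I : finType) (f : I -> {linear P1 -> (A^c)^o}) (x : I -> A) (h : {linear P1 -> (A^c)^o}) :
  (forall v, h v = \sum_i x i * (f i v : A) :> A) -> pr h = \sum_i x i *: pr (f i).
Proof.
move=> hE; rewrite -big_enum /=; have {}hE v : h v = \sum_(i <- enum I) x i * (f i v : A) :> A by rewrite big_enum; exact: hE.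
 move: hE; elim: (enum I) h => [|i s IH] h hE.
  rewrite big_nil; apply/pr_ker; have [z zE] := mlin0 P0 (A^c)^o; exists z => v; by rewrite zE [LHS]hE big_nil.
have [g gE] : exists g : {linear P1 -> (A^c)^o}, forall v, g v = \sum_(j <- s) x j * (f j v : A) :> A.
  apply: (@mlin_ex A) => a u v.
  rewrite rmul_suml -big_split; apply: eq_bigr => j _.
  rewrite linearD rmul_lin -[LHS]/(x j * ((f j u : A) * a + (f j v : A))).
  by rewrite -[RHS]/((x j * (f j u : A)) * a + x j * (f j v : A)) mulrDr mulrA.
by rewrite big_cons -(IH g gE); apply: pr_lin => v; rewrite hE big_cons gE.
Qed.

Lemma lin_comb a P (f : {linear P -> (A^c)^o}) (g : {linear P -> (A^c)^o}) :
  exists h : {linear P -> (A^c)^o}, forall v, h v = a * (f v : A) + (g v : A) :> A.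
Proof.
apply: (@mlin_ex A) => x u v; rewrite !linearD !rmul_lin.
rewrite -[LHS]/(a * ((f u : A) * x + (f v : A)) + ((g u : A) * x + (g v : A))).
rewrite -[RHS]/((a * (f u : A) + (g u : A)) * x + (a * (f v : A) + (g v : A))).
by rewrite mulrDl mulrDr mulrA addrACA.
Qed.

(** The pairing of f y with the class of ph is a trace, over a dual basis of P1, of the map v |-> y
    ph(v). If this map factors through p, a dual basis of P0 rewrites the trace with the forms ph0 i
    composed with p, whose classes in the transpose are zero. *)
Lemma AR_zero : (forall g : {linear P1 -> Y}, exists h : {linear P0 -> Y}, forall x, g x = h (p x)) ->
  forall (f : {linear Y -> N}) y, f y = 0.
Proof.
move=> fac f y.
have th_inj u v : (forall t, th u t = th v t) -> u = v.
  move=> uv; have [w [_ wu]] := th_ex (th_lin v).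
  by rewrite -(wu u uv) -(wu v).
apply: th_inj => t; have [ph <-] := pr_s t; rewrite th0.
have [k1 [x1 [ph1 E1]]] := dual_basis f1 pP1; have [k0 [x0 [ph0 E0]]] := dual_basis f0 pP0.
have [g gE] : exists g : {linear P1 -> Y}, forall v, g v = rmul y (ph v : A).
  by apply: (@mlin_ex A) => x u v; rewrite linearD rmul_lin rmulD -rmulM.
have [h hE] := fac g.
have phip i : exists w : {linear P1 -> (A^c)^o}, forall v, w v = ph0 i (p v) by exists (ph0 i \o p).
have [w wE] := choice phip.
have w0 i : pr (w i) = 0 by apply/pr_ker; exists (ph0 i).
transitivity (\sum_j th (f (g (x1 j))) (pr (ph1 j))).
  rewrite (@pr_comb _ ph1 (fun j => ph (x1 j) : A) ph) => [|v]; last first.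
    rewrite {1}(E1 v) linear_sum; apply: eq_bigr => j _; by rewrite rmul_lin.
  rewrite th_sumr; apply: eq_bigr => j _.
  have := th_act (ph (x1 j)) (f y) 0 (pr (ph1 j)); rewrite addr0 th0 addr0 => <-.
  by rewrite gE rmul_lin.
transitivity (\sum_i th (f (h (x0 i))) (pr (w i))); last first.
  by rewrite big1 // => i _; rewrite w0; have := @th_sumr (f (h (x0 i))) 'I_0 (fun=> 0); rewrite !big_ord0.
transitivity (\sum_j \sum_i th (f (h (x0 i))) ((w i (x1 j) : A) *: pr (ph1 j))).
  apply: eq_bigr => j _; rewrite hE {1}(E0 (p (x1 j))) !linear_sum th_sum; apply: eq_bigr => i _.
  have := th_act (w i (x1 j)) (f (h (x0 i))) 0 (pr (ph1 j)); rewrite addr0 th0 addr0 => <-.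
  by rewrite wE !rmul_lin.
rewrite exchange_big; apply: eq_bigr => i _; rewrite -th_sumr; congr (th _ _).
symmetry; apply: pr_comb => v; rewrite {1}(E1 v) linear_sum; apply: eq_bigr => j _; by rewrite rmul_lin.
Qed.

(** If g does not factor, some linear form lam vanishes on all maps that do and has lam g = 1. Then
    y |-> (ph |-> lam (y ph)) defines a map from Y to the dual of the transpose, which is zero by
    hypothesis. But g is a sum of maps y ph over a dual basis, so lam g = 0. *)
Lemma AR_factor : (forall (f : {linear Y -> N}) y, f y = 0) ->
  forall g : {linear P1 -> Y}, exists h : {linear P0 -> Y}, forall x, g x = h (p x).
Proof.
move=> hom0 g; apply: contrapT => nfac.
have [X1 [b1 b1P]] := rep_ex ga f1; have [X0 [b0 b0P]] := rep_ex ga f0; have [XY [bY bYP]] := rep_ex ga fY.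
pose W (u : 'Hom(X1, XY)) := exists h : {linear P0 -> Y}, forall v, bY (u v) = h (p (b1 v)).
have Wlin : lin_pred W.
  split=> [|k u v [hu huE] [hv hvE]].
    by have [z zE] := mlin0 P0 Y; exists z => v; rewrite zE zero_lfunE (md_0 bYP).
  have [w wE] : exists w : {linear P0 -> Y}, forall z, w z = rmul (hu z) (io k) + hv z.
    apply: (@mlin_ex A) => x y z; rewrite !linearD !rmul_lin !rmul_Dl -!rmulM.
    by rewrite (ga_comm ga) addrACA.
  by exists w => z; rewrite add_lfunE scale_lfunE (md_lin bYP) huE hvE wE.
have [gg [ggh ggE]] := hom_mlin g b1P bYP.
have [|lam [lam1 lamW]] := separating_form (v := gg) Wlin.
  move=> [h hE]; apply: nfac; exists h => x; have [v <-] := md_surj b1P x; by rewrite -ggE hE.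
have uex (y : Y) (f : {linear P1 -> (A^c)^o}) : exists u : 'Hom(X1, XY), forall v, bY (u v) = rmul y (f (b1 v) : A).
  have [h hE] : exists h : {linear P1 -> Y}, forall v, h v = rmul y (f v : A).
    by apply: (@mlin_ex A) => x u v; rewrite linearD rmul_lin rmulD -rmulM.
  by have [u [_ uE]] := hom_mlin h b1P bYP; exists u => v; rewrite uE hE.
pose U y f := projT1 (cid (uex y f)).
have UE y f v : bY (U y f v) = rmul y (f (b1 v) : A) by rewrite /U; case: cid.
pose L y f : K := lam (U y f).
have Luniq (u u' : 'Hom(X1, XY)) : (forall v, bY (u v) = bY (u' v)) -> u = u'.
  by move=> uu; apply/lfunP => v; apply: (md_inj bYP).
have star y f x t t' s s' : pr f = x *: t + t' -> pr s = t -> pr s' = t' -> L y f = L (rmul y x) s + L y s'.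
  move=> fE sE s'E; have [f2 f2E] := lin_comb x s s'; have [f3 f3E] := lin_comb (-1) f f2.
  have /pr_ker[h hE] : pr f3 = 0.
    by rewrite (pr_lin f3E) (pr_lin f2E) fE sE s'E scaleN1r addNr.
  have : lam (U y f3) = 0.
    apply: lamW; have [w wE] : exists w : {linear P0 -> Y}, forall z, w z = rmul y (h z : A).
      by apply: (@mlin_ex A) => x' u v; rewrite linearD rmul_lin rmulD -rmulM.
    by exists w => v; rewrite UE wE hE.
  have -> : U y f3 = U (rmul y x) s + U y s' - U y f.
    apply: Luniq => v; rewrite add_lfunE opp_lfunE (md_B bYP) add_lfunE (md_D bYP) !UE f3E f2E.
    by rewrite !rmulD mulN1r [rmul y (- _)]scaleNr addrC rmulM.
  by rewrite linearB linearD => /eqP; rewrite subr_eq0 => /eqP.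
have [sec secE] := choice pr_s.
have LioZ k y f : L (rmul y (io k)) f = k * L y f.
  transitivity (lam (k *: U y f)); last by rewrite linearZ.
  congr (lam _); apply: Luniq => v.
  by rewrite scale_lfunE (md_Z bYP) !UE -!rmulM (ga_comm ga).
have Lform y : K_linear_form io (fun t => L y (sec t)).
  by move=> k t t'; rewrite (star y _ (io k) t t' (sec t) (sec t')) ?secE // LioZ.
have [f0' f0E] := choice (fun y => th_ex (Lform y)).
have fE y t : th (f0' y) t = L y (sec t) by apply: (f0E y).1.
have [x u v|f fE'] := @mlin_ex A Y N f0'.
  apply: (f0E _).2 => t; rewrite th_act !fE.
  have -> : L (rmul u x + v) (sec t) = L (rmul u x) (sec t) + L v (sec t).
    transitivity (lam (U (rmul u x) (sec t) + U v (sec t))); last by rewrite linearD.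
    congr (lam _); apply: Luniq => z.
    by rewrite add_lfunE (md_D bYP) !UE rmul_Dl.
  congr (_ + _).
  have L0 : L u (sec 0) = 0.
    by have := Lform u 1 0 0; rewrite scaler0 addr0 mul1r => /eqP; rewrite eq_sym -subr_eq0 addrK => /eqP.
  by rewrite (star u _ x t 0 (sec t) (sec 0)) ?secE ?addr0 // L0 addr0.
have [k1 [x1 [ph1 E1]]] := dual_basis f1 pP1.
have : lam gg = \sum_j L (g (x1 j)) (ph1 j).
  transitivity (lam (\sum_j U (g (x1 j)) (ph1 j))); last by rewrite linear_sum.
  congr (lam _); apply: Luniq => v.
  rewrite ggE sum_lfunE (md_sum bYP) {1}(E1 (b1 v)) linear_sum; apply: eq_bigr => j _.
  by rewrite UE rmul_lin.
rewrite lam1 big1 => [/eqP|j _]; first by rewrite oner_eq0.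
have L0 y t : L y (sec t) = 0 by rewrite -fE -fE' hom0 th0.
have := @star (g (x1 j)) (ph1 j) 0 0 (pr (ph1 j)) (sec 0) (sec (pr (ph1 j))).
by rewrite !secE scaler0 add0r => -> //; rewrite !L0 addr0.
Qed.

End Factor.
End TauRigid.

(** * Tau-rigidity and Ext-projectivity *)

Section TauTilting.
Variables (n : nat) (D : gdata n) (o : rel 'I_n) (K : fieldType).
Variables (A : pzRingType) (io : {rmorphism K -> A}) (E : 'I_n -> A) (Lt At : A).
Hypothesis ga : gls_like D o io E Lt At.
Notation rep := (rep K (gen n)).
Notation mdl := (lmodType A^c).
Notation model := (@model n K A io E Lt At _ _).
Notation C := (inC D o finset.setT).
Implicit Types (M N P : mdl) (X Y Z : rep).

(** T is the space of A-linear forms on P1 modulo those that factor through p, built as a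
    subquotient of the finite-dimensional space of K-linear maps X1 -> XA. The dual N consists of
    the K-linear forms on T. *)
Lemma transpose_ex P1 P0 (p : {linear P1 -> P0}) : fin_gen P1 ->
  exists (T : lmodType A) (pr : {linear P1 -> (A^c)^o} -> T),
  [/\ forall (x : A) (f g h : {linear P1 -> (A^c)^o}),
        (forall v, h v = x * (f v : A) + (g v : A) :> A) -> pr h = x *: pr f + pr g,
      Defs.surj pr,
      forall f, pr f = 0 <-> exists g : {linear P0 -> (A^c)^o}, forall x, f x = g (p x)
    & exists (N : mdl), is_dual io T N].
Proof.
move=> f1; have [X1 [b1 b1P]] := rep_ex ga f1.
have fA : fin_gen ((A^c)^o : mdl).
  by exists 1%N, (fun=> 1) => m; exists (fun=> m); rewrite big_ord1; exact: (esym (mul1r (m : A))).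
have [XA [bA bAP]] := rep_ex ga fA.
pose W := @Rep K void 'Hom(X1, XA) (fun g => match g with end).
pose S (w : W) := exists f : {linear P1 -> (A^c)^o}, forall v, bA (w v) = f (b1 v).
have bAl k (u v : 'Hom(X1, XA)) x : bA ((k *: u + v) x) = io k * (bA (u x) : A) + (bA (v x) : A).
  rewrite add_lfunE scale_lfunE (md_lin bAP) (ga_comm ga); congr (_ + _).
have [| |V [i [_ im iS]]] := @subrep_ex K void W S.
- split=> [|k u v [f fE] [g gE]].
    by have [z zE] := mlin0 P1 (A^c)^o; exists z => v; rewrite zE zero_lfunE (md_0 bAP).
  have [h hE] := lin_comb (io k) f g; exists h => x.
  by rewrite bAl hE fE gE.
- by case.
pose Z (u : V) := exists g : {linear P0 -> (A^c)^o}, forall v, bA (i u v) = g (p (b1 v)).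
have il k (u v : V) : i (k *: u + v) = k *: (i u : 'Hom(X1, XA)) + i v by rewrite linearP.
have [| |Q [q [_ qe qZ]]] := @quotrep_ex K void V Z.
- split=> [|k u v [f fE] [g gE]].
    by have [z zE] := mlin0 P0 (A^c)^o; exists z => v; rewrite zE linear0 zero_lfunE (md_0 bAP).
  have [h hE] := lin_comb (io k) f g; exists h => x.
  by rewrite il bAl hE fE gE.
- by case.
pose cl (f : {linear P1 -> (A^c)^o}) (t : Q) := exists u, (forall v, bA (i u v) = f (b1 v)) /\ t = q u.
have cl_ex f : exists t, cl f t.
  have [w [_ wE]] := hom_mlin f b1P bAP.
  have /iS[u uE] : S w by exists f.
  by exists (q u), u; split=> // v; rewrite -uE.
have cl_fac f t : cl f t -> (t = 0 <-> exists g : {linear P0 -> (A^c)^o}, forall x, f x = g (p x)).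
  move=> [u [uf ->]]; split=> [/qZ[g gE]|[g gE]].
    by exists g => x; have [v <-] := md_surj b1P x; rewrite -uf gE.
  by apply/qZ; exists g => v; rewrite uf gE.
have cl_lin k (f g h : {linear P1 -> (A^c)^o}) t t' : (forall x, h x = io k * (f x : A) + (g x : A) :> A) -> cl f t -> cl g t' -> cl h (k *: t + t').
  move=> hE [u [uf ->]] [v [vg ->]]; exists (k *: u + v); split; last by rewrite linearP.
  by move=> x; rewrite il bAl hE uf vg.
have cl_uniq (f g : {linear P1 -> (A^c)^o}) t t' : f =1 g -> cl f t -> cl g t' -> t = t'.
  move=> fg [u [uf ->]] [v [vg ->]]; congr (q _); apply: (mono_inj im).
  by apply/lfunP => x; apply: (md_inj bAP); rewrite uf vg fg.
have cl_surj t : exists f, cl f t.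
  have [u <-] := qe t; have /iS[f fE] : exists w, i u = i w by exists u.
  by exists f, u.
have lc a f g := @lin_comb A a P1 f g.
(* The product x t is computed on any form representing t; it is well defined because left
   multiplication preserves the forms that factor through p. *)
pose act_rel (x : A) t t' := exists f g, [/\ cl f t, cl g t' & forall v, g v = x * (f v : A) :> A].
have act_fun x t t1 t2 : act_rel x t t1 -> act_rel x t t2 -> t1 = t2.
  move=> [f [g [ft gt gE]]] [f' [g' [ft' gt' gE']]].
  have [h hE] := lc (io (-1)) f f'; have h0 := cl_lin _ _ _ _ _ _ hE ft ft'.
  rewrite scaleN1r addNr in h0; have [w wE] := (cl_fac _ _ h0).1 erefl.
  have [h' hE'] := lc (io (-1)) g g'; have h1 := cl_lin _ _ _ _ _ _ hE' gt gt'.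
  have : -1 *: t1 + t2 = 0.
    apply/(cl_fac _ _ h1); have [z zE] := mlin0 P0 (A^c)^o; have [k kE] := lin_comb x w z.
    exists k => v; rewrite kE zE addr0 -wE hE hE' gE gE' mulrDr mulrA.
    by rewrite mulrA (ga_comm ga).
  by move/eqP; rewrite scaleN1r addrC subr_eq0 => /eqP.
have act_ex x t : exists t', act_rel x t t'.
  have [f ft] := cl_surj t; have [z zE] := mlin0 P1 (A^c)^o; have [g gE] := lc x f z.
  have [t' gt] := cl_ex g; exists t', f, g; split=> // v; by rewrite gE zE addr0.
have act_of x (f g : {linear P1 -> (A^c)^o}) t t' : (forall v, g v = x * (f v : A) :> A) -> cl f t -> cl g t' -> act_rel x t t'.
  by move=> gE ft gt; exists f, g.
have [op opP] := choice (fun xt => act_ex xt.1 xt.2).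
have op_lin x k t t' : op (x, k *: t + t') = k *: op (x, t) + op (x, t').
  have [f [g [/= ft gt gE]]] := opP (x, t); have [f' [g' [/= ft' gt' gE']]] := opP (x, t').
  have [h hE] := lc (io k) f f'; have [h' hE'] := lc (io k) g g'.
  apply: (act_fun x _ _ _ (opP (x, _))); apply: (act_of _ h h').
  - by move=> v; rewrite hE hE' gE gE' mulrDr !mulrA (ga_comm ga).
  - exact: cl_lin hE ft ft'.
  exact: cl_lin hE' gt gt'.
have opA x y t : op (x, op (y, t)) = op (x * y, t).
  have [f [g [/= ft gt gE]]] := opP (y, t).
  have [f' [g' [/= ft' gt' gE']]] := opP (x, op (y, t)).
  apply: (act_fun (x * y) t _ _ _ (opP (x * y, t))).
  have [z zE] := mlin0 P1 (A^c)^o; have [h hE] := lc (x * y) f z; have [s hs] := cl_ex h.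
  suff -> : op (x, op (y, t)) = s by apply: (act_of _ f h) => // v; rewrite hE zE addr0.
  apply: (act_fun x _ _ _ (opP (x, _))); apply: (act_of _ g h) => // v.
  by rewrite hE zE addr0 gE mulrA.
have op1 t : op (1, t) = t.
  have [f ft] := cl_surj t; apply: (act_fun 1 t _ _ (opP (1, t))).
  by apply: (act_of _ f f) => // v; rewrite mul1r.
have opD x : {morph (fun t => op (x, t)) : t t' / t + t'}.
  by move=> t t'; have := op_lin x 1 t t'; rewrite !scale1r.
have opDl t : {morph (fun x => op (x, t)) : x y / x + y}.
  move=> x y; have [f [g [/= ft gt gE]]] := opP (x, t).
  have [f' ft'] := cl_surj t; have [z zE] := mlin0 P1 (A^c)^o.
  have [g' gE'] := lc y f z; have [s gs] := cl_ex g'.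
  have -> : op (y, t) = s.
    by apply: (act_fun y _ _ _ (opP (y, _))); apply: (act_of _ f g') => // v; rewrite gE' zE addr0.
  have [h hE] := lc (io 1) g g'.
  apply: (act_fun (x + y) t _ _ (opP (x + y, t))); apply: (act_of _ f h) => // [v|].
    by rewrite hE rmorph1 mul1r gE gE' zE addr0 mulrDl.
  by rewrite -[op _]scale1r; apply: cl_lin hE gt gs.
have opio k t : op (io k, t) = k *: t.
  have [f ft] := cl_surj t; have [z zE] := mlin0 P1 (A^c)^o; have [h hE] := lc (io k) f z.
  apply: (act_fun (io k) t _ _ (opP (_, t))); apply: (act_of _ f h) => // [v|].
    by rewrite hE zE addr0.
  have [s zs] := cl_ex z; have s0 : s = 0.
    by apply/(cl_fac _ _ zs); have [z' zE'] := mlin0 P0 (A^c)^o; exists z' => x; rewrite zE zE'.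
  by rewrite -[k *: t]addr0 -s0; apply: cl_lin hE ft zs.
pose m := GRing.Zmodule_isLmodule.Build A Q (scale := fun x t => op (x, t)) opA op1 opD opDl.
pose T : lmodType A := HB.pack (Q : Type) (GRing.Zmodule.class Q) m.
have [pr prP] := choice cl_ex.
have Tsc (x : A) (t : T) : x *: t = op (x, t) by [].
exists T, pr; split.
- move=> x f g h hE; have [z zE] := mlin0 P1 (A^c)^o; have [k kE] := lc x f z.
  rewrite -[RHS]/(op (x, pr f) + pr g).
  have -> : op (x, pr f) = pr k.
    apply: (act_fun x _ _ _ (opP (x, _))); apply: (act_of _ f k) => // v; by rewrite kE zE addr0.
  apply: (cl_uniq h h) => //; rewrite -[pr k]scale1r; apply: cl_lin (prP k) (prP g) => v.
  by rewrite rmorph1 mul1r kE zE addr0 hE.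
- by move=> t; have [f ft] := cl_surj t; exists f; apply: cl_uniq (prP f) ft.
- by move=> f; apply: cl_fac (prP f).
have opl x : exists f : 'End(Q), forall t, f t = op (x, t) by apply: lin_ex; exact: op_lin.
have [ol olE] := choice opl.
pose N0 : vectType K := 'Hom(Q, K^o).
have NA (x y : A^c) (f : N0) : (((f \o ol y) \o ol x)%VF : N0) = (f \o ol (x * y)%R)%VF.
  by apply/lfunP => t; rewrite !comp_lfunE !olE opA.
have N1 (f : N0) : ((f \o ol 1)%VF : N0) = f by apply/lfunP => t; rewrite comp_lfunE olE op1.
have ND (x : A^c) : {morph (fun f : N0 => (f \o ol x)%VF : N0) : f g / f + g}.
  by move=> f g; apply/lfunP => t; rewrite !(comp_lfunE, add_lfunE).
have NDl (f : N0) : {morph (fun x : A^c => (f \o ol x)%VF : N0) : x y / x + y}.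
  by move=> x y; apply/lfunP => t; rewrite add_lfunE !comp_lfunE !olE opDl linearD.
pose mN := GRing.Zmodule_isLmodule.Build A^c N0 (scale := fun x f => (f \o ol x)%VF) NA N1 ND NDl.
pose N : mdl := HB.pack (N0 : Type) (GRing.Zmodule.class N0) mN.
exists N, (fun (f : N0) (t : Q) => f t); split.
- by move=> f k t t'; rewrite /= -[io k *: t]/(op (io k, t)) opio linearP.
- by move=> x f g t; rewrite -[LHS]/(((f \o ol x)%VF + g) t) add_lfunE comp_lfunE olE.
move=> phi phil; have [|f fE] := @lin_ex K Q K^o phi.
  by move=> k t t'; rewrite -opio; exact: phil.
by exists f; split=> // g gE; apply/lfunP => t; rewrite fE gE.
Qed.

(* Lift P0 -> M -> Q to u : P0 -> E; then u p factors through L, on which maps from P1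
   extend along p since they do so on M. *)
Lemma tau_lift M (L F Q : mdl) (i : {linear L -> F}) (q : {linear F -> Q}) (f : {linear M -> Q}) :
  tau_rigid io M -> injective i -> (forall y, q y = 0 <-> exists x, i x = y) -> Defs.surj q ->
  Fac M L -> exists h : {linear M -> F}, forall m, q (h m) = f m.
Proof.
move=> [fM [N [T [[P1 [P0 [p [pM [mpp [pr [prl prs prk]]]]]]] [th [thl tha the]]]] hom0]] ii iq qs [k [g gs]].
have [f0 f1] := pres_fin_gen ga fM mpp; have [[pP0 pP1] ps _ kp _] := mpp.
have fac := AR_factor ga f1 f0 pP1 prl prs prk tha the fM hom0.
have [u uE] := pP0 _ _ q (f \o pM) qs.
have [w wE] := choice (fun x => (iq (u (p x))).1 (etrans (uE (p x)) (etrans (congr1 f ((kp _).2 (ex_intro _ x erefl))) (linear0 f)))).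
have [w' wE'] : exists w' : {linear P1 -> L}, forall x, i (w' x) = u (p x).
  have [|w' wE'] := @mlin_ex A P1 L w; last by exists w' => x; rewrite wE' wE.
  by move=> x a b; apply: ii; rewrite wE !linearD !rmul_lin !wE.
have [v vE] := pP1 _ _ g w' gs.
(* Each component of v : P1 -> M^k factors through p because M is tau-rigid. *)
have [c cE] : exists c : 'I_k -> {linear P0 -> M}, forall t x, v x t = c t (p x).
  have ct t : exists h : {linear P0 -> M}, forall x, v x t = h (p x).
    have [vt vtE] : exists vt : {linear P1 -> M}, forall x, vt x = v x t.
      by apply: (@mlin_ex A) => x a b; rewrite linearD rmul_lin !ffunE.
    by have [h hE] := fac vt; exists h => x; rewrite -vtE hE.
  by have [c cP] := choice ct; exists c => t x.
have [v0 v0E] : exists v0 : {linear P0 -> {ffun 'I_k -> M}}, forall y, v0 y = [ffun t => c t y].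
  apply: (@mlin_ex A) => x a b; apply/ffunP => t; rewrite !ffunE linearD rmul_lin.
  by congr (_ + _); rewrite /rmul ffunE.
have vp x : v0 (p x) = v x by apply/ffunP => t; rewrite v0E ffunE cE.
(* Corrected by i g v0, the lift u kills the image of p and so descends to M. *)
have u0 y y' : pM y = pM y' -> u y - i (g (v0 y)) = u y' - i (g (v0 y')).
  move=> yy; have /kp[x xE] : pM (y - y') = 0 by rewrite linearB yy subrr.
  have : u (p x) = i (g (v0 (p x))) by rewrite -wE' -vE -vp.
  rewrite xE !linearB => /(canRL (subrK _)) ->.
  by rewrite addrAC [X in X - _ + _]addrC addrK addrC.
have [s sE] := choice ps.
have [|h hE] := @mlin_ex A M F (fun m => u (s m) - i (g (v0 (s m)))).
  move=> x a b; have : pM (s (rmul a x + b)) = pM (rmul (s a) x + s b) by rewrite linearD rmul_lin !sE.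
  move=> /u0 ->; rewrite linearD rmul_lin (linearD v0) (rmul_lin v0).
  rewrite (linearD g) (rmul_lin g) (linearD i) (rmul_lin i) rmul_Dl opprD addrACA.
  by rewrite -addrA /rmul scalerN addrA.
exists h => m; rewrite hE linearB uE /= sE.
by have -> : q (i (g (v0 (s m)))) = 0; [apply/iq; exists (g (v0 (s m))) | rewrite subr0].
Qed.

(* In the pushout of 0 -> p P1 -> P0 -> M -> 0 along P1 -> X / f (ker p) the kernel is a
   quotient of X, so the sequence splits, and f agrees with a map factoring through p up
   to a map into f (ker p).  The difference is zero since ker p is superfluous. *)
Lemma extproj_tau T X M (b : X -> M) : tors C T -> extproj C T X -> model b -> tau_rigid io M.
Proof.
move=> tT [TX eX] bP; have fM := model_fg bP.
have [P0 [q [f0 pP0 qs qmin]]] := proj_cover ga fM.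
have [X0 [b0 b0P]] := rep_ex ga f0.
have [qX [qXh qXE]] := hom_mlin q b0P bP.
have cX := model_crep ga bP; have cX0 := model_crep ga b0P.
have [MO [j [fO ji jq]]] := ker_ex ga q f0 fM.
have [P1 [c [f1 pP1 cs cmin]]] := proj_cover ga fO.
pose p := j \o c.
have qp y : q y = 0 <-> exists x, p x = y.
  rewrite jq; split=> [[m <-]|[x <-]]; last by exists (c x).
  by have [x <-] := cs m; exists x.
have mpp : min_proj_presentation p q.
  split=> // N g gmin; apply: cmin => m.
  have [|x xE] := gmin (j m); first by apply/jq; exists m.
  by exists x; apply: ji.
have [T' [pr [prl prs prk [N [th [thl tha the]]]]]] := transpose_ex p f1.
split=> //; exists N.
  exists T'; split; last by exists th.
  by exists P1, P0, p, q; split=> //; exists pr.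
apply: (AR_zero f1 f0 pP1 pP0 prl prs prk thl tha the) => f.
have [X1 [b1 b1P]] := rep_ex ga f1.
have [pX [pXh pXE]] := hom_mlin p b1P b0P.
have [fX [fXh fXE]] := hom_mlin f b1P bP.
have [S [i1 [i2 [p1 [p2 [[i1h i2h] [p1h p2h] pi1 pi2 Sd]]]]]] := dsum_ex X0 X.
pose R (s : S) := exists v, s = i1 (pX v) + i2 (fX v).
(* F is the pushout of p and f. The kernel of F -> M will be a quotient of X, hence in T. *)
have [| |F [r [rh re rR]]] := @quotrep_ex _ _ S R.
- split=> [|k u v [x ->] [y ->]]; first by exists 0; rewrite !linear0 addr0.
  by exists (k *: x + y); rewrite !linearP /= scalerDr addrACA.
- by move=> g s [v ->]; exists (act X1 g v); rewrite linearD /= -i1h -i2h -pXh -fXh.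
have qp1 : hom (qX \o p1)%VF by exact: hom_comp.
have qpX v : qX (pX v) = 0.
  by apply: (md_eq0 bP); rewrite qXE pXE; apply/qp; exists (b1 v).
have [|qF [qFh qFE]] := epi_factor rh re qp1.
  by move=> s /rR[v ->]; rewrite comp_lfunE linearD /= (pi1 _).1 (pi2 _).1 addr0 qpX.
have cF : crep D o F.
  apply: crep_quot rh re _; apply/(inC_setT D o S).
  have [_ _ pb] := crep_amb K D o finset.setT; apply: (pb X0 X S p1 p2) => //; try exact/inC_setT.
  by move=> v v1 v2; rewrite (Sd v) v1 v2 !linear0 addr0.
have qe v : exists u, qX u = v.
  by have [y yE] := qs (b v); have [u uE] := md_surj b0P y; exists u; apply: (md_inj bP); rewrite qXE uE.
have ker_p v : qX v = 0 -> exists w, v = pX w.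
  move=> v0; have /qp[x xE] : q (b0 v) = 0 by rewrite -qXE v0 (md_0 bP).
  by have [w wE] := md_surj b1P x; exists w; apply: (md_inj b0P); rewrite pXE wE.
have [L [jL [jh jm jP]]] := subrep_ex (lin_pred_ker qF) (stable_ker qFh).
have [|g0 [g0h g0E]] := mono_lift jh jm (hom_comp rh i2h).
  by move=> v; apply/jP; rewrite comp_lfunE qFE comp_lfunE (pi2 _).1 linear0.
have g0e : epi g0.
  move=> w; have [s sE] := re (jL w).
  have : qF (jL w) = 0 by apply/jP; exists w.
  rewrite -sE qFE comp_lfunE => /ker_p[v vE]; exists (p2 s - fX v); apply: (mono_inj jm).
  rewrite g0E comp_lfunE -sE; apply/eqP; rewrite eq_sym -subr_eq0 -linearB; apply/eqP/rR.
  exists v; rewrite {1}(Sd s) vE linearB /= -vE opprB addrA -[X in X = _]addrA.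
  by rewrite -addrA [X in _ + X]addrC addrNK.
have TL : T L by have [_ _ Tq _] := tT; exact: Tq g0h g0e TX.
have [h [hh hE]] : exists h : 'Hom(X, F), hom h /\ forall v, qF (h v) = v.
  have sj : ses jL qF.
    split=> // v; have [u <-] := qe v; exists (r (i1 u)); by rewrite qFE comp_lfunE (pi1 _).1.
  have [h [hh hE]] := eX L F X jL qF (\1%VF : 'Hom(X, X)) sj (proj2 (inC_setT D o F) cF) TL (@hom1 _ _ X).
  by exists h; split=> // v; rewrite hE id_lfunE.
(* Subtracting the splitting turns X0 -> F into a map to L, which lifts along X -> L because P0 is
   projective. *)
have [|g1 [g1h g1E]] := mono_lift jh jm (homB (hom_comp rh i1h) (hom_comp hh qXh)).
  move=> v; apply/jP; rewrite add_lfunE opp_lfunE !comp_lfunE linearB /= hE qFE comp_lfunE (pi1 _).1.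
  by rewrite subrr.
have [ML [bL bLP]] := module_ex ga (crep_sub jh jm cF).
have [G0 G0E] := mlin_hom ga bP bLP g0h; have [G1 G1E] := mlin_hom ga b0P bLP g1h.
have G0s : Defs.surj G0.
  by move=> m; have [w <-] := md_surj bLP m; have [v <-] := g0e w; exists (b v); rewrite G0E.
have [g' gE'] := pP0 _ _ G0 G1 G0s.
have [gX [gXh gXE]] := hom_mlin g' b0P bP.
have gX0 v : g0 (gX v) = g1 v by apply: (md_inj bLP); rewrite -G0E -G1E gXE gE'.
have fk v : exists w, pX w = 0 /\ gX (pX v) + fX v = fX w.
  have : r (i2 (gX (pX v) + fX v)) = 0.
    have rv : r (i2 (fX v)) = - r (i1 (pX v)).
      by apply/eqP; rewrite -addr_eq0 addrC -linearD; apply/eqP/rR; exists v.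
    rewrite !linearD /= rv -[r (i2 _)]comp_lfunE -g0E gX0 g1E add_lfunE opp_lfunE !comp_lfunE.
    by rewrite qpX linear0 subr0 subrr.
  move=> /rR[w wE]; exists w.
  have := congr1 p1 wE; rewrite !linearD /= (pi1 _).1 !(pi2 _).1 !addr0 => p0.
  by have := congr1 p2 wE; rewrite !linearD /= (pi1 _).2 !(pi2 _).2 add0r.
have [k kE] : exists k : {linear P1 -> M}, forall x, k x = g' (p x) + f x.
  have [gp gpE] : exists gp : {linear P1 -> M}, forall x, gp x = g' (p x) by exists (g' \o p).
  have [|k kE] := @mlin_ex A P1 M (fun x => gp x + f x); last by exists k => x; rewrite kE gpE.
  by move=> x u v; rewrite !linearD !rmul_lin rmul_Dl addrACA.
have [kX [kXh kXE]] := hom_mlin k b1P bP.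
have kXE' v : kX v = gX (pX v) + fX v.
  by apply: (md_inj bP); rewrite kXE kE (md_D bP) gXE pXE fXE.
(* The kernel of k = g' p + f still maps onto ker q, so by minimality it is all of P1, and f = - g'
   p factors through p. *)
have [Y [j' [_ _ kY]]] := ker_ex ga k f1 fM.
have js : Defs.surj j'.
  have [_ _ _ _ pmin] := mpp; apply: pmin => y /qp[x <-]; have [v <-] := md_surj b1P x.
  have [w [w0 wE]] := fk v; have /kY[u uE] : k (b1 (v - w)) = 0.
    by rewrite -kXE linearB /= !kXE' wE w0 linear0 add0r subrr (md_0 bP).
  by exists u; rewrite uE -!pXE linearB /= w0 subr0.
have [z zE] : exists z : {linear P0 -> M}, forall y, z y = - g' y.
  by apply: (@mlin_ex A) => x u v; rewrite linearD rmul_lin opprD /rmul scalerN.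
exists z => x; rewrite zE; apply/eqP; rewrite eq_sym -subr_eq0 -opprD oppr_eq0 -kE.
have [m <-] := js x; by apply/eqP/kY; exists m.
Qed.

End TauTilting.

(** * Krull-Schmidt arguments for representations *)

Section KrullSchmidt.
Variables (K : fieldType) (G : Type).
Notation rep := (rep K G).
Implicit Types M X Y Z S : rep.

Lemma retract_iso X Z (u : 'Hom(Z, X)) (r : 'Hom(X, Z)) : indec X -> ~ rep0 Z -> hom u -> hom r ->
  mono (r \o u)%VF -> mono u /\ epi u.
Proof.
move=> [X0 Xi] Z0 hu hr m; have um : mono u by move=> v uv; apply: m; rewrite comp_lfunE uv linear0.
have hru : hom (r \o u)%VF by exact: hom_comp.
have [j [jh jK _]] := hom_inv hru m (mono_epi m (leqnn _)).
have he : hom (u \o (j \o r))%VF by exact/hom_comp/hom_comp.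
have jru v : j (r (u v)) = v by have := jK v; rewrite comp_lfunE.
have [|e0|e1] := Xi _ he.
- by apply/lfunP => v; rewrite !comp_lfunE jru.
- exfalso; apply: Z0 => v; apply: um.
  by have := congr1 (fun f : 'End(X) => f (u v)) e0; rewrite /= !comp_lfunE jru zero_lfunE.
split=> // v; exists (j (r v)).
by have := congr1 (fun f : 'End(X) => f v) e1; rewrite /= !comp_lfunE id_lfunE.
Qed.

(** Fitting's image is a direct summand, so it is zero or everything. *)
Lemma indec_nil M (f : 'End(M)) : indec M -> hom f -> mono f \/ exists k, forall v, iter k f v = 0.
Proof.
move=> iM hf; have [k [I [i [r [hi hr im irE ri]]]]] := fitting hf.
have [I0|I0] := pselect (rep0 I).
  by right; exists k.+1 => v; rewrite -irE (I0 (r v)) linear0.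
have [|_ ie] := retract_iso iM I0 hi hr; first by move=> v; rewrite comp_lfunE; exact: ri.
left=> v fv; have [w wE] := ie v; rewrite -wE; suff -> : w = 0 by exact: linear0.
apply: ri; rewrite wE; apply: im; rewrite irE iterSr fv; elim: (k) => //= m ->; exact: linear0.
Qed.

(** Composed with the inverse j of f + g, the two maps add up to the identity; if g v = 0 then j f
    fixes v, which is impossible for v nonzero when j f is nilpotent. *)
Lemma indec_local M (f g : 'End(M)) : indec M -> hom f -> hom g -> mono (f + g) -> mono f \/ mono g.
Proof.
move=> iM hf hg m; have hs := homD hf hg; have [j [jh jK _]] := hom_inv hs m (mono_epi m (leqnn _)).
have [jf|[k nil]] := indec_nil iM (hom_comp jh hf).
  by left=> v fv; apply: jf; rewrite comp_lfunE fv linear0.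
right=> v gv; suff <- : iter k (j \o f)%VF v = v by exact: nil.
elim: (k) => //= m' ->; rewrite comp_lfunE -[RHS]jK; congr (j _).
by rewrite add_lfunE gv addr0.
Qed.

Lemma indec_local_sum M k (f : 'I_k -> 'End(M)) : indec M -> (forall t, hom (f t)) ->
  mono (\sum_t f t) -> exists t, mono (f t).
Proof.
move=> iM; elim: k f => [|k IH] f hf m.
  by exfalso; apply: iM.1 => v; apply: m; rewrite big_ord0 zero_lfunE.
move: m; rewrite big_ord_recl => m.
have hs : hom (\sum_(i < k) f (lift ord0 i)) by apply: hom_sum => t; exact: hf.
case: (indec_local iM (hf ord0) hs m) => [f0|fs]; first by exists ord0.
by have [|t ft] := IH _ _ fs; [move=> t; exact: hf | exists (lift ord0 t)].
Qed.

Record biproduct k (X : 'I_k -> rep) S (i : forall t, 'Hom(X t, S)) (p : forall t, 'Hom(S, X t)) : Prop := Biproduct {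
  bp_i : forall t, hom (i t);
  bp_p : forall t, hom (p t);
  bp_pi : forall t v, p t (i t v) = v;
  bp_pi0 : forall s t v, s != t -> p s (i t v) = 0;
  bp_sum : forall v, v = \sum_t i t (p t v) }.

Lemma biproduct_ex (P : rep -> Prop) :
  (forall X, rep0 X -> P X) ->
  (forall (M N Q : rep) (p1 : 'Hom(Q, M)) (p2 : 'Hom(Q, N)), hom p1 -> hom p2 ->
        (forall v, p1 v = 0 -> p2 v = 0 -> v = 0) -> P M -> P N -> P Q) ->
  forall k (X : 'I_k -> rep), (forall t, P (X t)) ->
  exists S (i : forall t, 'Hom(X t, S)) (p : forall t, 'Hom(S, X t)), P S /\ biproduct i p.
Proof.
move=> P0 Pj; elim=> [|k IH] X PX.
  pose Z := @Rep K G ('rV[K]_0) (fun=> 0).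
  have Zz (v : Z) : v = 0 by exact: thinmx0.
  exists Z, (fun=> 0), (fun=> 0); split; first exact: P0.
  by split=> [[]//|[]//|[]//|[]//|v]; rewrite (Zz v) big_ord0.
have [S [i [p [PS bp]]]] := IH _ (fun t => PX (lift ord0 t)).
have [T [j1 [j2 [q1 [q2 [[h1 h2] [k1 k2] qj1 qj2 Td]]]]]] := dsum_ex (X ord0) S.
have ex t : exists f : 'Hom(X t, T) * 'Hom(T, X t), [/\ hom f.1, hom f.2, forall v, f.2 (f.1 v) = v &
    [/\ t = ord0 -> forall v, f.1 (f.2 v) = j1 (q1 v) &
    forall s, t = lift ord0 s -> forall v, f.1 (f.2 v) = j2 (i s (p s (q2 v)))] ].
  have [->|t0] := eqVneq t ord0.
    by exists (j1, q1); split=> //= v; rewrite (qj1 _).1.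
  have [s ->] : exists s, t = lift ord0 s by have [s ->|e] := unliftP ord0 t; [exists s | move: t0; rewrite e eqxx].
  exists ((j2 \o i s)%VF, (p s \o q2)%VF); split=> /=; try exact/hom_comp/(bp_i bp); try exact/hom_comp/k2/(bp_p bp).
    by move=> v; rewrite !comp_lfunE (qj2 _).2 (bp_pi bp).
  split=> [e|s' /lift_inj <- v]; first by case: (negP (neq_lift ord0 s)); apply/eqP; exact: esym e.
  by rewrite !comp_lfunE.
pose f := fun t : 'I_k.+1 => projT1 (cid (ex t)).
have fP := fun t : 'I_k.+1 => projT2 (cid (ex t)).
have E0 v : (f ord0).1 ((f ord0).2 v) = j1 (q1 v) by have [_ _ _ [e0 _]] := fP ord0; exact: e0.
have E1 s v : (f (lift ord0 s)).1 ((f (lift ord0 s)).2 v) = j2 (i s (p s (q2 v))).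
  by have [_ _ _ [_ e1]] := fP (lift ord0 s); exact: e1.
have pi t v : (f t).2 ((f t).1 v) = v by have [_ _ e _] := fP t; exact: e.
exists T, (fun t => (f t).1), (fun t => (f t).2); split.
  apply: (Pj _ _ _ q1 q2) => // v v1 v2; by rewrite (Td v) v1 v2 !linear0 addr0.
split=> [t|t|t v|s t v st|v]; [by have [e _ _ _] := fP t; exact: e | by have [_ e _ _] := fP t; exact: e | exact: pi | | ].
  rewrite -[LHS]pi -(pi t v); move: ((f t).1 v) => w; suff -> : (f s).1 ((f s).2 ((f t).1 ((f t).2 w))) = 0 by rewrite linear0.
  case: (unliftP ord0 s) st => [s'|] ->; case: (unliftP ord0 t) => [t'|] ->.
  - by rewrite !E1 (qj2 _).2 => st; rewrite (bp_pi0 bp) ?linear0 ?linear0 //; apply: contraNneq st => ->.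
  - by rewrite E1 E0 (qj1 _).2 !linear0.
  - by rewrite E0 E1 (qj2 _).1 linear0.
  by rewrite eqxx.
rewrite {1}(Td v) big_ord_recl E0 {1}(bp_sum bp (q2 v)) linear_sum; congr (_ + _).
by apply: eq_bigr => s _; rewrite E1.
Qed.

Section Biproduct.
Variables (k : nat) (X : 'I_k -> rep) (S : rep) (i : forall t, 'Hom(X t, S)) (p : forall t, 'Hom(S, X t)).
Hypotheses (bp : biproduct i p) (Xi : forall t, indec (X t)).
Let hi t : hom (i t). Proof. by case: bp. Qed.
Let hp t : hom (p t). Proof. by case: bp. Qed.

Lemma biproduct_retract Z (u : 'Hom(Z, S)) (r : 'Hom(S, Z)) : indec Z -> hom u -> hom r ->
  (forall v, r (u v) = v) -> exists t, mono ((r \o i t) \o (p t \o u))%VF.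
Proof.
move=> iZ hu hr ru; apply: (indec_local_sum iZ) => [t|].
  exact/hom_comp/hom_comp/hu/(bp_p bp)/hom_comp/(bp_i bp).
move=> v; rewrite sum_lfunE => sv; rewrite -(ru v) (bp_sum bp (u v)) linear_sum -[RHS]sv.
by apply: eq_bigr => t _; rewrite !comp_lfunE.
Qed.

Lemma biproduct_iso Z (u : 'Hom(Z, S)) (r : 'Hom(S, Z)) t : indec Z -> hom u -> hom r ->
  mono ((r \o i t) \o (p t \o u))%VF -> iso Z (X t).
Proof.
move=> [Z0 _] hu hr m; have hpu := hom_comp (@hp t) hu.
have [] := retract_iso (Xi t) Z0 hpu (hom_comp hr (@hi t)) m.
by exists (p t \o u)%VF.
Qed.

Lemma biproduct_summand Z (u : 'Hom(Z, S)) (r : 'Hom(S, Z)) : indec Z -> hom u -> hom r ->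
  (forall v, r (u v) = v) -> exists t, iso Z (X t).
Proof.
move=> iZ hu hr ru; have [t m] := biproduct_retract iZ hu hr ru.
by exists t; exact: (biproduct_iso iZ hu hr m).
Qed.

(** Both copies of Z are seen isomorphically by the same X t, as the X t are pairwise
    non-isomorphic, so the t-th term of r1 u2 = 0 is injective. The other terms add up to its
    negative, hence by locality one of them is injective too, and a second X t' is isomorphic to
    Z. *)
Lemma biproduct_basic Z (u1 u2 : 'Hom(Z, S)) (r1 r2 : 'Hom(S, Z)) :
  (forall s t, iso (X s) (X t) -> s = t) -> indec Z -> hom u1 -> hom u2 -> hom r1 -> hom r2 ->
  (forall v, r1 (u1 v) = v) -> (forall v, r2 (u2 v) = v) -> (forall v, r1 (u2 v) = 0) -> False.
Proof.
move=> Xne iZ h1 h2 k1 k2 ru1 ru2 ru0.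
have [t m1] := biproduct_retract iZ h1 k1 ru1; have [s m2] := biproduct_retract iZ h2 k2 ru2.
have st : s = t.
  apply: Xne; apply: iso_trans (iso_sym (biproduct_iso iZ h2 k2 m2)) (biproduct_iso iZ h1 k1 m1).
subst s; have hw t' : hom ((r1 \o i t') \o (p t' \o u2))%VF.
  exact/hom_comp/hom_comp/h2/(bp_p bp)/hom_comp/(bp_i bp).
have mt : mono ((r1 \o i t) \o (p t \o u2))%VF.
  have [pm _] := retract_iso (Xi t) iZ.1 (hom_comp (@hp t) h2) (hom_comp k2 (@hi t)) m2.
  have [p1m p1e] := retract_iso (Xi t) iZ.1 (hom_comp (@hp t) h1) (hom_comp k1 (@hi t)) m1.
  move=> v; rewrite comp_lfunE => rv; apply: pm; have [w wE] := p1e ((p t \o u2)%VF v).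
  by rewrite -wE (m1 w) ?linear0 // comp_lfunE wE.
have [t' m'] : exists t', mono (if t' == t then 0 else ((r1 \o i t') \o (p t' \o u2))%VF : 'End(Z)).
  apply: (indec_local_sum iZ) => [t'|v]; first by case: eqP => _; [exact: hom0 | exact: hw].
  rewrite sum_lfunE => sv; apply: mt.
  have sv' : \sum_(t' | t' != t) r1 (i t' (p t' (u2 v))) = 0.
    rewrite -[RHS]sv [RHS](bigD1 t) //= eqxx zero_lfunE add0r.
    by apply: eq_bigr => t' /negbTE ->; rewrite !comp_lfunE.
  have := ru0 v; rewrite {1}(bp_sum bp (u2 v)) linear_sum (bigD1 t) //= sv' addr0 => <-.
  by rewrite !comp_lfunE.
move: m'; case: eqP => [_ m0|tt' m'].
  by apply: iZ.1 => v; apply: m0; rewrite zero_lfunE.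
apply: tt'; apply: Xne; apply: iso_trans (iso_sym (biproduct_iso iZ h2 k1 m')) (biproduct_iso iZ h1 k1 m1).
Qed.

End Biproduct.
End KrullSchmidt.

(** * The class Fac and direct summands *)

Section Fac.
Variables (n : nat) (D : gdata n) (o : rel 'I_n) (K : fieldType).
Variables (A : pzRingType) (io : {rmorphism K -> A}) (E : 'I_n -> A) (Lt At : A).
Hypothesis ga : gls_like D o io E Lt At.
Notation rep := (rep K (gen n)).
Notation mdl := (lmodType A^c).
Notation model := (@model n K A io E Lt At _ _).
Notation Tg := (@Tg n K A io E Lt At).
Notation C := (inC D o finset.setT).
Implicit Types (M N P : mdl) (X Y Z S : rep).

Definition facr X Y := crep D o Y /\ exists k (f : 'I_k -> 'Hom(X, Y)),
  (forall t, hom (f t)) /\ forall y, exists x : 'I_k -> X, y = \sum_t f t (x t).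

(** The condition Ext^1(X, Fac X) = 0, again as a lifting property. It holds for tau-rigid modules
    and makes Fac X a torsion class. *)
Definition lifts X := forall (L F Q : rep) (i : 'Hom(L, F)) (q : 'Hom(F, Q)) (f : 'Hom(X, Q)),
  ses i q -> crep D o F -> facr X L -> hom f -> exists h : 'Hom(X, F), hom h /\ forall v, q (h v) = f v.

Lemma fin_gen_fin M (I : finType) (g : I -> M) :
  (forall m, exists x : I -> A, m = \sum_t rmul (g t) (x t)) -> fin_gen M.
Proof.
move=> gP; exists #|I|, (fun t => g (enum_val t)) => m; have [x ->] := gP m.
exists (fun t => x (enum_val t)).
by rewrite -(big_enum_val (A := I) (fun t => rmul (g t) (x t))).
Qed.

Lemma Fac_facr X M (b : X -> M) : model b -> Fac M = Tg (facr X).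
Proof.
move=> bP; apply/funext => N; apply/propext; split.
  move=> [k [f fs]].
  have single t : exists s : {linear M -> {ffun 'I_k -> M}}, forall m, s m = [ffun s => if s == t then m else 0].
    apply: (@mlin_ex A) => x u v; apply/ffunP => s; rewrite !ffunE; case: eqP => _.
      by congr (_ + _); rewrite /rmul !ffunE eqxx.
    by rewrite scaler0 addr0.
  have [s sE] := choice single.
  have dec (x : {ffun 'I_k -> M}) : x = \sum_t s t (x t).
    apply/ffunP => j; rewrite sum_ffunE (bigD1 j) //= sE ffunE eqxx big1 ?addr0 // => t tj.
    by rewrite sE ffunE eq_sym (negbTE tj).
  have [m [g gP]] := model_fg bP.
  have fN : fin_gen N.
    apply: (fin_gen_fin (I := ('I_k * 'I_m)%type) (g := fun t => f (s t.1 (g t.2)))) => y.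
    have [x <-] := fs y; have [c cE] := choice (fun t => gP (x t)); exists (fun t => c t.1 t.2).
    rewrite {1}(dec x) linear_sum -(pair_bigA _ (fun i j => rmul (f (s i (g j))) (c i j))) /=.
    apply: eq_bigr => t _; rewrite [in LHS](cE t) !linear_sum; apply: eq_bigr => j _.
    by rewrite !rmul_lin.
  have [Y [b' bP']] := rep_ex ga fN; exists Y, b'; split=> //; split; first exact: (model_crep ga bP').
  have [h hP] := choice (fun t => hom_mlin (f \o s t) bP bP').
  exists k, h; split=> [t|y]; first exact: (hP t).1.
  have [x xE] := fs (b' y); have [c cE] := choice (fun t => md_surj bP (x t)); exists c.
  apply: (md_inj bP'); rewrite -xE {1}(dec x) linear_sum (md_sum bP'); apply: eq_bigr => t _.
  by rewrite (hP t).2 cE.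
move=> [Y [b' [bP' [cY [k [f [fh fs]]]]]]].
have [g gE] := choice (fun t => mlin_hom ga bP bP' (fh t)).
have [h hE] : exists h : {linear {ffun 'I_k -> M} -> N}, forall x, h x = \sum_t g t (x t).
  apply: (@mlin_ex A) => a u v; rewrite rmul_suml -big_split; apply: eq_bigr => t _.
  by rewrite ffunE linearD /rmul ffunE linearZ.
exists k, h => y; have [w <-] := md_surj bP' y; have [x ->] := fs w.
exists [ffun t => b (x t)]; rewrite hE (md_sum bP'); apply: eq_bigr => t _.
by rewrite ffunE gE.
Qed.

Lemma facr_quot X Y Z (q : 'Hom(Y, Z)) : hom q -> epi q -> facr X Y -> facr X Z.
Proof.
move=> qh qe [cY [k [f [fh fs]]]]; split; first exact: crep_quot qh qe cY.
exists k, (fun t => (q \o f t)%VF); split=> [t|z]; first exact: hom_comp.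
have [y <-] := qe z; have [x ->] := fs y; exists x; rewrite linear_sum.
by apply: eq_bigr => t _; rewrite comp_lfunE.
Qed.

Lemma facr_iso X Y Z : iso Y Z -> facr X Y -> facr X Z.
Proof. by move=> [f [fh _ fe]]; exact: facr_quot. Qed.

Lemma facr_self X : crep D o X -> facr X X.
Proof.
move=> cX; split=> //; exists 1%N, (fun=> \1%VF); split=> [t|y]; first exact: hom1.
by exists (fun=> y); rewrite big_ord1 id_lfunE.
Qed.

Lemma facr_epi X Y (q : 'Hom(X, Y)) : crep D o X -> hom q -> epi q -> facr X Y.
Proof. by move=> cX qh qe; exact: facr_quot qh qe (facr_self cX). Qed.

Lemma facr_le T X Y : tors C T -> T X -> facr X Y -> T Y.
Proof.
move=> tT TX [cY [k [f [fh fs]]]].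
by apply: (tors_span (X := fun _ : 'I_k => X) (i := f) (crep_amb K D o finset.setT) tT) => //; exact/inC_setT.
Qed.

(** For extension closure, the maps from X that cover the quotient lift to the middle term; with
    those covering the submodule they span it. *)
Lemma facr_tors X : crep D o X -> lifts X -> tors C (facr X).
Proof.
move=> cX lX; split.
- by move=> Y [cY _]; exact/inC_setT.
- move=> Y Y0; apply: (facr_epi (q := 0)) => //; first exact: hom0.
  by move=> y; exists 0; rewrite (Y0 y) zero_lfunE.
- by move=> Y Z q qh qe; exact: facr_quot.
move=> Y F Z i q sq /inC_setT cF fY [cZ [m [g [gh gs]]]].
have [h hP] := choice (fun t => lX _ _ _ _ _ _ sq cF fY (gh t)).
have [cY [k [f [fh fs]]]] := fY; have [ih im qh qe iq] := sq; split=> //.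
exists (k + m)%N, (fun t => match fintype.split t with inl s => (i \o f s)%VF | inr s => h s end).
split=> [t|y]; first by case: fintype.split => s; [exact: hom_comp | exact: (hP s).1].
have [z zE] := gs (q y).
have /iq[w wE] : q (y - \sum_t h t (z t)) = 0.
  rewrite linearB /= zE linear_sum /= -sumrB big1 // => t _; by rewrite (hP t).2 subrr.
have [x xE] := fs w.
exists (fun t => match fintype.split t with inl s => x s | inr s => z s end).
rewrite big_split_ord -[LHS](subrK (\sum_t h t (z t))) wE xE linear_sum; congr (_ + _).
  by apply: eq_bigr => t _; rewrite (unsplitK (inl t)) comp_lfunE.
by apply: eq_bigr => t _; rewrite (unsplitK (inr t)).
Qed.

Lemma lifts_extproj X : crep D o X -> lifts X -> extproj C (facr X) X.
Proof.
move=> cX lX; split=> [|L F Q i q f sq /inC_setT cF fL fh]; first exact: facr_self.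
exact: (lX _ _ _ _ _ _ sq cF fL fh).
Qed.

Lemma extproj_lifts T X : tors C T -> extproj C T X -> lifts X.
Proof.
move=> tT [TX eX] L F Q i q f sq /inC_setT cF fL fh.
exact: (eX _ _ _ _ _ _ sq cF (facr_le tT TX fL) fh).
Qed.

Lemma extproj_retract T X Z (u : 'Hom(Z, X)) (r : 'Hom(X, Z)) : extproj C T X -> T Z -> hom u -> hom r ->
  (forall v, r (u v) = v) -> extproj C T Z.
Proof.
move=> [TX eX] TZ uh rh ru; split=> // L F Q i q f sq cF TL fh.
have [h [hh hE]] := eX _ _ _ _ _ _ sq cF TL (hom_comp fh rh).
exists (h \o u)%VF; split=> [|v]; first exact: hom_comp.
by rewrite comp_lfunE hE comp_lfunE ru.
Qed.

Lemma extproj_biproduct T k (X : 'I_k -> rep) S (i : forall t, 'Hom(X t, S)) (p : forall t, 'Hom(S, X t)) :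
  biproduct i p -> T S -> (forall t, extproj C T (X t)) -> extproj C T S.
Proof.
move=> bp TS eX; split=> // L F Q j q f sq cF TL fh.
have hp t : hom (p t) by case: bp.
have hi t : hom (i t) by case: bp.
have ex t : exists g : 'Hom(X t, F), hom g /\ forall v, q (g v) = f (i t v).
  have [g [gh gE]] := (eX t).2 _ _ _ _ _ _ sq cF TL (hom_comp fh (@hi t)).
  by exists g; split=> // v; rewrite gE comp_lfunE.
pose g := fun t : 'I_k => projT1 (cid (ex t)).
have gP := fun t : 'I_k => projT2 (cid (ex t)).
have gh t : hom (g t) by exact: (gP t).1.
have gE t v : q (g t v) = f (i t v) by exact: (gP t).2.
exists (\sum_t (g t \o p t))%VF; split=> [|v].
  by apply: hom_sum => t; exact: hom_comp.
rewrite sum_lfunE linear_sum {2}(bp_sum bp v) linear_sum; apply: eq_bigr => t _.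
by rewrite /= comp_lfunE gE.
Qed.

Lemma tau_lifts X M (b : X -> M) : model b -> tau_rigid io M -> lifts X.
Proof.
move=> bP tM L F Q i q f [ih im qh qe iq] cF fL fh.
have [ML [bL bLP]] := module_ex ga fL.1; have [MF [bF bFP]] := module_ex ga cF.
have [MQ [bQ bQP]] := module_ex ga (crep_quot qh qe cF).
have [i' iE] := mlin_hom ga bLP bFP ih; have [q' qE] := mlin_hom ga bFP bQP qh.
have [f' fE] := mlin_hom ga bP bQP fh.
have [|y|m||h hE] := @tau_lift _ _ _ _ _ _ _ _ _ ga M ML MF MQ i' q' f' tM.
- move=> u v; have [x <-] := md_surj bLP u; have [z <-] := md_surj bLP v.
  by rewrite !iE => /(md_inj bFP)/(mono_inj im) ->.
- have [x <-] := md_surj bFP y; rewrite qE; split.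
    by move=> /(md_eq0 bQP)/iq[w ->]; exists (bL w); rewrite iE.
  move=> [u]; have [w <-] := md_surj bLP u; rewrite iE => /(md_inj bFP) <-.
  by have /iq -> : exists u, i w = i u; [exists w | rewrite (md_0 bQP)].
- by have [z <-] := md_surj bQP m; have [w <-] := qe z; exists (bF w); rewrite qE.
- by rewrite (Fac_facr bP); exists L, bL.
have [h' [hh hE']] := hom_mlin h bP bFP; exists h'; split=> // v.
by apply: (md_inj bQP); rewrite -qE hE' hE fE.
Qed.

Lemma pairl N N' a (x y : N) : (rmul x a + y, 0 : N') = rmul ((x, 0) : (N * N')%type) a + (y, 0).
Proof. by rewrite -[RHS]/(rmul x a + y, rmul 0 a + 0) rmul0x addr0. Qed.
Lemma pairr N N' a (x y : N') : (0 : N, rmul x a + y) = rmul ((0, x) : (N * N')%type) a + (0, y).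
Proof. by rewrite -[RHS]/(rmul 0 a + 0, rmul x a + y) rmul0x addr0. Qed.

Lemma summand_retract M N : summand N M -> exists (u : {linear N -> M}) (r : {linear M -> N}), forall x, r (u x) = x.
Proof.
move=> [X' [f [g fK gK]]].
have [u uE] : exists u : {linear N -> M}, forall x, u x = g (x, 0).
  apply: (@mlin_ex A) => a x y; apply: (can_inj fK); rewrite gK linearD rmul_lin !gK; exact: pairl.
have [r rE] : exists r : {linear M -> N}, forall m, r m = (f m).1.
  by apply: (@mlin_ex A) => a x y; rewrite linearD rmul_lin.
by exists u, r => x; rewrite rE uE gK.
Qed.

Lemma retract_summand M N (u : {linear N -> M}) (r : {linear M -> N}) : fin_gen M -> (forall x, r (u x) = x) ->
  exists (X' : mdl) (j : {linear X' -> M}), [/\ isom M ((N * X')%type : mdl), injective j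
    & forall m, r m = 0 <-> exists x, j x = m].
Proof.
move=> fM ru; have fN : fin_gen N by apply: (fin_gen_quot (f := r) _ fM) => y; exists (u y).
have [X' [j [_ ji jr]]] := ker_ex ga r fM fN.
exists X', j; split=> //.
have kr m : exists x, j x = m - u (r m) by apply/jr; rewrite linearB ru subrr.
have [k kE] := choice kr.
have key a x y : k (rmul x a + y) = rmul (k x) a + k y.
  apply: ji; rewrite kE (linearD j) (rmul_lin j) !kE (linearD r) (rmul_lin r) (linearD u) (rmul_lin u).
  by rewrite rmul_Dl opprD addrACA /rmul scalerN.
have [|f fE] := @mlin_ex A M ((N * X')%type : mdl) (fun m => (r m, k m)).
  by move=> a x y; rewrite key linearD rmul_lin.
exists f, (fun z => u z.1 + j z.2) => [m|[x y]].
  by rewrite fE /= kE addrC subrK.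
have jy : r (j y) = 0 by apply/jr; exists y.
rewrite fE linearD ru jy addr0; congr (_, _); apply: ji.
by rewrite kE linearD ru jy addr0 addrAC subrr add0r.
Qed.

Lemma indec_model X M (b : X -> M) : model b -> (indecomposable M <-> indec X).
Proof.
move=> bP; split=> [[M0 Mi]|[X0 Xi]].
  split=> [X0|f fh ff]; first by apply: M0; apply/(model_zero bP).
  have [I [q [i [qh qe ih im fE]]]] := image_ex fh.
  have qi v : q (i v) = v.
    have [w <-] := qe v; apply: (mono_inj im); rewrite -!fE.
    by have := congr1 (fun g : 'End(X) => g w) ff; rewrite /= comp_lfunE.
  have [N [b' bP']] := module_ex ga (crep_quot qh qe (model_crep ga bP)).
  have [u uE] := mlin_hom ga bP' bP ih; have [r rE] := mlin_hom ga bP bP' qh.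
  have [|X' [j [iso ji jr]]] := @retract_summand M N u r (model_fg bP).
    by move=> x; have [v <-] := md_surj bP' x; rewrite uE rE qi.
  have [N0|X0'] := Mi _ _ iso; [left|right]; apply/lfunP => v.
    by rewrite fE (proj1 (model_zero bP') N0 (q v)) linear0 zero_lfunE.
  rewrite id_lfunE fE; have : r (b (i (q v) - v)) = 0.
    by rewrite rE linearB /= qi subrr (md_0 bP').
  move=> /jr[x]; rewrite (X0' x) linear0 => /esym/(md_eq0 bP)/eqP.
  by rewrite subr_eq0 => /eqP.
split=> [M0|Y Z iso]; first by apply: X0; apply/(model_zero bP).
have [f [g fK gK]] := iso.
have [e eE] : exists e : {linear M -> M}, forall m, e m = g ((f m).1, 0).
  apply: (@mlin_ex A) => a x y; apply: (can_inj fK); rewrite gK !linearD !rmul_lin !gK; exact: pairl.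
have [h [hh hE]] := hom_mlin e bP bP.
have [|h0|h1] := Xi h hh.
- by apply/lfunP => v; apply: (md_inj bP); rewrite comp_lfunE !hE !eE gK.
- left=> y; have [v vE] := md_surj bP (g (y, 0)).
  have : e (b v) = 0 by rewrite -hE h0 zero_lfunE (md_0 bP).
  by rewrite eE vE gK /= => /(congr1 f); rewrite gK linear0 => -[].
right=> z; have [v vE] := md_surj bP (g (0, z)).
have : e (b v) = b v by rewrite -hE h1 id_lfunE.
by rewrite eE vE gK /= => /(congr1 f); rewrite !gK => -[].
Qed.

Section BiproductModule.
Variables (k : nat) (X : 'I_k -> rep) (S : rep) (i : forall t, 'Hom(X t, S)) (p : forall t, 'Hom(S, X t)).
Hypotheses (bp : biproduct i p) (Xi : forall t, indec (X t)) (cX : forall t, crep D o (X t)).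
Hypothesis Xne : forall s t, iso (X s) (X t) -> s = t.
Variables (M : mdl) (b : S -> M).
Hypothesis bP : model b.
Let hi t : hom (i t). Proof. by case: bp. Qed.
Let hp t : hom (p t). Proof. by case: bp. Qed.

Lemma bp_summand t N (b' : X t -> N) : model b' -> summand N M.
Proof.
move=> bP'; have [u uE] := mlin_hom ga bP' bP (@hi t); have [r rE] := mlin_hom ga bP bP' (@hp t).
have [|X' [j [iso _ _]]] := @retract_summand M N u r (model_fg bP); last by exists X'.
by move=> x; have [v <-] := md_surj bP' x; rewrite uE rE (bp_pi bp).
Qed.

Lemma bp_indec_summand N : indecomposable N -> summand N M -> exists t (b' : X t -> N), model b'.
Proof.
move=> iN /summand_retract[u [r ru]].
have fN : fin_gen N by apply: (fin_gen_quot (f := r) _ (model_fg bP)) => y; exists (u y).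
have [Z [b' bP']] := rep_ex ga fN; have iZ := proj1 (indec_model bP') iN.
have [u' [uh uE]] := hom_mlin u bP' bP; have [r' [rh rE]] := hom_mlin r bP bP'.
have [|t /iso_sym tZ] := biproduct_summand bp Xi iZ uh rh.
  by move=> v; apply: (md_inj bP'); rewrite rE uE ru.
have [N' [bt btP]] := module_ex ga (cX t).
have [f fb] := proj2 (model_iso ga btP bP') tZ.
by exists t, (fun v => f (bt v)); exact: model_transfer.
Qed.

Lemma bp_num : num_indec_summands M k.
Proof.
have ex t : exists N (b' : X t -> N), model b' by exact: (module_ex ga (cX t)).
pose N := fun t : 'I_k => projT1 (cid (ex t)).
have NP := fun t : 'I_k => projT2 (cid (ex t)).
exists N; split=> [t|s t st|N' iN' sN'].
- have [b' bP'] := NP t; split; last exact: bp_summand bP'.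
  exact/(indec_model bP').
- have [bs bsP] := NP s; have [bt btP] := NP t; apply: Xne; exact/(model_iso ga bsP btP).
have [t [b' bP']] := bp_indec_summand iN' sN'; exists t.
have [bt btP] := NP t; apply/(model_iso ga bP' btP); exact: iso_refl.
Qed.

Lemma bp_basic : basic M.
Proof.
move=> N iN /summand_retract[u [r ru]].
have [u1 u1E] : exists f : {linear N -> M}, forall x, f x = u (x, 0).
  apply: (@mlin_ex A) => a x y; rewrite -rmul_lin -linearD; congr (u _); exact: pairl.
have [u2 u2E] : exists f : {linear N -> M}, forall x, f x = u (0, x).
  apply: (@mlin_ex A) => a x y; rewrite -rmul_lin -linearD; congr (u _); exact: pairr.
have [r1 r1E] : exists f : {linear M -> N}, forall m, f m = (r m).1.
  by apply: (@mlin_ex A) => a x y; rewrite linearD rmul_lin.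
have [r2 r2E] : exists f : {linear M -> N}, forall m, f m = (r m).2.
  by apply: (@mlin_ex A) => a x y; rewrite linearD rmul_lin.
have fN : fin_gen N.
  by apply: (fin_gen_quot (f := r1) _ (model_fg bP)) => y; exists (u1 y); rewrite r1E u1E ru.
have [Z [b' bP']] := rep_ex ga fN; have iZ := proj1 (indec_model bP') iN.
have [v1 [v1h v1E]] := hom_mlin u1 bP' bP; have [v2 [v2h v2E]] := hom_mlin u2 bP' bP.
have [s1 [s1h s1E]] := hom_mlin r1 bP bP'; have [s2 [s2h s2E]] := hom_mlin r2 bP bP'.
apply: (biproduct_basic bp Xi Xne iZ v1h v2h s1h s2h) => v; apply: (md_inj bP').
- by rewrite s1E v1E r1E u1E ru.
- by rewrite s2E v2E r2E u2E ru.
by rewrite s1E v2E r1E u2E ru (md_0 bP').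
Qed.

End BiproductModule.
End Fac.

(** * Corner algebras, ranks and the projectives e_i A *)

Section Rank.
Variables (n : nat) (D : gdata n) (o : rel 'I_n) (K : fieldType).
Variables (A : pzRingType) (io : {rmorphism K -> A}) (E : 'I_n -> A) (Lt At : A).
Hypothesis ga : gls_like D o io E Lt At.
Notation rep := (rep K (gen n)).
Notation mdl := (lmodType A^c).
Notation model := (@model n K A io E Lt At _ _).
Notation d := (gd D).
Notation e i v := (act _ (Ge i) v).
Notation l v := (act _ Gl v).
Notation lpoly i k := (\sum_(t < d i) E i * Lt ^+ t * io (k t)).
Implicit Types (M N P : mdl) (X Y Z S : rep).

Lemma E_Lt_exp i k : E i * Lt ^+ k = Lt ^+ k * E i.
Proof.
elim: k => [|k IH]; first by rewrite expr0 mulr1 mul1r.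
by rewrite exprSr mulrA IH -!mulrA (ga_EL ga).
Qed.

Lemma md_lpoly X M (b : X -> M) i (k : nat -> K) v : model b -> e i v = v ->
  rmul (b v) (lpoly i k) = b (\sum_(t < d i) k t *: lk t v).
Proof.
move=> bP ev; rewrite rmul_sum (md_sum bP); apply: eq_bigr => t _.
by rewrite (md_Z bP) (md_lk bP) -!rmulM -{2}ev (md_e bP) -rmulM mulrA.
Qed.

(** Acting on the generator of the free module of rank one at i recovers the coefficients. *)
Lemma lpoly_inj i (k : nat -> K) : lpoly i k = 0 -> forall t, (t < d i)%N -> k t = 0.
Proof.
move=> k0; have [B [x Bx]] := @free_rep_ex K n D i K^o.
have [N [b bP]] := module_ex ga (fr_crep Bx o).
have [u uE] := fr_ex Bx (fun t => (t == 0%N)%:R).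
have := md_lpoly k bP (esym (fr_vertex Bx u)); rewrite k0 rmulx0 => /esym/(md_eq0 bP) s0 t td.
have := congr1 (fun w => x w t) s0; rewrite /= (fr0 Bx) (fr_sum Bx) (bigD1 (Ordinal td)) //=.
rewrite (frZ Bx) (fr_lk Bx) // leqnn subnn uE ?(leq_ltn_trans _ td) // eqxx big1 ?addr0 => [|s st].
  by rewrite /GRing.scale /= mulr1.
rewrite (frZ Bx) (fr_lk Bx) //; case: leqP => [st'|_]; last by rewrite scaler0.
rewrite uE ?(leq_ltn_trans (leq_subr _ _) td) // subn_eq0 leqNgt.
by rewrite ltn_neqAle st' andbT -(inj_eq val_inj) /= in st *; rewrite st scaler0.
Qed.

Lemma lpolyB i (k k' : nat -> K) : lpoly i k - lpoly i k' = lpoly i (fun t => k t - k' t).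
Proof. by rewrite -sumrB; apply: eq_bigr => t _; rewrite rmorphB mulrBr. Qed.

Lemma E_lpoly i k : E i * lpoly i k * E i = lpoly i k.
Proof.
rewrite mulr_sumr mulr_suml; apply: eq_bigr => t _.
by rewrite !mulrA (ga_EE ga) eqxx -mulrA (ga_comm ga) mulrA -[E i * _ * E i]mulrA -E_Lt_exp mulrA (ga_EE ga) eqxx.
Qed.

(** A basis over the corner identifies e_i X with the r x d_i matrices, whose entries are the
    coefficients at the powers of the loop. *)
Lemma corner_rank X M (b : X -> M) i r : model b -> corner_free (E i) M r -> vdim i X = (r * d i)%N.
Proof.
move=> bP [g [gE gP]]; have cX := model_crep ga bP.
have [v vE] := choice (fun j => md_surj bP (g j)).
have ev j : e i (v j) = v j by apply: (md_inj bP); rewrite (md_e bP) vE gE.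
pose phi (c : 'M[K]_(r, d i)) := \sum_j \sum_(t < d i) c j t *: lk t (v j).
have [|f fE] := @lin_ex K 'M[K]_(r, d i) X phi.
  move=> k c c'; rewrite /phi scaler_sumr -big_split; apply: eq_bigr => j _.
  rewrite scaler_sumr -big_split; apply: eq_bigr => t _ /=.
  by rewrite !mxE scalerDl scalerA.
pose c_ (c : 'M[K]_(r, d i)) j (t : nat) : K := if insub t is Some s then c j s else 0.
have c_E c j (t : 'I_(d i)) : c_ c j t = c j t by rewrite /c_ valK.
have bphi c : b (phi c) = \sum_j rmul (g j) (lpoly i (c_ c j)).
  rewrite (md_sum bP); apply: eq_bigr => j _; rewrite -vE (md_lpoly _ bP) //.
  by congr (b _); apply: eq_bigr => t _; rewrite c_E.
have <- : \dim {:'M[K]_(r, d i)} = (r * d i)%N by rewrite dimvf.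
symmetry; apply: (dim_bij (f := f)) => [c _|c _|w].
- apply/(mem_vdim i _ cX); rewrite fE /phi linear_sum; apply: eq_bigr => j _.
  by rewrite linear_sum; apply: eq_bigr => t _; rewrite linearZ /= (crep_elk _ _ _ cX) ev.
- rewrite fE => c0.
  have [|h [_ hu]] := gP 0; first by rewrite rmul0x.
  have h1 : h = [ffun j => lpoly i (c_ c j)].
    apply: hu; split=> [j|]; first by exists (lpoly i (c_ c j)); rewrite ffunE E_lpoly.
    transitivity (b (phi c)); first by rewrite c0 (md_0 bP).
    by rewrite bphi; apply: eq_bigr => j _; rewrite ffunE.
  have h2 : h = [ffun j => 0].
    apply: hu; split=> [j|]; first by exists 0; rewrite ffunE mulr0 mul0r.
    by rewrite big1 // => j _; rewrite ffunE rmulx0.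
  apply/matrixP => j t; rewrite mxE -c_E; apply: (@lpoly_inj i (c_ c j)) => //.
  by have := congr1 (fun h : {ffun 'I_r -> A} => h j) (etrans (esym h1) h2); rewrite !ffunE.
move=> /(mem_vdim _ _ cX) ew.
have [|h [[hP hw] _]] := gP (b w); first by rewrite -(md_e bP) ew.
have kex j : exists k : nat -> K, h j = lpoly i k.
  by have [a ->] := hP j; exact: ga_corner ga i a.
have [k kE] := choice kex; exists (\matrix_(j, t) k j t); first exact: memvf.
rewrite fE; apply: (md_inj bP); rewrite hw bphi; apply: eq_bigr => j _; rewrite kE.
by congr (rmul _ _); apply: eq_bigr => t _; rewrite c_E mxE.
Qed.

(* A complement of l W in W = e_i X spans W over K[l], and freely so since the trace form
   expresses v as an element of l W when l^(d - 1) v = 0. *)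
Lemma free_corner X M (b : X -> M) i : model b -> free_at D i X -> exists r, corner_free (E i) M r.
Proof.
move=> bP [th [th_e thP]]; have cX := model_crep ga bP.
pose W := limg (act X (Ge i)); pose LW := limg (act X Gl \o act X (Ge i))%VF.
pose C := (W :\: LW)%VS; pose r := \dim C; pose c (j : 'I_r) : X := (vbasis C)`_j.
have WP v : v \in W <-> e i v = v by exact: (mem_vdim i v cX).
have CW : (C <= W)%VS by exact: diffvSl.
have cC j : c j \in C by apply: vbasis_mem; rewrite mem_nth // size_tuple.
have ec j : e i (c j) = c j by apply/WP/(subvP CW).
have LWP v : e i v = v -> l v \in LW.
  by move=> ev; have := memv_img (act X Gl \o act X (Ge i))%VF (memvf v); rewrite comp_lfunE ev.
have elk t (v : X) : e i v = v -> e i (lk t v) = lk t v.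
  move=> ev; have := crep_elk i t v cX; rewrite ev; exact.
(* Each step splits the remainder w' into a part in the complement C and a part l z, raising the
   power of the loop by one; after d_i steps the remainder term vanishes. *)
have span m w : e i w = w -> exists (k : 'I_r -> nat -> K) w', e i w' = w' /\
    w = \sum_j \sum_(t < m) k j t *: lk t (c j) + lk m w'.
  elim: m => [|m IH] ew.
    by exists (fun _ _ => 0), w; split=> //; rewrite big1 ?add0r // => j _; rewrite big_ord0.
  have [k [w' [ew' wE]]] := IH ew.
  have : w' \in (C + W :&: LW)%VS by rewrite addv_diff_cap; exact/WP.
  move=> /memv_addP[x xC [y]]; rewrite memv_cap => /andP[_ /memv_imgP[z _]]; rewrite comp_lfunE => -> w'E.
  exists (fun j t => if t == m then coord (vbasis C) j x else k j t), (e i z); split; first exact: (crep_eii _ _ cX).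
  rewrite {1}wE w'E lkD iterSr addrA; congr (_ + _).
  have -> : lk m x = \sum_(j < r) coord (vbasis C) j x *: lk m (c j).
    rewrite {1}(coord_vbasis xC) lk_sum; apply: eq_bigr => j _.
    by have := lkP m (coord (vbasis C) j x) (c j) 0; rewrite lk0 !addr0.
  rewrite -big_split; apply: eq_bigr => j _; rewrite big_ord_recr /= eqxx; congr (_ + _).
  by apply: eq_bigr => t _; rewrite ltn_eqF.
have Cl0 x : x \in C -> lk (d i).-1 x = 0 -> x = 0.
  move=> xC x0; apply/eqP; rewrite -memv0 -(capv_diff W LW) memv_cap xC /=.
  have ex : e i x = x by apply/WP/(subvP CW).
  rewrite (thP x ex) /trace; apply: rpred_sum => -[[|k] kd] _ /=.
    by rewrite subn1 x0 linear0 mem0v.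
  by apply/LWP/elk; rewrite -th_e.
(* The coefficients vanish one power at a time: l^(d_i - 1 - m) kills all higher terms and leaves
   l^(d_i - 1) (x m), to which [Cl0] applies. *)
have free m (x : nat -> X) : (forall t, x t \in C) -> (m <= d i)%N -> \sum_(t < d i) lk t (x t) = 0 ->
    forall t, (t < m)%N -> x t = 0.
  move=> xC; elim: m => // m IH md x0 t; rewrite ltnS leq_eqVlt => /orP[/eqP ->|]; last exact: (IH (ltnW md)).
  apply: Cl0 => //; have := congr1 (fun v => lk ((d i).-1 - m) v) x0; rewrite lk0 lk_sum (bigD1 (Ordinal md)) //=.
  have mp : (m <= (d i).-1)%N by rewrite -ltnS prednK ?gd_gt0.
  rewrite lk_add subnK // big1 ?addr0 // => s sm; rewrite lk_add.
  have [sm'|ms|E0] := ltngtP s m.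
  - by rewrite (IH (ltnW md) x0 s sm') lk0.
  - have ds : (d i <= (d i).-1 - m + s)%N.
      by rewrite -[X in (X <= _)%N](prednK (gd_gt0 D i)) -[in X in (X <= _)%N](subnK mp) -addnS leq_add2l.
    rewrite -(subnK ds) -lk_add; have ex : e i (x s) = x s by apply/WP/(subvP CW).
    by rewrite -ex (crep_ld cX) lk0.
  by rewrite -(inj_eq val_inj) /= E0 eqxx in sm.
have bc (k : 'I_r -> nat -> K) : \sum_j rmul (b (c j)) (lpoly i (k j)) = b (\sum_j \sum_(t < d i) k j t *: lk t (c j)).
  by rewrite (md_sum bP); apply: eq_bigr => j _; rewrite (md_lpoly _ bP).
exists r, (fun j => b (c j)); split=> [j|m em]; first by rewrite -(md_e bP) ec.
have [w wE] := md_surj bP m; have ew : e i w = w by apply: (md_inj bP); rewrite (md_e bP) wE em.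
have [k [w' [ew' wk]]] := span (d i) w ew.
exists [ffun j => lpoly i (k j)]; split.
  split=> [j|]; first by exists (lpoly i (k j)); rewrite ffunE E_lpoly.
  transitivity (\sum_j rmul (b (c j)) (lpoly i (k j))); last by apply: eq_bigr => j _; rewrite ffunE.
  by rewrite bc -wE {1}wk -ew' (crep_ld cX) addr0.
move=> h [hP hm]; have kex j : exists k : nat -> K, h j = lpoly i k.
  by have [a ->] := hP j; exact: ga_corner ga i a.
have [k' kE'] := choice kex; apply/ffunP => j; rewrite ffunE kE'; apply/eqP; rewrite -subr_eq0 lpolyB.
have s0 : \sum_(t < d i) lk t (\sum_j (k j t - k' j t) *: c j) = 0.
  apply: (md_eq0 bP); transitivity (\sum_j rmul (b (c j)) (lpoly i (fun t => k j t - k' j t))).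
    rewrite [RHS](bc (fun j t => k j t - k' j t)); congr (b _); rewrite exchange_big; apply: eq_bigr => t _; rewrite lk_sum.
    by apply: eq_bigr => j' _; have := lkP t (k j' t - k' j' t) (c j') 0; rewrite lk0 !addr0.
  have E1 : \sum_j rmul (b (c j)) (lpoly i (k j)) = m by rewrite bc -wE {1}wk -ew' (crep_ld cX) addr0.
  have E2 : \sum_j rmul (b (c j)) (lpoly i (k' j)) = m by rewrite hm; apply: eq_bigr => j' _; rewrite kE'.
  transitivity (\sum_j' (rmul (b (c j')) (lpoly i (k j')) - rmul (b (c j')) (lpoly i (k' j')))); last first.
    by rewrite sumrB E1 E2 subrr.
  apply: eq_bigr => j' _.
  by rewrite -lpolyB rmulD; congr (_ + _); rewrite /rmul scaleNr.
rewrite big1 ?eqxx // => t _.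
have ct := free (d i) (fun t => \sum_j (k j t - k' j t) *: c j) _ (leqnn _) s0 t (ltn_ord t).
have {}ct : \sum_j (k j t - k' j t) *: c j = 0.
  by apply: ct => t'; apply: rpred_sum => j' _; exact: memvZ.
have /freeP fr := basis_free (vbasisP C).
by rewrite (fr (fun j => k j t - k' j t) ct j) rmorph0 mulr0.
Qed.

Section RightIdeal.
Variables (i : 'I_n) (Q : mdl).
Hypothesis iQ : isom_right_ideal (E i) Q.

Lemma ideal_gen_ex : exists x : Q,
  [/\ rmul x (E i) = x, forall a, rmul x a = 0 -> E i * a = 0 & forall M (m : M), rmul m (E i) = m ->
  exists g : {linear Q -> M}, g x = m /\ forall y, exists a : A, y = rmul x a /\ g y = rmul m a].
Proof.
have [f [fi fP]] := iQ; have [x xE] : exists x, f x = E i by apply/fP; exists 1; rewrite mulr1.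
have fE y : E i * (f y : A) = f y.
  have [a ->] : exists a, (f y : A) = E i * a by apply/fP; exists y.
  by rewrite mulrA (ga_EE ga) eqxx.
have yE y : y = rmul x (f y : A).
  by apply: fi; rewrite rmul_lin xE; exact: (esym (fE y)).
exists x; split=> [|a xa|M m em]; first by rewrite {2}(yE x) xE.
  by have := rmul_lin f x a; rewrite xa linear0 xE => /esym.
have [g gE] : exists g : {linear Q -> M}, forall y, g y = rmul m (f y : A).
  by apply: (@mlin_ex A) => a u v; rewrite linearD rmul_lin rmulD -rmulM.
exists g; split=> [|y]; first by rewrite gE xE.
by exists (f y); split; [exact: yE | exact: gE].
Qed.

Lemma ideal_fin_gen : fin_gen Q.
Proof.
have [x [ex xf xP]] := ideal_gen_ex; have [g [_ gP]] := xP Q x ex.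
by exists 1%N, (fun=> x) => y; have [a [-> _]] := gP y; exists (fun=> a); rewrite big_ord1.
Qed.

Lemma ideal_proj : projective Q.
Proof.
have [x [ex xf xP]] := ideal_gen_ex => M N f g fs; have [m mE] := fs (g x).
have [|h [hx hP]] := xP M (rmul m (E i)); first by rewrite -rmulM (ga_EE ga) eqxx.
exists h => y; have [a [-> _]] := hP y.
by rewrite !rmul_lin hx rmul_lin mE -[in RHS]ex rmul_lin.
Qed.

Lemma ideal_hom0 M : (forall (f : {linear Q -> M}) x, f x = 0) <-> forall m : M, rmul m (E i) = 0.
Proof.
have [x [ex xf xP]] := ideal_gen_ex; split=> [h m|h f y].
  have [|g [gx _]] := xP M (rmul m (E i)); first by rewrite -rmulM (ga_EE ga) eqxx.
  by rewrite -gx h.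
have [g [_ gP]] := xP Q x ex; have [a [-> _]] := gP y.
by rewrite rmul_lin -ex rmul_lin h rmul0x.
Qed.

Lemma lpoly_nil (k : nat -> K) : k 0%N = 0 -> lpoly i k ^+ d i = 0.
Proof.
move=> k0; pose y := \sum_(t < (d i).-1) E i * Lt ^+ t * io (k t.+1).
have zE : lpoly i k = Lt * y.
  rewrite -(prednK (gd_gt0 D i)) big_ord_recl k0 rmorph0 mulr0 add0r mulr_sumr.
  by apply: eq_bigr => t _; rewrite exprS !mulrA (ga_EL ga).
have Ly : GRing.comm Lt y.
  rewrite /GRing.comm mulr_sumr mulr_suml; apply: eq_bigr => t _.
  by rewrite -[RHS]mulrA (ga_comm ga) !mulrA -(ga_EL ga) -!mulrA [Lt ^+ _ * (Lt * _)]mulrA -exprSr [Lt * (_ * _)]mulrA -exprS.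
have Ey : y = E i * y.
  by rewrite mulr_sumr; apply: eq_bigr => t _; rewrite !mulrA (ga_EE ga) eqxx.
rewrite zE exprMn_comm // -(prednK (gd_gt0 D i)) [y ^+ _]exprS {1}Ey !mulrA -E_Lt_exp prednK ?gd_gt0 //.
by rewrite (ga_Ld ga) !mul0r.
Qed.

(** The corner is a local ring. With zero constant term z is nilpotent and idempotent, so zero.
    Otherwise w = e_i - z / k_0 is nilpotent, while (e_i - z) w = e_i - z, so e_i - z is zero. *)
Lemma lpoly_idem (k : nat -> K) : lpoly i k * lpoly i k = lpoly i k -> lpoly i k = 0 \/ lpoly i k = E i.
Proof.
set z := lpoly i k => zz.
have zX m : z ^+ m.+1 = z by elim: m => [|m IH]; rewrite ?expr1 // exprS IH.
have [k0|k0] := eqVneq (k 0%N) 0.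
  by left; rewrite -(zX (d i).-1) prednK ?gd_gt0 // lpoly_nil.
right; pose w := lpoly i (fun t => (t == 0%N)%:R - k t / k 0%N).
have wd : w ^+ d i = 0 by apply: lpoly_nil; rewrite /= divff // subrr.
have wE : w = E i - z * io (k 0%N)^-1.
  have -> : E i = lpoly i (fun t => (t == 0%N)%:R).
    rewrite -(prednK (gd_gt0 D i)) big_ord_recl expr0 mulr1 rmorph1 mulr1 big1 ?addr0 // => t _.
    by rewrite rmorph0 mulr0.
  rewrite /z mulr_suml -sumrB; apply: eq_bigr => t _.
  by rewrite rmorphB mulrBr rmorphM !mulrA.
have zc : E i * z * E i = z by exact: E_lpoly.
have zE : z * E i = z by rewrite -{1}zc -mulrA (ga_EE ga) eqxx.
have Ez : E i * z = z by rewrite -{1}zc !mulrA (ga_EE ga) eqxx.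
have u1 : (E i - z) * w = E i - z.
  by rewrite wE mulrBr mulrBl (ga_EE ga) eqxx zE mulrA mulrBl Ez zz subrr mul0r subr0.
have um m : (E i - z) * w ^+ m = E i - z.
  by elim: m => [|m IH]; rewrite ?expr0 ?mulr1 // exprSr mulrA IH.
by apply/eqP; rewrite eq_sym -subr_eq0 -(um (d i)) wd mulr0.
Qed.

Lemma E_neq0 : E i <> 0.
Proof.
move=> E0; have /(@lpoly_inj i (fun t => (t == 0%N)%:R)) /(_ 0%N (gd_gt0 D i)) /eqP : lpoly i (fun t => (t == 0%N)%:R) = 0.
  by rewrite big1 // => t _; rewrite E0 !mul0r.
by rewrite oner_eq0.
Qed.

(** An endomorphism of e_i A is given by an element of the corner e_i A e_i, whose idempotents are
    trivial. *)
Lemma ideal_indec X (b : X -> Q) : model b -> indec X.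
Proof.
move=> bP; have [x [ex xf xP]] := ideal_gen_ex; have [g [_ gP]] := xP Q x ex.
have [f [fi fP]] := iQ.
split=> [X0|h hh idem].
  have Q0 := proj2 (model_zero bP) X0.
  have [y yE] : exists y, f y = E i by apply/fP; exists 1; rewrite mulr1.
  by apply: E_neq0; rewrite -yE (Q0 y) linear0.
have [phi phiE] := mlin_hom ga bP bP hh.
have phi_idem y : phi (phi y) = phi y.
  have [v <-] := md_surj bP y; rewrite !phiE.
  by have := congr1 (fun f : 'End(X) => f v) idem; rewrite /= comp_lfunE => ->.
have [a [xa _]] := gP (phi x).
have [k kE] := ga_corner ga i a.
have xk : phi x = rmul x (lpoly i k).
  by rewrite -kE !rmulM ex -xa -rmul_lin ex.
set z := lpoly i k in kE xk.
have Ez : E i * z = z by rewrite -kE !mulrA (ga_EE ga) eqxx.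
have zz : z * z = z.
  have := phi_idem x; rewrite {1}xk rmul_lin xk -rmulM => E1.
  have /xf : rmul x (z * z - z) = 0 by rewrite rmulD E1 /rmul scaleNr subrr.
  by rewrite mulrBr mulrA Ez => /eqP; rewrite subr_eq0 => /eqP.
have gen y : exists c, y = rmul x c by have [c [yc _]] := gP y; exists c.
have [z0|z1] := lpoly_idem zz; [left|right]; apply/lfunP => v; apply: (md_inj bP); rewrite -phiE.
  have [c ->] := gen (b v); rewrite rmul_lin xk /z z0 -rmulM mul0r rmulx0.
  by rewrite zero_lfunE (md_0 bP).
rewrite id_lfunE; have [c ->] := gen (b v).
by rewrite rmul_lin xk /z z1 ex.
Qed.

End RightIdeal.

Lemma ideal_ex i : exists Q, isom_right_ideal (E i) Q.
Proof.
have fA : fin_gen ((A^c)^o : mdl).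
  by exists 1%N, (fun=> 1) => m; exists (fun=> m); rewrite big_ord1; exact: (esym (mul1r (m : A))).
have [X [b bP]] := rep_ex ga fA.
have [f fE] : exists f : {linear (A^c)^o -> (A^c)^o}, forall x, f x = E i * (x : A) :> A.
  apply: (@mlin_ex A) => x u v; rewrite -[LHS]/(E i * ((u : A) * x + (v : A))).
  by rewrite -[RHS]/((E i * (u : A)) * x + (E i * (v : A))) mulrDr mulrA.
have [h [hh hE]] := hom_mlin f bP bP.
have [I [q [j [qh qe jh jm hj]]]] := image_ex hh.
have [Q [b' bP']] := module_ex ga (crep_quot qh qe (model_crep ga bP)).
have [g gE] := mlin_hom ga bP' bP jh; exists Q, g; split.
  move=> x y; have [v <-] := md_surj bP' x; have [w <-] := md_surj bP' y.
  by rewrite !gE => /(md_inj bP)/(mono_inj jm) ->.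
move=> y; split=> [[x <-]|[a ->]].
  have [v <-] := md_surj bP' x; have [w <-] := qe v.
  by rewrite gE -hj hE fE; exists (b w).
have [v vE] := md_surj bP (a : (A^c)^o); exists (b' (q v)).
by rewrite gE -hj hE vE fE.
Qed.

Lemma ideal_isom i Q Q' : isom Q Q' -> isom_right_ideal (E i) Q' -> isom_right_ideal (E i) Q.
Proof.
move=> [f [g fK gK]] [h [hi hP]]; exists (h \o f); split=> [x y /hi/(can_inj fK)//|y].
rewrite -hP; split=> [[x <-]|[x <-]]; first by exists (f x).
by exists (g x); rewrite /= gK.
Qed.

(** The simple module S_i tells them apart: e_i A maps to it nontrivially, and e_j A does not for j
    other than i. *)
Lemma ideal_uniq i j Q : isom_right_ideal (E i) Q -> isom_right_ideal (E j) Q -> i = j.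
Proof.
move=> Qi Qj; have cS : crep D o (srep K i).
  exact: (srep_in K D o (finset.in_setT i : i \in finset.setT)).1.
have sE k (v : srep K i) : e k v = if k == i then v else 0.
  by rewrite /=; case: ifP => _; rewrite ?id_lfunE ?zero_lfunE.
have [N [b bP]] := module_ex ga cS; apply/eqP; apply: contraT => ij.
have [H _] := ideal_hom0 Qi N; have [_ H'] := ideal_hom0 Qj N.
have e0 : forall m : N, rmul m (E j) = 0.
  move=> m; have [v <-] := md_surj bP m; rewrite -(md_e bP).
  suff -> : e j (v : srep K i) = 0 by exact: md_0 bP.
  by rewrite sE eq_sym (negbTE ij).
have z := H (H' e0); exfalso; apply: (@srep_neq0 K n i) => v; apply: (md_eq0 bP).
have <- : e i v = v by rewrite sE eqxx.
by rewrite (md_e bP) z.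
Qed.

End Rank.

(** * Sortable elements, tau-tilting pairs and torsion classes *)

Section Main.
Variables (R : realType) (V : vectType R) (n : nat) (Phi : root_system V n).
Variables (d : 'I_n -> nat) (K : fieldType).
Hypothesis hd : is_symmetrizer Phi d.
Notation D := (cox_data hd).
Notation cls c J := (inC D (cox_arr Phi c) J).
Notation TD := (@TD R V n Phi d hd K).
Notation rep := (rep K (gen n)).
Notation e i v := (act _ (Ge i) v).
Notation alpha := (alpha Phi).
Notation wp a := (wprod Phi a).
Notation deriv := (deriv Phi).
Notation clset := (clset Phi).
Notation clpos := (clpos Phi).
Notation invl := (invl Phi).
Implicit Types (X Y Z S : rep).

(** [TD0] starts from the empty J, whereas [deriv0] accepts any J, so the remaining letters have to
    be dropped one by one; v holds those already dropped. *)
Lemma TD_nil u v (J : {set 'I_n}) : coxeter_word (u ++ v) -> (forall j, j \in v -> j \notin J) ->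
  TD (u ++ v) J [::] (@rep0 K (gen n)).
Proof.
elim: u v J => [|i u IH] v J huv vJ.
  have -> : J = finset.set0; last exact: TD0.
  by apply/setP => j; rewrite finset.in_set0; apply/negbTE/vJ/(cox_mem _ huv).
apply: TDdrop; rewrite -cats1 -catA.
apply: IH => [|j]; first by rewrite catA cats1; exact: (cox_rot (c := u ++ v)).
rewrite mem_cat => /orP[/vJ|]; first by rewrite !inE negb_and => ->; rewrite orbT.
by rewrite mem_seq1 => /eqP ->; rewrite !inE eqxx.
Qed.

(** If S_i were in the smaller torsion class, alpha_i would be an inversion of a, contradicting that
    i :: a is reduced. *)
Lemma deriv_TD c J a : deriv c J a -> coxeter_word c -> exists T, TD c J a T.
Proof.
elim=> {c J a} [c J|i c J a _ IH|i c J a iJ _ IH ria] hc.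
- by exists (@rep0 K (gen n)); rewrite -(cats0 c); apply: TD_nil; rewrite ?cats0.
- by have [T td] := IH (cox_rot hc); exists T; exact: TDdrop.
have [T td] := IH (cox_rot hc); exists (down D i (cox_arr Phi (i :: c)) (cox_arr Phi (rcons c i)) J T).
apply: TDtake => // Ti; have hc' := cox_rot hc.
have [t [r [t0 rI E]]] := TD_bricks td hc' (srep_brick K i) Ti.
have /andP[ra ai] := ria; have /andP[pr pnr] := invl_pos ra rI.
have rE : r = (t^-1 * (d i)%:R^-1) *: alpha i.
  have E0 : (d i)%:R^-1 *: alpha i = t *: r by rewrite -E rt_srep.
  by rewrite -scalerA E0 scalerA mulVf ?scale1r // gt_eqF.
have t1 : 0 < t^-1 * (d i)%:R^-1 :> R by rewrite mulr_gt0 ?invr_gt0 // ltr0n hd.1.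
have /andP[rr _] := pr; rewrite rE in rr.
have [t2|t2] := rs_reduced (alpha_root Phi i) rr; last by rewrite t2 oppr_gt0 ltr10 in t1.
by move: pnr; rewrite rE t2 scale1r => /(pos_anti ai).
Qed.

Lemma TD_deriv c J a T : TD c J a T -> coxeter_word c -> deriv c J a.
Proof.
move=> td; elim: (td) => {c J a T td} [c|i c J a T _ IH|i c J a T iJ td IH Ti] hc.
- exact: deriv0.
- by apply: deriv_drop; exact: IH (cox_rot hc).
apply: deriv_take => //; first exact: IH (cox_rot hc).
exact: (TD_red (TDtake iJ td Ti) hc).
Qed.

Lemma clpos_subseq a : subseq (clpos a) (invl a).
Proof.
elim: a => //= i a IH; case: ifP => _ /=; last by rewrite eqxx map_subseq.
by apply: subseq_trans (map_subseq _ IH) (subseq_cons _ _).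
Qed.

Lemma size_clpos a : size (clpos a) = size (undup a).
Proof. by elim: a => //= i a IH; rewrite size_cat size_map IH; case: ifP. Qed.

Variable c : seq 'I_n.
Hypothesis hc : coxeter_word c.
Notation A := (gls Phi c d K).
Notation mdl := (lmodType A^c).
Notation io := (@gls_scalar R V n Phi c d K).
Notation E := (@gls_idem R V n Phi c d K).
Notation Lt := (@Lt R V n Phi c d K).
Notation At := (@At R V n Phi c d K).
Notation model := (@model n K A io E Lt At _ _).
Notation Tg := (@Tg n K A io E Lt At).
Notation C := (cls c finset.setT).
Implicit Types (M N P Q : mdl).
Let ga := @gls_is_like R V n Phi c d K hc hd.

Lemma rank_rt X N (b : X -> N) r : model b -> rank_vector N r -> rt Phi d X = \sum_i alpha i *+ r i.
Proof.
move=> bP rN; apply: eq_bigr => i _; rewrite (corner_rank ga bP (rN i)) natrM mulfK ?scaler_nat //.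
exact: (d_neq0 hd).
Qed.

Lemma locfree_rank X N (b : X -> N) : model b -> locfree D X -> exists r, rank_vector N r.
Proof. by move=> bP lX; have [r rP] := choice (fun i => free_corner ga bP (lX i)); exists r. Qed.

Section Tilting.
Variables (a : seq 'I_n) (T : rep -> Prop).
Hypothesis td : TD c finset.setT a T.

(** M is the sum of one indecomposable Ext-projective for each root of [clpos], and P the sum of the
    e_j A with j not a letter of a. T vanishes at these vertices, so P has no nonzero map to M;
    [clpos] has as many roots as a has distinct letters, so the two counts add up to n. *)
Lemma tilting_ex : exists M P, [/\ tau_tilting_pair io n M P, tphi_c M P = clset a & Fac M = Tg T].
Proof.
have tT := TD_tors td hc; have [TC _ _ _] := tT; have [eL eI _ eX] := TD_extproj td hc.
pose s := clpos a.
have us : uniq s := subseq_uniq (clpos_subseq a) (invl_uniq (TD_red td hc)).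
pose k := size s; have kP (t : 'I_k) := eX _ (mem_nth 0 (ltn_ord t)).
have [X XP] := choice kP.
have TX t : T (X t) by have [[]] := XP t.
have [C0 _ Cj] := crep_amb K D (cox_arr Phi c) finset.setT.
have [S [i [p [CS bp]]]] := biproduct_ex C0 Cj (fun t => TC _ (TX t)).
have hi t : hom (i t) by case: bp.
have hp t : hom (p t) by case: bp.
have TS : T S.
  apply: (tors_span (crep_amb K D (cox_arr Phi c) finset.setT) tT CS TX hi) => v.
  by exists (fun t => p t v); exact: (bp_sum bp).
have eS : extproj C T S by apply: (extproj_biproduct bp TS) => t; have [] := XP t.
have cS := proj1 (inC_setT D _ S) CS; have [M [b bP]] := module_ex ga cS.
have Xi t : indec (X t) by have [] := XP t.
have cX t : crep D (cox_arr Phi c) (X t) := (TC _ (TX t)).1.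
have Xrt t : rt Phi d (X t) = nth 0 s t by have [] := XP t.
have Xne s' t : iso (X s') (X t) -> s' = t.
  move=> st; apply/val_inj/eqP; rewrite -(nth_uniq 0 (ltn_ord s') (ltn_ord t) us).
  by rewrite -!Xrt (rt_iso (cX s') (cX t) st).
have tM := extproj_tau ga tT eS bP.
have fT : Fac M = Tg T.
  rewrite (Fac_facr ga bP); congr (Tg _); apply/funext => Y; apply/propext; split; first exact: (facr_le tT TS).
  (* [TD_gen] is applied to the torsion class Fac S: every indecomposable Ext-projective is
     isomorphic to some X t, which is a quotient of S. *)
  move=> TY; apply: (TD_gen td hc (facr_tors cS (extproj_lifts tT eS)) _ TY) => Z eZ iZ.
  have /(nthP 0)[t tk tE] := eI _ eZ iZ; pose t' : 'I_k := Ordinal tk.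
  have [_ _ e3 _] := TD_extproj td hc; have [eXt _ _] := XP t'.
  have itZ : iso (X t') Z by apply: (e3 _ _ eXt (Xi t') eZ iZ); rewrite Xrt.
  apply: (facr_iso itZ); apply: (facr_epi cS (hp t')) => v.
  by exists (i t' v); rewrite (bp_pi bp).
pose B := [pred j : 'I_n | j \notin a]; pose m := #|B|.
have [Q QP] := choice (fun t : 'I_m => ideal_ex ga (enum_val t)).
have [Y YP] := choice (fun t => rep_ex ga (ideal_fin_gen ga (QP t))).
have Yi t : indec (Y t) by have [b' bP'] := YP t; exact: (ideal_indec ga (QP t) bP').
have cY t : crep D (cox_arr Phi c) (Y t) by have [b' bP'] := YP t; exact: (model_crep ga bP').
have Yne s' t : iso (Y s') (Y t) -> s' = t.
  have [b1 b1P] := YP s'; have [b2 b2P] := YP t.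
  move=> /(model_iso ga b1P b2P)/(ideal_isom)/(_ (QP t)) Qs.
  exact/enum_val_inj/(ideal_uniq ga (QP s') Qs).
have [U [iu [pu [CU bu]]]] := biproduct_ex C0 Cj (fun t => proj2 (inC_setT D _ (Y t)) (cY t)).
have hiu t : hom (iu t) by case: bu.
have hpu t : hom (pu t) by case: bu.
have [P [bU bUP]] := module_ex ga (proj1 (inC_setT D _ U) CU).
have comp t : exists jq : {linear Q t -> P} * {linear P -> Q t}, forall v, jq.1 (jq.2 (bU v)) = bU (iu t (pu t v)).
  have [b' bP'] := YP t; have [j jE] := mlin_hom ga bP' bUP (hiu t).
  have [q qE] := mlin_hom ga bUP bP' (hpu t).
  by exists (j, q) => v; rewrite /= qE jE.
pose jq := fun t : 'I_m => projT1 (cid (comp t)).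
have jqE : forall (t : 'I_m) v, (jq t).1 ((jq t).2 (bU v)) = bU (iu t (pu t v)) := fun t => projT2 (cid (comp t)).
have Psum y : y = \sum_t (jq t).1 ((jq t).2 y).
  have [v <-] := md_surj bUP y; rewrite {1}(bp_sum bu v) (md_sum bUP).
  by apply: eq_bigr => t _; rewrite jqE.
have pP : projective P.
  move=> M1 N1 f g fs.
  have lift t : exists h : {linear Q t -> M1}, forall x, f (h x) = g ((jq t).1 x).
    by have [h hE] := ideal_proj ga (QP t) (g \o (jq t).1) fs; exists h.
  pose h := fun t : 'I_m => projT1 (cid (lift t)).
  have hE : forall (t : 'I_m) x, f (h t x) = g ((jq t).1 x) := fun t => projT2 (cid (lift t)).
  have [H HE] : exists H : {linear P -> M1}, forall y, H y = \sum_t h t ((jq t).2 y).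
    apply: (@mlin_ex A) => x u v; rewrite rmul_suml -big_split; apply: eq_bigr => t _.
    by rewrite !linearD !rmul_lin.
  exists H => y; rewrite HE linear_sum [in RHS](Psum y) linear_sum; apply: eq_bigr => t _.
  exact: hE.
have hPM (f : {linear P -> M}) x : f x = 0.
  rewrite (Psum x) linear_sum big1 // => t _.
  have [_ H] := ideal_hom0 ga (QP t) M; apply: (H _ (f \o (jq t).1)) => y.
  have [v <-] := md_surj bP y; rewrite -(md_e bP).
  by rewrite (TD_supp0 td hc (enum_valP t) TS) (md_0 bP).
have zM : exists Z : mdl, zero_module Z.
  by exists ({ffun 'I_0 -> (A^c)^o} : mdl) => x; apply/ffunP => -[].
exists M, P; split=> //.
  split; first by split=> //; exact: model_fg bUP.
  - exact: (bp_basic ga bp Xi Xne bP).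
  - exact: (bp_basic ga bu Yi Yne bUP).
  exists k, m; split; [exact: (bp_num ga bp Xi cX Xne bP) | exact: (bp_num ga bu Yi cY Yne bUP) |].
  rewrite /k /s size_clpos -(card_uniqP (undup_uniq a)) -[RHS](card_ord n) -(cardC (mem a)).
  by congr (_ + _)%N; apply: eq_card => j; rewrite ?mem_undup.
apply/funext => x; apply/propext; split.
  move=> [N [Q' [[[iN sN Q0]|[N0 iQ sQ]] [[Q0' [r rN ->]]|[N0' [j Qj ->]]]]]].
  - have [t [b' bP']] := bp_indec_summand ga bp Xi cX bP iN sN.
    by left; rewrite -(rank_rt bP' rN) Xrt mem_nth.
  - by have [] := iN.
  - by have [] := iQ.
  have [t [b' bP']] := bp_indec_summand ga bu Yi cY bUP iQ sQ.
  right; exists j => //; have [b2 b2P] := YP t.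
  have iso1 : isom Q' (Q t) by apply/(model_iso ga bP' b2P); exact: iso_refl.
  by rewrite (ideal_uniq ga Qj (ideal_isom iso1 (QP t))); exact: (enum_valP t).
have [Z0 Z0P] := zM.
move=> [/(nthP 0)[t tk <-]|[j ja ->]].
  pose t' : 'I_k := Ordinal tk; have [N [b' bP']] := module_ex ga (cX t').
  have [eXt _ _] := XP t'; have [r rN] := locfree_rank bP' (eL _ eXt).
  exists N, Z0; split; last by left; split=> //; exists r => //; rewrite -(rank_rt bP' rN) Xrt.
  left; split=> //; last exact: (bp_summand ga bp bP bP').
  exact/(indec_model ga bP')/Xi.
have jB : j \in B by [].
pose t := enum_rank_in jB j; have tj : enum_val t = j by exact: enum_rankK_in.
have [b' bP'] := YP t; exists Z0, (Q t); split; last first.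
  by right; split=> //; exists j => //; rewrite -tj; exact: QP.
right; split=> //; last exact: (bp_summand ga bu bUP bP').
exact/(indec_model ga bP')/Yi.
Qed.

Lemma tilting_Fac M P : tau_tilting_pair io n M P -> tphi_c M P = clset a -> Fac M = Tg T.
Proof.
move=> [[tM _ _ homPM] _ _ _] tE; have [X [b bP]] := rep_ex ga tM.1.
have cX := model_crep ga bP; have lX := tau_lifts ga bP tM.
have tF := facr_tors cX lX; have eX := lifts_extproj cX lX.
have [a' td'] := TD_surj hc tF; have [eL eI _ _] := TD_extproj td' hc.
have sub : forall x, clset a x -> clset a' x.
  rewrite -tE => x [N [Q [[[iN sN Q0]|[N0 iQ sQ]] [[Q0' [r rN ->]]|[N0' [j Qj ->]]]]]].
  - have [u [q qu]] := summand_retract sN.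
    have fN : fin_gen N by apply: (fin_gen_quot (f := q) _ tM.1) => y; exists (u y).
    have [Z [b' bP']] := rep_ex ga fN; have iZ := proj1 (indec_model ga bP') iN.
    have [u' [uh uE]] := hom_mlin u bP' bP; have [q' [qh qE]] := hom_mlin q bP bP'.
    have qu' v : q' (u' v) = v by apply: (md_inj bP'); rewrite qE uE qu.
    left; rewrite -(rank_rt bP' rN); apply: eI iZ; apply: (extproj_retract eX _ uh qh qu').
    by apply: (facr_epi cX qh) => v; exists (u' v).
  - by have [] := iN.
  - by have [] := iQ.
  (* A summand e_j A of P forces M to vanish at j, hence so does Fac M, and j is not a letter of
     a'. *)
  right; exists j => //; apply/negP => /(TD_supp_ex td' hc)[Y [[_ [k [f [fh fs]]]] [v]]].
  have [u [q qu]] := summand_retract sQ.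
  have z : forall m : M, rmul m (E j) = 0.
    apply/(ideal_hom0 ga Qj) => f' x'; rewrite -(qu x').
    exact: (homPM (f' \o q) (u x')).
  have [y ->] := fs v; rewrite linear_sum big1 ?eqxx // => t _; rewrite /= -fh.
  suff -> : e j (y t) = 0 by rewrite linear0.
  by apply: (md_eq0 bP); rewrite (md_e bP) z.
have da := TD_deriv td hc; have da' := TD_deriv td' hc.
have [_ cmax] := clset_cluster hd da hc; have [cp' _] := clset_cluster hd da' hc.
have aa : a = a' by apply: (clset_inj da hc da'); exact/esym/cmax.
rewrite (Fac_facr ga bP); congr (Tg _).
by apply: (TD_uniq hc td' td); rewrite aa.
Qed.

End Tilting.

Lemma cambrianP w : cambrian Phi c w <-> exists a T, [/\ TD c finset.setT a T, wp a = w & cl Phi c w = clset a].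
Proof.
rewrite /cambrian /= (sortableP _ hc); split=> [[a [da <-]]|[a [T [td <- _]]]].
  by have [T td] := deriv_TD da hc; exists a, T; split=> //; exact: (clE hc da).
by exists a; split=> //; exact: TD_deriv td hc.
Qed.

(** The existential form makes this a function of w without choosing a word; [TD_uniq] shows that
    the word does not matter. For w not sortable it is the empty class. *)
Definition sortable_tors (w : 'End(V)) (M : mdl) := exists a T, [/\ TD c finset.setT a T, wp a = w & Tg T M].

Lemma sortable_torsE a T : TD c finset.setT a T -> sortable_tors (wp a) = Tg T.
Proof.
move=> td; apply/funext => M; apply/propext; split; last by exists a, T.
by move=> [a' [T' [td' aa TM]]]; rewrite -(TD_uniq hc td' td aa).
Qed.

Lemma Psi_sortable_tors w : cambrian Phi c w ->
  forall S : mdl -> Prop, Psi_tphi_inv_cl w S <-> S = sortable_tors w.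
Proof.
move=> /cambrianP[a [T [td <- clE']]] S; rewrite (sortable_torsE td); split.
  by move=> [M [P [_ tt]]]; rewrite clE' => tE ->; exact: (tilting_Fac td tt tE).
move=> ->; have [M [P [tt tE FM]]] := tilting_ex td.
by exists M, P; split=> //; rewrite clE' //; exact: (clset_cluster hd (TD_deriv td hc) hc).
Qed.

Lemma sortable_tors_iso :
  order_iso (cambrian Phi c) (cambrian_le Phi) (@torsion_class A) (@subclass A) sortable_tors.
Proof.
have le : forall w w', cambrian Phi c w -> cambrian Phi c w' ->
    (cambrian_le Phi w w' <-> subclass (sortable_tors w) (sortable_tors w')).
  move=> w w' /cambrianP[a [T [td <- _]]] /cambrianP[a' [T' [td' <- _]]].
  have [TC _ _ _] := TD_tors td hc.
  rewrite (sortable_torsE td) (sortable_torsE td') (Tg_sub ga); first last.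
  - by move=> Y Z; exact: (tors_iso (TD_tors td' hc)).
  - by move=> Y /TC[].
  by rewrite (TD_le hc td td') /cambrian_le (inversionsE (TD_red td hc)) (inversionsE (TD_red td' hc)).
split; last exact: le.
split=> [w /cambrianP[a [T [td <- _]]]|w w' cw cw' ww|S].
- by rewrite (sortable_torsE td); exact: (Tg_torsion ga (TD_tors td hc)).
- have l1 : cambrian_le Phi w w' by apply/(le _ _ cw cw'); rewrite ww.
  have l2 : cambrian_le Phi w' w by apply/(le _ _ cw' cw); rewrite ww.
  have /cambrianP[a [T [td aw _]]] := cw; have /cambrianP[a' [T' [td' aw' _]]] := cw'; subst w w'.
  apply: (red_inv_inj (TD_red td hc) (TD_red td' hc)) => x.
  rewrite /cambrian_le (inversionsE (TD_red td hc)) (inversionsE (TD_red td' hc)) in l1 l2.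
  by apply/idP/idP; [exact: l1 | exact: l2].
move=> tS; have [T [tT ->]] := torsion_Tg ga tS; have [a td] := TD_surj hc tT.
exists (wp a); last exact: (sortable_torsE td).
apply/cambrianP; exists a, T; split=> //; exact: (clE hc (TD_deriv td hc)).
Qed.

End Main.

Lemma order_iso_hasse (T U : Type) (inX : T -> Prop) (leX : T -> T -> Prop)
    (inY : U -> Prop) (leY : U -> U -> Prop) (f : T -> U) :
  order_iso inX leX inY leY f -> hasse_iso inX leX inY leY f.
Proof.
move=> [fb fle]; split=> // x y Xx Xy; have [fX fi fs] := fb; split=> -[yx ne cov]; split.
- exact/fle.
- by move=> fxy; apply: ne; exact: (fi _ _ Xx Xy fxy).
- move=> z /fs[z' Xz' <-] /(fle _ _ Xy Xz') yz /(fle _ _ Xz' Xx) zx.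
  by have [->|->] := cov _ Xz' yz zx; [left|right].
- exact/(fle _ _ Xy Xx).
- by move=> xy; apply: ne; rewrite xy.
move=> z Xz /(fle _ _ Xy Xz) yz /(fle _ _ Xz Xx) zx.
by have [E|E] := cov _ (fX _ Xz) yz zx; [left; exact: (fi _ _ Xz Xx E) | right; exact: (fi _ _ Xz Xy E)].
Qed.

Theorem corollary8p17 (R : realType) (V : vectType R) (n : nat)
    (Phi : root_system V n) (c : seq 'I_n) (hc : coxeter_word c)
    (d : 'I_n -> nat) (hd : is_symmetrizer Phi d) (K : fieldType) :
  exists F : 'End(V) -> lmodType (gls Phi c d K)^c -> Prop,
    [/\ forall w, cambrian Phi c w ->
          forall T, Psi_tphi_inv_cl w T <-> T = F w,
        hasse_iso (cambrian Phi c) (cambrian_le Phi)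
                  (@torsion_class (gls Phi c d K))
                  (@subclass (gls Phi c d K)) F
      & exists G : 'End(V) -> lmodType (gls Phi c d K)^c -> Prop,
          order_iso (cambrian Phi c) (cambrian_le Phi)
                    (@torsion_class (gls Phi c d K))
                    (@subclass (gls Phi c d K)) G].
Proof.
have iso := sortable_tors_iso K hd hc.
exists (@sortable_tors R V n Phi d K hd c); split.
- by move=> w cw T; exact: Psi_sortable_tors.
- exact: order_iso_hasse.
by exists (@sortable_tors R V n Phi d K hd c).
Qed.
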